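(* Let $(u_{h,\tau},m_{h,\tau})\in\mathbb V_1\times\mathbb V_2$ be a solution of the stabilized finite element scheme (stated in the context) with stabilizations given, for all $v\in\mathbb V$, by $$\mathcal S_1(u_{h,\tau};m_{h,\tau};v)=\int_0^T\big[(\partial_tU_{h,\tau},v)_\Omega-(\partial_tU_{h,\tau},v)_{\Omega,h}+\mathcal S_{h,1}(u_{h,\tau};m_{h,\tau};v)\big]dt,$$ $$\mathcal S_2(u_{h,\tau};m_{h,\tau};v)=\int_0^T\big[(\partial_tM_{h,\tau},v)_{\Omega,h}-(\partial_tM_{h,\tau},v)_\Omega+\mathcal S_{h,2}(u_{h,\tau};m_{h,\tau};v)\big]dt,$$ where $\mathcal S_{h,i}:V_h\times V_h\times V_h\to\mathbb R$, $i\in\{1,2\}$, are possibly nonlinear in the first two arguments and linear in the third, and are evaluated at the values of the functions at time $t$. Suppose that: 1. for every interior vertex $z\in\mathcal V^I$ and $i\in\{1,2\}$, $\mathcal S_{h,i}(v_h;\widetilde v_h;\varphi_z)=0$ whenever $v_h,\widetilde v_h\in V_h$ satisfy $v_h|_{\omega_z}\in\mathcal P_1(\omega_z)$ and $\widetilde v_h|_{\omega_z}\in\mathcal P_1(\omega_z)$; 2. there is a constant $L_{\mathcal S}>0$ independent of the discretization parameters such that for $i\in\{1,2\}$, all $v_h,w_h,\widetilde v_h,\widetilde w_h\in V_h$ and all $z\in\mathcal V^I$, $$|\mathcal S_{h,i}(v_h;w_h;\varphi_z)-\mathcal S_{h,i}(\widetilde v_h;\widetilde w_h;\varphi_z)|\le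 L_{\mathcal S}|\omega_z|_d^{1/2}\big(\|\nabla(v_h-\widetilde v_h)\|_{\omega_z}+\|\nabla(w_h-\widetilde w_h)\|_{\omega_z}\big);$$ 3. $\|m_{h,\tau}\|_{L^\infty(Q_T)}\le\widetilde M_\infty$ for a constant $\widetilde M_\infty>0$ independent of the discretization parameters. Then $$\sum_{i=1}^2\left[\sup_{v\in\mathbb V\setminus\{0\}}\frac{\int_0^T\mathcal S_{h,i}(u_{h,\tau};m_{h,\tau};v)\,dt}{\|v\|_X}\right]\le C\sum_{i=1}^2\eta_{R,i},$$ where $C>0$ depends only on $d$, $\nu$, $L_{H_p}$, $L_{\mathcal S}$, $\widetilde M_\infty$ and the shape-regularity parameter of $\mathcal T$.
   Context: **Spaces.** Let $d\in\mathbb N$, let $\Omega\subset\mathbb R^d$ be a bounded connected open set with Lipschitz boundary, $T>0$, $I=(0,T)$, $Q_T=I\times\Omega$. $(\cdot,\cdot)_\omega$ and $\|\cdot\|_\omega$ are the inner product and norm of $L^2(\omega)$ (scalar- or vector-valued), $|\omega|_d$ is Lebesgue measure. $H^{-1}(\Omega)$ is the dual of $H^1_0(\Omega)$ with pairing $\langle\cdot,\cdot\rangle$. $X=L^2(I;H^1_0(\Omega))$ with $\|w\|_X^2=\int_0^T\|\nabla w\|_\Omega^2\,dt$; $X^*$ is its dual, identified with $L^2(I;H^{-1}(\Omega))$. $Y=L^2(I;H^1_0(\Omega))\cap H^1(I;H^{-1}(\Omega))$ with $\|v\|_Y^2=\int_0^T(\|\partial_t v\|_{H^{-1}(\Omega)}^2+\|\nabla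 v\|_\Omega^2)\,dt+\|v(T)\|_\Omega^2$. **Data.** $\nu>0$ is constant; $m_0\in L^\infty(\Omega)$, $m_0\ge0$ a.e. The Hamiltonian is $H(t,x,p)=\sup_{\alpha\in\mathcal A}[b(t,x,\alpha)\cdot p-f(t,x,\alpha)]$ for $(t,x,p)\in\overline{Q_T}\times\mathbb R^d$, with $\mathcal A$ a compact metric space and $b$ ($\mathbb R^d$-valued), $f$ (real-valued) uniformly continuous on $\overline{Q_T}\times\mathcal A$; hence $H$ is convex in $p$ and Lipschitz in $p$ with constant $L_H=\|b\|_{C(\overline{Q_T}\times\mathcal A;\mathbb R^d)}$. It is assumed that $H$ is differentiable in $p$, with gradient $H_p$ satisfying $|H_p(t,x,p)-H_p(t,x,q)|\le L_{H_p}|p-q|$. For $v\in X$: $H[\nabla v](t,x)=H(t,x,\nabla v(t,x))$, $H_p[\nabla v](t,x)=H_p(t,x,\nabla v(t,x))$. There is a Hilbert space $Z$ into which $X$ and $Y$ embed continuously, with $Y\hookrightarrow Z$ compact. $F:Z\to X^*$ and $S:L^2(\Omega)\to L^2(\Omega)$ are Lipschitz with constants $L_F$, $L_S$, and satisfy for all $v_1,v_2\in Y$: $0\le\int_0^T\langle F[v_1]-F[v_2],v_1-v_2\rangle dt+(S[v_1(T)]-S[v_2(T)],v_1(T)-v_2(T))_\Omega$. $G=g_0-\nabla\cdot g_1\in L^2(I;H^{-1}(\Omega))$ with $g_0\in L^r(I;L^s(\Omega))$, $g_1\in L^{2r}(I;L^{2s}(\Omega;\mathbb R^d))$ for some $r,s\in(1,\infty]$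 with $\frac1r+\frac d{2s}<1$, and $\int_0^T\langle G,w\rangle dt\ge0$ for all $w\in X$ with $w\ge0$ a.e. Moreover $F[v]\in L^2(Q_T)$ for all $v\in X$, and $G\in L^2(Q_T)$. **Discretization.** $\mathcal T$ is a conforming simplicial mesh of $\Omega$ (closed elements), $h_K=\operatorname{diam}K$, $\varrho_K$ is the largest diameter of a ball inscribed in $K$, and the shape-regularity parameter is $\max_{K\in\mathcal T}h_K/\varrho_K$. $\mathcal F^I$ is the set of interior faces, $\mathcal F^I_K$ the set of interior faces contained in $K$, $h_F=\operatorname{diam}F$ (for $d=1$, where faces are points, $h_F$ is understood as the largest diameter of the elements containing $F$). $V_h=\{v\in H^1_0(\Omega): v|_K\in\mathcal P_1(K)\ \forall K\in\mathcal T\}$; $\mathcal V^I$ is the set of vertices of $\mathcal T$ in $\Omega$, $\{\varphi_z\}_{z\in\mathcal V^I}$ the nodal (hat function) basis of $V_h$, and $\omega_z$ the union of the elements containing $z$. The mass-lumped inner product is $(v_h,w_h)_{\Omega,h}=\sum_{z\in\mathcal V^I}(\varphi_z,1)_\Omega v_h(z)w_h(z)$. $0=t_0<t_1<\dots<t_N=T$, $I_n=(t_{n-1},t_n)$, $\tau_n=t_n-t_{n-1}$. $\mathbb V$ is the space of $V_h$-valued functions on $(0,T)$ constant on each $I_n$. $\mathbb V_1$ (resp. $\mathbb V_2$) is the space of functions $[0,T]\to V_h$, defined at every point, whose restriction to $(0,T)$ is in $\mathbb V$ and that are right-continuous at $t_0,\dots,t_{N-1}$ (resp. left-continuous at $t_1,\dots,t_N$).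 Temporal jumps: $(|w|)_n=w(t_n^-)-w(t_n^+)$ for $1\le n\le N-1$, $(|w|)_0=w(0)-w(0^+)$, $(|w|)_N=w(T^-)-w(T)$. The reconstructions are the continuous-in-time functions $(\mathcal I_1w)(t)=w(t)-\frac{t-t_{n-1}}{\tau_n}(|w|)_n$ for $t\in[t_{n-1},t_n)$, $w\in\mathbb V_1$, and $(\mathcal I_2w)(t)=w(t)+\frac{t_n-t}{\tau_n}(|w|)_{n-1}$ for $t\in(t_{n-1},t_n]$, $w\in\mathbb V_2$, $1\le n\le N$ (with $(\mathcal I_1w)(T)=w(T)$, $(\mathcal I_2w)(0)=w(0)$). **Scheme.** $\Pi_0,\Pi_T:L^2(\Omega)\to V_h$ are given operators. A solution of the scheme with stabilizations $\mathcal S_1,\mathcal S_2:\mathbb V_1\times\mathbb V_2\times\mathbb V\to\mathbb R$ is $(u_{h,\tau},m_{h,\tau})\in\mathbb V_1\times\mathbb V_2$ with $m_{h,\tau}(0)=\Pi_0m_0$, $u_{h,\tau}(T)=\Pi_TS[m_{h,\tau}(T)]$ and, writing $U_{h,\tau}=\mathcal I_1u_{h,\tau}$, $M_{h,\tau}=\mathcal I_2m_{h,\tau}$, for all $v\in\mathbb V$, $$\int_0^T[-(\partial_tU_{h,\tau},v)_\Omega+(\nu\nabla u_{h,\tau},\nabla v)_\Omega+(H[\nabla u_{h,\tau}],v)_\Omega]dt+\mathcal S_1(u_{h,\tau};m_{h,\tau};v)=\int_0^T\langle F[m_{h,\tau}],v\rangle dt,$$ $$\int_0^T[(\partial_tM_{h,\tau},v)_\Omega+(\nu\nabla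 m_{h,\tau},\nabla v)_\Omega+(m_{h,\tau}H_p[\nabla u_{h,\tau}],\nabla v)_\Omega]dt+\mathcal S_2(u_{h,\tau};m_{h,\tau};v)=\int_0^T\langle G,v\rangle dt.$$ **Residual estimators.** Volume residuals on $I_n\times K$: $r_{K,n,1}=F[m_{h,\tau}]+\partial_tU_{h,\tau}+\nu\Delta(u_{h,\tau}|_K)-H[\nabla u_{h,\tau}]$, $r_{K,n,2}=G-\partial_tM_{h,\tau}+\nu\Delta(m_{h,\tau}|_K)+\mathrm{div}(m_{h,\tau}H_p[\nabla u_{h,\tau}])$ (divergence taken on $K$); it is implicitly assumed that these are well-defined $L^2(I_n\times K)$ functions. Face residuals on $I_n\times F$, $F\in\mathcal F^I$: $j_{F,n,1}=\nu[\![\nabla u_{h,\tau}\cdot n_F]\!]_F$, $j_{F,n,2}=\nu[\![\nabla m_{h,\tau}\cdot n_F]\!]_F+m_{h,\tau}[\![H_p[\nabla u_{h,\tau}]\cdot n_F]\!]_F$, where $[\![q\cdot n_F]\!]_F$ is the jump of the normal component across $F$ (the sum of $q|_K\cdot n_K$ over the two elements $K\supset F$, $n_K$ the outward normal). Then $\eta_{R,i}^2=\sum_{n=1}^N\sum_{K\in\mathcal T}\big(h_K^2\|r_{K,n,i}\|_{L^2(I_n\times K)}^2+\sum_{F\in\mathcal F_K^I}h_F\|j_{F,n,i}\|_{L^2(I_n\times F)}^2\big)$.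
   Formalization: The constant C may also depend on the domain Ω, which the list of dependencies omits; a constant independent of Ω is impossible (already for Ω=(0,D) with unit mesh, C must grow with D). C is still independent of T, the time steps and all other data. *)

(* Defs.v *)
From HB Require Import structures.
From mathcomp Require Import all_boot all_order all_algebra finmap.
From mathcomp Require Import all_classical all_reals all_analysis.

Set Implicit Arguments.
Unset Strict Implicit.
Unset Printing Implicit Defensive.
Import Order.TTheory GRing.Theory Num.Theory.
Import numFieldNormedType.Exports.
Local Open Scope classical_set_scope.
Local Open Scope ring_scope.

Definition row_display : measure_display.
Proof. exact: default_measure_display. Qed.

(* 'rV[R]_n carries the product sigma-algebra, i.e. the Borel one. *)
Section row_measurable.
Context {R : realType} {n : nat}.

Let coord : 'I_n -> 'rV[R]_n -> R := fun i x => x ord0 i.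

Let row_set0 : g_sigma_preimage coord set0.
Proof. exact: sigma_algebra0. Qed.

Let row_setC A : g_sigma_preimage coord A -> g_sigma_preimage coord (~` A).
Proof. exact: sigma_algebraC. Qed.

Let row_bigcup (F : _^nat) : (forall i, g_sigma_preimage coord (F i)) ->
  g_sigma_preimage coord (\bigcup_i (F i)).
Proof. exact: sigma_algebra_bigcup. Qed.

HB.instance Definition _ := @isMeasurable.Build row_display
  'rV[R]_n (g_sigma_preimage coord) row_set0 row_setC row_bigcup.

End row_measurable.

Lemma measurable_coord (R : realType) n (i : 'I_n) :
  measurable_fun [set: 'rV[R]_n] (fun x => x ord0 i).
Proof.
move=> _ Y mY; rewrite setTI; apply: sub_sigma_algebra => /=.
rewrite -bigcup_seq/=; exists i => /=; first by rewrite mem_index_enum.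
by exists Y => //; rewrite setTI.
Qed.

Lemma measurable_fun_row d (T : measurableType d) (R : realType) n
    (f : T -> 'rV[R]_n) :
  (forall i, measurable_fun [set: T] (fun x => f x ord0 i)) ->
  measurable_fun [set: T] f.
Proof.
move=> mf; pose coord (i : 'I_n) (x : 'rV[R]_n) : R := x ord0 i.
have h : g_sigma_preimage (fun i => coord i \o f) `<=` measurable.
  apply: smallest_sub; first exact: sigma_algebra_measurable.
  case: n => [|n] in f mf coord *; first by rewrite big_ord0.
  rewrite -bigcup_mkord_ord; apply: bigcup_sub => i Ii.
  by move=> A [B mB <-]; exact: mf.
move=> _ A mA; apply: h.
by rewrite g_sigma_preimage_comp; exists A.
Qed.

Definition row_cons (R : realType) n (p : R * 'rV[R]_n) : 'rV[R]_n.+1 :=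
  \row_i oapp (p.2 ord0) p.1 (unlift ord0 i).

Lemma measurable_row_cons (R : realType) n :
  measurable_fun [set: R * 'rV[R]_n] (@row_cons R n).
Proof.
apply: measurable_fun_row => i; case: (unliftP ord0 i) => [j|] ->.
  rewrite (_ : (fun _ => _) = (fun x : 'rV[R]_n => x ord0 j) \o snd); last first.
    by apply/funext => p /=; rewrite mxE liftK.
  by apply: measurableT_comp => //; exact: measurable_coord.
rewrite (_ : (fun _ => _) = fst)//.
by apply/funext => p /=; rewrite mxE unlift_none.
Qed.

Section row_product.
Context {R : realType} {n : nat}.
Variable mu : {sigma_finite_measure set 'rV[R]_n -> \bar R}.

Definition row_product : set 'rV[R]_n.+1 -> \bar R :=
  pushforward (lebesgue_measure \x mu)%E (@row_cons R n).

Let mc (A : set 'rV[R]_n.+1) : measurable A ->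
  measurable (@row_cons R n @^-1` A).
Proof. by move=> mA; rewrite -[X in measurable X]setTI; exact: measurable_row_cons. Qed.

Let p0 : row_product set0 = 0%E.
Proof. by rewrite /row_product /pushforward preimage_set0 measure0. Qed.

Let p_ge0 A : (0 <= row_product A)%E.
Proof. by rewrite /row_product /pushforward. Qed.

Let p_sigma_additive : semi_sigma_additive row_product.
Proof.
move=> F mF tF mUF; rewrite /row_product /pushforward preimage_bigcup.
apply: measure_semi_sigma_additive.
- by move=> k; exact: mc.
- apply/trivIsetP => /= i j _ _ ij; rewrite -preimage_setI.
  by move/trivIsetP : tF => /(_ _ _ _ _ ij) ->//; rewrite preimage_set0.
- by rewrite -preimage_bigcup; exact: mc.
Qed.

HB.instance Definition _ := isMeasure.Build _ _ _ row_product
  p0 p_ge0 p_sigma_additive.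

Let rest (x : 'rV[R]_n.+1) : R * 'rV[R]_n :=
  (x ord0 ord0, \row_j x ord0 (lift ord0 j)).

Let rest_cons p : rest (row_cons p) = p.
Proof.
case: p => a y; rewrite /rest /row_cons; congr pair.
  by rewrite mxE unlift_none.
by apply/rowP => j; rewrite !mxE liftK.
Qed.

Let mrest : measurable_fun [set: 'rV[R]_n.+1] rest.
Proof.
apply: measurable_fun_pair; first exact: measurable_coord.
apply: measurable_fun_row => i; rewrite (_ : (fun _ => _) =
  (fun x : 'rV[R]_n.+1 => x ord0 (lift ord0 i))); first exact: measurable_coord.
by apply/funext => x; rewrite mxE.
Qed.

Let p_sigma_finite : sigma_finite setT row_product.
Proof.
have /sigma_finiteP[F [TF ndF Foo]] := sigma_finiteT (@lebesgue_measure R).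
have /sigma_finiteP[G [TG ndG Goo]] := sigma_finiteT mu.
exists (fun k => rest @^-1` (F k `*` G k)).
  rewrite -preimage_bigcup; apply/esym/seteqP; split=> // x _ /=.
  have [i _ Fi] : (\bigcup_i F i) (rest x).1 by rewrite -TF.
  have [j _ Gj] : (\bigcup_i G i) (rest x).2 by rewrite -TG.
  exists (maxn i j) => //; split.
  - by move: Fi; exact/subsetPset/ndF/leq_maxl.
  - by move: Gj; exact/subsetPset/ndG/leq_maxr.
move=> k; have [mFk Fk] := Foo k; have [mGk Gk] := Goo k.
have mFG : measurable (F k `*` G k) by exact: measurableX.
split; first by rewrite -[X in measurable X]setTI; exact: mrest.
rewrite /row_product /pushforward -comp_preimage.
rewrite (_ : rest \o _ = id); last by apply/funext => p /=; rewrite rest_cons.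
by rewrite preimage_id product_measure1E// lte_mul_pinfty// ge0_fin_numE.
Qed.

HB.instance Definition _ := Measure_isSigmaFinite.Build _ _ _ row_product
  p_sigma_finite.

End row_product.

Section point_mass.
Context {R : realType}.
Definition row0 : set 'rV[R]_0 -> \bar R := \d_(0 : 'rV[R]_0).
HB.instance Definition _ := Measure.on row0.
Let row0_sf : sigma_finite setT row0.
Proof.
apply: fin_num_fun_sigma_finite; first by rewrite measure0.
by move=> A mA; rewrite /row0 /dirac.
Qed.
HB.instance Definition _ := Measure_isSigmaFinite.Build _ _ _ row0 row0_sf.
End point_mass.

(* Lebesgue measure on R^n, as an iterated product *)
Fixpoint vol (R : realType) n : {sigma_finite_measure set 'rV[R]_n -> \bar R} :=
  match n with
  | 0 => row0
  | n'.+1 => row_product (vol R n')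
  end.

Lemma vol_rectangle (R : realType) n (A : 'I_n -> set R) :
  (forall i, measurable (A i)) ->
  vol R n [set x | forall i, A i (x ord0 i)] =
  (\prod_i @lebesgue_measure R (A i))%E.
Proof.
elim: n A => [|n IH] A mA.
  rewrite big_ord0 /= /row0 diracE mem_set//.
  by case.
rewrite big_ord_recl -IH; last by move=> i; exact: mA.
have mB : measurable [set x : 'rV[R]_n | forall i, A (lift ord0 i) (x ord0 i)].
  rewrite (_ : [set _ | _] = \bigcap_(i in [set: 'I_n])
    ((fun x : 'rV[R]_n => x ord0 i) @^-1` A (lift ord0 i))); last first.
    by apply/seteqP; split=> [x /= Ax i _|x /= Ax i]; [exact: Ax|exact: (Ax i)].
  apply: fin_bigcap_measurable => // i _.
  by rewrite -[X in measurable X]setTI; exact: measurable_coord.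
rewrite -product_measure1E//=; rewrite /row_product /pushforward.
congr (product_measure1 _ _ _); apply/seteqP; split=> -[a y] /=.
  move=> Ax.
  split; first by move: (Ax ord0); rewrite mxE unlift_none.
  by move=> i; move: (Ax (lift ord0 i)); rewrite mxE liftK.
move=> [A0 Ay] i.
case: (unliftP ord0 i) => [j|] ->; rewrite mxE ?liftK ?unlift_none//=.
exact: mA.
Qed.

Section euclidean.
Context {R : realType}.

Definition dotv n (x y : 'rV[R]_n) : R := \sum_i x ord0 i * y ord0 i.

(* The canonical norm of 'rV[R]_n is the sup norm, hence this one. *)
Definition enorm n (x : 'rV[R]_n) : R := Num.sqrt (dotv x x).

Definition ediam n (A : set 'rV[R]_n) : R :=
  sup [set enorm (x - y) | x in A & y in A].

Definition partial n (i : 'I_n) (f : 'rV[R]_n -> R) : 'rV[R]_n -> R :=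
  fun x => 'D_(delta_mx ord0 i) f x.

Definition grad n (f : 'rV[R]_n -> R) (x : 'rV[R]_n) : 'rV[R]_n :=
  \row_i partial i f x.

Definition laplacian n (f : 'rV[R]_n -> R) (x : 'rV[R]_n) : R :=
  \sum_i partial i (partial i f) x.

Fixpoint Ck n (k : nat) (f : 'rV[R]_n -> R) : Prop :=
  continuous f /\
  if k is k'.+1 then
    forall i : 'I_n, (forall x, derivable f x (delta_mx ord0 i)) /\
                     Ck k' (partial i f)
  else True.

(* C_c^oo(U) *)
Definition test_fun n (U : set 'rV[R]_n) (f : 'rV[R]_n -> R) : Prop :=
  (forall k, Ck k f) /\
  exists K, [/\ compact K, K `<=` U & forall x, ~ K x -> f x = 0].

Definition itime (T : R) : set R := `]0, T[%classic.

(* C_c^oo(0, T) *)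
Definition time_test (T : R) (psi : R -> R) : Prop :=
  (forall k t, derivable (derive1n k psi) t 1) /\
  exists a b, [/\ 0 < a, b < T & forall t, t < a \/ b < t -> psi t = 0].

Definition affine_on n (A : set 'rV[R]_n) (v : 'rV[R]_n -> R) : Prop :=
  exists g c, forall x, A x -> v x = c + dotv g x.

(* Near each boundary point the domain is, up to an isometry Q and the choice
   of a coordinate i, the set above the graph of a Lipschitz function of the
   remaining coordinates. *)
Definition lipschitz_boundary n (Om : set 'rV[R]_n) : Prop :=
  forall x, closure Om x -> ~ Om x ->
  exists (Q : 'M[R]_n) (i : 'I_n) (gamma : 'rV[R]_n.-1 -> R) (L r : R),
    [/\ Q *m Q^T = 1%:M, 0 < r,
        forall y z, `|gamma y - gamma z| <= L * enorm (y - z) &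
        forall y, enorm (y - x) < r ->
          (Om y <-> gamma (col' i (y *m Q)) < (y *m Q) ord0 i)].

Definition lipschitz_domain n (Om : set 'rV[R]_n) : Prop :=
  [/\ open Om, bounded_set Om, connected Om & lipschitz_boundary Om].

End euclidean.

Section lebesgue_spaces.
Context {R : realType} {d : nat}.
Local Notation Rd := 'rV[R]_d.

Definition inner (D : set Rd) (f g : Rd -> R) : R :=
  \int[vol R d]_(x in D) (f x * g x).

Definition innerv (D : set Rd) (f g : Rd -> Rd) : R :=
  \int[vol R d]_(x in D) dotv (f x) (g x).

Definition normL2 (D : set Rd) (f : Rd -> R) : \bar R :=
  sqrte (\int[vol R d]_(x in D) ((f x) ^+ 2)%:E)%E.

Definition normL2v (D : set Rd) (f : Rd -> Rd) : \bar R :=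
  sqrte (\int[vol R d]_(x in D) ((enorm (f x)) ^+ 2)%:E)%E.

Definition L2 (D : set Rd) (f : Rd -> R) : Prop :=
  measurable_fun D f /\ (normL2 D f < +oo)%E.

(* norms of L^p(D) and L^p(D; R^d), 1 <= p <= +oo *)
Definition normLp (p : \bar R) (D : set Rd) (f : Rd -> R) : \bar R :=
  Lnorm (vol R d) p ((EFin \o f) \_ D).

Definition normLpv (p : \bar R) (D : set Rd) (f : Rd -> Rd) : \bar R :=
  Lnorm (vol R d) p ((EFin \o (@enorm R d \o f)) \_ D).

Definition Lp (p : \bar R) (D : set Rd) : set (Rd -> R) :=
  [set f | measurable_fun D f /\ (normLp p D f < +oo)%E].

Definition Lpv (p : \bar R) (D : set Rd) : set (Rd -> Rd) :=
  [set f | measurable_fun D f /\ (normLpv p D f < +oo)%E].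

(* H^1_0 is the closure of C_c^oo in H^1: v belongs to it, with weak gradient
   g, iff some test functions converge to v in L^2 and their gradients to g.
   Representatives are taken measurable on the whole of R^d; their values
   outside Om are otherwise irrelevant. *)
Definition H10_grad (Om : set Rd) (v : Rd -> R) (g : Rd -> Rd) : Prop :=
  [/\ measurable_fun setT v /\ (normL2 Om v < +oo)%E,
      measurable_fun setT g /\ (normL2v Om g < +oo)%E &
      exists phi : nat -> Rd -> R,
        [/\ forall k, test_fun Om (phi k),
            normL2 Om (fun x => phi k x - v x) @[k --> \oo] --> 0%E &
            normL2v Om (fun x => grad (phi k) x - g x) @[k --> \oo] --> 0%E]].

Definition H10 (Om : set Rd) : set (Rd -> R) :=
  [set v | exists g, H10_grad Om v g].

(* the weak gradient of v in H^1_0 (unique a.e. in Om) *)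
Definition wgrad (Om : set Rd) (v : Rd -> R) : Rd -> Rd :=
  xget (fun=> 0) [set g | H10_grad Om v g].

Definition normH10 (Om : set Rd) (v : Rd -> R) : \bar R :=
  normL2v Om (wgrad Om v).

(* H^{-1}: bounded linear functionals on H^1_0 *)
Definition Hm1 (Om : set Rd) : set ((Rd -> R) -> R) :=
  [set l | (forall a v w, H10 Om v -> H10 Om w ->
             l (fun x => a * v x + w x) = a * l v + l w) /\
           exists C, forall v, H10 Om v ->
             (`|l v|%:E <= C%:E * normH10 Om v)%E].

Definition normHm1 (Om : set Rd) (l : (Rd -> R) -> R) : \bar R :=
  ereal_sup [set (`|l v|%:E)%E | v in
             [set v | H10 Om v /\ (normH10 Om v <= 1)%E]].

End lebesgue_spaces.

(* Bochner spaces on I = (0, T) of functions valued in a normed space (E, N) of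
   functions X -> V. *)
Section bochner.
Context {R : realType} (T : R) {X : Type} {V : lmodType R}.
Variables (E : set (X -> V)) (N : (X -> V) -> \bar R).

Definition simple_valued (s : R -> X -> V) : Prop :=
  exists (m : nat) (B : 'I_m -> set R) (e : 'I_m -> X -> V),
    [/\ forall i, measurable (B i), forall i, E (e i) &
        forall t x, s t x = \sum_i (\1_(B i) t : R) *: e i x].

Definition strongly_measurable (v : R -> X -> V) : Prop :=
  {ae @lebesgue_measure R, forall t, itime T t -> E (v t)} /\
  exists s : nat -> R -> X -> V,
    (forall k, simple_valued (s k)) /\
    {ae @lebesgue_measure R, forall t, itime T t ->
       N (fun x => v t x - s k t x) @[k --> \oo] --> 0%E}.

Definition bochner (p : \bar R) (v : R -> X -> V) : Prop :=
  strongly_measurable v /\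
  (Lnorm (@lebesgue_measure R) p ((fun t => N (v t)) \_ (itime T)) < +oo)%E.

End bochner.

Section spacetime.
Context {R : realType} {d : nat}.
Local Notation Rd := 'rV[R]_d.
Variables (T : R) (Om : set Rd).
Local Notation leb := (@lebesgue_measure R).

(* X = L^2(I; H^1_0) *)
Definition spX (v : R -> Rd -> R) : Prop :=
  @bochner R T Rd R^o (H10 Om) (normH10 Om) 2%:E v.

Definition normX (v : R -> Rd -> R) : \bar R :=
  sqrte (\int[leb]_(t in itime T) (normH10 Om (v t) ^+ 2))%E.

Definition dualX (l : (R -> Rd -> R) -> R) : Prop :=
  (forall a v w, spX v -> spX w ->
     l (fun t x => a * v t x + w t x) = a * l v + l w) /\
  exists C, forall v, spX v -> (`|l v|%:E <= C%:E * normX v)%E.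

(* vT is the value at time T of the L^2-continuous representative of v *)
Definition final_trace (v : R -> Rd -> R) (vT : Rd -> R) : Prop :=
  exists w : R -> Rd -> R,
    [/\ {ae leb, forall t, itime T t ->
           {ae vol R d, forall x, Om x -> w t x = v t x}},
        forall t, `[0, T]%classic t -> L2 Om (w t),
        forall t, `[0, T]%classic t ->
          normL2 Om (fun x => w s x - w t x)
            @[s --> within `[0, T]%classic (nbhs t)] --> 0%E &
        w T = vT].

(* v belongs to Y, with time derivative dv in L^2(I; H^{-1}) and final value
   vT *)
Definition spY (v : R -> Rd -> R) (dv : R -> (Rd -> R) -> R) (vT : Rd -> R)
    : Prop :=
  [/\ spX v,
      @bochner R T (Rd -> R) R^o (Hm1 Om) (normHm1 Om) 2%:E dv,
      forall psi phi, time_test T psi -> H10 Om phi ->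
        \int[leb]_(t in itime T) (dv t phi * psi t) =
        - \int[leb]_(t in itime T) (inner Om (v t) phi * derive1 psi t) &
      final_trace v vT].

Definition normY (v : R -> Rd -> R) (dv : R -> (Rd -> R) -> R) (vT : Rd -> R)
    : \bar R :=
  sqrte (\int[leb]_(t in itime T)
           (normHm1 Om (dv t) ^+ 2 + normH10 Om (v t) ^+ 2)
         + normL2 Om vT ^+ 2)%E.

(* L^2 of J x D *)
Definition L2Q (J : set R) (D : set Rd) (f : R -> Rd -> R) : Prop :=
  measurable_fun (J `*` D) (fun p : R * Rd => f p.1 p.2) /\
  (\int[leb]_(t in J) \int[vol R d]_(x in D) ((f t x) ^+ 2)%:E < +oo)%E.

(* the functional l on X is the L^2(Q_T) function f *)
Definition represented_by (l : (R -> Rd -> R) -> R) (f : R -> Rd -> R) : Prop :=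
  L2Q (itime T) Om f /\
  forall v, spX v -> l v = \int[leb]_(t in itime T) inner Om (f t) (v t).

Definition normLinfQ (f : R -> Rd -> R) : \bar R :=
  Lnorm (leb \x vol R d)%E +oo%E
    ((fun p : R * Rd => (f p.1 p.2)%:E) \_ (itime T `*` Om)).

End spacetime.

Section data.
Context {R : realType} {d : nat}.
Local Notation Rd := 'rV[R]_d.
Local Notation leb := (@lebesgue_measure R).
Variables (T : R) (Om : set Rd).

Definition closed_cylinder (t : R) (x : Rd) : Prop :=
  `[0, T]%classic t /\ closure Om x.

Section hamiltonian.
Variables (A : metricType R) (b : R -> Rd -> A -> Rd) (f : R -> Rd -> A -> R).

Definition Ham (t : R) (x p : Rd) : R :=
  sup [set dotv (b t x a) p - f t x a | a in [set: A]].

Record hamiltonian_data (Hp : R -> Rd -> Rd -> Rd) (LHp : R) : Prop := {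
  controls_nonempty : [set: A] !=set0 ;
  controls_compact : compact [set: A] ;
  coefficients_unif_continuous : forall e : R, 0 < e ->
    exists2 dl : R, 0 < dl & forall t x a t' x' a',
      closed_cylinder t x -> closed_cylinder t' x' ->
      `|t - t'| < dl -> enorm (x - x') < dl -> mdist a a' < dl ->
      enorm (b t x a - b t' x' a') < e /\ `|f t x a - f t' x' a'| < e ;
  Ham_differentiable : forall t x, closed_cylinder t x -> forall p,
    differentiable (Ham t x : Rd -> R) p /\
    forall q, 'd (Ham t x : Rd -> R) p q = dotv (Hp t x p) q ;
  Hp_lipschitz : forall t x, closed_cylinder t x -> forall p q,
    enorm (Hp t x p - Hp t x q) <= LHp * enorm (p - q) }.
End hamiltonian.

(* jX is the embedding of X into the Hilbert space Z; that of Y is its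
   restriction, as Y is a subspace of X. *)
Record embedding_data (Z : completeNormedModType R) (ip : Z -> Z -> R)
    (jX : (R -> Rd -> R) -> Z) : Prop := {
  ip_sym : forall x y, ip x y = ip y x ;
  ip_linear : forall a x y z, ip (a *: x + y) z = a * ip x z + ip y z ;
  ip_norm : forall x, ip x x = `|x| ^+ 2 ;
  jX_linear : forall a v w, spX T Om v -> spX T Om w ->
    jX (fun t x => a * v t x + w t x) = a *: jX v + jX w ;
  jX_injective : forall v, spX T Om v -> jX v = 0 -> normX T Om v = 0%E ;
  jX_continuous : exists C, forall v, spX T Om v ->
    (`|jX v|%:E <= C%:E * normX T Om v)%E ;
  jY_continuous : exists C, forall v dv vT, spY T Om v dv vT ->
    (`|jX v|%:E <= C%:E * normY T Om v dv vT)%E ;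
  jY_compact : forall (v : nat -> R -> Rd -> R) dv vT (C : R),
    (forall k, spY T Om (v k) (dv k) (vT k)) ->
    (forall k, (normY T Om (v k) (dv k) (vT k) <= C%:E)%E) ->
    exists2 sigma : nat -> nat, {homo sigma : i j / (i < j)%N} &
      cvgn (fun k => jX (v (sigma k))) }.

Record coupling_data (Z : completeNormedModType R) (jX : (R -> Rd -> R) -> Z)
    (F : Z -> (R -> Rd -> R) -> R) (S : (Rd -> R) -> Rd -> R) (LF LS : R)
    : Prop := {
  F_dual : forall z, dualX T Om (F z) ;
  F_lipschitz : forall z1 z2 v, spX T Om v ->
    (`|F z1 v - F z2 v|%:E <= (LF * `|z1 - z2|)%:E * normX T Om v)%E ;
  S_L2 : forall g, L2 Om g -> L2 Om (S g) ;
  S_lipschitz : forall g1 g2, L2 Om g1 -> L2 Om g2 ->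
    (normL2 Om (fun x => S g1 x - S g2 x)%R <=
     LS%:E * normL2 Om (fun x => g1 x - g2 x)%R)%E ;
  FS_monotone : forall v1 dv1 v1T v2 dv2 v2T,
    spY T Om v1 dv1 v1T -> spY T Om v2 dv2 v2T ->
    let w := fun t x => v1 t x - v2 t x in
    0 <= F (jX v1) w - F (jX v2) w
         + inner Om (fun x => S v1T x - S v2T x) (fun x => v1T x - v2T x) ;
  F_L2 : forall v, spX T Om v ->
    exists f, represented_by T Om (F (jX v)) f }.

(* G = g0 - div g1 is an identity of distributions on Q_T; it is tested with
   products psi(t) phi(x), whose span is dense in C_c^oo(Q_T). *)
Record source_data (G : (R -> Rd -> R) -> R) (g0 : R -> Rd -> R)
    (g1 : R -> Rd -> Rd) (r s : \bar R) : Prop := {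
  G_dual : dualX T Om G ;
  r_gt1 : (1 < r)%E ;
  s_gt1 : (1 < s)%E ;
  rs_lt1 : (r^-1 + (d%:R / 2)%:E * s^-1 < 1)%E ;
  g0_integrable :
    @bochner R T Rd R^o (Lp s Om) (normLp s Om) r g0 ;
  g1_integrable :
    bochner T (Lpv (2%:E * s)%E Om) (normLpv (2%:E * s)%E Om) (2%:E * r)%E g1 ;
  G_eq : forall psi phi, time_test T psi -> test_fun Om phi ->
    G (fun t x => psi t * phi x) =
    \int[leb]_(t in itime T)
      (psi t * (inner Om (g0 t) phi + innerv Om (g1 t) (grad phi))) ;
  G_ge0 : forall w, spX T Om w ->
    {ae leb, forall t, itime T t ->
       {ae vol R d, forall x, Om x -> 0 <= w t x}} ->
    0 <= G w ;
  G_L2 : exists g, represented_by T Om G g }.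

Record initial_density (m0 : Rd -> R) : Prop := {
  m0_Linf : Lp +oo%E Om m0 ;
  m0_ge0 : {ae vol R d, forall x, Om x -> 0 <= m0 x} }.

End data.

(* A simplex is the finite set of its vertices; a mesh is a finite set of
   simplices. *)
Section mesh.
Context {R : realType} {d : nat}.
Local Notation Rd := 'rV[R]_d.
Implicit Types (K F : {fset Rd}) (Th : {fset {fset Rd}}) (Om : set Rd).

Definition hull K : set Rd :=
  [set x | exists lam : Rd -> R,
     [/\ forall a, a \in K -> 0 <= lam a, \sum_(a <- K) lam a = 1 &
         x = \sum_(a <- K) lam a *: a]].

Definition affinely_independent K : Prop :=
  forall lam : Rd -> R, \sum_(a <- K) lam a = 0 ->
    \sum_(a <- K) lam a *: a = 0 -> forall a, a \in K -> lam a = 0.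

Record conforming_mesh Om Th : Prop := {
  mesh_simplex : forall K, K \in Th ->
    #|` K| = d.+1 /\ affinely_independent K ;
  mesh_cover : [set x | exists2 K, K \in Th & hull K x] = closure Om ;
  mesh_conforming : forall K K', K \in Th -> K' \in Th ->
    hull K `&` hull K' = hull (K `&` K')%fset }.

Definition hK K : R := ediam (hull K).

Definition rhoK K : R :=
  sup [set 2 * r | r in [set r | 0 <= r /\
    exists c, forall x, enorm (x - c) <= r -> hull K x]].

Definition shape_regularity Th : R := \big[Num.max/0]_(K <- Th) (hK K / rhoK K).

Definition interior_face Th F : bool :=
  (#|` F| == d) && (#|` [fset K in Th | (F `<=` K)%fset]%fset| == 2)%N.

Definition interior_faces_of Th K : {fset {fset Rd}} :=
  [fset F in fpowerset K | interior_face Th F]%fset.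

Definition hF Th F : R :=
  if d == 1%N then \big[Num.max/0]_(K <- Th | (F `<=` K)%fset) hK K
  else ediam (hull F).

Definition normal K F : Rd :=
  xget 0 [set nu | [/\ enorm nu = 1,
    forall x y, x \in F -> y \in F -> dotv nu (x - y) = 0 &
    forall x a, x \in F -> a \in K -> a \notin F -> dotv nu (a - x) < 0]].

Definition face_jump Th F (q : {fset Rd} -> Rd) : R :=
  \sum_(K <- Th | (F `<=` K)%fset) dotv (q K) (normal K F).

(* gradient of the restriction to K of a function that is affine on K *)
Definition gradK K (v : Rd -> R) : Rd :=
  xget 0 [set g | exists c, forall x, hull K x -> v x = c + dotv g x].

(* Surface integral over the (d-1)-simplex F, by the affine parametrization
   s |-> a_0 + sum_i s_i (a_(i+1) - a_0) of F = {a_0, ..., a_(d-1)} over the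
   unit simplex of R^(d-1), whose Jacobian is the square root of the Gram
   determinant of the edges; for d = 1 this is evaluation at the point F. *)
Definition unit_simplex n : set 'rV[R]_n :=
  [set s | (forall i, 0 <= s ord0 i) /\ \sum_i s ord0 i <= 1].

Definition face_edges F : 'M[R]_(d.-1, d) :=
  \matrix_(i < d.-1, j < d)
    (nth 0 (enum_fset F) i.+1 - nth 0 (enum_fset F) 0) ord0 j.

Definition face_integral F (g : Rd -> \bar R) : \bar R :=
  (\int[vol R d.-1]_(s in @unit_simplex d.-1)
     (g (nth 0%R (enum_fset F) 0 + s *m face_edges F)%R *
      (Num.sqrt (\det (face_edges F *m (face_edges F)^T)))%:E))%E.

Definition vertices Th : {fset Rd} := [fset z | K in Th, z in K]%fset.

Definition interior_vertices Om Th : {fset Rd} :=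
  [fset z in vertices Th | z \in Om]%fset.

Definition patch_of Th (z : Rd) : set Rd :=
  [set x | exists K, [/\ K \in Th, z \in K & hull K x]].

(* V_h.  An element is identified with its representative that is affine on
   every closed element (hence continuous on the closure of Om) and vanishes
   off Om, so that equality of functions is equality in V_h and point values
   make sense. *)
Definition Vh Om Th : set (Rd -> R) :=
  [set v | [/\ H10 Om v, forall K, K \in Th -> affine_on (hull K) v &
               forall x, ~ Om x -> v x = 0]].

Definition nodal_basis Om Th (phi : Rd -> Rd -> R) : Prop :=
  forall z, z \in interior_vertices Om Th ->
    Vh Om Th (phi z) /\
    forall z', z' \in interior_vertices Om Th -> phi z z' = (z == z')%:R.

Definition lumped Om Th (phi : Rd -> Rd -> R) (v w : Rd -> R) : R :=
  \sum_(z <- interior_vertices Om Th)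
    (inner Om (phi z) (fun=> 1)) * v z * w z.

End mesh.

Section discrete.
Context {R : realType} {d : nat}.
Local Notation Rd := 'rV[R]_d.
Local Notation leb := (@lebesgue_measure R).
Variables (T : R) (Om : set Rd) (Th : {fset {fset Rd}}).
Variables (N : nat) (tt : nat -> R).

Definition time_partition : Prop :=
  [/\ tt 0%N = 0, tt N = T & forall k, (k < N)%N -> tt k < tt k.+1].

Definition slab (k : nat) : set R := `]tt k, tt k.+1[%classic.

Definition Vtau (v : R -> Rd -> R) : Prop :=
  forall k, (k < N)%N -> exists2 w, Vh Om Th w & forall t, slab k t -> v t = w.

(* elements of Vtau are functions on the union of the open slabs *)
Definition Vtau_nonzero (v : R -> Rd -> R) : Prop :=
  exists k t, [/\ (k < N)%N, slab k t & v t <> 0].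

Definition V1 (v : R -> Rd -> R) : Prop :=
  [/\ forall t, `[0, T]%classic t -> Vh Om Th (v t), Vtau v &
      forall k, (k < N)%N -> forall x, v s x @[s --> (tt k)^'+] --> v (tt k) x].

Definition V2 (v : R -> Rd -> R) : Prop :=
  [/\ forall t, `[0, T]%classic t -> Vh Om Th (v t), Vtau v &
      forall k, (k < N)%N ->
        forall x, v s x @[s --> (tt k.+1)^'-] --> v (tt k.+1) x].

Definition jump_t (w : R -> Rd -> R) (k : nat) (x : Rd) : R :=
  if k == 0%N then w 0 x - lim (w s x @[s --> 0^'+])
  else if k == N then lim (w s x @[s --> T^'-]) - w T x
  else lim (w s x @[s --> (tt k)^'-]) - lim (w s x @[s --> (tt k)^'+]).

Definition I1 (w : R -> Rd -> R) (t : R) (x : Rd) : R :=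
  if t == T then w T x else
  \sum_(k < N) (if tt k <= t < tt k.+1 then
    w t x - (t - tt k) / (tt k.+1 - tt k) * jump_t w k.+1 x else 0).

Definition I2 (w : R -> Rd -> R) (t : R) (x : Rd) : R :=
  if t == 0 then w 0 x else
  \sum_(k < N) (if tt k < t <= tt k.+1 then
    w t x + (tt k.+1 - t) / (tt k.+1 - tt k) * jump_t w k x else 0).

Definition d_t (U : R -> Rd -> R) (t : R) (x : Rd) : R := derive1 (U ^~ x) t.

Definition L2_to_Vh (P : (Rd -> R) -> Rd -> R) : Prop :=
  (forall g, L2 Om g -> Vh Om Th (P g)) /\
  forall g g', L2 Om g -> L2 Om g' ->
    {ae vol R d, forall x, Om x -> g x = g' x} -> P g = P g'.

Variables (nu : R) (H : R -> Rd -> Rd -> R) (Hp : R -> Rd -> Rd -> Rd).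

Record scheme_solution (Z : completeNormedModType R)
    (jX : (R -> Rd -> R) -> Z) (F : Z -> (R -> Rd -> R) -> R)
    (S : (Rd -> R) -> Rd -> R) (G : (R -> Rd -> R) -> R) (m0 : Rd -> R)
    (Pi0 PiT : (Rd -> R) -> Rd -> R)
    (S1 S2 : (R -> Rd -> R) -> (R -> Rd -> R) -> (R -> Rd -> R) -> R)
    (u m : R -> Rd -> R) : Prop := {
  scheme_u : V1 u ;
  scheme_m : V2 m ;
  scheme_m0 : m 0 = Pi0 m0 ;
  scheme_uT : u T = PiT (S (m T)) ;
  scheme_HJB : forall v, Vtau v ->
    \int[leb]_(t in itime T)
      (- inner Om (d_t (I1 u) t) (v t)
       + innerv Om (fun x => nu *: wgrad Om (u t) x) (wgrad Om (v t))
       + inner Om (fun x => H t x (wgrad Om (u t) x)) (v t))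
    + S1 u m v = F (jX m) v ;
  scheme_KFP : forall v, Vtau v ->
    \int[leb]_(t in itime T)
      (inner Om (d_t (I2 m) t) (v t)
       + innerv Om (fun x => nu *: wgrad Om (m t) x) (wgrad Om (v t))
       + innerv Om (fun x => m t x *: Hp t x (wgrad Om (u t) x))
                   (wgrad Om (v t)))
    + S2 u m v = G v }.

Section stabilization.
Variables (phi : Rd -> Rd -> R) (Sh : (Rd -> R) -> (Rd -> R) -> (Rd -> R) -> R).

Definition stab1 (u m v : R -> Rd -> R) : R :=
  \int[leb]_(t in itime T)
    (inner Om (d_t (I1 u) t) (v t) - lumped Om Th phi (d_t (I1 u) t) (v t)
     + Sh (u t) (m t) (v t)).

Definition stab2 (u m v : R -> Rd -> R) : R :=
  \int[leb]_(t in itime T)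
    (lumped Om Th phi (d_t (I2 m) t) (v t) - inner Om (d_t (I2 m) t) (v t)
     + Sh (u t) (m t) (v t)).

Definition linear_in_third : Prop :=
  forall v w p q a, Vh Om Th v -> Vh Om Th w -> Vh Om Th p -> Vh Om Th q ->
    Sh v w (fun x => a * p x + q x) = a * Sh v w p + Sh v w q.

Definition vanishes_on_affine : Prop :=
  forall z v w, z \in interior_vertices Om Th -> Vh Om Th v -> Vh Om Th w ->
    affine_on (patch_of Th z) v -> affine_on (patch_of Th z) w ->
    Sh v w (phi z) = 0.

Definition stab_lipschitz (L : R) : Prop :=
  forall z v w v' w', z \in interior_vertices Om Th ->
    Vh Om Th v -> Vh Om Th w -> Vh Om Th v' -> Vh Om Th w' ->
    (`|Sh v w (phi z) - Sh v' w' (phi z)|%:E <=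
     L%:E * sqrte (vol R d (patch_of Th z)) *
     (normL2v (patch_of Th z) (wgrad Om (fun x => v x - v' x)%R) +
      normL2v (patch_of Th z) (wgrad Om (fun x => w x - w' x)%R)))%E.

Definition stab_dual_norm (u m : R -> Rd -> R) : \bar R :=
  ereal_sup [set ((\int[leb]_(t in itime T) Sh (u t) (m t) (v t)) /
                  fine (normX T Om v))%:E
            | v in [set v | Vtau v /\ Vtau_nonzero v]].

End stabilization.

(* dq is the divergence on every element of q *)
Definition broken_div (q : R -> Rd -> Rd) (dq : R -> Rd -> R) : Prop :=
  forall k K, (k < N)%N -> K \in Th ->
    {ae leb, forall t, slab k t ->
       forall psi, test_fun (interior (hull K)) psi ->
         innerv (hull K) (q t) (grad psi) = - inner (hull K) (dq t) psi}.

(* Second derivatives are taken pointwise, so that on the interior of K the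
   Laplacian is that of the restriction to K. *)
Definition residual1 (fm : R -> Rd -> R) (u : R -> Rd -> R)
    (t : R) (x : Rd) : R :=
  fm t x + d_t (I1 u) t x + nu * laplacian (u t) x
  - H t x (wgrad Om (u t) x).

Definition residual2 (g dq : R -> Rd -> R) (m : R -> Rd -> R)
    (t : R) (x : Rd) : R :=
  g t x - d_t (I2 m) t x + nu * laplacian (m t) x + dq t x.

Definition face_residual1 (u : R -> Rd -> R) (F : {fset Rd})
    (t : R) (x : Rd) : R :=
  nu * face_jump Th F (fun K => gradK K (u t)).

Definition face_residual2 (u m : R -> Rd -> R) (F : {fset Rd})
    (t : R) (x : Rd) : R :=
  nu * face_jump Th F (fun K => gradK K (m t))
  + m t x * face_jump Th F (fun K => Hp t x (gradK K (u t))).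

Definition elementwise_L2 (r : R -> Rd -> R) : Prop :=
  forall k K, (k < N)%N -> K \in Th -> L2Q (slab k) (hull K) r.

Definition estimator (r : R -> Rd -> R) (j : {fset Rd} -> R -> Rd -> R)
    : \bar R :=
  sqrte (\sum_(k < N) \sum_(K <- Th)
    ((hK K ^+ 2)%:E *
       (\int[leb]_(t in slab k) \int[vol R d]_(x in hull K) ((r t x) ^+ 2)%:E)
     + \sum_(F <- interior_faces_of Th K)
         (hF Th F)%:E *
         (\int[leb]_(t in slab k)
            face_integral F (fun x => ((j F t x) ^+ 2)%:E))))%E.

End discrete.

(* Main.v *)
(* The jump parts of the estimators alone control the stabilization.

   Around an interior vertex z, two simplices of the patch are linked by a chain
   of interior faces containing z, so the gradients of v in V_h on the patch
   differ by sums of jumps.  If the patch has a vertex a on the boundary, a chain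
   of interior faces containing a leads to a boundary facet at a, so the gradient
   is, up to jumps, normal to that facet.  The boundary facets of all meshes of
   Om lie in the finitely many facet planes of one fixed reference mesh.  Hence
   either a single plane passes through all boundary vertices of the patch, and a
   multiple of its equation approximates v there, or two different planes occur,
   which forces the gradient itself to be bounded by jumps, with a constant
   depending on Om only.  In all cases v is close, on the patch, to an element of
   V_h that is affine there and on which the stabilization vanishes; the
   Lipschitz condition then bounds the stabilization at phi_z by jumps.

   Expanding test functions in the nodal basis, it remains to use the
   Cauchy-Schwarz inequality, the finite overlap of the patches, an inverse
   estimate and the Poincare inequality.  Finally j_1 bounds the jumps of grad u,
   and, since the jump of H_p[grad u] is at most L_Hp times that of grad u and m
   is bounded, j_2 and j_1 bound the jumps of grad m. *)
Require Import Defs.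
From HB Require Import structures.
From mathcomp Require Import all_boot all_order all_algebra finmap.
From mathcomp Require Import all_classical all_reals all_analysis.
From mathcomp Require Import perm measurable_realfun ess_sup_inf.
From mathcomp Require Import ring lra.
Set Implicit Arguments.
Unset Strict Implicit.
Unset Printing Implicit Defensive.
Import Order.TTheory GRing.Theory Num.Theory.
Import numFieldNormedType.Exports.
Local Open Scope classical_set_scope.
Local Open Scope ring_scope.


(** * Lebesgue measure and integration by parts on boxes *)

Section measurable_rows.
Context {R : realType}.

(** The powers of the mesh size h balance at each vertex. On a patch, the gradient differs from that
    of the affine substitute by at most h^(-d/2) times the root of a local jump energy. The factor
    |omega_z|^(1/2) of the Lipschitz condition and the one from the L^2 norm of this difference give
    h^d, and h^(d/2) |p(z)| is an L^2 quantity of the test function p. No negative power of h is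
    left, so the Poincare inequality is enough to return to the norm of X. The obstacle is
    geometric. A mesh is only a set of simplices that meet along common faces and cover the closure
    of Om. That a facet has at most two sides, that patches are connected through facets and that
    boundary facets lie in fixed planes is derived from this by moving points into general position.
    In dimension one, neighbouring intervals may have unrelated lengths, and the convention for h_F
    replaces their comparison. Finally, [wgrad] is an arbitrary choice among weak gradients and has
    to be identified almost everywhere with the elementwise gradient. *)

Definition box {n} (a b : 'rV[R]_n) : set 'rV[R]_n :=
  [set x | forall i, a ord0 i <= x ord0 i <= b ord0 i].

Lemma box_setE {n} (a b : 'rV[R]_n) :
  box a b = [set x | forall i, `[a ord0 i, b ord0 i]%classic (x ord0 i)].
Proof.
by apply/seteqP; split => x /= h i; move: (h i); rewrite in_itv.
Qed.

Lemma measurable_box {n} (a b : 'rV[R]_n) : measurable (box a b).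
Proof.
rewrite box_setE.
rewrite [X in measurable X](_ : _ = \bigcap_(i in [set: 'I_n])
    ((fun x : 'rV[R]_n => x ord0 i) @^-1` `[a ord0 i, b ord0 i])).
  apply: fin_bigcap_measurable => // i _.
  by rewrite -[X in measurable X]setTI; exact: measurable_coord.
by apply/seteqP; split=> [x /= Ax i _|x /= Ax i]; [exact: Ax|exact: (Ax i)].
Qed.

Lemma vol_box {n} (a b : 'rV[R]_n) : (forall i, a ord0 i <= b ord0 i) ->
  vol R n (box a b) = (\prod_i (b ord0 i - a ord0 i))%:E.
Proof.
move=> ab; rewrite box_setE (vol_rectangle (A := fun i => `[a ord0 i, b ord0 i]%classic)).
  rewrite -prodEFin; apply: eq_bigr => i _.
  rewrite lebesgue_measure_itv /= lte_fin; case: ltP => // h.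
  by have /eqP -> : b ord0 i == a ord0 i; [rewrite eq_le h ab|rewrite subrr].
by move=> i; exact: measurable_itv.
Qed.

Lemma mx_ballP {n} (x y : 'rV[R]_n) (e : R) : 0 < e ->
  ball x e y <-> forall i, `|x ord0 i - y ord0 i| < e.
Proof.
move=> e0; split => [[_ h] i|h]; first exact: h.
by split => // i j; rewrite (ord1 i); exact: h.
Qed.

(** Rational corners make the union countable. Since the sigma-algebra is generated by the
    coordinates, this is what makes open sets, and then continuous functions, measurable. *)
Lemma open_box_cover {n} (U : set 'rV[R]_n) : open U ->
  U = \bigcup_(p in [set p : 'rV[rat]_n * 'rV[rat]_n |
         (forall i, p.1 ord0 i < p.2 ord0 i) /\
         box (map_mx ratr p.1) (map_mx ratr p.2) `<=` U])
       box (map_mx ratr p.1) (map_mx ratr p.2).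
Proof.
move=> oU; apply/seteqP; split => [x Ux|x [p /= [_ pU] px]]; last exact: pU.
have /nbhs_ballP[e /= e0 xeU] : nbhs x U by move: oU; rewrite openE; exact.
have h1 (i : 'I_n) : exists q : rat, ratr q \in `]x ord0 i - e, x ord0 i[.
  by apply: rat_in_itvoo; rewrite ltrBlDr ltrDl.
have h2 (i : 'I_n) : exists q : rat, ratr q \in `]x ord0 i, x ord0 i + e[.
  by apply: rat_in_itvoo; rewrite ltrDl.
have [f1 hf1] := choice h1; have [f2 hf2] := choice h2.
exists (\row_i f1 i, \row_i f2 i) => [/=|i].
  split => [i|y py].
    have := hf1 i; have := hf2 i; rewrite !in_itv /= !mxE => /andP[? ?] /andP[? ?].
    by rewrite -(ltr_rat R); lra.
  apply: xeU; apply/mx_ballP => // i.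
  have /andP[] := py i; have := hf1 i; have := hf2 i; rewrite !in_itv /= !mxE.
  by rewrite ltr_norml => /andP[? ?] /andP[? ?] ? ?; apply/andP; split; lra.
have := hf1 i; have := hf2 i; rewrite !in_itv /= !mxE => /andP[? ?] /andP[? ?].
by apply/andP; split; apply: ltW.
Qed.

Lemma open_measurable_row {n} (U : set 'rV[R]_n) : open U -> measurable U.
Proof.
move=> /open_box_cover ->; rewrite bigcup_mkcond.
apply: countable_bigcupT_measurable => [|p].
  exact: (@countableP (('rV[rat]_n * 'rV[rat]_n)%type : countType)).
by case: ifPn => // _; exact: measurable_box.
Qed.

Lemma closed_measurable_row {n} (U : set 'rV[R]_n) : closed U -> measurable U.
Proof.
by move=> cU; rewrite -(setCK U); apply: measurableC; apply: open_measurable_row; exact: closed_openC.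
Qed.

Lemma continuous_measurable_row {n} (f : 'rV[R]_n -> R) : continuous f ->
  measurable_fun setT f.
Proof.
move=> /continuousP cf.
apply: (measurability _ (RGenOpens.measurableE R)) => // _ [_ [a [b ->] <-]].
by rewrite setTI; apply: open_measurable_row; apply: cf; exact: itv_open.
Qed.

End measurable_rows.

Section fubini_rows.
Context {R : realType} {n : nat}.

(** [vol] is an iterated product, so its value is the integral of the measures of the slices at
    fixed first coordinate. This is the induction step for null sets. *)
Lemma vol_null_section (A : set 'rV[R]_n.+1) : measurable A ->
  {ae @lebesgue_measure R, forall a, vol R n [set y | A (row_cons (a, y))] = 0%E} ->
  vol R n.+1 A = 0%E.
Proof.
move=> mA A0.
have mc : measurable (@row_cons R n @^-1` A).
  by rewrite -[X in measurable X]setTI; exact: measurable_row_cons.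
rewrite /= /row_product /pushforward /product_measure1.
rewrite (ae_eq_integral (cst 0%E))//; first by rewrite integral0_eq.
  exact: measurable_fun_xsection.
case: A0 => N [mN N0 AN]; exists N; split => // a /= h.
apply: AN => /= h'; apply: h => _ /=.
by rewrite -[RHS]h'; congr (vol R n _); apply/seteqP; split => y /=; rewrite /xsection /= in_setE.
Qed.

End fubini_rows.

Section affine_rows.
Context {R : realType} {n : nat}.
Implicit Types x y g : 'rV[R]_n.

Lemma dotvDr g x y : dotv g (x + y) = dotv g x + dotv g y.
Proof. by rewrite /dotv -big_split; apply: eq_bigr => i _; rewrite mxE mulrDr. Qed.

Lemma dotvC g x : dotv g x = dotv x g.
Proof. by apply: eq_bigr => i _; rewrite mulrC. Qed.

Lemma dotvDl g x y : dotv (x + y) g = dotv x g + dotv y g.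
Proof. by rewrite dotvC dotvDr !(dotvC g). Qed.

Lemma dotvZr (k : R) g x : dotv g (k *: x) = k * dotv g x.
Proof. by rewrite /dotv mulr_sumr; apply: eq_bigr => i _; rewrite mxE mulrCA. Qed.

Lemma dotvZl (k : R) g x : dotv (k *: g) x = k * dotv g x.
Proof. by rewrite dotvC dotvZr dotvC. Qed.

Lemma dotvNr g x : dotv g (- x) = - dotv g x.
Proof. by rewrite -scaleN1r dotvZr mulN1r. Qed.

Lemma dotvNl g x : dotv (- g) x = - dotv g x.
Proof. by rewrite dotvC dotvNr dotvC. Qed.

Lemma dotvBr g x y : dotv g (x - y) = dotv g x - dotv g y.
Proof. by rewrite dotvDr dotvNr. Qed.

Lemma dotvBl g x y : dotv (x - y) g = dotv x g - dotv y g.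
Proof. by rewrite dotvDl dotvNl. Qed.

Lemma dotv0r g : dotv g 0 = 0.
Proof. by rewrite -(scale0r 0) dotvZr mul0r. Qed.

Lemma dotv0l g : dotv 0 g = 0.
Proof. by rewrite dotvC dotv0r. Qed.

Lemma dotv_sumr (I : Type) (r : seq I) (P : pred I) g (F : I -> 'rV[R]_n) :
  dotv g (\sum_(i <- r | P i) F i) = \sum_(i <- r | P i) dotv g (F i).
Proof. by apply: (big_morph (dotv g)); [exact: dotvDr|exact: dotv0r]. Qed.

Lemma dotv_delta g (i : 'I_n) : dotv g (delta_mx ord0 i) = g ord0 i.
Proof.
rewrite /dotv (bigD1 i)//= mxE !eqxx mulr1 big1 ?addr0// => j ji.
by rewrite mxE (negbTE ji) mulr0.
Qed.

Lemma dotv_ge0 x : 0 <= dotv x x.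
Proof. by apply: sumr_ge0 => i _; exact: sqr_ge0. Qed.

Lemma dotv_eq0 x : (dotv x x == 0) = (x == 0).
Proof.
apply/eqP/eqP => [h|->]; last exact: dotv0l.
apply/rowP => i; rewrite mxE; apply/eqP; rewrite -sqrf_eq0 expr2.
by move/psumr_eq0P : h => -> // j _; exact: sqr_ge0.
Qed.

Lemma enorm_ge0 x : 0 <= enorm x.
Proof. exact: sqrtr_ge0. Qed.

Lemma sqr_enorm x : enorm x ^+ 2 = dotv x x.
Proof. by rewrite sqr_sqrtr// dotv_ge0. Qed.

Lemma enorm_eq0 x : (enorm x == 0) = (x == 0).
Proof. by rewrite -sqrf_eq0 sqr_enorm dotv_eq0. Qed.

Lemma enorm0 : enorm (0 : 'rV[R]_n) = 0.
Proof. by apply/eqP; rewrite enorm_eq0. Qed.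

Lemma enorm_gt0 x : (0 < enorm x) = (x != 0).
Proof. by rewrite lt_def enorm_ge0 andbT enorm_eq0. Qed.

Lemma enormZ (k : R) x : enorm (k *: x) = `|k| * enorm x.
Proof.
by rewrite /enorm dotvZl dotvZr mulrA -expr2 sqrtrM ?sqr_ge0// sqrtr_sqr.
Qed.

Lemma enormN x : enorm (- x) = enorm x.
Proof. by rewrite -scaleN1r enormZ normrN1 mul1r. Qed.

Lemma enormB x y : enorm (x - y) = enorm (y - x).
Proof. by rewrite -enormN opprB. Qed.

Lemma cauchy_schwarz_dotv x y : `|dotv x y| <= enorm x * enorm y.
Proof.
have [->|y0] := eqVneq y 0; first by rewrite dotv0r normr0 mulr_ge0// enorm_ge0.
have yy : 0 < dotv y y by rewrite lt_def dotv_eq0 y0 dotv_ge0.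
have h := dotv_ge0 (x - (dotv x y / dotv y y) *: y).
rewrite !(dotvBr, dotvBl, dotvZr, dotvZl) (dotvC y x) in h.
have {}h : dotv x y ^+ 2 <= dotv x x * dotv y y.
  rewrite -ler_pdivrMr// -subr_ge0; apply: le_trans h _; rewrite le_eqVlt; apply/orP; left.
  by apply/eqP; field; rewrite gt_eqF.
rewrite -[leLHS]ger0_norm// -ler_sqr ?nnegrE ?mulr_ge0 ?enorm_ge0// exprMn !sqr_enorm.
by rewrite !normr_id real_normK ?num_real.
Qed.

Lemma ler_enormD x y : enorm (x + y) <= enorm x + enorm y.
Proof.
rewrite -ler_sqr ?nnegrE ?addr_ge0 ?enorm_ge0// sqrrD !sqr_enorm.
rewrite !(dotvDr, dotvDl) (dotvC y x).
have := le_trans (ler_norm _) (cauchy_schwarz_dotv x y); lra.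
Qed.

Lemma ler_enormB x y : enorm (x - y) <= enorm x + enorm y.
Proof. by rewrite -(enormN y) ler_enormD. Qed.

Lemma ler_coord_enorm x i : `|x ord0 i| <= enorm x.
Proof.
rewrite -ler_sqr ?nnegrE ?enorm_ge0// sqr_enorm real_normK ?num_real//.
rewrite /dotv (bigD1 i)//= -expr2 lerDl.
by apply: sumr_ge0 => j _; rewrite -expr2 sqr_ge0.
Qed.

Lemma ler_enorm_coord x (e : R) : 0 <= e -> (forall i, `|x ord0 i| <= e) ->
  enorm x <= n%:R * e.
Proof.
move=> e0 xe; rewrite -ler_sqr ?nnegrE ?mulr_ge0 ?ler0n ?enorm_ge0// sqr_enorm.
apply: (@le_trans _ _ (\sum_(i < n) e ^+ 2)).
  apply: ler_sum => i _; rewrite -expr2 -real_normK ?num_real//.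
  by rewrite ler_sqr ?nnegrE.
rewrite sumr_const card_ord exprMn -[leLHS]mulr_natl ler_wpM2r ?sqr_ge0//.
by case: (n) => [|k]; rewrite ?expr0n// ler_eXnr// ler1n.
Qed.

Lemma enorm_nbhs x (U : set 'rV[R]_n) : nbhs x U ->
  exists2 e : R, 0 < e & forall y, enorm (y - x) < e -> U y.
Proof.
move=> /nbhs_ballP[e /= e0 xeU]; exists e => // y yx; apply: xeU.
apply/mx_ballP => // i; apply: le_lt_trans yx.
by rewrite enormB; have := ler_coord_enorm (x - y) i; rewrite !mxE.
Qed.

Lemma nbhs_enorm x (U : set 'rV[R]_n) (e : R) : 0 < e ->
  (forall y, enorm (y - x) < e -> U y) -> nbhs x U.
Proof.
move=> e0 h; apply/nbhs_ballP; exists (e / n.+1%:R) => /=.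
  by rewrite divr_gt0.
move=> y /mx_ballP yx; apply: h.
apply: (@le_lt_trans _ _ (n%:R * (e / n.+1%:R))).
  apply: ler_enorm_coord; first by rewrite divr_ge0// ltW.
  by move=> i; rewrite !mxE distrC ltW// yx// divr_gt0.
by rewrite mulrCA gtr_pMr// ltr_pdivrMr// mul1r ltr_nat.
Qed.

End affine_rows.

Section continuity.
Context {R : realType}.

Lemma continuous_enormP {n} (f : 'rV[R]_n -> R) x :
  {for x, continuous f} <-> forall e : R, 0 < e ->
  exists2 d : R, 0 < d & forall y, enorm (y - x) < d -> `|f y - f x| < e.
Proof.
split => [cf e e0|h].
  have /enorm_nbhs[d d0 xd] : nbhs x (f @^-1` ball (f x) e).
    by apply: cf; exact: nbhsx_ballx.
  by exists d => // y /xd; rewrite /= distrC.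
move=> A /nbhs_ballP[e /= e0 xe]; have [d d0 yx] := h _ e0.
apply: (@nbhs_enorm R n x (f @^-1` A) d d0) => y /yx yxe.
by apply: xe; rewrite /ball /= distrC.
Qed.

Lemma continuous_dotv {n} (g : 'rV[R]_n) : continuous (dotv g).
Proof.
move=> x; apply/continuous_enormP => e e0.
have g0 : 0 < enorm g + 1 by rewrite ltr_wpDl// enorm_ge0.
exists (e / (enorm g + 1)) => [|y]; first by rewrite divr_gt0.
rewrite ltr_pdivlMr// => yx; rewrite -dotvBr.
apply: le_lt_trans (cauchy_schwarz_dotv _ _) (le_lt_trans _ yx).
by rewrite mulrC ler_wpM2l ?enorm_ge0// lerDl.
Qed.

Lemma dotv_row_cons {n} (s : R) (y : 'rV[R]_n) (g : 'rV[R]_n.+1) :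
  dotv g (row_cons (s, y)) = g ord0 ord0 * s + dotv (\row_j g ord0 (lift ord0 j)) y.
Proof.
rewrite /dotv big_ord_recl; congr (_ + _); first by rewrite mxE unlift_none.
by apply: eq_bigr => i _; rewrite !mxE liftK.
Qed.

Lemma row_consB {n} (s t : R) (y z : 'rV[R]_n) :
  row_cons (s, y) - row_cons (t, z) = row_cons (s - t, y - z).
Proof.
by apply/rowP => i; case: (unliftP ord0 i) => [j|] ->;
  rewrite !mxE ?liftK ?unlift_none //= !mxE.
Qed.

Lemma enorm_row_cons {n} (s : R) (y : 'rV[R]_n) :
  enorm (row_cons (s, y)) = Num.sqrt (s ^+ 2 + enorm y ^+ 2).
Proof.
rewrite /enorm dotv_row_cons; congr (Num.sqrt (_ + _)).
  by rewrite mxE unlift_none.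
rewrite -[in RHS]/(enorm y) sqr_enorm; congr dotv.
by apply/rowP => i; rewrite !mxE liftK.
Qed.

Lemma continuous_slice {n} (f : 'rV[R]_n.+1 -> R) (s : R) : continuous f ->
  continuous (fun y => f (row_cons (s, y))).
Proof.
move=> cf x; apply/continuous_enormP => e e0.
have /continuous_enormP/(_ _ e0)[d d0 h] := cf (row_cons (s, x)).
exists d => // y yx; apply: h.
by rewrite row_consB enorm_row_cons subrr expr0n add0r sqrtr_sqr ger0_norm// enorm_ge0.
Qed.

Lemma continuous_slice_head {n} (f : 'rV[R]_n.+1 -> R) (y : 'rV[R]_n) : continuous f ->
  continuous (fun s => f (row_cons (s, y))).
Proof.
move=> cf s; apply/cvgrPdist_lt => e e0.
have /continuous_enormP/(_ _ e0)[d d0 h] := cf (row_cons (s, y)).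
exists d => // t /= st; rewrite distrC; apply: h.
by rewrite row_consB enorm_row_cons subrr enorm0 expr0n addr0 sqrtr_sqr distrC.
Qed.

Lemma vol_hyperplane {n} (g : 'rV[R]_n) (c : R) : g != 0 ->
  vol R n [set x | dotv g x = c] = 0%E.
Proof.
elim: n g c => [|n IH] g c g0.
  by exfalso; move/eqP : g0; apply; apply/rowP => -[].
apply: vol_null_section.
  have -> : [set x | dotv g x = c] = dotv g @^-1` [set c] by [].
  apply: closed_measurable_row; apply: closed_comp; last exact: closed_eq.
  by move=> x _; exact: continuous_dotv.
pose g' : 'rV[R]_n := \row_j g ord0 (lift ord0 j).
(* If the tail g' of g is nonzero, every slice is a hyperplane of lower dimension; otherwise only
   the slice at c / g_0 is nonempty. *)
have [g'0|g'0] := eqVneq g' 0; last first.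
  apply: aeW => a; rewrite -[RHS](IH g' (c - g ord0 ord0 * a) g'0).
  congr (vol R n _); apply/seteqP; split => y /=; rewrite dotv_row_cons -/g'.
    by move=> <-; rewrite addrC addKr.
  by move=> ->; rewrite addrC subrK.
have h0 : g ord0 ord0 != 0.
  apply: contra g0 => /eqP h0; apply/eqP/rowP => i; rewrite mxE.
  case: (unliftP ord0 i) => [j|] -> //.
  by move/rowP/(_ j) : g'0; rewrite !mxE.
exists [set c / g ord0 ord0]; split => //; first exact: lebesgue_measure_set1.
move=> a /= ; apply: contra_notP => ac.
rewrite (_ : [set _ | _] = set0) ?measure0// -subset0 => y /=.
rewrite dotv_row_cons -/g' g'0 dotv0l addr0 => h; apply: ac.
by rewrite -h mulrC mulKf.
Qed.

End continuity.

(** * Iterated integrals and integration by parts on boxes *)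

Section box_integrals.
Context {R : realType}.
Local Notation leb := (@lebesgue_measure R).

Definition row_tail {n} (x : 'rV[R]_n.+1) : 'rV[R]_n := \row_j x ord0 (lift ord0 j).

Lemma box_row_cons {n} (a b : 'rV[R]_n.+1) s y :
  box a b (row_cons (s, y)) <->
  a ord0 ord0 <= s <= b ord0 ord0 /\ box (row_tail a) (row_tail b) y.
Proof.
split => [h|[h1 h2] i].
  split; first by have := h ord0; rewrite mxE unlift_none.
  by move=> i; have := h (lift ord0 i); rewrite !mxE liftK.
case: (unliftP ord0 i) => [j|] ->; rewrite mxE ?unlift_none ?liftK//=.
by have := h2 j; rewrite !mxE.
Qed.

Lemma compact_box {n} (a b : 'rV[R]_n) : compact (box a b).
Proof.
by rewrite box_setE; apply: (@rV_compact R^o _ (fun i => `[a ord0 i, b ord0 i]%classic)) => i; exact: segment_compact.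
Qed.

Lemma continuous_bounded_box {n} (f : 'rV[R]_n -> R) (a b : 'rV[R]_n) : continuous f ->
  exists2 M : R, 0 < M & forall x, box a b x -> `|f x| <= M.
Proof.
move=> cf; have /compact_bounded[M [_ h]] : compact (f @` box a b).
  apply: continuous_compact; last exact: compact_box.
  exact: continuous_subspaceT.
exists (`|M| + 1); first by rewrite ltr_wpDl.
move=> x abx; apply: h; last by exists x.
by rewrite (le_lt_trans (ler_norm M))// ltrDl.
Qed.

Lemma vol_box_lty {n} (a b : 'rV[R]_n) : (vol R n (box a b) < +oo)%E.
Proof.
have [ab|/existsNP[i /negP]] := pselect (forall i, a ord0 i <= b ord0 i).
  by rewrite vol_box// ltry.
rewrite -ltNge => ba; rewrite (_ : box a b = set0) ?measure0// -subset0 => x /(_ i).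
by move=> /andP[/le_trans h /h]; rewrite leNgt ba.
Qed.

Lemma integrable_box {n} (f : 'rV[R]_n -> R) (a b : 'rV[R]_n) : continuous f ->
  (vol R n).-integrable (box a b) (EFin \o f).
Proof.
move=> cf; apply: measurable_bounded_integrable.
- exact: measurable_box.
- exact: vol_box_lty.
- by apply: measurable_funTS; exact: continuous_measurable_row.
- have [M M0 h] := continuous_bounded_box a b cf.
  by exists M; split; [exact: num_real|move=> N MN x /h /le_trans; apply; exact: ltW].
Qed.

Lemma partial_slice {n} (f : 'rV[R]_n.+1 -> R) (s : R) (j : 'I_n) y :
  (derivable (fun y => f (row_cons (s, y))) y (delta_mx ord0 j) <->
   derivable f (row_cons (s, y)) (delta_mx ord0 (lift ord0 j))) /\
  partial j (fun y => f (row_cons (s, y))) y = partial (lift ord0 j) f (row_cons (s, y)).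
Proof.
have e (h : R) : row_cons (s, h *: delta_mx ord0 j + y) =
    h *: delta_mx ord0 (lift ord0 j) + row_cons (s, y).
  apply/rowP => i; case: (unliftP ord0 i) => [k|] ->; rewrite !mxE ?liftK ?unlift_none //=.
    by rewrite !mxE (inj_eq lift_inj).
  by rewrite mulr0 add0r.
rewrite /partial /derivable /derive /=.
by under eq_fun do rewrite e.
Qed.

Lemma partial_slice_head {n} (f : 'rV[R]_n.+1 -> R) (s : R) y :
  (derivable (fun s => f (row_cons (s, y))) s 1 <->
   derivable f (row_cons (s, y)) (delta_mx ord0 ord0)) /\
  derive1 (fun s => f (row_cons (s, y))) s = partial ord0 f (row_cons (s, y)).
Proof.
have e (h : R) : row_cons (h *: 1 + s, y) =
    h *: delta_mx ord0 ord0 + row_cons (s, y).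
  apply/rowP => i; case: (unliftP ord0 i) => [k|] ->; rewrite !mxE ?liftK ?unlift_none //=.
  by rewrite mulr0 add0r.
rewrite derive1E /partial /derivable /derive /=.
by under eq_fun do rewrite e.
Qed.

(** Both orders of integration are needed below: the first variable innermost to integrate its own
    derivative, outermost to pass to slices for the other derivatives. *)
Lemma integral_box_row_cons {n} (F : 'rV[R]_n.+1 -> R) (a b : 'rV[R]_n.+1) : continuous F ->
  (\int[vol R n.+1]_(x in box a b) (F x)%:E =
   \int[leb]_(s in `[a ord0 ord0, b ord0 ord0])
     \int[vol R n]_(y in box (row_tail a) (row_tail b)) (F (row_cons (s, y)))%:E)%E /\
  (\int[vol R n.+1]_(x in box a b) (F x)%:E =
   \int[vol R n]_(y in box (row_tail a) (row_tail b))
     \int[leb]_(s in `[a ord0 ord0, b ord0 ord0]) (F (row_cons (s, y)))%:E)%E.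
Proof.
move=> cF; pose G := (EFin \o F) \_ (box a b).
have mG : measurable_fun setT G.
  apply/(measurable_restrictT _ _).1; first exact: measurable_box.
  by apply/measurable_EFinP; apply: measurable_funTS; exact: continuous_measurable_row.
have iG : (vol R n.+1).-integrable setT G.
  by apply/(integrable_mkcond _ _).1; [exact: measurable_box|exact: integrable_box].
have mGc : measurable_fun setT (G \o @row_cons R n).
  by apply: measurableT_comp => //; exact: measurable_row_cons.
have iGc : (leb \x vol R n)%E.-integrable setT (G \o @row_cons R n).
  apply/integrableP; split => //; case/integrableP : iG => _.
  rewrite {1}/vol /= /row_product ge0_integral_pushforward//.
    exact: measurable_row_cons.
  exact: measurableT_comp.
have E : (\int[vol R n.+1]_(x in box a b) (F x)%:E =
    \int[leb \x vol R n]_z (G \o @row_cons R n) z)%E.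
  rewrite integral_mkcond -/G {1}/vol /= /row_product.
  rewrite integral_pushforward//; exact: measurable_row_cons.
split; rewrite E.
  rewrite -integral12_prod_meas1// [RHS]integral_mkcond; apply: eq_integral => s _.
  rewrite /fubini_F patchE /=; case: ifPn => sab.
    rewrite [RHS]integral_mkcond; apply: eq_integral => y _; rewrite /G !patchE.
    have {}sab : a ord0 ord0 <= s <= b ord0 ord0 by move/set_mem: sab; rewrite /= in_itv.
    suff -> : (row_cons (s, y) \in box a b) = (y \in box (row_tail a) (row_tail b)) by [].
    by apply/idP/idP; rewrite !inE; [case/box_row_cons|move=> h; apply/box_row_cons].
  apply: integral0_eq => y _; rewrite /G patchE; case: ifPn => //.
  rewrite inE => /box_row_cons[h _]; move/negP: sab; case; rewrite inE /=.
  by rewrite in_itv.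
rewrite -integral21_prod_meas1// [RHS]integral_mkcond; apply: eq_integral => y _.
rewrite /fubini_G patchE /=; case: ifPn => yab.
  rewrite [RHS]integral_mkcond; apply: eq_integral => s _; rewrite /G !patchE.
  move/set_mem : yab => yab.
  suff -> : (row_cons (s, y) \in box a b) = (s \in `[a ord0 ord0, b ord0 ord0]%classic) by [].
  by apply/idP/idP; rewrite !inE /= in_itv /=; [case/box_row_cons|move=> h; apply/box_row_cons].
apply: integral0_eq => s _; rewrite /G patchE; case: ifPn => //.
by rewrite inE => /box_row_cons[_ h]; move/negP: yab; case; rewrite inE.
Qed.

(** For the first coordinate this is the fundamental theorem of calculus on segments. Any other
    coordinate survives in the slices, where the boundary condition on the two faces is inherited
    and induction applies. *)
Lemma integral_partial_box {n} (f : 'rV[R]_n -> R) (i : 'I_n) (a b : 'rV[R]_n) :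
  (forall j, a ord0 j < b ord0 j) -> continuous f -> continuous (partial i f) ->
  (forall x, derivable f x (delta_mx ord0 i)) ->
  (forall x : 'rV[R]_n, x ord0 i = a ord0 i \/ x ord0 i = b ord0 i -> f x = 0) ->
  (\int[vol R n]_(x in box a b) (partial i f x)%:E = 0)%E.
Proof.
elim: n f i a b => [f []//|n IH] f i a b ab cf cpf df f0.
have [E1 E2] := integral_box_row_cons a b cpf.
case: (unliftP ord0 i) => [j|] ij; last first.
  rewrite E2; apply: integral0_eq => y _.
  rewrite (continuous_FTC2 (F := fun s => f (row_cons (s, y)))).
  - by rewrite !f0 ?subee//; [left|right]; rewrite ij mxE unlift_none.
  - exact: ab.
  - apply: continuous_subspaceT; exact: continuous_slice_head.
  - split.
    + by move=> s _; apply/(partial_slice_head f s y).1; rewrite -ij.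
    + by apply: cvg_at_right_filter; exact: continuous_slice_head.
    + by apply: cvg_at_left_filter; exact: continuous_slice_head.
  - by move=> s _; rewrite (partial_slice_head f s y).2 ij.
rewrite E1; apply: integral0_eq => s _.
rewrite (eq_integral (fun y => (partial j (fun z => f (row_cons (s, z))) y)%:E)); last first.
  by move=> y _; rewrite (partial_slice f s j y).2 ij.
apply: IH.
- by move=> k; rewrite !mxE.
- exact: continuous_slice.
- rewrite (_ : partial _ _ = fun y => partial i f (row_cons (s, y))).
    exact: continuous_slice.
  by apply/funext => y; rewrite (partial_slice f s j y).2 ij.
- by move=> y; apply/(partial_slice f s j y).1; rewrite -ij.
- by move=> y h; apply: f0; rewrite ij !mxE liftK /=; move: h; rewrite !mxE.
Qed.

End box_integrals.

(** * The space H^1_0 *)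

Section square_integrals.
Context {R : realType} {n : nat}.
Implicit Types (D : set 'rV[R]_n) (f g : 'rV[R]_n -> R).

(** The square of [normL2]. Estimates are made on it because it is a plain integral, monotone and
    additive on domains. *)
Definition sqint D f : \bar R := (\int[vol R n]_(x in D) (f x ^+ 2)%:E)%E.

Lemma sqint_ge0 D f : (0 <= sqint D f)%E.
Proof. by apply: integral_ge0 => x _; rewrite lee_fin sqr_ge0. Qed.

Lemma measurable_sqr_EFin D f : measurable_fun D f ->
  measurable_fun D (fun x => (f x ^+ 2)%:E).
Proof. by move=> mf; apply/measurable_EFinP; exact: measurable_funX. Qed.

Lemma le_sqint D f g : measurable D -> measurable_fun D f -> measurable_fun D g ->
  (forall x, D x -> `|f x| <= `|g x|) -> (sqint D f <= sqint D g)%E.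
Proof.
move=> mD mf mg fg; apply: ge0_le_integral => //.
- by move=> x _; rewrite lee_fin sqr_ge0.
- exact: measurable_sqr_EFin.
- exact: measurable_sqr_EFin.
move=> x Dx; rewrite lee_fin -[f x ^+ 2]real_normK ?num_real//.
by rewrite -[g x ^+ 2]real_normK ?num_real// ler_sqr ?nnegrE// fg.
Qed.

Lemma le_sqintD D f g (h : 'rV[R]_n -> R) : measurable D -> measurable_fun D f -> measurable_fun D g ->
  measurable_fun D h -> (forall x, D x -> `|h x| <= `|f x| + `|g x|) ->
  (sqint D h <= 2%:E * sqint D f + 2%:E * sqint D g)%E.
Proof.
move=> mD mf mg mh hfg.
rewrite /sqint -!ge0_integralZl_EFin//; try by
  [move=> x _; rewrite lee_fin sqr_ge0|exact: measurable_sqr_EFin].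
rewrite -ge0_integralD//; last 4 first.
- by move=> x _; rewrite lee_fin mulr_ge0// sqr_ge0.
- apply/measurable_EFinP; apply: measurable_funM => //; exact: measurable_funX.
- by move=> x _; rewrite lee_fin mulr_ge0// sqr_ge0.
- apply/measurable_EFinP; apply: measurable_funM => //; exact: measurable_funX.
apply: ge0_le_integral => //.
- by move=> x _; rewrite lee_fin sqr_ge0.
- exact: measurable_sqr_EFin.
- apply: emeasurable_funD; apply/measurable_EFinP; apply: measurable_funM => //; exact: measurable_funX.
move=> x Dx; rewrite -EFinD lee_fin.
have := hfg x Dx; have := sqr_ge0 (`|f x| - `|g x|).
rewrite -[f x ^+ 2]real_normK ?num_real// -[g x ^+ 2]real_normK ?num_real//.
rewrite -[h x ^+ 2]real_normK ?num_real//.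
have := normr_ge0 (h x); nra.
Qed.

Lemma sqintZ D f (c : R) : measurable D -> measurable_fun D f ->
  sqint D (fun x => c * f x) = ((c ^+ 2)%:E * sqint D f)%E.
Proof.
move=> mD mf; rewrite /sqint -ge0_integralZl_EFin ?sqr_ge0//.
- by apply: eq_integral => x _; rewrite exprMn EFinM.
- by move=> x _; rewrite lee_fin sqr_ge0.
- exact: measurable_sqr_EFin.
Qed.

Lemma subset_sqint D E f : measurable D -> measurable E -> measurable_fun E f ->
  D `<=` E -> (sqint D f <= sqint E f)%E.
Proof.
move=> mD mE mf DE; apply: ge0_subset_integral => //; first exact: measurable_sqr_EFin.
by move=> x _; rewrite lee_fin sqr_ge0.
Qed.

Lemma sqint_lty D f : (normL2 D f < +oo)%E <-> (sqint D f < +oo)%E.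
Proof.
rewrite -!ge0_fin_numE ?sqrte_ge0 ?sqint_ge0//.
by rewrite /normL2 sqrte_fin_num// sqint_ge0.
Qed.

(** Turns convergence of norms into bounds of squared norms by real numbers, so that the limit
    arguments contain no square roots. *)
Lemma sqrte_cvg0 (x : nat -> \bar R) : (forall k, 0 <= x k)%E ->
  sqrte (x k) @[k --> \oo] --> 0%E <->
  forall e : R, 0 < e -> \forall k \near \oo, (x k <= e%:E)%E.
Proof.
move=> x0; split => [/fine_cvgP[xfin /cvgrPdist_lt h] e e0|h].
  have s0 : 0 < Num.sqrt e by rewrite sqrtr_gt0.
  near=> k; have xk : sqrte (x k) \is a fin_num by near: k.
  have : `|0 - fine (sqrte (x k))| < Num.sqrt e by near: k; exact: h.
  rewrite sub0r normrN ger0_norm ?fine_ge0 ?sqrte_ge0// => /ltW.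
  rewrite -lee_fin fineK// -[(Num.sqrt e)%:E]/(sqrte e%:E) lee_sqrt//.
  by rewrite lee_fin ltW.
have xfin : \forall k \near \oo, sqrte (x k) \is a fin_num.
  near=> k; rewrite sqrte_fin_num// ge0_fin_numE//.
  by apply: (@le_lt_trans _ _ 1%:E); [near: k; exact: h|rewrite ltry].
apply/fine_cvgP; split => //; apply/cvgrPdist_le => e e0.
near=> k; have xk : sqrte (x k) \is a fin_num by near: k.
rewrite sub0r normrN ger0_norm ?fine_ge0 ?sqrte_ge0// -lee_fin fineK//.
have -> : e%:E = sqrte (e ^+ 2)%:E by rewrite /= sqrtr_sqr gtr0_norm.
rewrite lee_sqrt ?lee_fin ?sqr_ge0//.
by near: k; apply: h; rewrite exprn_gt0.
Unshelve. all: by end_near. Qed.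

Lemma normL2_cvg0 D (u : nat -> 'rV[R]_n -> R) :
  normL2 D (u k) @[k --> \oo] --> 0%E <->
  forall e : R, 0 < e -> \forall k \near \oo, (sqint D (u k) <= e%:E)%E.
Proof. by apply: sqrte_cvg0 => k; exact: sqint_ge0. Qed.

Lemma normL2vE D (f : 'rV[R]_n -> 'rV[R]_n) : normL2v D f = normL2 D (fun x => enorm (f x)).
Proof. by []. Qed.

Lemma le_sqint_lin D f g (h : 'rV[R]_n -> R) (a : R) : measurable D ->
  measurable_fun D f -> measurable_fun D g ->
  measurable_fun D h -> (forall x, D x -> `|h x| <= `|a| * `|f x| + `|g x|) ->
  (sqint D h <= (2 * a ^+ 2)%:E * sqint D f + 2%:E * sqint D g)%E.
Proof.
move=> mD mf mg mh hfg; rewrite EFinM -muleA -sqintZ//.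
apply: le_sqintD => //; first exact: measurable_funM.
by move=> x Dx; rewrite normrM; exact: hfg.
Qed.

Lemma sqint_lin_lty D f g (h : 'rV[R]_n -> R) (a : R) : measurable D ->
  measurable_fun D f -> measurable_fun D g ->
  measurable_fun D h -> (forall x, D x -> `|h x| <= `|a| * `|f x| + `|g x|) ->
  (normL2 D f < +oo)%E -> (normL2 D g < +oo)%E -> (normL2 D h < +oo)%E.
Proof.
move=> mD mf mg mh hfg /sqint_lty fy /sqint_lty gy; apply/sqint_lty.
apply: le_lt_trans (le_sqint_lin mD mf mg mh hfg) _.
by rewrite lte_add_pinfty// lte_mul_pinfty// lee_fin mulr_ge0// sqr_ge0.
Qed.

Lemma sqint_lin_cvg0 D (f g h : nat -> 'rV[R]_n -> R) (a : R) : measurable D ->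
  (forall k, measurable_fun D (f k)) -> (forall k, measurable_fun D (g k)) ->
  (forall k, measurable_fun D (h k)) ->
  (forall k x, D x -> `|h k x| <= `|a| * `|f k x| + `|g k x|) ->
  normL2 D (f k) @[k --> \oo] --> 0%E -> normL2 D (g k) @[k --> \oo] --> 0%E ->
  normL2 D (h k) @[k --> \oo] --> 0%E.
Proof.
move=> mD mf mg mh hfg /normL2_cvg0 fc /normL2_cvg0 gc; apply/normL2_cvg0 => e e0.
have a0 : 0 < 2 * a ^+ 2 + 1 by rewrite ltr_wpDl// mulr_ge0// sqr_ge0.
near=> k.
apply: le_trans (le_sqint_lin mD (mf k) (mg k) (mh k) (hfg k)) _.
have h1 : (sqint D (f k) <= (e / 2 / (2 * a ^+ 2 + 1))%:E)%E.
  by near: k; apply: fc; rewrite !divr_gt0.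
have h2 : (sqint D (g k) <= (e / 2 / 2)%:E)%E.
  by near: k; apply: gc; rewrite !divr_gt0.
have h3 : (e%:E = (2 * a ^+ 2 + 1)%:E * (e / 2 / (2 * a ^+ 2 + 1))%:E + 2%:E * (e / 2 / 2)%:E)%E.
  by rewrite -!EFinM -EFinD; congr EFin; field; rewrite gt_eqF.
rewrite h3; apply: leeD.
  apply: lee_pmul => //; rewrite ?sqint_ge0 ?lee_fin ?lerDl//.
  by rewrite mulr_ge0// sqr_ge0.
by apply: lee_pmul => //; rewrite ?sqint_ge0.
Unshelve. all: by end_near. Qed.

End square_integrals.

Section test_functions.
Context {R : realType} {n : nat}.
Implicit Types (Om : set 'rV[R]_n) (f g v w : 'rV[R]_n -> R).

Lemma continuous_enorm : continuous (@enorm R n).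
Proof.
move=> x; apply/continuous_enormP => e e0; exists e => // y; apply: le_lt_trans.
have := ler_enormD (x - y) y; have := ler_enormD (y - x) x; rewrite !subrK enormB.
by rewrite ler_norml => ? ?; apply/andP; split; lra.
Qed.

Lemma measurable_enorm D (f : 'rV[R]_n -> 'rV[R]_n) : measurable_fun D f ->
  measurable_fun D (fun x => enorm (f x)).
Proof.
move=> mf; apply: (measurableT_comp _ mf).
exact: continuous_measurable_row continuous_enorm.
Qed.

Lemma partial_lin (a : R) f g i x :
  derivable f x (delta_mx ord0 i) -> derivable g x (delta_mx ord0 i) ->
  derivable (fun y => a * f y + g y) x (delta_mx ord0 i) /\
  partial i (fun y => a * f y + g y) x = a * partial i f x + partial i g x.
Proof.
move=> df dg; have da : derivable (a *: f) x (delta_mx ord0 i) by exact: derivableZ.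
split; first exact: (derivableD da dg).
rewrite /partial; have := deriveD da dg; rewrite (deriveZ _ df).
by move=> <-.
Qed.

Lemma partialM f g i x :
  derivable f x (delta_mx ord0 i) -> derivable g x (delta_mx ord0 i) ->
  derivable (fun y => f y * g y) x (delta_mx ord0 i) /\
  partial i (fun y => f y * g y) x = f x * partial i g x + g x * partial i f x.
Proof. by move=> df dg; split; [exact: (derivableM df dg)|exact: (deriveM df dg)]. Qed.

Lemma partial_coord (i j : 'I_n) (x : 'rV[R]_n) :
  derivable (fun y : 'rV[R]_n => y ord0 j) x (delta_mx ord0 i) /\
  partial i (fun y => y ord0 j) x = (i == j)%:R.
Proof.
have e : (fun h : R => h^-1 *: ((h *: delta_mx ord0 i + x : 'rV[R]_n) ord0 j - x ord0 j))
    @ 0^' --> ((i == j)%:R : R).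
  apply: cvg_near_cst; near=> h; rewrite !mxE eqxx /= addrK eq_sym.
  have h0 : h != 0 by near: h; exact: nbhs_dnbhs_neq.
  by case: eqP; rewrite ?mulr0 ?mulr1 ?scaler0// /GRing.scale /= mulVf.
split; first by apply/cvg_ex; exists ((i == j)%:R).
exact/cvg_lim.
Unshelve. all: by end_near. Qed.

Lemma partial_cst (c : R) (i : 'I_n) (x : 'rV[R]_n) :
  derivable (fun y : 'rV[R]_n => c) x (delta_mx ord0 i) /\
  partial i (fun y => c) x = 0.
Proof. by split; [exact: derivable_cst|exact: derive_cst]. Qed.

Lemma continuous_lin (a : R) f g : continuous f -> continuous g ->
  continuous (fun x => a * f x + g x).
Proof.
move=> cf cg x.
have ca : {for x, continuous (fun=> a : R)} by exact: cst_continuous.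
exact: (continuousD (continuousM ca (cf x)) (cg x)).
Qed.

Lemma continuousM_row f g : continuous f -> continuous g ->
  continuous (fun x => f x * g x).
Proof.
by move=> cf cg x; exact: (continuousM (cf x) (cg x)).
Qed.

Lemma Ck_lin k (a : R) f g : Ck k f -> Ck k g -> Ck k (fun x => a * f x + g x).
Proof.
elim: k f g => [|k IH] f g [cf df] [cg dg].
  by split => //; exact: continuous_lin.
split=> [|i]; first exact: continuous_lin.
have [df1 df2] := df i; have [dg1 dg2] := dg i.
split=> [x|]; first exact: (partial_lin a (df1 x) (dg1 x)).1.
rewrite (_ : partial i _ = fun x => a * partial i f x + partial i g x); first exact: IH.
by apply/funext => x; exact: (partial_lin a (df1 x) (dg1 x)).2.
Qed.

Lemma test_fun_lin Om (a : R) f g : test_fun Om f -> test_fun Om g ->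
  test_fun Om (fun x => a * f x + g x).
Proof.
move=> [Cf [Kf [cKf KfO f0]]] [Cg [Kg [cKg KgO g0]]]; split.
  by move=> k; exact: Ck_lin.
exists (Kf `|` Kg); split; [exact: compactU|by rewrite subUset|].
by move=> x /not_orP[/f0 -> /g0 ->]; rewrite mulr0 addr0.
Qed.

Lemma test_fun_continuous Om f : test_fun Om f -> continuous f.
Proof. by move=> [/(_ 0%N)[]]. Qed.

Lemma test_fun_partial Om f i : test_fun Om f ->
  [/\ forall x, derivable f x (delta_mx ord0 i), continuous (partial i f),
      (forall x, derivable (partial i f) x (delta_mx ord0 i)) &
      continuous (partial i (partial i f))].
Proof.
move=> [/(_ 2)[_ /(_ i)[df [cpf /(_ i)[ddf [cppf _]]]]] _].
by split.
Qed.

(** The support is compact, hence closed, so f vanishes in a whole neighbourhood of a point outside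
    Om. *)
Lemma test_fun_out Om f i x : test_fun Om f -> ~ Om x -> f x = 0 /\ partial i f x = 0.
Proof.
move=> [_ [K [cK KO f0]]] Ox; have Kx : ~ K x by move/KO.
split; first exact: f0.
have : nbhs x (~` K).
  apply: open_nbhs_nbhs; split => //; apply: closed_openC.
  by apply: compact_closed => //; exact: norm_hausdorff.
move=> /enorm_nbhs[e e0 h].
apply/cvg_lim => //; apply: cvg_near_cst.
have d0 : 0 < enorm (delta_mx ord0 i : 'rV[R]_n).
  rewrite enorm_gt0; apply/eqP => /rowP/(_ i); rewrite !mxE !eqxx => /eqP.
  by rewrite oner_eq0.
near=> t; rewrite /= (f0 x Kx) f0 ?subr0 ?scaler0//; apply: h.
rewrite addrK enormZ -ltr_pdivlMr//.
near: t; apply: dnbhs0_lt; exact: divr_gt0.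
Unshelve. all: by end_near. Qed.

Lemma measurable_grad Om f : test_fun Om f -> measurable_fun setT (grad f).
Proof.
move=> tf; apply: measurable_fun_row => i.
rewrite (_ : (fun _ => _) = partial i f); last by apply/funext => x; rewrite mxE.
by have [_ c _ _] := test_fun_partial i tf; exact: continuous_measurable_row.
Qed.

Lemma test_fun_measurable Om f : test_fun Om f -> measurable_fun setT f.
Proof. by move=> tf; apply: continuous_measurable_row; exact: test_fun_continuous tf. Qed.

Lemma H10_grad_lin Om (a : R) v w (g h : 'rV[R]_n -> 'rV[R]_n) : measurable Om ->
  H10_grad Om v g -> H10_grad Om w h ->
  H10_grad Om (fun x => a * v x + w x) (fun x => a *: g x + h x).
Proof.
move=> mO [[mv vy] [mg gy] [f [tf fv fg]]] [[mw wy] [mh hy] [f' [tf' fw fh]]].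
have mavw : measurable_fun setT (fun x => a * v x + w x).
  by apply: measurable_funD => //; exact: measurable_funM.
have magh : measurable_fun setT (fun x => a *: g x + h x).
  apply: measurable_fun_row => i.
  rewrite (_ : (fun _ => _) = (fun x => a * g x ord0 i + h x ord0 i)); last first.
    by apply/funext => x; rewrite !mxE.
  apply: measurable_funD; last by apply: (measurableT_comp (measurable_coord i)).
  by apply: measurable_funM => //; apply: (measurableT_comp (measurable_coord i)).
have sb (A : set 'rV[R]_n) (u : 'rV[R]_n -> R) : measurable_fun setT u -> measurable_fun Om u.
  by move=> mu; exact: measurable_funTS.
split.
- split => //; apply: (sqint_lin_lty (f := v) (g := w) (a := a) mO) => //; try exact: measurable_funTS.
  by move=> x _; rewrite -normrM ler_normD.
- split => //; rewrite normL2vE.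
  apply: (sqint_lin_lty (f := fun x => enorm (g x)) (g := fun x => enorm (h x)) (a := a) mO) => //;
    try (by apply: measurable_funTS; exact: measurable_enorm).
  by move=> x _; rewrite !(ger0_norm (enorm_ge0 _)) -enormZ ler_enormD.
exists (fun k x => a * f k x + f' k x); split.
- by move=> k; exact: test_fun_lin.
- apply: (sqint_lin_cvg0 (a := a) mO _ _ _ _ fv fw) => k;
    try (apply: measurable_funTS; apply: measurable_funB => //; try exact: test_fun_measurable;
         apply: test_fun_measurable; exact: test_fun_lin).
  move=> x _; rewrite -normrM; apply: le_trans (ler_normD _ _).
  by rewrite le_eqVlt; apply/orP; left; apply/eqP; congr Num.norm; ring.
have mB (u u' : 'rV[R]_n -> 'rV[R]_n) : measurable_fun setT u -> measurable_fun setT u' ->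
    measurable_fun setT (fun x => u x - u' x).
  move=> mu mu'; apply: measurable_fun_row => i.
  rewrite (_ : (fun _ => _) = (fun x => u x ord0 i - u' x ord0 i)); last first.
    by apply/funext => x; rewrite !mxE.
  by apply: measurable_funB; apply: (measurableT_comp (measurable_coord i)).
apply: (sqint_lin_cvg0 (a := a) (f := fun k x => enorm (grad (f k) x - g x))
  (g := fun k x => enorm (grad (f' k) x - h x)) mO _ _ _ _ fg fh) => k;
  try (apply: measurable_funTS; apply: measurable_enorm; apply: mB => //;
    try (exact: measurable_grad (tf k) || exact: measurable_grad (tf' k));
    exact: measurable_grad (test_fun_lin a (tf k) (tf' k))).
move=> x _; rewrite !(ger0_norm (enorm_ge0 _)) -enormZ; apply: le_trans (ler_enormD _ _).
rewrite le_eqVlt; apply/orP; left; apply/eqP; congr enorm.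
apply/rowP => i; rewrite !mxE.
have [d1 _ _ _] := test_fun_partial i (tf k); have [d2 _ _ _] := test_fun_partial i (tf' k).
by rewrite (partial_lin a (d1 x) (d2 x)).2; ring.
Qed.

Lemma H10_0 Om : H10 Om (fun=> 0).
Proof.
have t0 : test_fun Om (fun=> 0).
  split; last by exists set0; split => //; exact: compact0.
  elim => [|k IH]; first by split => //; exact: cst_continuous.
  split=> [|i]; first exact: cst_continuous.
  split => [x|]; first exact: (partial_cst 0 i x).1.
  by rewrite (_ : partial i _ = fun=> 0)//; apply/funext => x; exact: (partial_cst 0 i x).2.
have s0 (D : set 'rV[R]_n) : normL2 D (fun=> 0) = 0%E.
  by rewrite /normL2 (integral0_eq) ?sqrte0// => x _; rewrite expr0n.
exists (fun=> 0); split.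
- by split => //; rewrite s0.
- by split; [exact: measurable_cst|rewrite normL2vE enorm0 s0].
exists (fun _ _ => 0); split => //.
  by rewrite subrr s0; exact: cvg_cst.
rewrite (_ : (fun _ => _) = fun=> 0%E); first exact: cvg_cst.
apply/funext => k; rewrite normL2vE -[RHS](s0 Om); congr normL2; apply/funext => x.
rewrite (_ : grad _ x = 0) ?subrr ?enorm0//; apply/rowP => i; rewrite !mxE.
exact: (partial_cst 0 i x).2.
Qed.

End test_functions.

Section integral_inequality.
Local Open Scope ereal_scope.
Context d (T : measurableType d) {R : realType} (mu : {measure set T -> \bar R}).

(** The corrector c, of zero integral, carries an integration by parts: a pointwise inequality up to
    c is enough. If f2 is not integrable the right side is +oo; otherwise f1 is integrable as well
    and integrals may be added. *)
Lemma le_integral_corrector (D : set T) (f1 f2 c : T -> R) : measurable D ->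
  (forall x, D x -> (0 <= f1 x)%R) -> (forall x, D x -> (0 <= f2 x)%R) ->
  measurable_fun D f1 -> measurable_fun D f2 ->
  mu.-integrable D (EFin \o c) -> \int[mu]_(x in D) (c x)%:E = 0 ->
  (forall x, D x -> (f1 x <= f2 x + c x)%R) ->
  \int[mu]_(x in D) (f1 x)%:E <= \int[mu]_(x in D) (f2 x)%:E.
Proof.
move=> mD f10 f20 mf1 mf2 ic c0 f12.
have [i2|i2] := pselect (mu.-integrable D (EFin \o f2)); last first.
  suff -> : \int[mu]_(x in D) (f2 x)%:E = +oo by rewrite leey.
  apply/eqP; rewrite -leye_eq leNgt; apply: contra_notN i2 => h.
  apply/integrableP; split; first exact/measurable_EFinP.
  apply: le_lt_trans h; apply: ge0_le_integral => //.
  - by apply: measurableT_comp => //; exact/measurable_EFinP.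
  - exact/measurable_EFinP.
  - by move=> x Dx /=; rewrite lee_fin ger0_norm ?f20.
have i2c : mu.-integrable D (fun x => (f2 x)%:E + (c x)%:E) by exact: integrableD.
have i1 : mu.-integrable D (EFin \o f1).
  apply: le_integrable i2c => //; first exact/measurable_EFinP.
  move=> x Dx /=; rewrite lee_fin ger0_norm ?f10//.
  exact: le_trans (f12 x Dx) (ler_norm _).
apply: (@le_trans _ _ (\int[mu]_(x in D) ((f2 x)%:E + (c x)%:E))).
  by apply: le_integral => // x /set_mem Dx; rewrite -EFinD lee_fin f12.
by rewrite integralD// c0 adde0.
Qed.

End integral_inequality.

(** * The Poincare inequality *)

Section poincare.
Context {R : realType} {n : nat}.
Implicit Types (Om : set 'rV[R]_n.+1).

Lemma bounded_in_box Om : bounded_set Om ->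
  exists2 D : R, 0 < D & forall x, Om x -> forall i, `|x ord0 i| < D.
Proof.
move=> [M [_ h]]; exists (`|M| + 2) => [|x Ox i]; first by rewrite ltr_wpDl.
have : `|x| <= `|M| + 1.
  by apply: (h (`|M| + 1)) => //; rewrite (le_lt_trans (ler_norm M))// ltrDl.
rewrite /Num.norm /= mx_normrE => /bigmax_leP[_ /(_ (ord0, i) isT)] /= h1.
by rewrite (le_lt_trans h1)// ltrD2l (ltr_nat R 1 2).
Qed.

(* Integrate x_0 f^2 by parts, then absorb the mixed term. *)
Lemma poincare_test Om (D : R) f : measurable Om -> 0 < D ->
  (forall x, Om x -> forall i, `|x ord0 i| < D) -> test_fun Om f ->
  (sqint Om f <= (4 * D ^+ 2)%:E * sqint Om (partial ord0 f))%E.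
Proof.
move=> mO D0 OD tf.
pose a : 'rV[R]_n.+1 := const_mx (- D); pose b : 'rV[R]_n.+1 := const_mx D.
have Oab : Om `<=` box a b.
  move=> x Ox i; rewrite !mxE; have := OD x Ox i.
  by rewrite ltr_norml => /andP[/ltW -> /ltW ->].
have cf := test_fun_continuous tf.
have [df cpf _ _] := test_fun_partial ord0 tf.
pose F (x : 'rV[R]_n.+1) := x ord0 ord0 * (f x * f x).
(* c is the first partial derivative of F = x_0 f^2. The faces x_0 = -D and x_0 = D lie outside Om,
   so F vanishes there and c has integral zero over the box. *)
pose c (x : 'rV[R]_n.+1) := x ord0 ord0 * (f x * partial ord0 f x + f x * partial ord0 f x) + (f x * f x) * 1.
have [Fd FE] : (forall x, derivable F x (delta_mx ord0 ord0)) /\ partial ord0 F = c.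
  have h x : derivable F x (delta_mx ord0 ord0) /\ partial ord0 F x = c x.
    have [d1 e1] := partialM (df x) (df x).
    have [d2 e2] := partial_coord ord0 ord0 x.
    have [d3 e3] := partialM d2 d1.
    by split => //; rewrite e3 e1 e2.
  by split => [x|]; [exact: (h x).1|apply/funext => x; exact: (h x).2].
have cc0 : continuous (fun x : 'rV[R]_n.+1 => x ord0 ord0) by move=> x; exact: coord_continuous.
have cff : continuous (fun x => f x * f x) by exact: continuousM_row.
have cfp : continuous (fun x => f x * partial ord0 f x) by exact: continuousM_row.
have cF : continuous F by exact: continuousM_row.
have cc : continuous c.
  rewrite (_ : c = fun x => 2 * (x ord0 ord0 * (f x * partial ord0 f x)) + f x * f x); last first.
    by apply/funext => x; rewrite /c; ring.
  by apply: continuous_lin => //; exact: continuousM_row.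
have ic : (\int[vol R n.+1]_(x in box a b) (2 * c x)%:E = 0)%E.
  under eq_integral do rewrite EFinM.
  rewrite integralZl//; first last.
  - exact: integrable_box.
  - exact: measurable_box.
  rewrite -FE integral_partial_box ?mule0// ?FE//.
  - by move=> j; rewrite !mxE; lra.
  - move=> x xab; have Ox : ~ Om x.
      by move=> /OD/(_ ord0); case: xab => ->; rewrite !mxE ?normrN ger0_norm ?ltxx// ltW.
    by rewrite /F (test_fun_out ord0 tf Ox).1 mul0r mulr0.
have mf := continuous_measurable_row cf; have mpf := continuous_measurable_row cpf.
have sub : (sqint (box a b) (partial ord0 f) <= sqint Om (partial ord0 f))%E.
  rewrite le_eqVlt; apply/orP; left; apply/eqP.
  rewrite /sqint integral_mkcond [RHS]integral_mkcond; apply: eq_integral => x _.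
  rewrite !patchE; case: ifPn => [xab|xab]; case: ifPn => [xO|xO] //.
    by rewrite (test_fun_out ord0 tf _).2 ?expr0n// => Ox; rewrite mem_set in xO.
  by exfalso; move/set_mem/Oab : xO => xO; rewrite mem_set in xab.
apply: (@le_trans _ _ (sqint (box a b) f)).
  by apply: subset_sqint => //; [exact: measurable_box|exact: measurable_funTS].
apply: (@le_trans _ _ ((4 * D ^+ 2)%:E * sqint (box a b) (partial ord0 f))%E); last first.
  by rewrite lee_pmul2l// lte_fin mulr_gt0// exprn_gt0.
rewrite /sqint -ge0_integralZl_EFin//; first last.
- by rewrite mulr_ge0// sqr_ge0.
- by apply: measurable_sqr_EFin; exact: measurable_funTS.
- by move=> x _; rewrite lee_fin sqr_ge0.
- exact: measurable_box.
apply: (@le_integral_corrector _ _ _ _ _ (fun x => f x ^+ 2)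
  (fun x => 4 * D ^+ 2 * partial ord0 f x ^+ 2) (fun x => 2 * c x)) => //.
- exact: measurable_box.
- by move=> x _; rewrite sqr_ge0.
- by move=> x _; apply: mulr_ge0; [apply: mulr_ge0 => //; exact: sqr_ge0|exact: sqr_ge0].
- by apply: measurable_funX; exact: measurable_funTS.
- by apply: measurable_funM => //; apply: measurable_funX; exact: measurable_funTS.
- by apply: integrable_box; apply: continuousM_row => //; exact: cst_continuous.
move=> x abx; rewrite /c.
have xD : x ord0 ord0 ^+ 2 <= D ^+ 2.
  rewrite -[x _ _ ^+ 2]real_normK ?num_real// ler_sqr ?nnegrE ?(ltW D0)//.
  by rewrite ler_norml; have := abx ord0; rewrite !mxE.
set y := x _ _ in xD *; set p := partial _ _ _; set q := f x.
have : y ^+ 2 * p ^+ 2 <= D ^+ 2 * p ^+ 2 by rewrite ler_wpM2r// sqr_ge0.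
(* Completing the square: 4 D^2 p^2 + 2 c - q^2 is at least (q + 2 y p)^2, because y^2 is at most
   D^2. *)
have := sqr_ge0 (q + 2 * y * p); lra.
Qed.

Lemma poincare Om : measurable Om -> bounded_set Om ->
  exists2 C : R, 0 < C & forall v g, H10_grad Om v g ->
  (sqint Om v <= C%:E * sqint Om (fun x => enorm (g x)))%E.
Proof.
(* 16 D^2 is 4 D^2, the constant for test functions, times 2 for each of the two approximations, of
   v and of its gradient. *)
move=> mO /bounded_in_box[D D0 OD]; exists (16 * D ^+ 2).
  by rewrite mulr_gt0// exprn_gt0.
move=> v g [[mv vy] [mg gy] [f [tf fv fg]]].
have s0 := sqint_ge0.
have D20 : 0 < 8 * D ^+ 2 by rewrite mulr_gt0// exprn_gt0.
suff key (e : R) : 0 < e ->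
    (sqint Om v <= (16 * D ^+ 2)%:E * sqint Om (fun x => enorm (g x)) + e%:E)%E.
  by apply/lee_addgt0Pr => e e0; exact: key.
move=> e0; move/normL2_cvg0 : fv => fv.
have {}fg : forall e : R, 0 < e -> \forall k \near \oo,
    (sqint Om (fun x => enorm (grad (f k) x - g x))%R <= e%:E)%E.
  exact: (normL2_cvg0 _ _).1 fg.
have [k [k1 k2]] : exists k, (sqint Om (fun x => f k x - v x)%R <= (e / 4)%:E)%E /\
   (sqint Om (fun x => enorm (grad (f k) x - g x))%R <= (e / 4 / (8 * D ^+ 2))%:E)%E.
  near \oo => k; exists k; split; near: k; [apply: fv|apply: fg]; rewrite ?divr_gt0//.
have mfk := test_fun_measurable (tf k).
have mgk := measurable_grad (tf k).
have mB (u u' : 'rV[R]_n.+1 -> 'rV[R]_n.+1) : measurable_fun setT u -> measurable_fun setT u' ->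
    measurable_fun setT (fun x => u x - u' x).
  move=> mu mu'; apply: measurable_fun_row => i.
  rewrite (_ : (fun _ => _) = (fun x => u x ord0 i - u' x ord0 i)); last first.
    by apply/funext => x; rewrite !mxE.
  by apply: measurable_funB; apply: (measurableT_comp (measurable_coord i)).
have h1 : (sqint Om v <= 2%:E * sqint Om (fun x => (f k x - v x)%R) + 2%:E * sqint Om (f k))%E.
  apply: le_sqintD => //; try exact: measurable_funTS.
    by apply: measurable_funTS; exact: measurable_funB.
  move=> x _; rewrite addrC distrC; apply: le_trans (ler_normD _ _).
  by rewrite addrC subrK.
have h2 := poincare_test mO D0 OD (tf k).
have [_ cp _ _] := test_fun_partial ord0 (tf k).
have h3 : (sqint Om (partial ord0 (f k)) <=
    2%:E * sqint Om (fun x => enorm (grad (f k) x - g x))%R + 2%:E * sqint Om (fun x => enorm (g x)))%E.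
  apply: le_sqintD => //; try (apply: measurable_funTS; apply: measurable_enorm => //; exact: mB).
    by apply: measurable_funTS; exact: continuous_measurable_row.
  move=> x _; rewrite !(ger0_norm (enorm_ge0 _)); apply: le_trans (ler_enormD _ _).
  by rewrite subrK; have := ler_coord_enorm (grad (f k) x) ord0; rewrite mxE.
apply: (le_trans h1).
apply: (@le_trans _ _ (2%:E * (e / 4)%:E + 2%:E * ((4 * D ^+ 2)%:E *
    (2%:E * (e / 4 / (8 * D ^+ 2))%:E + 2%:E * sqint Om (fun x => enorm (g x)))))%E).
  apply: leeD; first by rewrite lee_pmul2l.
  rewrite lee_pmul2l//; apply: (le_trans h2).
  rewrite lee_pmul2l ?lte_fin ?mulr_gt0 ?exprn_gt0//.
  by apply: (le_trans h3); rewrite leeD2r// lee_pmul2l.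
case: (sqint Om (fun x => enorm (g x))) (s0 _ _ Om (fun x => enorm (g x))) => [r| |] // r0.
  rewrite -!(EFinM, EFinD) lee_fin le_eqVlt; apply/orP; left; apply/eqP.
  by field; rewrite gt_eqF.
rewrite [X in (_ <= X + _)%E](_ : _ = +oo)%E ?addye ?leey//.
by rewrite mulry gtr0_sg ?mul1e// mulr_gt0// exprn_gt0.
Unshelve. all: by end_near. Qed.

End poincare.

(** * Uniqueness of the weak gradient where the function is affine *)

Section weak_gradient.
Context {R : realType} {n : nat}.
Implicit Types (Om : set 'rV[R]_n).

Lemma H10_grad_cvg Om v g (i : 'I_n) (gam : R) : measurable Om -> H10_grad Om v g ->
  exists f : nat -> 'rV[R]_n -> R, [/\ forall k, test_fun Om (f k),
    forall e : R, 0 < e -> \forall k \near \oo, (sqint Om (fun x => f k x - v x)%R <= e%:E)%E &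
    forall e : R, 0 < e -> \forall k \near \oo,
      (sqint Om (fun x => (g x ord0 i - gam) - (partial i (f k) x - gam))%R <= e%:E)%E].
Proof.
move=> mO [[mv vy] [mg gy] [f [tf fv fg]]]; exists f; split => //.
  exact/normL2_cvg0.
move=> e e0; move: ((normL2_cvg0 _ _).1 fg e e0); apply: filterS => k.
apply: le_trans; apply: le_sqint => //.
- apply: measurable_funTS; apply: measurable_funB.
    by apply: measurable_funB => //; exact: (measurableT_comp (measurable_coord i)).
  apply: measurable_funB => //; apply: continuous_measurable_row.
  by have [_ ? _ _] := test_fun_partial i (tf k).
- apply: measurable_funTS; apply: measurable_enorm; apply: measurable_fun_row => j.
  rewrite (_ : (fun _ => _) = (fun x => grad (f k) x ord0 j - g x ord0 j)); last first.
    by apply/funext => x; rewrite !mxE.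
  apply: measurable_funB; apply: (measurableT_comp (measurable_coord j)) => //.
  exact: measurable_grad (tf k).
move=> x _; rewrite (ger0_norm (enorm_ge0 _)).
have := ler_coord_enorm (grad (f k) x - g x) i; rewrite !mxE; apply: le_trans.
by rewrite distrC le_eqVlt; apply/orP; left; apply/eqP; congr Num.norm; ring.
Qed.

Lemma ge0_integral_lin4 (D : set 'rV[R]_n) (f1 f2 f3 : 'rV[R]_n -> R) (a b c e : R) :
  measurable D -> 0 <= a -> 0 <= b -> 0 <= c -> 0 <= e ->
  measurable_fun D f1 -> measurable_fun D f2 -> measurable_fun D f3 ->
  (\int[vol R n]_(x in D) (a * f1 x ^+ 2 + b * f2 x ^+ 2 + c * f3 x ^+ 2 + e)%:E =
   a%:E * sqint D f1 + b%:E * sqint D f2 + c%:E * sqint D f3 + e%:E * vol R n D)%E.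
Proof.
move=> mD a0 b0 c0 e0 m1 m2 m3.
have mZ (k : R) (f : 'rV[R]_n -> R) : measurable_fun D f -> measurable_fun D (fun x => k * f x ^+ 2).
  by move=> mf; apply: measurable_funM => //; exact: measurable_funX.
have pZ (k : R) (f : 'rV[R]_n -> R) (x : 'rV[R]_n) : 0 <= k -> 0 <= k * f x ^+ 2.
  by move=> k0; rewrite mulr_ge0// sqr_ge0.
have iZ (k : R) (f : 'rV[R]_n -> R) : 0 <= k -> measurable_fun D f ->
    (\int[vol R n]_(x in D) (k * f x ^+ 2)%:E = k%:E * sqint D f)%E.
  move=> k0 mf; rewrite /sqint -ge0_integralZl_EFin//.
    by move=> x _; rewrite lee_fin sqr_ge0.
  exact: measurable_sqr_EFin.
under eq_integral do rewrite !EFinD.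
rewrite ge0_integralD//; last 2 first.
- by move=> x _; rewrite -!EFinD lee_fin !addr_ge0// pZ.
- apply: emeasurable_funD; last by apply/measurable_EFinP; exact: mZ.
  by apply: emeasurable_funD; apply/measurable_EFinP; exact: mZ.
rewrite integral_cst//; congr (_ + _)%E.
rewrite ge0_integralD//; last 4 first.
- by move=> x _; rewrite -!EFinD lee_fin !addr_ge0// pZ.
- by apply: emeasurable_funD; apply/measurable_EFinP; exact: mZ.
- by move=> x _; rewrite lee_fin pZ.
- by apply/measurable_EFinP; exact: mZ.
rewrite iZ//; congr (_ + _)%E.
rewrite ge0_integralD//; last 4 first.
- by move=> x _; rewrite lee_fin pZ.
- by apply/measurable_EFinP; exact: mZ.
- by move=> x _; rewrite lee_fin pZ.
- by apply/measurable_EFinP; exact: mZ.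
by rewrite !iZ.
Qed.

Lemma young (x y e : R) : 0 < e -> x * y <= e * y ^+ 2 + e^-1 * x ^+ 2.
Proof.
move=> e0; have e1 : 0 < e^-1 by rewrite invr_gt0.
have := sqr_ge0 (x - e * y); rewrite -(pmulr_lge0 _ e1) => h.
have e2 : e * e^-1 = 1 by rewrite mulfV// gt_eqF.
have h' : (x - e * y) ^+ 2 * e^-1 = e^-1 * x ^+ 2 - 2 * (x * y) * (e * e^-1) + e * y ^+ 2 * (e * e^-1).
  by ring.
rewrite h' e2 in h.
have : 0 <= e * y ^+ 2 by rewrite mulr_ge0 ?sqr_ge0 ?ltW.
have : 0 <= e^-1 * x ^+ 2 by rewrite mulr_ge0 ?sqr_ge0 ?ltW.
lra.
Qed.

(* With w_k the difference of the k-th test function and the affine function, and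
   theta vanishing on the two faces orthogonal to the i-th axis, integration by
   parts gives [int (d_i w_j) (d_i w_k) theta -> 0] as j -> oo; then let k -> oo. *)
Lemma weak_grad_box Om v g (a b gam : 'rV[R]_n) (c : R) (i : 'I_n) :
  measurable Om -> H10_grad Om v g ->
  (forall j, a ord0 j < b ord0 j) -> box a b `<=` Om ->
  (forall x, box a b x -> v x = c + dotv gam x) ->
  (\int[vol R n]_(x in box a b)
    ((g x ord0 i - gam ord0 i) ^+ 2 * ((x ord0 i - a ord0 i) * (b ord0 i - x ord0 i)))%:E = 0)%E.
Proof.
move=> mO Hvg ab abO vE.
have [[mv vy] [mg gy] _] := Hvg.
have [f [tf fv fg]] := H10_grad_cvg i (gam ord0 i) mO Hvg.
pose B := box a b; have mB : measurable B by exact: measurable_box.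
pose h (x : 'rV[R]_n) := g x ord0 i - gam ord0 i.
have mh : measurable_fun B h.
  apply: measurable_funTS; apply: measurable_funB => //.
  exact: (measurableT_comp (measurable_coord i)).
(* This weight vanishes on the two faces orthogonal to the i-th axis, so that no boundary term
   appears, and is positive between them, so that the integral still detects every interior
   point. *)
pose th (x : 'rV[R]_n) := (x ord0 i - a ord0 i) * (b ord0 i - x ord0 i).
have cth : continuous th.
  apply: continuousM_row.
    rewrite (_ : (fun _ => _) = fun x : 'rV[R]_n => 1 * x ord0 i + - a ord0 i); last first.
      by apply/funext => x; rewrite mul1r.
    by apply: continuous_lin => [x|]; [exact: coord_continuous|exact: cst_continuous].
  rewrite (_ : (fun _ => _) = fun x : 'rV[R]_n => (-1) * x ord0 i + b ord0 i); last first.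
    by apply/funext => x; rewrite mulN1r addrC.
  by apply: continuous_lin => [x|]; [exact: coord_continuous|exact: cst_continuous].
have th0 x : B x -> 0 <= th x.
  by move=> /(_ i)/andP[? ?]; rewrite mulr_ge0// subr_ge0.
have dth x : derivable th x (delta_mx ord0 i) /\
    partial i th x = (x ord0 i - a ord0 i) * (-1) + (b ord0 i - x ord0 i).
  have [d1] := partial_coord i i x; rewrite eqxx mulr1n => e1.
  have [d2 e2] := partial_cst (- a ord0 i) i x.
  have [d3 e3] := partial_cst (b ord0 i) i x.
  have [d4 e4] := partial_lin 1 d1 d2; have [d5 e5] := partial_lin (-1) d1 d3.
  have [d6 e6] := partialM d4 d5.
  rewrite (_ : th = fun x => (1 * x ord0 i - a ord0 i) * (-1 * x ord0 i + b ord0 i)); last first.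
    by apply/funext => y; rewrite /th; ring.
  by split => //; rewrite e6 e5 e4 e1 e2 e3; ring.
pose w k (x : 'rV[R]_n) := f k x - (c + dotv gam x).
have cw k : continuous (w k).
  rewrite (_ : w k = fun x => (-1) * (1 * dotv gam x + c) + f k x); last first.
    by apply/funext => x; rewrite /w; ring.
  apply: continuous_lin; last exact: test_fun_continuous (tf k).
  by apply: continuous_lin; [exact: continuous_dotv|exact: cst_continuous].
pose p k (x : 'rV[R]_n) := partial i (f k) x - gam ord0 i.
have ddot (x : 'rV[R]_n) : derivable (dotv gam) x (delta_mx ord0 i) /\ partial i (dotv gam) x = gam ord0 i.
  have e : (fun t : R => t^-1 *: (dotv gam (t *: delta_mx ord0 i + x) - dotv gam x))
      @ 0^' --> (gam ord0 i : R).
    apply: cvg_near_cst; near=> t; rewrite dotvDr dotvZr dotv_delta addrK.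
    have t0 : t != 0 by near: t; exact: nbhs_dnbhs_neq.
    by rewrite /GRing.scale /= mulKf.
  split; first by apply/cvg_ex; exists (gam ord0 i).
  exact/cvg_lim.
have dw k x : derivable (w k) x (delta_mx ord0 i) /\ partial i (w k) x = p k x.
  have [d1 _ _ _] := test_fun_partial i (tf k).
  have [d2 e2] := ddot x; have [d3 e3] := partial_cst c i x.
  have [d4 e4] := partial_lin 1 d2 d3; have [d5 e5] := partial_lin (-1) d4 (d1 x).
  rewrite (_ : w k = fun x => (-1) * (1 * dotv gam x + c) + f k x); last first.
    by apply/funext => y; rewrite /w; ring.
  by split => //; rewrite e5 e4 e2 e3 /p; ring.
have cp k : continuous (p k).
  have [_ c1 _ _] := test_fun_partial i (tf k).
  rewrite (_ : p k = fun x => 1 * partial i (f k) x + (- gam ord0 i)); last first.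
    by apply/funext => x; rewrite mul1r.
  by apply: continuous_lin => //; exact: cst_continuous.
pose psi k (x : 'rV[R]_n) := p k x * th x.
have cpsi k : continuous (psi k) by exact: continuousM_row.
pose q k (x : 'rV[R]_n) := p k x * partial i th x + th x * partial i (partial i (f k)) x.
have dpsi k x : derivable (psi k) x (delta_mx ord0 i) /\ partial i (psi k) x = q k x.
  have [_ _ d1 _] := test_fun_partial i (tf k).
  have [d3 e3] := partial_cst (- gam ord0 i) i x.
  have [d4 e4] := partial_lin 1 (d1 x) d3.
  have [d5 e5] := dth x.
  have [d6 e6] := partialM d4 d5.
  rewrite (_ : psi k = fun x => (1 * partial i (f k) x - gam ord0 i) * th x); last first.
    by apply/funext => y; rewrite /psi /p mul1r.
  by split => //; rewrite e6 e4 e3 /q /p; ring.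
have cdth : continuous (partial i th).
  rewrite (_ : partial i th = fun x : 'rV[R]_n => (-2) * x ord0 i + (a ord0 i + b ord0 i)); last first.
    by apply/funext => x; rewrite (dth x).2; ring.
  by apply: continuous_lin => [x|]; [exact: coord_continuous|exact: cst_continuous].
have cq k : continuous (q k).
  have [_ _ _ c1] := test_fun_partial i (tf k).
  rewrite (_ : q k = fun x => 1 * (p k x * partial i th x) + th x * partial i (partial i (f k)) x); last first.
    by apply/funext => x; rewrite mul1r.
  by apply: continuous_lin; exact: continuousM_row.
pose V := fine (vol R n B).
have VE : vol R n B = V%:E by rewrite fineK// ge0_fin_numE// vol_box_lty.
have V0 : 0 <= V by rewrite fine_ge0.
have hy : (sqint B h < +oo)%E.
  apply: (@le_lt_trans _ _ (2%:E * sqint B (fun x => enorm (g x)) + 2%:E * sqint B (fun=> gam ord0 i)))%E.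
    apply: le_sqintD => //; first by apply: measurable_funTS; exact: measurable_enorm.
    move=> x _; rewrite (ger0_norm (enorm_ge0 _)) (le_trans (ler_normB _ _))// lerD2r.
    exact: ler_coord_enorm.
  rewrite lte_add_pinfty// lte_mul_pinfty//.
    apply: le_lt_trans ((sqint_lty _ _).1 gy).
    by apply: subset_sqint => //; apply: measurable_funTS; exact: measurable_enorm.
  by rewrite /sqint integral_cst//; apply: lte_mul_pinfty => //; [rewrite lee_fin sqr_ge0|exact: vol_box_lty].
pose A := fine (sqint B h).
have AE : sqint B h = A%:E by rewrite fineK// ge0_fin_numE// sqint_ge0.
have A0 : 0 <= A by rewrite fine_ge0// sqint_ge0.
have [Mt Mt0 Mth] := continuous_bounded_box a b cth.
suff key (e : R) : 0 < e -> (\int[vol R n]_(x in B) (h x ^+ 2 * th x)%:E <= e%:E)%E.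
  apply/eqP; rewrite eq_le; apply/andP; split.
    by apply/lee_addgt0Pr => e e0; rewrite add0e; exact: key.
  by apply: integral_ge0 => x /th0 ?; rewrite lee_fin mulr_ge0// sqr_ge0.
move=> e0.
pose e1 := e / 4 / (Mt * (A + 1)).
have A1 : 0 < A + 1 by rewrite ltr_wpDl.
have e10 : 0 < e1 by rewrite /e1 !divr_gt0// mulr_gt0.
have sB k : measurable_fun B (fun x => h x - p k x).
  by apply: measurable_funB => //; apply: measurable_funTS; exact: continuous_measurable_row.
have subO k : (sqint B (fun x => h x - p k x)%R <=
    sqint Om (fun x => (g x ord0 i - gam ord0 i) - (partial i (f k) x - gam ord0 i))%R)%E.
  apply: subset_sqint => //; apply: measurable_funTS; apply: measurable_funB.
    by apply: measurable_funB => //; exact: (measurableT_comp (measurable_coord i)).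
  exact: continuous_measurable_row.
have subw k : (sqint B (w k) <= sqint Om (fun x => f k x - v x)%R)%E.
  apply: (@le_trans _ _ (sqint B (fun x => f k x - v x)%R)).
    rewrite /sqint le_eqVlt; apply/orP; left; apply/eqP; apply: eq_integral => x /set_mem Bx.
    by rewrite /w vE.
  apply: subset_sqint => //; apply: measurable_funTS; apply: measurable_funB => //.
  exact: test_fun_measurable (tf k).
(* The index k is fixed first; the tolerance dl for j may then depend on the bounds of psi_k and of
   its derivative q_k on the box. *)
have [k Ik] : exists k, (sqint B (fun x => h x - p k x)%R <= (e / 4 / (Mt / e1))%:E)%E.
  near \oo => k; exists k; apply: (le_trans (subO k)).
  by near: k; apply: fg; apply: divr_gt0; exact: divr_gt0.
have [Mp Mp0 Mpsi] := continuous_bounded_box a b (cpsi k).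
have [Mq Mq0 Mqq] := continuous_bounded_box a b (cq k).
pose dl := e / 4 / ((Mp ^+ 2 + Mq ^+ 2) * (V + 1)).
have V1 : 0 < V + 1 by rewrite ltr_wpDl.
have MM : 0 < Mp ^+ 2 + Mq ^+ 2 by rewrite addr_gt0// exprn_gt0.
have dl0 : 0 < dl by rewrite /dl !divr_gt0// mulr_gt0.
have [j [Ij Jj]] : exists j, (sqint B (fun x => h x - p j x)%R <= (e / 8 * dl)%:E)%E /\
    (sqint B (w j) <= (e / 8 * dl)%:E)%E.
  near \oo => j; exists j; split.
    apply: (le_trans (subO j)).
    by near: j; apply: fg; rewrite mulr_gt0// divr_gt0.
  apply: (le_trans (subw j)).
  by near: j; apply: fv; rewrite mulr_gt0// divr_gt0.
pose F (x : 'rV[R]_n) := w j x * psi k x.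
pose dF (x : 'rV[R]_n) := w j x * q k x + psi k x * p j x.
have FdF x : derivable F x (delta_mx ord0 i) /\ partial i F x = dF x.
  have [d1 e1'] := dw j x; have [d2 e2] := dpsi k x; have [d3 e3] := partialM d1 d2.
  by split => //; rewrite e3 e2 e1'.
have cF : continuous F by exact: continuousM_row.
have cdF : continuous dF.
  rewrite (_ : dF = fun x => 1 * (w j x * q k x) + psi k x * p j x); last first.
    by apply/funext => x; rewrite mul1r.
  by apply: continuous_lin; exact: continuousM_row.
have idF : (\int[vol R n]_(x in B) (dF x)%:E = 0)%E.
  have pF : partial i F = dF by apply/funext => x; exact: (FdF x).2.
  rewrite -pF; apply: integral_partial_box => //; first by rewrite pF.
    by move=> x; exact: (FdF x).1.
  move=> x xab; rewrite /F /psi /th.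
  by case: xab => ->; rewrite subrr ?mul0r ?mulr0 ?mulr0.
pose f2 (x : 'rV[R]_n) := Mt * e1 * h x ^+ 2 + Mt / e1 * (h x - p k x) ^+ 2 +
  0 * (w j x) ^+ 2 + 0.
pose f3 (x : 'rV[R]_n) := 0 * h x ^+ 2 + dl^-1 * (h x - p j x) ^+ 2 +
  dl^-1 * (w j x) ^+ 2 + dl * (Mp ^+ 2 + Mq ^+ 2).
have mw : measurable_fun B (w j).
  by apply: measurable_funTS; exact: continuous_measurable_row.
have dM0 : 0 <= dl * (Mp ^+ 2 + Mq ^+ 2) by rewrite mulr_ge0 ?ltW.
have Me1 : 0 <= Mt * e1 by rewrite mulr_ge0 ?ltW.
have Me2 : 0 <= Mt / e1 by rewrite divr_ge0 ?ltW.
have di0 : 0 <= dl^-1 by rewrite invr_ge0 ltW.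
have if2 : (\int[vol R n]_(x in B) (f2 x)%:E <= (e / 4 + e / 4)%:E)%E.
  rewrite ge0_integral_lin4// AE !mul0e !adde0 EFinD; apply: leeD.
    rewrite -EFinM lee_fin /e1.
    rewrite (_ : _ * A = e / 4 * (A / (A + 1))); last by field; rewrite !gt_eqF.
    by rewrite ler_piMr ?divr_ge0 ?(ltW e0)// ler_pdivrMr// mul1r lerDl.
  apply: (@le_trans _ _ ((Mt / e1)%:E * (e / 4 / (Mt / e1))%:E)%E).
    by rewrite lee_pmul2l// lte_fin divr_gt0.
  by rewrite -EFinM lee_fin mulrCA divff ?mulr1// gt_eqF// divr_gt0.
have if3 : (\int[vol R n]_(x in B) (f3 x)%:E <= (e / 8 + e / 8 + e / 4)%:E)%E.
  rewrite ge0_integral_lin4// mul0e add0e !EFinD VE; apply: leeD; first apply: leeD.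
  - apply: (@le_trans _ _ (dl^-1%:E * (e / 8 * dl)%:E)%E).
      by rewrite lee_pmul2l// lte_fin invr_gt0.
    by rewrite -EFinM lee_fin mulrCA mulVf ?mulr1// gt_eqF.
  - apply: (@le_trans _ _ (dl^-1%:E * (e / 8 * dl)%:E)%E).
      by rewrite lee_pmul2l// lte_fin invr_gt0.
    by rewrite -EFinM lee_fin mulrCA mulVf ?mulr1// gt_eqF.
  - rewrite -EFinM lee_fin /dl.
    rewrite (_ : _ * V = e / 4 * (V / (V + 1))); last by field; rewrite !gt_eqF.
    by rewrite ler_piMr ?divr_ge0 ?(ltW e0)// ler_pdivrMr// mul1r lerDl.
have f20 x : 0 <= f2 x.
  by rewrite /f2 mul0r !addr0 addr_ge0// mulr_ge0// sqr_ge0.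
have f30 x : 0 <= f3 x.
  by rewrite /f3 mul0r add0r !addr_ge0// mulr_ge0// sqr_ge0.
have m2 (k' : R) (u : 'rV[R]_n -> R) : measurable_fun B u -> measurable_fun B (fun x => k' * u x ^+ 2).
  by move=> mu; apply: measurable_funM => //; exact: measurable_funX.
have mf2 : measurable_fun B f2.
  by apply: measurable_funD => //; apply: measurable_funD; [apply: measurable_funD|]; exact: m2.
have mf3 : measurable_fun B f3.
  by apply: measurable_funD => //; apply: measurable_funD; [apply: measurable_funD|]; exact: m2.
have -> : e%:E = ((e / 4 + e / 4)%:E + (e / 8 + e / 8 + e / 4)%:E)%E.
  by rewrite -EFinD; congr EFin; field.
apply: le_trans (leeD if2 if3).
rewrite -ge0_integralD//; last 4 first.
- by move=> x _; rewrite lee_fin.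
- exact/measurable_EFinP.
- by move=> x _; rewrite lee_fin.
- exact/measurable_EFinP.
under [leRHS]eq_integral do rewrite -EFinD.
apply: (@le_integral_corrector _ _ _ (vol R n) B (fun x => h x ^+ 2 * th x) (fun x => f2 x + f3 x) dF) => //.
- by move=> x /th0 ?; rewrite mulr_ge0// sqr_ge0.
- by move=> x _; rewrite addr_ge0.
- apply: measurable_funM; first exact: measurable_funX.
  by apply: measurable_funTS; exact: continuous_measurable_row.
- exact: measurable_funD.
- exact: integrable_box.
move=> x Bx; rewrite /f2 /f3 /dF !mul0r !addr0 add0r.
have tx := th0 x Bx; have tM : th x <= Mt := le_trans (ler_norm _) (Mth x Bx).
have y1 : h x * (h x - p k x) * th x <= Mt * e1 * h x ^+ 2 + Mt / e1 * (h x - p k x) ^+ 2.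
  have y := young (h x - p k x) (h x) e10.
  set Y := e1 * h x ^+ 2 + e1^-1 * (h x - p k x) ^+ 2 in y.
  have Y0 : 0 <= Y by rewrite /Y addr_ge0// mulr_ge0 ?sqr_ge0 ?invr_ge0 ?ltW.
  apply: (@le_trans _ _ (Y * th x)); first by rewrite ler_wpM2r// mulrC.
  apply: (@le_trans _ _ (Y * Mt)); first by rewrite ler_wpM2l.
  by rewrite /Y le_eqVlt; apply/orP; left; apply/eqP; ring.
have y2 : (h x - p j x) * psi k x <= dl^-1 * (h x - p j x) ^+ 2 + dl * Mp ^+ 2.
  apply: le_trans (young (h x - p j x) (psi k x) dl0) _.
  rewrite [leRHS]addrC lerD2r ler_wpM2l ?(ltW dl0)//.
  rewrite -[_ ^+ 2]real_normK ?num_real// ler_sqr ?nnegrE ?(ltW Mp0)//.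
  exact: Mpsi.
have y3 : - w j x * q k x <= dl^-1 * w j x ^+ 2 + dl * Mq ^+ 2.
  apply: le_trans (young (- w j x) (q k x) dl0) _.
  rewrite sqrrN [leRHS]addrC lerD2r ler_wpM2l ?(ltW dl0)//.
  rewrite -[_ ^+ 2]real_normK ?num_real// ler_sqr ?nnegrE ?(ltW Mq0)//.
  exact: Mqq.
(* Exact splitting of the integrand: an error of index k, two errors of index j, and the derivative
   of w_j psi_k, whose integral is zero. *)
have -> : h x ^+ 2 * th x = h x * (h x - p k x) * th x + (h x - p j x) * psi k x +
   (- w j x * q k x) + (w j x * q k x + psi k x * p j x) by rewrite /psi; ring.
lra.
Unshelve. all: by end_near. Qed.

Lemma negligible_bigcup_countType (T : countType) (F : T -> set 'rV[R]_n) (A : set T) :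
  (forall t, A t -> (vol R n).-negligible (F t)) ->
  (vol R n).-negligible (\bigcup_(t in A) F t).
Proof.
move=> h.
pose G (k : nat) : set 'rV[R]_n :=
  if @choice.unpickle T k is Some t then (if t \in A then F t else classical_sets.set0)
  else classical_sets.set0.
have hG k : (vol R n).-negligible (G k).
  rewrite /G; case: (choice.unpickle k) => [t|]; last exact: negligible_set0.
  by case: ifPn => [/set_mem /h //|_]; exact: negligible_set0.
apply: negligibleS (negligible_bigcup hG) => x [t At Ft].
by exists (choice.pickle t) => //; rewrite /G choice.pickleK mem_set.
Qed.

(** U is a countable union of rational boxes. On each of them the weighted integral vanishes, and
    the weight is zero only on two faces, which are null. This makes the arbitrary choice in [wgrad]
    harmless on open simplices. *)
Lemma weak_grad_affine Om U v g (gam : 'rV[R]_n) (c : R) :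
  measurable Om -> H10_grad Om v g -> open U -> U `<=` Om ->
  (forall x, U x -> v x = c + dotv gam x) ->
  (vol R n).-negligible [set x | U x /\ g x <> gam].
Proof.
move=> mO Hvg oU UO vE.
have -> : [set x | U x /\ g x <> gam] = (U `&` [set x | g x <> gam]) by [].
rewrite [X in X `&` _](open_box_cover oU) setI_bigcupl.
apply: negligible_bigcup_countType => -[p1 p2] /= [p12 pU].
set a : 'rV[R]_n := map_mx ratr p1; set b : 'rV[R]_n := map_mx ratr p2.
have ab j : a ord0 j < b ord0 j by rewrite !mxE ltr_rat.
pose B := box a b.
suff hi i : (vol R n).-negligible (B `&` [set x | g x ord0 i <> gam ord0 i]).
  apply: (@negligibleS _ _ _ _ (\bigcup_(i in [set: 'I_n]) (B `&` [set x | g x ord0 i <> gam ord0 i]))).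
    move=> x [Bx gx]; apply: contrapT => h; apply: gx; apply/rowP => i.
    by apply: contrapT => hgi; apply: h; exists i.
  exact: negligible_bigcup_countType.
have abU : B `<=` Om by move=> x /pU /UO.
have := weak_grad_box i mO Hvg ab abU (fun x Bx => vE x (pU x Bx)).
have [[mv vy] [mg gy] _] := Hvg.
pose F (x : 'rV[R]_n) : \bar R := ((g x ord0 i - gam ord0 i) ^+ 2 *
  ((x ord0 i - a ord0 i) * (b ord0 i - x ord0 i)))%:E.
move=> hF.
have mh : measurable_fun B (fun x => g x ord0 i - gam ord0 i).
  apply: measurable_funTS; apply: measurable_funB => //.
  exact: (measurableT_comp (measurable_coord i)).
have mB : measurable B by exact: measurable_box.
have mF : measurable_fun B F.
  apply/measurable_EFinP; apply: measurable_funM; first exact: measurable_funX.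
  apply: measurable_funM; apply: measurable_funTS; apply: measurable_funB => //; exact: measurable_coord.
have F0 x : B x -> (0 <= F x)%E.
  by move=> /(_ i)/andP[? ?]; rewrite lee_fin mulr_ge0 ?sqr_ge0// mulr_ge0// subr_ge0.
have : (\int[vol R n]_(x in B) `|F x| = 0)%E.
  by rewrite -[RHS]hF; apply: eq_integral => x /set_mem Bx; rewrite gee0_abs// F0.
move/(ae_eq_integral_abs _ mB mF) => aeF.
have hyp (t : R) : (vol R n).-negligible [set x : 'rV[R]_n | x ord0 i = t].
  exists [set x : 'rV[R]_n | x ord0 i = t]; split => //.
    have -> : [set x : 'rV[R]_n | x ord0 i = t] = (fun x : 'rV[R]_n => x ord0 i) @^-1` [set t] by [].
    by rewrite -[X in measurable X]setTI; exact: measurable_coord.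
  rewrite -(@vol_hyperplane _ n (delta_mx ord0 i) t).
    by congr (vol R n _); apply/seteqP; split => x /=; rewrite dotvC dotv_delta.
  by apply/eqP => /rowP/(_ i); rewrite !mxE !eqxx => /eqP; rewrite oner_eq0.
apply: negligibleS (negligibleU aeF (negligibleU (hyp (a ord0 i)) (hyp (b ord0 i)))).
move=> x [Bx gx] /=; apply: contrapT => /not_orP[h1 /not_orP[h2 h3]].
apply: h1 => /(_ Bx) /=; rewrite /F => -[/eqP]; rewrite !mulf_eq0 orbb !subr_eq0.
by move=> /orP[/eqP//|/orP[/eqP//|/eqP/esym//]].
Qed.

End weak_gradient.

(** * Simplices and barycentric coordinates *)

Section small_parameters.
Context {R : realType}.

(** The threshold is kept at most 1 so that the parameters stay in the segments on which they are
    used. *)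
Lemma small_all (I : eqType) (s : seq I) (Q : I -> R -> Prop) :
  (forall i, i \in s -> exists2 e : R, 0 < e & forall t, 0 < t -> t <= e -> Q i t) ->
  exists2 e : R, 0 < e <= 1 & forall t, 0 < t -> t <= e -> forall i, i \in s -> Q i t.
Proof.
elim: s => [_|i s IH h]; first by exists 1; rewrite ?ltr01 ?lexx.
have [|e /andP[e0 e1] he] := IH; first by move=> j js; apply: h; rewrite inE js orbT.
have [e' e'0 he'] := h i (mem_head _ _).
exists (Num.min e e'); first by rewrite lt_min e0 e'0 ge_min e1.
move=> t t0; rewrite le_min => /andP[te te'] j; rewrite inE => /orP[/eqP -> |js].
  exact: he'.
exact: he.
Qed.

Lemma small_pos (c a : R) : 0 < c -> exists2 e : R, 0 < e & forall t, 0 < t -> t <= e -> 0 < c + t * a.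
Proof.
move=> c0; have a1 : 0 < `|a| + 1 by rewrite ltr_wpDl.
exists (c / (`|a| + 1)) => [|t t0]; first exact: divr_gt0.
rewrite ler_pdivlMr// => h.
have : t * - a <= t * `|a| by rewrite ler_wpM2l ?(ltW t0)// -normrN ler_norm.
lra.
Qed.

End small_parameters.

Section affine_functions.
Context {R : realType} {d : nat}.
Local Notation Rd := 'rV[R]_d.

(** Affine functions are handled through their coefficients, so that two of them agreeing at the
    vertices of a simplex are equal as pairs. *)
Definition aff (l : R * Rd) (x : Rd) : R := l.1 + dotv l.2 x.

Lemma aff_comb (I : Type) (r : seq I) (w : I -> R) (p : I -> Rd) l :
  \sum_(i <- r) w i = 1 ->
  aff l (\sum_(i <- r) w i *: p i) = \sum_(i <- r) w i * aff l (p i).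
Proof.
move=> w1; rewrite {1}/aff dotv_sumr.
have -> : l.1 = \sum_(i <- r) w i * l.1 by rewrite -mulr_suml w1 mul1r.
by rewrite -big_split /=; apply: eq_bigr => i _; rewrite dotvZr -mulrDr.
Qed.

Lemma aff_line l (x v : Rd) t : aff l (x + t *: v) = aff l x + t * dotv l.2 v.
Proof. by rewrite /aff dotvDr dotvZr addrA. Qed.

Lemma affB l x y : aff l x - aff l y = dotv l.2 (x - y).
Proof. by rewrite /aff dotvBr; ring. Qed.

Lemma aff_small_pos l (x v : Rd) : 0 < aff l x ->
  exists2 e : R, 0 < e & forall t, 0 < t -> t <= e -> 0 < aff l (x + t *: v).
Proof.
move=> /(small_pos (dotv l.2 v))[e e0 h]; exists e => // t t0 te.
by rewrite aff_line h.
Qed.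

Lemma aff_small_neq0 l (x v : Rd) : aff l x != 0 ->
  exists2 e : R, 0 < e & forall t, 0 < t -> t <= e -> aff l (x + t *: v) != 0.
Proof.
rewrite neq_lt => /orP[h|/(aff_small_pos v)[e e0 h]]; last first.
  by exists e => // t t0 te; rewrite gt_eqF// h.
have /(aff_small_pos v)[e e0 h'] : 0 < aff (- l.1, - l.2) x.
  by rewrite /aff /= dotvNl -opprD oppr_gt0.
exists e => // t t0 te; rewrite lt_eqF//.
by have := h' t t0 te; rewrite /aff /= dotvNl -opprD oppr_gt0.
Qed.

Lemma continuous_aff l : continuous (aff l).
Proof.
rewrite (_ : aff l = fun x => 1 * dotv l.2 x + l.1); last first.
  by apply/funext => x; rewrite mul1r addrC.
by apply: continuous_lin; [exact: continuous_dotv|exact: cst_continuous].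
Qed.

(** General position. A point off the zero sets treated so far is moved slightly, inside the convex
    set, towards a point off the next one; the earlier conditions are open and survive a small
    move. *)
Lemma avoid_zeros (P : set Rd) (ls : seq (R * Rd)) :
  (forall x y t, P x -> P y -> 0 <= t -> t <= 1 -> P (x + t *: (y - x))) ->
  P !=set0 -> (forall l, l \in ls -> exists2 x, P x & aff l x != 0) ->
  exists2 x, P x & forall l, l \in ls -> aff l x != 0.
Proof.
move=> cP P0; elim: ls => [_|l ls IH h]; first by have [x Px] := P0; exists x.
have [|q Pq hq] := IH; first by move=> l' l's; apply: h; rewrite inE l's orbT.
have [p Pp lp] := h l (mem_head _ _).
have [lq|lq] := eqVneq (aff l q) 0; last first.
  by exists q => // l'; rewrite inE => /orP[/eqP -> //|]; exact: hq.
have [|e /andP[e0 e1] he] := @small_all R _ ls (fun l' t => aff l' (q + t *: (p - q)) != 0).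
  by move=> l' /hq; exact: aff_small_neq0.
exists (q + e *: (p - q)); first by apply: cP => //; exact: ltW.
move=> l'; rewrite inE => /orP[/eqP ->|]; last exact: he.
by rewrite aff_line lq add0r -affB lq subr0 mulf_neq0// gt_eqF.
Qed.

End affine_functions.

Section barycentric.
Context {R : realType} {d : nat}.
Local Notation Rd := 'rV[R]_d.
Implicit Types (K F : {fset Rd}).

Definition simplex K := #|` K| = d.+1 /\ affinely_independent K.

Definition bary_spec K (l : Rd -> R * Rd) : Prop :=
  [/\ forall a b, a \in K -> b \in K -> aff (l a) b = (a == b)%:R,
      forall x, \sum_(a <- K) aff (l a) x = 1 &
      forall x, \sum_(a <- K) aff (l a) x *: a = x].

(** Affine independence makes the matrix with rows (1, vertex) invertible; the columns of its
    inverse contain the coefficients of the barycentric coordinates. *)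
Lemma bary_exists K : simplex K -> exists l, bary_spec K l.
Proof.
move=> [cK iK]; pose e : seq Rd := K.
have se : size e = d.+1 by rewrite -cK.
have ue : uniq e by exact: fset_uniq.
pose M : 'M[R]_d.+1 := \matrix_(i, j) row_cons (1, nth 0 e i) ord0 j.
have M0 (i : 'I_d.+1) : M i ord0 = 1 by rewrite !mxE unlift_none.
have Ml (i : 'I_d.+1) j : M i (lift ord0 j) = nth 0 e i ord0 j by rewrite !mxE liftK.
have sumE (F : Rd -> R) : \sum_(a <- K) F a = \sum_(i < d.+1) F (nth 0 e i).
  by rewrite (big_nth 0) -/e se big_mkord.
have sumEv (F : Rd -> Rd) : \sum_(a <- K) F a = \sum_(i < d.+1) F (nth 0 e i).
  by rewrite (big_nth 0) -/e se big_mkord.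
have uM : M \in unitmx.
  rewrite -row_free_unit -kermx_eq0; apply/eqP/row_matrixP => k; rewrite row0.
  set v := row k _.
  have vM : v *m M = 0 by apply/sub_kermxP; exact: row_sub.
  pose lam a := v ord0 (inord (index a e)).
  have lamE (i : 'I_d.+1) : lam (nth 0 e i) = v ord0 i.
    by rewrite /lam index_uniq ?se// inord_val.
  have h1 : \sum_(a <- K) lam a = 0.
    rewrite sumE; move/rowP/(_ ord0) : vM; rewrite !mxE => E; rewrite -[RHS]E.
    by apply: eq_bigr => i _; rewrite lamE M0 mulr1.
  have h2 : \sum_(a <- K) lam a *: a = 0.
    rewrite sumEv; apply/rowP => j; move/rowP/(_ (lift ord0 j)) : vM; rewrite !mxE => E; rewrite -[RHS]E.
    by rewrite summxE; apply: eq_bigr => i _; rewrite lamE Ml !mxE.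
  apply/rowP => i; rewrite [RHS]mxE -lamE; apply: (iK lam) => //.
  by apply: mem_nth; rewrite se.
pose N := invmx M.
pose l a : R * Rd := (N ord0 (inord (index a e)), \row_j N (lift ord0 j) (inord (index a e))).
have lE x (i : 'I_d.+1) : aff (l (nth 0 e i)) x = (row_cons (1, x) *m N) ord0 i.
  rewrite /aff /l /= index_uniq ?se// inord_val [RHS]mxE big_ord_recl.
  rewrite !mxE unlift_none mul1r; congr (_ + _).
  by apply: eq_bigr => j _; rewrite !mxE liftK mulrC.
exists l; split.
- move=> a b aK bK; rewrite -{1}(nth_index 0 aK) -{1}(nth_index 0 bK).
  have ia : (index a e < d.+1)%N by rewrite -se index_mem.
  have ib : (index b e < d.+1)%N by rewrite -se index_mem.
  rewrite (lE _ (Ordinal ia)).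
  rewrite (_ : row_cons _ = row (Ordinal ib) M); last first.
    by apply/rowP => j; rewrite !mxE.
  rewrite -row_mul mulmxV// !mxE; congr ((nat_of_bool _)%:R).
  apply/idP/idP => [/eqP/(congr1 val) /= h|/eqP ab]; last first.
    by apply/eqP/val_inj; rewrite /= ab.
  by rewrite -(nth_index 0 aK) -(nth_index 0 bK) -/e h.
- move=> x; rewrite sumE.
  have := congr1 (fun v : 'rV_d.+1 => v ord0 ord0) (mulmxKV uM (row_cons (1, x))).
  rewrite mxE [row_cons _ _ _]mxE unlift_none /= => <-.
  by apply: eq_bigr => i _; rewrite lE M0 mulr1.
move=> x; rewrite sumEv; apply/rowP => j.
have := congr1 (fun v : 'rV_d.+1 => v ord0 (lift ord0 j)) (mulmxKV uM (row_cons (1, x))).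
rewrite mxE [row_cons _ _ _]mxE liftK /= => <-.
by rewrite summxE; apply: eq_bigr => i _; rewrite mxE lE Ml.
Qed.

Definition bary_fun K : Rd -> R * Rd := xget (fun=> (0, 0)) [set l | bary_spec K l].

Definition bary K a x : R := aff (bary_fun K a) x.
Definition bgrad K a : Rd := (bary_fun K a).2.

Lemma bary_funP K : simplex K -> bary_spec K (bary_fun K).
Proof. by move=> /bary_exists[l hl]; exact: (@xgetPex _ (fun=> (0, 0)) _ (ex_intro _ l hl)). Qed.

Lemma bary_vertex K a b : simplex K -> a \in K -> b \in K -> bary K a b = (a == b)%:R.
Proof. by move=> /bary_funP[h _ _]; exact: h. Qed.

Lemma bary_vertex1 K a : simplex K -> a \in K -> bary K a a = 1.
Proof. by move=> sK aK; rewrite bary_vertex// eqxx. Qed.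

Lemma bary_vertex0 K a b : simplex K -> a \in K -> b \in K -> b != a -> bary K a b = 0.
Proof. by move=> sK aK bK ba; rewrite bary_vertex// eq_sym (negbTE ba). Qed.

Lemma bary_sum1 K x : simplex K -> \sum_(a <- K) bary K a x = 1.
Proof. by move=> /bary_funP[_ h _]; exact: h. Qed.

Lemma bary_comb K x : simplex K -> \sum_(a <- K) bary K a x *: a = x.
Proof. by move=> /bary_funP[_ _ h]; exact: h. Qed.

Lemma aff_bary K l x : simplex K -> aff l x = \sum_(a <- K) bary K a x * aff l a.
Proof.
move=> sK; rewrite -{1}(bary_comb x sK) aff_comb//; exact: bary_sum1.
Qed.

Lemma sum_fset_delta K (F : Rd -> R) a : a \in K ->
  \sum_(b <- K) F b * (a == b)%:R = F a.
Proof.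
move=> aK; rewrite (big_fsetD1 a)//= eqxx mulr1 big_seq big1 ?addr0//.
by move=> b; rewrite !inE => /andP[ba _]; rewrite eq_sym (negbTE ba) mulr0.
Qed.

Lemma bary_hull_comb K (w : Rd -> R) a : simplex K -> \sum_(b <- K) w b = 1 ->
  a \in K -> bary K a (\sum_(b <- K) w b *: b) = w a.
Proof.
move=> sK w1 aK; rewrite /bary aff_comb// -[RHS](sum_fset_delta w aK) big_seq [RHS]big_seq.
by apply: eq_bigr => b bK; rewrite -/(bary K a b) bary_vertex.
Qed.

Lemma hullE K x : simplex K -> hull K x <-> forall a, a \in K -> 0 <= bary K a x.
Proof.
move=> sK; split => [[w [w0 w1 ->]] a aK|h]; first by rewrite bary_hull_comb// w0.
by exists (fun a => bary K a x); split; [exact: h|exact: bary_sum1|rewrite bary_comb].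
Qed.

Lemma hull_vertex K a : simplex K -> a \in K -> hull K a.
Proof. by move=> sK aK; apply/hullE => // b bK; rewrite bary_vertex// ler0n. Qed.

Lemma hull_faceE K F x : simplex K -> (F `<=` K)%fset ->
  hull F x <-> hull K x /\ forall a, a \in K -> a \notin F -> bary K a x = 0.
Proof.
move=> sK FK.
have sumF (V : lmodType R) (w : Rd -> V) : (forall a, a \in K -> a \notin F -> w a = 0) ->
    \sum_(a <- F) w a = \sum_(a <- K) w a.
  move=> w0; rewrite (big_fsetID _ [pred a | a \in F] K)/= [X in _ + X]big_seq [X in _ + X]big1 ?addr0.
    apply: perm_big; apply: uniq_perm; rewrite ?fset_uniq// => a.
    rewrite !inE /=; apply/idP/andP => [aF|[]//]; split => //.
    exact: (fsubsetP FK).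
  by move=> a; rewrite !inE => /andP[aK aF]; exact: w0.
split => [[w [w0 w1 xE]]|[hx h]].
  pose w' a := if a \in F then w a else 0.
  have w'1 : \sum_(a <- K) w' a = 1.
    rewrite -(sumF R^o)//; last by move=> a _; rewrite /w' => /negbTE ->.
    by rewrite -[RHS]w1 big_seq [RHS]big_seq; apply: eq_bigr => a aF; rewrite /w' aF.
  have xE' : x = \sum_(a <- K) w' a *: a.
    rewrite -sumF; last by move=> a _; rewrite /w' => /negbTE ->; rewrite scale0r.
    by rewrite xE big_seq [RHS]big_seq; apply: eq_bigr => a aF; rewrite /w' aF.
  split; last by move=> a aK aF; rewrite xE' bary_hull_comb// /w' (negbTE aF).
  exists w'; split => // a _; rewrite /w'; case: ifPn => // aF; exact: w0.
exists (fun a => bary K a x); split.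
- by move=> a aF; apply: (hullE x sK).1 => //; exact: (fsubsetP FK).
- by rewrite (sumF R^o)// bary_sum1.
- by rewrite sumF ?bary_comb// => a aK aF; rewrite h// scale0r.
Qed.

Lemma aff_inj K l l' : simplex K -> (forall a, a \in K -> aff l a = aff l' a) -> l = l'.
Proof.
move=> sK h.
have h' x : aff l x = aff l' x.
  by rewrite !(aff_bary _ _ sK) big_seq [RHS]big_seq; apply: eq_bigr => a /h ->.
case: l l' h' {h} => [c g] [c' g'] h'.
have c0 : c = c' by have := h' 0; rewrite /aff !dotv0r !addr0.
rewrite c0; congr pair; apply/rowP => i.
by have := h' (delta_mx ord0 i); rewrite /aff c0 !dotv_delta => /addrI.
Qed.

(** Both sides agree at all vertices. Every comparison across a facet rests on this: normals, jumps
    of gradients and gradients of functions vanishing on a facet are multiples of one barycentric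
    gradient. *)
Lemma aff_facet K a l : simplex K -> a \in K ->
  (forall b, b \in K -> b != a -> aff l b = 0) ->
  l.2 = aff l a *: bgrad K a /\ forall x, aff l x = aff l a * bary K a x.
Proof.
move=> sK aK h.
have lE : l = (aff l a * (bary_fun K a).1, aff l a *: bgrad K a).
  apply: (aff_inj sK) => b bK.
  rewrite {2}/aff /= dotvZl -mulrDr -/(aff (bary_fun K a) b) -/(bary K a b) bary_vertex//.
  have [->|ba] := eqVneq b a; first by rewrite mulr1.
  by rewrite (h b bK ba) mulr0.
split; first by rewrite {1}lE.
by move=> x; rewrite {1}lE {1}/aff /= dotvZl -mulrDr.
Qed.

Lemma bary_le1 K a x : simplex K -> a \in K -> hull K x -> bary K a x <= 1.
Proof.
move=> sK aK /(hullE _ sK) hx; rewrite -(bary_sum1 x sK) (big_fsetD1 a)//= lerDl.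
by rewrite big_seq sumr_ge0// => b; rewrite !inE => /andP[_]; exact: hx.
Qed.

Lemma bgrad_neq0 K a : (0 < d)%N -> simplex K -> a \in K -> bgrad K a != 0.
Proof.
move=> d0 sK aK; have [b /andP[ba bK]] : exists b, (b != a) && (b \in K).
  have : (0 < #|` (K `\ a)%fset|)%N.
    by have := cardfsD1 a K; rewrite aK sK.1 add1n => -[<-].
  by rewrite cardfs_gt0 => /fset0Pn[b]; rewrite !inE => bh; exists b.
apply/negP => /eqP g0.
have h1 := bary_vertex sK aK aK; have h2 := bary_vertex sK aK bK.
move: h1 h2; rewrite /bary /aff -/(bgrad K a) g0 !dotv0l => ->.
by rewrite eqxx eq_sym (negbTE ba) => /eqP; rewrite oner_eq0.
Qed.

(** The open simplex, written with coordinates so that openness and disjointness become statements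
    about signs. *)
Definition pos K : set Rd := [set x | forall a, a \in K -> 0 < bary K a x].

Lemma pos_hull K x : simplex K -> pos K x -> hull K x.
Proof. by move=> sK px; apply/hullE => // a /px /ltW. Qed.

Definition center K : Rd := \sum_(a <- K) d.+1%:R^-1 *: a.

Lemma bary_center K a : simplex K -> a \in K -> bary K a (center K) = d.+1%:R^-1.
Proof.
move=> sK aK; rewrite (@bary_hull_comb K (fun=> d.+1%:R^-1))//.
have sz : size K = d.+1 by rewrite -sK.1.
by rewrite big_const_seq count_predT iter_addr_0 sz -[LHS]mulr_natr mulVf// pnatr_eq0.
Qed.

Lemma pos_center K : simplex K -> pos K (center K).
Proof. by move=> sK a aK; rewrite bary_center// invr_gt0. Qed.

Lemma gradK_unique K v l : simplex K -> (forall x, hull K x -> v x = aff l x) ->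
  gradK K v = l.2.
Proof.
move=> sK h; rewrite /gradK; case: xgetP => [g _ [c hc]|/(_ l.2)[]]; last by exists l.1.
suff -> : l = (c, g) by [].
by apply: (aff_inj sK) => a aK; rewrite -h ?hc//; exact: hull_vertex.
Qed.

Lemma affine_onP K v : affine_on (hull K) v <-> exists l, forall x, hull K x -> v x = aff l x.
Proof.
split => [[g [c h]]|[[c g] h]]; first by exists (c, g).
by exists g, c.
Qed.

End barycentric.

(** * Conforming meshes *)

Section simplicial_meshes.
Context {R : realType} {d : nat}.
Local Notation Rd := 'rV[R]_d.
Variables (Om : set Rd) (Th : {fset {fset Rd}}).
Hypotheses (d0 : (0 < d)%N) (hTh : conforming_mesh Om Th).
Implicit Types (K F : {fset Rd}) (a b x y : Rd).

Let sK K : K \in Th -> simplex K.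
Proof. exact: (mesh_simplex hTh). Qed.

Lemma card_eq_sub K K' : K \in Th -> K' \in Th -> (K `<=` K')%fset -> K = K'.
Proof.
move=> /sK[cK _] /sK[cK' _] KK'; apply/eqP; rewrite eqEfcard KK' /=.
by rewrite cK cK'.
Qed.

(** Conformity puts x in the hull of the common vertices, where the coordinates of all other
    vertices of K vanish. *)
Lemma conforming_face K K' x a : K \in Th -> K' \in Th -> hull K x -> hull K' x ->
  a \in K -> 0 < bary K a x -> a \in K'.
Proof.
move=> KT K'T Kx K'x aK ax; apply: contraT => aK'.
have : hull (K `&` K')%fset x by rewrite -(mesh_conforming hTh KT K'T).
move=> /(hull_faceE _ (sK KT) (fsubsetIl _ _))[_ /(_ a aK)].
by rewrite !inE aK /= (negbTE aK') => /(_ isT) h; rewrite h ltxx in ax.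
Qed.

Lemma pos_uniq K K' x : K \in Th -> K' \in Th -> pos K x -> hull K' x -> K = K'.
Proof.
move=> KT K'T Kx K'x; apply: (card_eq_sub KT K'T); apply/fsubsetP => a aK.
by apply: (conforming_face KT K'T _ K'x aK (Kx a aK)); exact: pos_hull (sK KT) Kx.
Qed.

Lemma near_hull K x (v : Rd) : K \in Th -> ~ hull K x ->
  exists2 e : R, 0 < e & forall t, 0 < t -> t <= e -> ~ hull K (x + t *: v).
Proof.
move=> KT Kx.
have [a aK ax] : exists2 a, a \in K & bary K a x < 0.
  apply: contrapT => h; apply: Kx; apply/hullE; first exact: sK.
  by move=> a aK; rewrite leNgt; apply/negP => ax; apply: h; exists a.
pose l := bary_fun K a.
have /(aff_small_pos v)[e e0 h] : 0 < aff (- l.1, - l.2) x.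
  by rewrite /aff /= dotvNl -opprD oppr_gt0.
exists e => // t t0 te /(hullE _ (sK KT))/(_ a aK); apply/negP; rewrite -ltNge.
by have := h t t0 te; rewrite /aff /= dotvNl -opprD oppr_gt0.
Qed.

(** Simplices are closed and finite in number, so a short move away from x enters none that misses
    x. *)
Lemma near_simplices x (v : Rd) :
  exists2 e : R, 0 < e & forall t, 0 < t -> t <= e ->
    forall K, K \in Th -> hull K (x + t *: v) -> hull K x.
Proof.
have [|e /andP[e0 _] h] := @small_all R _ Th (fun K t => K \in Th -> hull K (x + t *: v) -> hull K x).
  move=> K KT; have [Kx|Kx] := pselect (hull K x); first by exists 1.
  by have [e e0 h] := near_hull v KT Kx; exists e => // t t0 te _ /(h t t0 te).
by exists e => // t t0 te K KT; exact: h.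
Qed.

Lemma hull_closure K x : K \in Th -> hull K x -> closure Om x.
Proof. by move=> KT Kx; rewrite -(mesh_cover hTh); exists K. Qed.

Lemma closure_hull x : closure Om x -> exists2 K, K \in Th & hull K x.
Proof. by rewrite -(mesh_cover hTh). Qed.

(* Facets of K are denoted by the opposite vertex. *)
Definition relint K a : set Rd :=
  [set x | bary K a x = 0 /\ forall b, b \in K -> b != a -> 0 < bary K b x].

Lemma relint_hull K a x : K \in Th -> relint K a x -> hull K x.
Proof.
move=> KT [ax h]; apply/hullE; first exact: sK.
by move=> b bK; have [->|/(h b bK)/ltW//] := eqVneq b a; rewrite ax.
Qed.

Lemma facet_sub K K' a x : K \in Th -> K' \in Th -> relint K a x -> hull K' x ->
  (K `\ a `<=` K')%fset.
Proof.
move=> KT K'T Kx K'x; apply/fsubsetP => b; rewrite !inE => /andP[ba bK].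
by apply: (conforming_face KT K'T (relint_hull KT Kx) K'x bK); exact: Kx.2.
Qed.

(** If the remaining vertex a' of K' were strictly on the side of a, a short move from the centre of
    the facet towards a' would reach a point of K' interior to K. If it were in the plane of the
    facet, the coordinate of a would vanish on all of K', hence everywhere. *)
Lemma opposite_side K K' a : K \in Th -> K' \in Th -> a \in K -> K != K' ->
  (K `\ a `<=` K')%fset -> exists a', [/\ a' \in K', K' = (a' |` (K `\ a))%fset & bary K a a' < 0].
Proof.
move=> KT K'T aK KK' sub.
have cF : #|` (K `\ a)%fset| = d.
  by have := cardfsD1 a K; rewrite aK (sK KT).1 add1n => -[<-].
have : (0 < #|` (K' `\` (K `\ a))%fset|)%N.
  have := cardfsID (K `\ a)%fset K'; rewrite (fsetIidPr sub) cF (sK K'T).1 => h.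
  by rewrite -(ltn_add2l d) addn0 h.
rewrite cardfs_gt0 => /fset0Pn[a']; rewrite 3!inE => /andP[a'F a'K'].
have K'E : K' = (a' |` (K `\ a))%fset.
  apply/esym/eqP; rewrite eqEfcard fsubUset fsub1set a'K' sub /=.
  have -> : #|` (a' |` (K `\ a))%fset| = d.+1 by rewrite cardfsU1 !inE a'F cF.
  by rewrite (sK K'T).1.
have aa' : a' \notin K.
  apply/negP => a'K; move: a'F; rewrite a'K andbT negbK => /eqP a'a.
  move/eqP : KK'; apply; apply: (card_eq_sub KT K'T).
  by apply/fsubsetP => b bK; rewrite K'E !inE a'a bK andbT orbN.
exists a'; split => //; rewrite ltNge; apply/negP => h.
have [z|z] := eqVneq (bary K a a') 0.
  have : aff (bary_fun K a) = aff (0, 0 : Rd).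
    suff -> : bary_fun K a = (0, 0) by [].
    apply: (aff_inj (sK K'T)) => b; rewrite [aff (0, 0) b]/aff dotv0l addr0 K'E !inE.
    move=> /orP[/eqP -> //|/andP[ba bK]].
    exact: (bary_vertex0 (sK KT) aK bK ba).
  move=> /(congr1 (fun f => f a)); rewrite -/(bary K a a) (bary_vertex1 (sK KT) aK) /aff dotv0l addr0.
  by move/eqP; rewrite oner_eq0.
have {}h : 0 < bary K a a' by rewrite lt_def z h.
pose x : Rd := \sum_(b <- (K `\ a)%fset) d%:R^-1 *: b.
have Fx : hull (K `\ a)%fset x.
  exists (fun=> d%:R^-1); split => //.
  have sz : size (K `\ a)%fset = d by rewrite -[RHS]cF.
  by rewrite big_const_seq count_predT iter_addr_0 sz -[LHS]mulr_natr mulVf// pnatr_eq0 -lt0n.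
have [Kx xa] := (hull_faceE x (sK KT) (fsubsetDl _ _)).1 Fx.
have xb b : b \in K -> b != a -> 0 < bary K b x.
  move=> bK ba; pose w c : R := if c == a then 0 else d%:R^-1.
  have xE : x = \sum_(c <- K) w c *: c.
    rewrite [RHS](big_fsetD1 a)//= /w eqxx scale0r add0r /x big_seq [RHS]big_seq.
    by apply: eq_bigr => c; rewrite !inE => /andP[/negbTE ->].
  have w1 : \sum_(c <- K) w c = 1.
    rewrite (big_fsetD1 a)//= {1}/w eqxx add0r big_seq.
    have sz : size (K `\ a)%fset = d by rewrite -[RHS]cF.
    rewrite (eq_bigr (fun=> d%:R^-1)); last by move=> c; rewrite /w !inE => /andP[/negbTE ->].
    by rewrite -big_seq big_const_seq count_predT iter_addr_0 sz -[LHS]mulr_natr mulVf// pnatr_eq0 -lt0n.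
  by rewrite xE (bary_hull_comb (sK KT) w1)// /w (negbTE ba) invr_gt0 ltr0n.
have xa0 : bary K a x = 0 by apply: xa => //; rewrite !inE eqxx.
have [|e /andP[e0 e1] he] := @small_all R _ K (fun b t => 0 < bary K b (x + t *: (a' - x))).
  move=> b bK; have [->|ba] := eqVneq b a.
    exists 1 => // t t0 _; rewrite /bary aff_line -affB -!/(bary _ _ _) xa0 subr0 add0r.
    exact: mulr_gt0.
  by apply: aff_small_pos; exact: xb.
have K'y : hull K' (x + e *: (a' - x)).
  have FK' : hull K' x.
    by have [] := (hull_faceE x (sK K'T) sub).1 Fx.
  apply/hullE; first exact: sK.
  move=> b bK'; rewrite /bary aff_line -affB -!/(bary _ _ _).
  have := (hullE x (sK K'T)).1 FK' b bK'.
  have : 0 <= bary K' b a' by rewrite (bary_vertex (sK K'T))// ler0n.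
  move: (bary K' b a') (bary K' b x) => s t s0 t0.
  have -> : t + e * (s - t) = (1 - e) * t + e * s by ring.
  by rewrite addr_ge0// mulr_ge0 ?subr_ge0// ltW.
move/eqP : KK'; apply; apply: (pos_uniq KT K'T _ K'y) => b bK.
by apply: he => //; exact: lexx.
Qed.

Definition nbrs F := [fset K in Th | (F `<=` K)%fset]%fset.

Lemma nbrsE F K : (K \in nbrs F) = (K \in Th) && (F `<=` K)%fset.
Proof. by rewrite !inE. Qed.

(** Two further simplices K1 and K2 on the facet would have their free vertices a1 and a2 both
    opposite to a. But K1 and K2 are also opposite to each other, so that the coordinate of a at a2
    would be a product of two negative numbers. *)
Lemma at_most_two K K1 K2 a : K \in Th -> a \in K ->
  K1 \in nbrs (K `\ a)%fset -> K2 \in nbrs (K `\ a)%fset -> K1 != K -> K2 != K -> K1 = K2.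
Proof.
rewrite !nbrsE => KT aK /andP[K1T s1] /andP[K2T s2] n1 n2.
apply/eqP/negPn/negP => n12.
rewrite eq_sym in n1; rewrite eq_sym in n2.
have [a1 [a1K K1E b1]] := opposite_side KT K1T aK n1 s1.
have [a2 [a2K K2E b2]] := opposite_side KT K2T aK n2 s2.
have nF : a1 \notin (K `\ a)%fset.
  apply/negP; rewrite !inE => /andP[h1 h2]; move: b1.
  by rewrite (bary_vertex0 (sK KT) aK h2 h1) ltxx.
have F1 : (K1 `\ a1)%fset = (K `\ a)%fset.
  apply/fsetP => b; rewrite K1E 2!inE in_fset1U; have [->|ba] := eqVneq b a1 => //=.
  by rewrite (negbTE nF).
have [|a3 [a3K K2E' b3]] := opposite_side K1T K2T a1K n12; first by rewrite F1.
have a23 : a3 = a2.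
  rewrite K2E' F1 in a2K.
  move: a2K; rewrite in_fset1U => /orP[/eqP//|].
  rewrite !inE => /andP[h1 h2]; move: b2.
  by rewrite (bary_vertex0 (sK KT) aK h2 h1) ltxx.
have hE y : (forall b, b \in K1 -> b != a1 -> aff (bary_fun K a) b = 0) ->
    bary K a y = bary K a a1 * bary K1 a1 y.
  by move=> h; exact: (aff_facet (sK K1T) a1K h).2.
have : bary K a a2 = bary K a a1 * bary K1 a1 a2.
  apply: hE => b bK1 ba1.
  have : b \in (K1 `\ a1)%fset by rewrite !inE ba1.
  rewrite F1 !inE => /andP[h1 h2].
  exact: (bary_vertex0 (sK KT) aK h2 h1).
move=> h; have : 0 < bary K a a1 * bary K1 a1 a2 by rewrite nmulr_rgt0// -a23.
by rewrite -h ltNge (ltW b2).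
Qed.

Lemma facet_card K a : K \in Th -> a \in K -> #|` (K `\ a)%fset| = d.
Proof. by move=> KT aK; have := cardfsD1 a K; rewrite aK (sK KT).1 add1n => -[<-]. Qed.

Lemma interior_faceP K a : K \in Th -> a \in K ->
  interior_face Th (K `\ a)%fset <->
  exists K', [/\ K' \in Th, K' != K & (K `\ a `<=` K')%fset].
Proof.
move=> KT aK; rewrite /interior_face facet_card// eqxx /= -/(nbrs _).
have Kn : K \in nbrs (K `\ a)%fset by rewrite nbrsE KT fsubsetDl.
split => [/eqP c2|[K' [K'T n s]]].
  have : (0 < #|` (nbrs (K `\ a)%fset `\ K)%fset|)%N.
    by have := cardfsD1 K (nbrs (K `\ a)%fset); rewrite Kn c2 add1n => -[<-].
  rewrite cardfs_gt0 => /fset0Pn[K']; rewrite inE in_fset1 nbrsE => /andP[n /andP[KT' s]].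
  by exists K'.
have -> : nbrs (K `\ a)%fset = [fset K; K']%fset.
  apply/fsetP => K2; rewrite !in_fset2; apply/idP/orP => [h|[/eqP -> //|/eqP ->]].
    have [->|n2] := eqVneq K2 K; first by left.
    by right; apply/eqP; apply: (at_most_two KT aK h _ n2 n); rewrite nbrsE K'T.
  by rewrite nbrsE K'T.
by rewrite cardfs2 (eq_sym K) n.
Qed.

(** Crossing the facet outwards from x, one remains in Om for a while, hence in some simplex of the
    mesh. It contains x, therefore the whole facet, and it is not K because the coordinate of a is
    negative there. *)
Lemma relint_Om_interior K a x : K \in Th -> a \in K -> open Om -> relint K a x -> Om x ->
  interior_face Th (K `\ a)%fset.
Proof.
move=> KT aK oO Kx Ox; apply/interior_faceP => //.
have [r r0 xr] : exists2 r : R, 0 < r & forall y, enorm (y - x) < r -> Om y.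
  by apply: enorm_nbhs; apply: open_nbhs_nbhs.
pose v : Rd := - bgrad K a.
have [e e0 he] := near_simplices x v.
have v0 : 0 < enorm v by rewrite enormN enorm_gt0 (bgrad_neq0 d0 (sK KT)).
pose t := Num.min e (r / 2 / enorm v).
have t0 : 0 < t by rewrite lt_min e0 !divr_gt0.
have Oy : Om (x + t *: v).
  apply: xr; rewrite addrC addKr enormZ gtr0_norm//.
  apply: (@le_lt_trans _ _ (r / 2 / enorm v * enorm v)).
    by rewrite ler_wpM2r ?(ltW v0)// ge_min lexx orbT.
  by rewrite divfK ?gt_eqF//; lra.
have [K' K'T K'y] := closure_hull (subset_closure Oy).
have te : t <= e by rewrite ge_min lexx.
have K'x := he t t0 te K' K'T K'y.
exists K'; split => //; last exact: facet_sub KT K'T Kx K'x.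
apply/negP => /eqP K'K; rewrite K'K in K'y.
have := (hullE _ (sK KT)).1 K'y a aK; apply/negP; rewrite -ltNge.
rewrite /bary aff_line -/(bary K a x) Kx.1 add0r pmulr_rlt0// -/(bgrad K a) dotvNr oppr_lt0.
by rewrite lt_def dotv_eq0 dotv_ge0 andbT (bgrad_neq0 d0 (sK KT)).
Qed.

Definition facet_center K a : Rd := \sum_(b <- (K `\ a)%fset) d%:R^-1 *: b.

Lemma facet_centerP K a : K \in Th -> a \in K -> relint K a (facet_center K a).
Proof.
move=> KT aK; pose w c : R := if c == a then 0 else d%:R^-1.
have xE : facet_center K a = \sum_(c <- K) w c *: c.
  rewrite [RHS](big_fsetD1 a)//= /w eqxx scale0r add0r /facet_center big_seq [RHS]big_seq.
  by apply: eq_bigr => c; rewrite !inE => /andP[/negbTE ->].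
have w1 : \sum_(c <- K) w c = 1.
  rewrite (big_fsetD1 a)//= {1}/w eqxx add0r big_seq.
  have sz : size (K `\ a)%fset = d by rewrite -[RHS](facet_card KT aK).
  rewrite (eq_bigr (fun=> d%:R^-1)); last by move=> c; rewrite /w !inE => /andP[/negbTE ->].
  by rewrite -big_seq big_const_seq count_predT iter_addr_0 sz -[LHS]mulr_natr mulVf// pnatr_eq0 -lt0n.
split; first by rewrite xE (bary_hull_comb (sK KT) w1)// /w eqxx.
by move=> b bK ba; rewrite xE (bary_hull_comb (sK KT) w1)// /w (negbTE ba) invr_gt0 ltr0n.
Qed.

Lemma relint_segment K a b x (t : R) : K \in Th -> a \in K -> b \in K -> b != a -> relint K a x ->
  0 < t -> t < 1 -> relint K a (x + t *: (b - x)).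
Proof.
move=> KT aK bK ba [xa xp] t0 t1; split=> [|c cK ca].
  rewrite /bary aff_line -affB -!/(bary _ _ _) xa.
  by rewrite (bary_vertex0 (sK KT) aK bK ba) subr0 mulr0 addr0.
rewrite /bary aff_line -affB -!/(bary _ _ _).
have := xp c cK ca; have : 0 <= bary K c b by rewrite (bary_vertex (sK KT))// ler0n.
move: (bary K c b) (bary K c x) => s u s0 u0.
have -> : u + t * (s - u) = (1 - t) * u + t * s by ring.
by apply: ltr_pwDl; [apply: mulr_gt0 => //; rewrite subr_gt0|apply: mulr_ge0 => //; exact: ltW].
Qed.

(** The segment from the centre of the facet to its vertex b consists of relative interior points
    before b, and those close to b lie in Om. *)
Lemma vertex_Om_interior K a b : K \in Th -> a \in K -> b \in K -> b != a -> open Om -> Om b ->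
  interior_face Th (K `\ a)%fset.
Proof.
move=> KT aK bK ba oO Ob.
have [r r0 xr] : exists2 r : R, 0 < r & forall y, enorm (y - b) < r -> Om y.
  by apply: enorm_nbhs; apply: open_nbhs_nbhs.
have hx := facet_centerP KT aK; set x := facet_center K a in hx.
have [e e0 he] : exists2 e : R, 0 < e & forall t, 0 < t -> t <= e -> t * enorm (x - b) < r.
  have [e e0 h] := small_pos (- enorm (x - b)) r0; exists e => // t t0 te.
  by have := h t t0 te; lra.
pose t := Num.min e (1/2).
have t0 : 0 < t by rewrite lt_min e0 /=; lra.
have t1 : t < 1 by rewrite gt_min; apply/orP; right; lra.
apply: (relint_Om_interior KT aK oO (x := x + (1 - t) *: (b - x))).
  by apply: relint_segment => //; lra.
apply: xr; rewrite (_ : _ - b = t *: (x - b)); last first.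
  by apply/rowP => i; rewrite !mxE; ring.
by rewrite enormZ gtr0_norm// he// ge_min lexx.
Qed.

(** Near x the coordinates of the common vertices are positive in both simplices, so only the sign
    of the coordinate of a matters; it decides between K and K', the free vertices being on opposite
    sides. *)
Lemma two_sides K K' a x : K \in Th -> K' \in Th -> a \in K -> K != K' ->
  (K `\ a `<=` K')%fset -> relint K a x ->
  exists2 r : R, 0 < r & forall y, enorm (y - x) < r -> hull K y \/ hull K' y.
Proof.
move=> KT K'T aK KK' sub Kx.
have [a' [a'K' K'E b']] := opposite_side KT K'T aK KK' sub.
have cb K1 b : {for x, continuous (bary K1 b)} by exact: continuous_aff.
have rad K1 b : 0 < bary K1 b x ->
    exists2 r : R, 0 < r & forall y, enorm (y - x) < r -> 0 < bary K1 b y.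
  move=> b0; have /continuous_enormP/(_ _ b0)[r r0 h] := cb K1 b; exists r => // y /h.
  by rewrite ltr_norml => /andP[h1 _]; lra.
have a'F : a' \notin (K `\ a)%fset.
  apply/negP; rewrite !inE => /andP[h1 h2]; move: b'.
  by rewrite (bary_vertex0 (sK KT) aK h2 h1) ltxx.
have K'x : hull K' x.
  have : hull (K `\ a)%fset x.
    apply/(hull_faceE x (sK KT) (fsubsetDl _ _)); split; first exact: relint_hull Kx.
    move=> b bK; rewrite !inE bK andbT negbK => /eqP ->; exact: Kx.1.
  by move=> /(hull_faceE x (sK K'T) sub)[].
have K'b b : b \in (K `\ a)%fset -> 0 < bary K' b x.
  move=> bF; rewrite lt_def (hullE x (sK K'T)).1 ?(fsubsetP sub)// andbT.
  apply/negP => /eqP b0.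
  have [_ xE] : hull K x /\ forall c, c \in K -> c \notin (K `\ a)%fset -> bary K c x = 0.
    split; first exact: relint_hull Kx.
    by move=> c cK; rewrite !inE cK andbT negbK => /eqP ->; exact: Kx.1.
  have bK : b \in K by move: bF; rewrite !inE => /andP[].
  have ba : b != a by move: bF; rewrite !inE => /andP[].
  have hI : hull (K' `\ b)%fset x.
    apply/(hull_faceE x (sK K'T) (fsubsetDl _ _)); split => // c cK'.
    by rewrite !inE cK' andbT negbK => /eqP ->.
  have bK' : b \in K' by apply: (fsubsetP sub).
  (* compare the coordinate of K at b with the combination of the vertices of K' *)
  have xc := bary_comb x (sK K'T).
  have e1 : bary K b x = \sum_(c <- K') bary K' c x * bary K b c.
    by rewrite -(aff_bary (bary_fun K b) x (sK K'T)).
  have e2 : bary K a x = \sum_(c <- K') bary K' c x * bary K a c.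
    by rewrite -(aff_bary (bary_fun K a) x (sK K'T)).
  have K'D : (K' `\ a')%fset = (K `\ a)%fset.
    apply/fsetP => c; rewrite K'E 2!inE in_fset1U; have [->|ca] := eqVneq c a' => //=.
    by rewrite (negbTE a'F).
  have a'0 : bary K' a' x = 0.
    move: e2; rewrite Kx.1 (big_fsetD1 a')//= K'D big_seq big1 ?addr0.
      by move/esym/eqP; rewrite mulf_eq0 (lt_eqF b') orbF => /eqP.
    move=> c; rewrite !inE => /andP[ca cK].
    by rewrite (bary_vertex0 (sK KT) aK cK ca) mulr0.
  move: (Kx.2 b bK ba); rewrite e1 (big_fsetD1 a')//= K'D a'0 mul0r add0r.
  rewrite (big_fsetD1 b)//= b0 mul0r add0r big_seq big1 ?ltxx// => c.
  rewrite !inE => /andP[cb' /andP[_ cK]].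
  by rewrite (bary_vertex0 (sK KT) bK cK cb') mulr0.
have radall K1 (s : seq Rd) : (forall b, b \in s -> 0 < bary K1 b x) ->
    exists2 r : R, 0 < r & forall y, enorm (y - x) < r -> forall b, b \in s -> 0 < bary K1 b y.
  elim: s => [_|b s IH h]; first by exists 1.
  have [|r r0 hr] := IH; first by move=> c cs; apply: h; rewrite inE cs orbT.
  have [r' r'0 hr'] := rad K1 b (h b (mem_head _ _)).
  exists (Num.min r r'); first by rewrite lt_min r0.
  move=> y; rewrite lt_min => /andP[y1 y2] c; rewrite inE => /orP[/eqP ->|]; first exact: hr'.
  exact: hr.
have [r r0 hr] := radall K (K `\ a)%fset (fun b bF => Kx.2 b (fsubsetP (fsubsetDl _ _) b bF)
  (ltac:(by move: bF; rewrite !inE => /andP[]))).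
have [r' r'0 hr'] := radall K' (K `\ a)%fset K'b.
exists (Num.min r r'); first by rewrite lt_min r0.
move=> y; rewrite lt_min => /andP[y1 y2].
have [ya|ya] := leP 0 (bary K a y).
  left; apply/hullE; first exact: sK.
  move=> b bK; have [->//|ba] := eqVneq b a.
  by rewrite ltW// hr// !inE ba.
right; apply/hullE; first exact: sK.
move=> b; rewrite {1}K'E in_fset1U => /orP[/eqP ->|bF]; last by rewrite ltW// hr'.
have h : bary K a y = bary K a a' * bary K' a' y.
  apply: (aff_facet (sK K'T) a'K' _).2 => c cK' ca'.
  have : c \in (K' `\ a')%fset by rewrite !inE ca'.
  rewrite K'E !inE => /andP[_ /orP[/eqP ca''|/andP[ca cK]]]; first by rewrite ca'' eqxx in ca'.
  exact: (bary_vertex0 (sK KT) aK cK ca).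
by rewrite h nmulr_rlt0// in ya; exact: ltW.
Qed.

End simplicial_meshes.

(** * Lipschitz boundaries and the simplices around a vertex *)

Lemma convex_gt0 (R : realDomainType) (t u s : R) : 0 <= t -> t <= 1 -> 0 < u -> 0 < s ->
  0 < u + t * (s - u).
Proof.
move=> t0 t1 u0 s0; have -> : u + t * (s - u) = (1 - t) * u + t * s by ring.
have [->|tn] := eqVneq t 0; first by rewrite subr0 mul1r mul0r addr0.
apply: ltr_wpDl; first by rewrite mulr_ge0 ?subr_ge0// ltW.
by rewrite mulr_gt0// lt_def tn.
Qed.

Section finite_radii.
Context {R : realType} {d : nat}.
Local Notation Rd := 'rV[R]_d.

Lemma near_all (I : eqType) (s : seq I) (x : Rd) (Q : I -> Rd -> Prop) :
  (forall i, i \in s -> exists2 r : R, 0 < r & forall y, enorm (y - x) < r -> Q i y) ->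
  exists2 r : R, 0 < r & forall y, enorm (y - x) < r -> forall i, i \in s -> Q i y.
Proof.
elim: s => [_|i s IH h]; first by exists 1.
have [|r r0 hr] := IH; first by move=> j js; apply: h; rewrite inE js orbT.
have [r' r'0 hr'] := h i (mem_head _ _).
exists (Num.min r r'); first by rewrite lt_min r0.
move=> y; rewrite lt_min => /andP[y1 y2] j; rewrite inE => /orP[/eqP ->|js].
  exact: hr'.
exact: hr.
Qed.

Lemma aff_pos_near (l : R * Rd) x : 0 < aff l x ->
  exists2 r : R, 0 < r & forall y, enorm (y - x) < r -> 0 < aff l y.
Proof.
move=> l0; have /continuous_enormP/(_ _ l0)[r r0 h] := @continuous_aff _ _ l x.
by exists r => // y /h; rewrite ltr_norml => /andP[h1 _]; lra.
Qed.

Lemma pos_near (K : {fset Rd}) x : pos K x ->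
  exists2 r : R, 0 < r & forall y, enorm (y - x) < r -> pos K y.
Proof.
move=> Kx; apply: (@near_all _ K x (fun a y => 0 < bary K a y)) => a aK.
exact: aff_pos_near (Kx a aK).
Qed.

Lemma not_hull_near (K : {fset Rd}) x : simplex K -> ~ hull K x ->
  exists2 r : R, 0 < r & forall y, enorm (y - x) < r -> ~ hull K y.
Proof.
move=> sK Kx.
have [a aK ax] : exists2 a, a \in K & bary K a x < 0.
  apply: contrapT => h; apply: Kx; apply/hullE => // a aK.
  by rewrite leNgt; apply/negP => ax; apply: h; exists a.
pose l := bary_fun K a.
have E y : aff (- l.1, - l.2) y = - bary K a y by rewrite /aff /= dotvNl -opprD.
have [|r r0 h] := @aff_pos_near (- l.1, - l.2) x; first by rewrite E oppr_gt0.
exists r => // y /h; rewrite E oppr_gt0 => y0 /(hullE _ sK)/(_ a aK).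
by rewrite leNgt y0.
Qed.

Lemma aff_neq0_near (P : set Rd) (l : R * Rd) x (r : R) : 0 < r ->
  (forall y, enorm (y - x) < r -> P y) -> l.2 != 0 -> exists2 y, P y & aff l y != 0.
Proof.
move=> r0 xP l0; have [lx|lx] := eqVneq (aff l x) 0; last first.
  by exists x => //; apply: xP; rewrite subrr enorm0.
have g0 : 0 < enorm l.2 by rewrite enorm_gt0.
exists (x + (r / 2 / enorm l.2) *: l.2).
  apply: xP; rewrite addrC addKr enormZ gtr0_norm ?divr_gt0// divfK ?gt_eqF//.
  by lra.
by rewrite aff_line lx add0r mulf_neq0 ?dotv_eq0// gt_eqF// !divr_gt0.
Qed.

End finite_radii.

Section lipschitz_boundaries.
Context {R : realType}.

Lemma dotv_mx n (x y : 'rV[R]_n) : dotv x y = (x *m y^T) ord0 ord0.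
Proof. by rewrite mxE; apply: eq_bigr => i _; rewrite mxE. Qed.

Lemma enorm_orthogonal n (Q : 'M[R]_n) (x : 'rV[R]_n) : Q *m Q^T = 1%:M ->
  enorm (x *m Q) = enorm x.
Proof.
by move=> QQ; rewrite /enorm !dotv_mx trmx_mul mulmxA -(mulmxA x) QQ mulmx1.
Qed.

Lemma ler_enorm_col' n (i : 'I_n) (x : 'rV[R]_n) : enorm (col' i x) <= enorm x.
Proof.
rewrite -ler_sqr ?nnegrE ?enorm_ge0// !sqr_enorm /dotv [leRHS](bigD1_ord i)//=.
rewrite (eq_bigr (fun j => x ord0 (lift i j) * x ord0 (lift i j))).
  by rewrite lerDr -expr2 sqr_ge0.
by move=> j _; rewrite !mxE.
Qed.

(** Going down from x by s along the axis of the graph gives a point y at depth at least s below it.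
    A ball around y of radius at most s / (|L| + 1) stays under the graph, so y is not in the
    closure. *)
Lemma lipschitz_exterior n (Om : set 'rV[R]_n) x (e : R) : lipschitz_domain Om ->
  closure Om x -> ~ Om x -> 0 < e -> exists2 y, enorm (y - x) < e & ~ closure Om y.
Proof.
move=> [_ _ _ lO] cx Ox e0; have [Q [i [gam [L [r [QQ r0 gL OE]]]]]] := lO x cx Ox.
pose v : 'rV[R]_n := delta_mx ord0 i *m Q^T.
have vQ : v *m Q = delta_mx ord0 i by rewrite /v -mulmxA (mulmx1C QQ) mulmx1.
have v1 : 0 < enorm v + 1 by rewrite ltr_wpDl// enorm_ge0.
have [s s0 [se sr]] : exists2 s : R, 0 < s & s * enorm v < e /\ s * enorm v < r / 2.
  exists (Num.min e (r / 2) / (enorm v + 1)).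
    by rewrite divr_gt0// lt_min e0 divr_gt0.
  have h : Num.min e (r / 2) / (enorm v + 1) * enorm v < Num.min e (r / 2).
    rewrite mulrAC ltr_pdivrMr// ltr_pM2l ?ltrDl// lt_min e0 divr_gt0//.
  by split; apply: lt_le_trans h _; rewrite ge_min lexx ?orbT.
pose y := x - s *: v.
have yx : enorm (y - x) = s * enorm v.
  by rewrite /y addrC addKr enormN enormZ gtr0_norm.
exists y; first by rewrite yx.
have yQ : y *m Q = x *m Q - s *: delta_mx ord0 i by rewrite mulmxBl -scalemxAl vQ.
have cy : col' i (y *m Q) = col' i (x *m Q).
  apply/rowP => j; rewrite yQ !mxE eqxx /= eq_sym (negbTE (neq_lift _ _)).
  by rewrite mulr0 subr0.
have xO : (x *m Q) ord0 i <= gam (col' i (x *m Q)).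
  rewrite leNgt; apply/negP => h; apply: Ox; apply/OE => //.
  by rewrite subrr enorm0.
have yO : (y *m Q) ord0 i <= gam (col' i (y *m Q)) - s.
  by rewrite cy yQ; move: (x *m Q) xO => w wO; rewrite !mxE !eqxx mulr1 lerD2r.
clearbody y.
have L1 : 0 < `|L| + 1 by rewrite ltr_wpDl.
pose rho := Num.min (r / 2) (s / (`|L| + 1)).
have rho0 : 0 < rho by rewrite lt_min !divr_gt0.
move=> /(_ [set z | enorm (z - y) < rho])[|z [Oz /= zy]].
  exact: (nbhs_enorm rho0).
have zr : enorm (z - x) < r.
  have -> : z - x = (z - y) + (y - x) by rewrite addrA subrK.
  apply: le_lt_trans (ler_enormD _ _) _; rewrite yx.
  have : enorm (z - y) < r / 2 by apply: lt_le_trans zy _; rewrite ge_min lexx.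
  lra.
move/(OE z zr) : Oz; apply/negP; rewrite -leNgt.
have zs : enorm (z - y) * (`|L| + 1) < s.
  by rewrite -ltr_pdivlMr//; apply: lt_le_trans zy _; rewrite ge_min lexx orbT.
have h1 : (z *m Q) ord0 i - (y *m Q) ord0 i <= enorm (z - y).
  apply: le_trans (ler_norm _) _; rewrite -(enorm_orthogonal (z - y) QQ) mulmxBl.
  have := ler_coord_enorm (z *m Q - y *m Q) i.
  by move: (z *m Q) (y *m Q) => w w'; rewrite !mxE.
have h2 : gam (col' i (y *m Q)) - gam (col' i (z *m Q)) <= `|L| * enorm (z - y).
  apply: le_trans (ler_norm _) (le_trans (gL _ _) _).
  apply: (@le_trans _ _ (`|L| * enorm (col' i (y *m Q) - col' i (z *m Q)))).
    by rewrite ler_wpM2r ?enorm_ge0// ler_norm.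
  rewrite ler_wpM2l// [leLHS]enormB -(enorm_orthogonal (z - y) QQ) mulmxBl.
  have -> : col' i (z *m Q) - col' i (y *m Q) = col' i (z *m Q - y *m Q).
    by apply/rowP => j; rewrite !mxE.
  exact: ler_enorm_col'.
lra.
Qed.

(** A Lipschitz domain is the interior of its closure. Since a mesh covers the closure only, this is
    how points surrounded by simplices are recognized as points of Om. *)
Lemma interior_closure n (Om : set 'rV[R]_n) x (e : R) : lipschitz_domain Om -> 0 < e ->
  (forall y, enorm (y - x) < e -> closure Om y) -> Om x.
Proof.
move=> lO e0 h; apply: contrapT => Ox.
have cx : closure Om x by apply: h; rewrite subrr enorm0.
by have [y /h] := lipschitz_exterior lO cx Ox e0.
Qed.

End lipschitz_boundaries.

(** * Chains of simplices through facets *)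

Section mesh_connectivity.
Context {R : realType} {d : nat}.
Local Notation Rd := 'rV[R]_d.
Variables (Om : set Rd) (Th : {fset {fset Rd}}).
Hypotheses (d0 : (0 < d)%N) (hOm : lipschitz_domain Om) (hTh : conforming_mesh Om Th).
Implicit Types (K F : {fset Rd}) (a b x y z : Rd).

Let sK K : K \in Th -> simplex K.
Proof. exact: (mesh_simplex hTh). Qed.

Let oO : open Om.
Proof. by case: hOm. Qed.

Lemma pos_Om K x : K \in Th -> pos K x -> Om x.
Proof.
move=> KT /pos_near[r r0 h]; apply: (interior_closure hOm r0) => y /h Ky.
apply: (hull_closure hTh KT); exact: pos_hull (sK KT) Ky.
Qed.

Lemma interior_relint_Om K a x : K \in Th -> a \in K -> interior_face Th (K `\ a)%fset ->
  relint K a x -> Om x.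
Proof.
move=> KT aK /(interior_faceP d0 hTh KT aK)[K' [K'T n s]] Kx.
rewrite eq_sym in n.
have [r r0 h] := two_sides d0 hTh KT K'T aK n s Kx.
apply: (interior_closure hOm r0) => y /h[]; exact: (hull_closure hTh).
Qed.

Lemma hull_vertex_mem K K' a : K \in Th -> K' \in Th -> a \in K -> hull K' a -> a \in K'.
Proof.
move=> KT K'T aK K'a; apply: (conforming_face hTh KT K'T _ K'a aK).
  by apply: hull_vertex (sK KT) aK.
by rewrite (bary_vertex1 (sK KT)).
Qed.

(* b != a makes the common facet contain a. *)
Definition adj a : rel {fset Rd} := fun K K' =>
  [&& K' \in Th, K' != K & has (fun b => (b != a) && (K `\ b `<=` K')%fset) K].

Definition reach a K K' := exists2 p, path (adj a) K p & last K p = K'.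

Lemma reach_refl a K : reach a K K.
Proof. by exists [::]. Qed.

Lemma reach_step a K K' K'' : reach a K K' -> adj a K' K'' -> reach a K K''.
Proof.
move=> [p pp lp] h; exists (rcons p K''); last by rewrite last_rcons.
by rewrite rcons_path pp lp.
Qed.

Lemma adj_mem a K K' : a \in K -> adj a K K' -> K' \in Th /\ a \in K'.
Proof.
move=> aK /and3P[K'T _ /hasP[b bK /andP[ba s]]]; split => //.
by apply: (fsubsetP s); rewrite !inE eq_sym ba.
Qed.

Lemma reach_mem a K K' : K \in Th -> a \in K -> reach a K K' -> K' \in Th /\ a \in K'.
Proof.
move=> KT aK [p]; elim: p K KT aK => [|K1 p IH] K KT aK /=; first by move=> _ <-.
move=> /andP[h pp]; have [K1T aK1] := adj_mem aK h.
exact: IH.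
Qed.

(* Generic segments starting near a meet no face of codimension two. *)
Lemma walk a K0 : K0 \in Th -> a \in K0 ->
  (forall K b, reach a K0 K -> b \in K -> b != a -> interior_face Th (K `\ b)%fset) ->
  exists2 r : R, 0 < r & forall y, enorm (y - a) < r -> exists2 K, reach a K0 K & hull K y.
Proof.
move=> K0T aK0 hint.
(* In this ball only simplices with vertex a are met, and there the coordinate of a is positive; so
   the facet opposite to a is never crossed. *)
have [r r0 hr] : exists2 r : R, 0 < r & forall y, enorm (y - a) < r -> forall K, K \in Th ->
    (hull K y -> a \in K) /\ (a \in K -> 0 < bary K a y).
  apply: near_all => K KT; have [aK|aK] := boolP (a \in K).
    have [|r r0 h] := @aff_pos_near _ _ (bary_fun K a) a.
      by rewrite -/(bary K a a) (bary_vertex1 (sK KT)).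
    by exists r => // y /h ya; split.
  have [|r r0 h] := not_hull_near (sK KT) (x := a).
    by move=> /(hull_vertex_mem K0T KT aK0); rewrite (negbTE aK).
  by exists r => // y /h Ky; split => // /Ky.
exists r => // y0 y0r; apply: contrapT => y0C.
pose B : set Rd := [set y | enorm (y - a) < r].
have cB x y t : B x -> B y -> 0 <= t -> t <= 1 -> B (x + t *: (y - x)).
  rewrite /B /= => Bx By t0 t1.
  have -> : x + t *: (y - x) - a = (1 - t) *: (x - a) + t *: (y - a).
    by apply/rowP => i; rewrite !mxE; ring.
  apply: le_lt_trans (ler_enormD _ _) _; rewrite !enormZ !ger0_norm ?subr_ge0//.
  have [->|tn0] := eqVneq t 0; first by rewrite mul0r addr0 subr0 mul1r.
  have t0' : 0 < t by rewrite lt_def tn0.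
  have h1 : (1 - t) * enorm (x - a) <= (1 - t) * r by rewrite ler_wpM2l ?subr_ge0 ?(ltW Bx).
  have h2 : t * enorm (y - a) < t * r by rewrite ltr_pM2l.
  lra.
have bg K b : K \in Th -> b \in K -> (bary_fun K b).2 != 0.
  by move=> KT bK; exact: bgrad_neq0 d0 (sK KT) bK.
(* a generic starting point in K0 *)
pose ls := [seq bary_fun Kb.1 Kb.2 | Kb <- [seq (K, b) | K <- (Th : seq _), b <- (K : seq _)]].
have lsP K b : K \in Th -> b \in K -> bary_fun K b \in ls.
  by move=> KT bK; apply/mapP; exists (K, b) => //; apply/allpairsPdep; exists K, b.
have lsI l : l \in ls -> exists K b, [/\ K \in Th, b \in K & l = bary_fun K b].
  by move=> /mapP[[K b] /allpairsPdep[K' [b' [? ? [-> ->]]]] ->]; exists K', b'.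
have [p [Bp pK0] pls] : exists2 p, B p /\ pos K0 p & forall l, l \in ls -> aff l p != 0.
  have v1 : 0 < enorm (center K0 - a) + 1 by rewrite ltr_wpDl// enorm_ge0.
  pose e := Num.min 1 (r / (enorm (center K0 - a) + 1)).
  have e0 : 0 < e by rewrite lt_min ltr01 divr_gt0.
  have e1 : e <= 1 by rewrite ge_min lexx.
  pose x0 := a + e *: (center K0 - a).
  have Bx0 : B x0.
    rewrite /B /= /x0 addrC addKr enormZ gtr0_norm//.
    apply: (@le_lt_trans _ _ (r / (enorm (center K0 - a) + 1) * enorm (center K0 - a))).
      by rewrite ler_wpM2r ?enorm_ge0// ge_min lexx orbT.
    by rewrite mulrAC ltr_pdivrMr// ltr_pM2l// ltrDl.
  have px0 : pos K0 x0.
    move=> b bK0; rewrite /bary aff_line -affB -!/(bary _ _ _) (bary_center (sK K0T) bK0).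
    rewrite (bary_vertex (sK K0T) bK0 aK0).
    have : 0 < d.+1%:R^-1 :> R by rewrite invr_gt0.
    have : 0 <= (b == a)%:R :> R by rewrite ler0n.
    move: (_^-1) (_%:R) => s t t0 s0.
    have -> : t + e * (s - t) = (1 - e) * t + e * s by ring.
    by apply: ltr_wpDl; [rewrite mulr_ge0 ?subr_ge0|rewrite mulr_gt0].
  have [r1 r10 h1] := pos_near px0.
  pose r2 := Num.min r1 (r - enorm (x0 - a)).
  have r20 : 0 < r2 by rewrite lt_min r10 subr_gt0.
  have h2 y : enorm (y - x0) < r2 -> B y /\ pos K0 y.
    rewrite lt_min => /andP[y1 y2]; split; last exact: h1.
    rewrite /B /= (_ : y - a = (y - x0) + (x0 - a)); last by rewrite addrA subrK.
    by apply: le_lt_trans (ler_enormD _ _) _; rewrite -ltrBrDr.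
  apply: (@avoid_zeros _ _ (fun y => B y /\ pos K0 y) ls).
  - move=> x y t [Bx Kx] [By Ky] t0 t1; split; first exact: cB.
    move=> b bK0; rewrite /bary aff_line -affB -!/(bary _ _ _).
    by apply: convex_gt0 => //; [exact: Kx|exact: Ky].
  - by exists x0.
  - move=> l /lsI[K [b [KT bK ->]]]; apply: aff_neq0_near r20 h2 _; exact: bg.
have [rho rho0 hrho] : exists2 rho : R, 0 < rho & forall y, enorm (y - y0) < rho ->
    forall K, K \in Th -> reach a K0 K -> ~ hull K y.
  apply: near_all => K KT; have [rK|rK] := pselect (reach a K0 K); last by exists 1.
  have [|s s0 h] := not_hull_near (sK KT) (x := y0).
    by move=> Ky0; apply: y0C; exists K.
  by exists s => // y /h.
(* a generic end point near y0 *)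
pose cr (l l' : R * Rd) : R * Rd :=
  (aff l' p * l.1 - aff l p * l'.1, aff l' p *: l.2 - aff l p *: l'.2).
have crE l l' x : aff (cr l l') x = aff l' p * aff l x - aff l p * aff l' x.
  by rewrite /aff /= dotvBl !dotvZl /aff; ring.
pose ls2 := [seq cr Kbb.1 Kbb.2 | Kbb <- [seq (bary_fun Kb.1 Kb.2, bary_fun Kb.1 c) |
   Kb <- [seq (K, b) | K <- (Th : seq _), b <- (K : seq _)], c <- [seq c <- (Kb.1 : seq _) | c != Kb.2]]].
have ls2P K b c : K \in Th -> b \in K -> c \in K -> c != b -> cr (bary_fun K b) (bary_fun K c) \in ls2.
  move=> KT bK cK cb; apply/mapP; exists (bary_fun K b, bary_fun K c) => //.
  apply/allpairsPdep; exists (K, b), c; split => //=.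
    by apply/allpairsPdep; exists K, b.
  by rewrite mem_filter cb.
have ls2I l : l \in ls2 -> exists K b c, [/\ K \in Th, b \in K, c \in K, c != b &
    l = cr (bary_fun K b) (bary_fun K c)].
  move=> /mapP[[l1 l2] /allpairsPdep[[K b] [c [h1 h2 [-> ->]]]] ->] /=.
  move: h1 h2 => /allpairsPdep[K' [b' [KT bK [eK eb]]]].
  by rewrite mem_filter /= eK eb => /andP[cb cK]; exists K', b', c.
pose rho' := Num.min rho (r - enorm (y0 - a)).
have rho'0 : 0 < rho' by rewrite lt_min rho0 subr_gt0.
have hrho' y : enorm (y - y0) < rho' -> enorm (y - y0) < rho /\ B y.
  rewrite lt_min => /andP[y1 y2]; split => //.
  rewrite /B /= (_ : y - a = (y - y0) + (y0 - a)); last by rewrite addrA subrK.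
  by apply: le_lt_trans (ler_enormD _ _) _; rewrite -ltrBrDr.
have [q qy0 qls] : exists2 q, enorm (q - y0) < rho' & forall l, l \in ls2 -> aff l q != 0.
  apply: (@avoid_zeros _ _ (fun y => enorm (y - y0) < rho') ls2).
  - move=> x y t xr yr t0 t1.
    have -> : x + t *: (y - x) - y0 = (1 - t) *: (x - y0) + t *: (y - y0).
      by apply/rowP => i; rewrite !mxE; ring.
    apply: le_lt_trans (ler_enormD _ _) _; rewrite !enormZ !ger0_norm ?subr_ge0//.
    have [->|tn0] := eqVneq t 0; first by rewrite mul0r addr0 subr0 mul1r.
    have t0' : 0 < t by rewrite lt_def tn0.
    have h1 : (1 - t) * enorm (x - y0) <= (1 - t) * rho' by rewrite ler_wpM2l ?subr_ge0 ?(ltW xr).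
    have h2 : t * enorm (y - y0) < t * rho' by rewrite ltr_pM2l.
    lra.
  - by exists y0; rewrite subrr enorm0.
  - move=> l /ls2I[K [b [c [KT bK cK cb ->]]]].
    apply: aff_neq0_near rho'0 (fun y h => h) _.
    apply/negP => /eqP /= E.
    have hcr : aff (cr (bary_fun K b) (bary_fun K c)) b = aff (cr (bary_fun K b) (bary_fun K c)) c.
      by rewrite /aff /= E !dotv0l.
    move: hcr; rewrite !crE -!/(bary _ _ _) !(bary_vertex1 (sK KT))//.
    rewrite (bary_vertex0 (sK KT) cK bK) 1?eq_sym// (bary_vertex0 (sK KT) bK cK)//.
    rewrite !mulr1 !mulr0 subr0 sub0r => hpc.
    (* the combination is then constant, hence so are the two coordinates *)
    have [[e he]|allz] := pselect (exists e, [/\ e \in K, e != b & e != c]).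
      move: he => [eK eb ec].
      have : aff (cr (bary_fun K b) (bary_fun K c)) b = aff (cr (bary_fun K b) (bary_fun K c)) e.
        by rewrite /aff /= E !dotv0l.
      rewrite !crE -!/(bary _ _ _) (bary_vertex1 (sK KT))//.
      rewrite (bary_vertex0 (sK KT) cK bK) 1?eq_sym// (bary_vertex0 (sK KT) bK eK)//.
      rewrite (bary_vertex0 (sK KT) cK eK)// !mulr0 mulr1 !subr0 => /eqP.
      by rewrite (negbTE (pls _ (lsP _ _ KT cK))).
    have KE : K = [fset b; c]%fset.
      apply/fsetP => e; rewrite in_fset2; apply/idP/orP => [eK|[/eqP ->|/eqP ->]//].
      apply: contrapT => /not_orP[eb ec]; apply: allz; exists e.
      by split => //; apply/negP.
    have := bary_sum1 p (sK KT).
    rewrite (big_fsetD1 b)//= (_ : (K `\ b)%fset = [fset c]%fset); last first.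
      apply/fsetP => e; rewrite !inE {1}KE in_fset2.
      by have [->|eb] //= := eqVneq e b; rewrite ?orbF// eq_sym (negbTE cb).
    rewrite big_seq_fset1 => s1; have : bary K c p = - bary K b p by [].
    move=> h; rewrite h subrr in s1; move/eqP : s1; rewrite eq_sym.
    by rewrite oner_eq0.
have [qr Bq] := hrho' q qy0.
pose v := q - p.
(* Continuity argument along the segment from p to q: the parameters at which a reached simplex is
   met form a closed set containing 0, and it is shown to be extendable beyond its supremum unless
   this is 1. *)
pose S : set R := [set t | 0 <= t <= 1 /\ exists2 K, reach a K0 K & hull K (p + t *: v)].
have S0 : S 0.
  split; first by rewrite lexx ler01.
  exists K0; first exact: reach_refl.
  by rewrite scale0r addr0; exact: pos_hull (sK K0T) pK0.
have S1 : ubound S 1 by move=> t [/andP[_ ?] _].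
have hS : has_sup S by split; [exists 0|exists 1].
pose s := sup S.
have s0 : 0 <= s by apply: ub_le_sup => //; exact: hS.2.
have s1 : s <= 1 by apply: ge_sup => //; exists 0.
pose x := p + s *: v.
have Bx : B x by exact: cB.
have [K1 rK1 K1x] : exists2 K, reach a K0 K & hull K x.
  apply: contrapT => hx.
  have [e e0 he] : exists2 e : R, 0 < e & forall y, enorm (y - x) < e ->
      forall K, K \in Th -> reach a K0 K -> ~ hull K y.
    apply: near_all => K KT; have [rK|rK] := pselect (reach a K0 K); last by exists 1.
    have [|t t0 h] := not_hull_near (sK KT) (x := x).
      by move=> Kx; apply: hx; exists K.
    by exists t => // y /h.
  have v1 : 0 < enorm v + 1 by rewrite ltr_wpDl// enorm_ge0.
  have e1 : 0 < e / (enorm v + 1) by rewrite divr_gt0.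
  have [t [t01 [K rK Kt]] ts] := sup_adherent e1 hS.
  have tS : t <= s by apply: ub_le_sup; [exact: hS.2|split => //; exists K].
  have [KT _] := reach_mem K0T aK0 rK.
  apply: (he _ _ K KT rK Kt).
  rewrite /x opprD addrACA subrr add0r -scalerBl enormZ distrC ger0_norm ?subr_ge0//.
  apply: (@le_lt_trans _ _ ((s - t) * (enorm v + 1))).
    by rewrite ler_wpM2l ?subr_ge0// lerDl.
  by rewrite -ltr_pdivlMr//; rewrite -/s in ts; lra.
have [K1T aK1] := reach_mem K0T aK0 rK1.
have [s1E|sn1] := eqVneq s 1.
  apply: (hrho q qr K1 K1T rK1).
  by move: K1x; rewrite /x s1E scale1r /v addrC subrK.
have s1' : s < 1 by rewrite lt_def eq_sym sn1.
(* the walk can be continued beyond s *)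
suff [e e0 he] : exists2 e : R, 0 < e & forall y, enorm (y - x) < e ->
    exists2 K, reach a K0 K & hull K y.
  have v1 : 0 < enorm v + 1 by rewrite ltr_wpDl// enorm_ge0.
  pose t := Num.min (1 - s) (e / 2 / (enorm v + 1)).
  have t0 : 0 < t by rewrite lt_min subr_gt0 s1' !divr_gt0.
  have : S (s + t).
    split; first by rewrite addr_ge0 ?(ltW t0)//= -lerBrDl ge_min lexx.
    have E : p + (s + t) *: v - x = t *: v by apply/rowP => i; rewrite /x !mxE; ring.
    apply: he; rewrite E enormZ gtr0_norm//.
    apply: (@le_lt_trans _ _ (e / 2 / (enorm v + 1) * (enorm v + 1))).
      apply: ler_pM; rewrite ?enorm_ge0 ?(ltW t0)//; last by rewrite lerDl.
      by rewrite ge_min lexx orbT.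
    by rewrite divfK ?gt_eqF//; lra.
  move=> St; have : s + t <= s by apply: ub_le_sup => //; exact: hS.2.
  by rewrite gerDl leNgt t0.
(* [cr] of two coordinates is their combination vanishing at p. If both vanished at x, with s < 1,
   the combination would vanish along the whole line, hence at q, against the choice of q. *)
have two b c : b \in K1 -> c \in K1 -> c != b -> bary K1 b x = 0 -> bary K1 c x = 0 -> False.
  move=> bK1 cK1 cb b0 c0; have := qls _ (ls2P _ _ _ K1T bK1 cK1 cb).
  have E l : aff l x = (1 - s) * aff l p + s * aff l q.
    by rewrite /x aff_line -affB; ring.
  move/negP; apply; rewrite crE -!/(bary _ _ _).
  move: b0 c0; rewrite /bary !E -!/(bary _ _ _).
  move: (bary K1 b p) (bary K1 c p) (bary K1 b q) (bary K1 c q) => bp cp bq cq e1 e2.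
  rewrite -(mulrI_eq0 _ (lregP (_ : 1 - s != 0))) ?subr_eq0 1?eq_sym//.
  apply/eqP.
  have -> : (1 - s) * (cp * bq - bp * cq) = ((1 - s) * cp + s * cq) * bq - ((1 - s) * bp + s * bq) * cq.
    by ring.
  by rewrite e1 e2 !mul0r subrr.
have K1x' := (hullE x (sK K1T)).1 K1x.
have [/hasP[b bK1 /eqP b0]|nb] := boolP (has (fun b => bary K1 b x == 0) K1); last first.
  have px : pos K1 x.
    move=> b bK1; rewrite lt_def K1x'// andbT.
    by apply: contra nb => b0; apply/hasP; exists b.
  have [e e0 he] := pos_near px; exists e => // y /he Ky.
  by exists K1 => //; exact: pos_hull (sK K1T) Ky.
have ba : b != a.
  apply/negP => /eqP ba; have := (hr x Bx K1 K1T).2 aK1.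
  by rewrite -ba b0 ltxx.
have rx : relint K1 b x.
  split => // c cK1 cb; rewrite lt_def K1x'// andbT.
  by apply/negP => /eqP c0; exact: (two b c).
(* The walk leaves K1 through the relative interior of an interior facet containing a; the simplex
   on the other side is reached too. *)
have /(interior_faceP d0 hTh K1T bK1)[K2 [K2T n s2]] := hint K1 b rK1 bK1 ba.
have rK2 : reach a K0 K2.
  apply: reach_step rK1 _; apply/and3P; split => //.
  by apply/hasP; exists b => //; rewrite ba.
rewrite eq_sym in n.
have [e e0 he] := two_sides d0 hTh K1T K2T bK1 n s2 rx.
by exists e => // y /he[Ky|Ky]; [exists K1|exists K2].
Qed.

Lemma reach_uniq a K K' : reach a K K' ->
  exists p, [/\ path (adj a) K p, last K p = K' & uniq (K :: p)].
Proof. by move=> [p pp <-]; case/shortenP: pp => p' pp' up' _; exists p'. Qed.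

(** All facets at an interior vertex are interior, so the reached simplices cover a ball around z. A
    point of the open simplex K' in that ball lies in a reached simplex, which can only be K'. *)
Lemma reach_interior z K K' : K \in Th -> K' \in Th -> z \in K -> z \in K' -> Om z ->
  reach z K K'.
Proof.
move=> KT K'T zK zK' Oz.
have [|r r0 h] := walk KT zK.
  move=> K1 b /(reach_mem KT zK)[K1T zK1] bK1 bz.
  by apply: (vertex_Om_interior d0 hTh K1T bK1 zK1) => //; rewrite eq_sym.
have v1 : 0 < enorm (center K' - z) + 1 by rewrite ltr_wpDl// enorm_ge0.
pose e := Num.min 1 (r / 2 / (enorm (center K' - z) + 1)).
have e0 : 0 < e by rewrite lt_min ltr01 !divr_gt0.
have e1 : e <= 1 by rewrite ge_min lexx.
pose x := z + e *: (center K' - z).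
have px : pos K' x.
  move=> b bK; rewrite /bary aff_line -affB -!/(bary _ _ _) (bary_center (sK K'T) bK).
  rewrite (bary_vertex (sK K'T) bK zK').
  have : 0 < d.+1%:R^-1 :> R by rewrite invr_gt0.
  have : 0 <= (b == z)%:R :> R by rewrite ler0n.
  move: (_^-1) (_%:R) => s t t0 s0.
  have -> : t + e * (s - t) = (1 - e) * t + e * s by ring.
  by apply: ltr_wpDl; [rewrite mulr_ge0 ?subr_ge0|rewrite mulr_gt0].
have [|K1 rK1 K1x] := h x.
  rewrite /x addrC addKr enormZ gtr0_norm//.
  apply: (@le_lt_trans _ _ (r / 2 / (enorm (center K' - z) + 1) * (enorm (center K' - z) + 1))).
    apply: ler_pM; rewrite ?enorm_ge0 ?(ltW e0)//; last by rewrite lerDl.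
    by rewrite ge_min lexx orbT.
  by rewrite divfK ?gt_eqF//; lra.
have [K1T _] := reach_mem KT zK rK1.
by rewrite (pos_uniq hTh K'T K1T px K1x).
Qed.

(** Otherwise the reached simplices would cover a ball around a, and a would be in Om. *)
Lemma reach_boundary a K : K \in Th -> a \in K -> ~ Om a ->
  exists K' b, [/\ reach a K K', b \in K', b != a & ~~ interior_face Th (K' `\ b)%fset].
Proof.
move=> KT aK Oa; apply: contrapT => hn; apply: Oa.
have [|r r0 h] := walk KT aK.
  move=> K1 b rK1 bK1 ba; apply: contraT => ni; exfalso; apply: hn.
  by exists K1, b.
apply: (interior_closure hOm r0) => y /h[K1 rK1 K1y].
have [K1T _] := reach_mem KT aK rK1.
exact: (hull_closure hTh K1T).
Qed.

End mesh_connectivity.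

(** * Boundary facets and the planes of a reference mesh *)

Section boundary_planes.
Context {R : realType} {d : nat}.
Local Notation Rd := 'rV[R]_d.
Variables (Om : set Rd) (Th0 Th : {fset {fset Rd}}).
Hypotheses (d0 : (0 < d)%N) (hOm : lipschitz_domain Om).
Hypotheses (hTh0 : conforming_mesh Om Th0) (hTh : conforming_mesh Om Th).
Implicit Types (K F : {fset Rd}) (a b x : Rd).

(* A boundary facet is covered by the facet planes of any other mesh, hence
   contained in one of them. *)
Lemma boundary_facet_plane K a : K \in Th -> a \in K -> ~~ interior_face Th (K `\ a)%fset ->
  exists K0 b0, [/\ K0 \in Th0, b0 \in K0 & forall b, b \in K -> b != a -> bary K0 b0 b = 0].
Proof.
move=> KT aK nint; apply: contrapT => hn.
have sK := mesh_simplex hTh KT.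
have oO : open Om by case: hOm.
pose ls := [seq bary_fun Kb.1 Kb.2 | Kb <- [seq (K, b) | K <- (Th0 : seq _), b <- (K : seq _)]].
have lsP K' b : K' \in Th0 -> b \in K' -> bary_fun K' b \in ls.
  by move=> KT' bK; apply/mapP; exists (K', b) => //; apply/allpairsPdep; exists K', b.
have lsI l : l \in ls -> exists K b, [/\ K \in Th0, b \in K & l = bary_fun K b].
  by move=> /mapP[[K1 b] /allpairsPdep[K' [b' [? ? [-> ->]]]] ->]; exists K', b'.
have rc := facet_centerP d0 hTh KT aK.
(* If no facet plane of [Th0] contained the facet, a generic point of its relative interior would
   avoid them all. It would then be interior to a simplex of [Th0], hence in Om, and the facet would
   be interior. *)
have [x rx hx] : exists2 x, relint K a x & forall l, l \in ls -> aff l x != 0.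
  apply: avoid_zeros.
  - move=> x y t [xa xb] [ya yb] t0 t1; split=> [|b bK ba].
      by rewrite /bary aff_line -affB -!/(bary _ _ _) xa ya subrr mulr0 addr0.
    rewrite /bary aff_line -affB -!/(bary _ _ _).
    by apply: convex_gt0 => //; [exact: xb|exact: yb].
  - by exists (facet_center K a).
  - move=> l /lsI[K0 [b0 [K0T b0K0 ->]]].
    have [z|z] := eqVneq (aff (bary_fun K0 b0) (facet_center K a)) 0; last first.
      by exists (facet_center K a).
    have [b [bK ba bn]] : exists b, [/\ b \in K, b != a & bary K0 b0 b != 0].
      apply: contrapT => hb; apply: hn; exists K0, b0; split => // b bK ba.
      by apply/eqP; apply: contrapT => /negP bn; apply: hb; exists b.
    exists (facet_center K a + (1/2) *: (b - facet_center K a)).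
      by apply: (relint_segment hTh KT aK bK ba rc); lra.
    by rewrite aff_line -affB z subr0 add0r mulf_neq0.
have [K0 K0T K0x] : exists2 K0, K0 \in Th0 & hull K0 x.
  apply: (closure_hull hTh0); exact: (hull_closure hTh KT (relint_hull hTh KT rx)).
have px : pos K0 x.
  move=> b bK0; rewrite lt_def (hx _ (lsP _ _ K0T bK0)) /=.
  exact: (hullE x (mesh_simplex hTh0 K0T)).1.
move/negP : nint; apply; apply: (relint_Om_interior d0 hTh KT aK oO rx).
exact: (pos_Om hOm hTh0 K0T px).
Qed.

End boundary_planes.

(** * Shape regularity *)

Section shape_regular_simplices.
Context {R : realType} {d : nat}.
Local Notation Rd := 'rV[R]_d.
Implicit Types (K F : {fset Rd}) (a b x y : Rd).

Lemma ediam_hull_ge F x y : hull F x -> hull F y -> enorm (x - y) <= ediam (hull F).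
Proof.
move=> Fx Fy; apply: ub_le_sup; last by exists x => //; exists y.
pose M := \sum_(a <- F) enorm a.
have hM z : hull F z -> enorm z <= M.
  move=> [w [w0 w1 ->]]; apply: (@le_trans _ _ (\sum_(a <- F) w a * enorm a)).
    have := w0; rewrite big_seq [X in _ <= X]big_seq => {}w0.
    elim/big_rec2: _ => [|a u v aF uv]; first by rewrite enorm0.
    apply: le_trans (ler_enormD _ _) _; rewrite enormZ ger0_norm ?w0// lerD2l.
    exact: uv.
  rewrite /M big_seq [X in _ <= X]big_seq; apply: ler_sum => a aF.
  rewrite ler_piMl ?enorm_ge0// -w1 (big_fsetD1 a)//= lerDl big_seq sumr_ge0// => b.
  by rewrite !inE => /andP[_]; exact: w0.
exists (M + M) => _ [u Fu [v Fv <-]].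
by apply: le_trans (ler_enormB _ _) _; apply: lerD; exact: hM.
Qed.

Lemma hK_ge K x y : hull K x -> hull K y -> enorm (x - y) <= hK K.
Proof. exact: ediam_hull_ge. Qed.

Lemma hK_ge0 K : simplex K -> 0 <= hK K.
Proof.
move=> sK; have Kc := pos_hull sK (pos_center sK).
by apply: le_trans (hK_ge Kc Kc); exact: enorm_ge0.
Qed.

(** The working form of shape regularity: a contained ball whose radius controls the diameter. *)
Definition regular (L : R) K (c : Rd) (r : R) : Prop :=
  [/\ 0 < r, forall x, enorm (x - c) <= r -> hull K x & hK K <= L * r].

Lemma regular_hull L K c r : regular L K c r -> hull K c.
Proof. by move=> [r0 h _]; apply: h; rewrite subrr enorm0 ltW. Qed.

(** From the centre of the ball, moving by r along the gradient raises the coordinate by |grad| r,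
    and it stays between 0 and 1. *)
Lemma bgrad_bound L K c r a : simplex K -> regular L K c r -> a \in K ->
  enorm (bgrad K a) * r <= 1.
Proof.
move=> sK Kr aK; have [r0 h _] := Kr.
have [->|g0] := eqVneq (bgrad K a) 0; first by rewrite enorm0 mul0r.
have gp : 0 < enorm (bgrad K a) by rewrite enorm_gt0.
pose x := c + (r / enorm (bgrad K a)) *: bgrad K a.
have Kx : hull K x.
  by apply: h; rewrite /x addrC addKr enormZ gtr0_norm ?divr_gt0// divfK ?gt_eqF.
have := bary_le1 sK aK Kx.
have := (hullE c sK).1 (regular_hull Kr) a aK.
rewrite {2}/bary aff_line -/(bgrad K a) -/(bary K a c) -sqr_enorm.
have -> : r / enorm (bgrad K a) * enorm (bgrad K a) ^+ 2 = enorm (bgrad K a) * r.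
  by field; rewrite gt_eqF.
lra.
Qed.

(** Along the edge the coordinate of a changes by 1, with slope at most 1 / r. *)
Lemma regular_edge L K c r a b : simplex K -> regular L K c r -> a \in K -> b \in K ->
  b != a -> r <= enorm (a - b).
Proof.
move=> sK Kr aK bK ba; have [r0 _ _] := Kr.
have := bgrad_bound sK Kr aK.
have : 1 <= enorm (bgrad K a) * enorm (a - b).
  apply: le_trans (le_trans (ler_norm _) (cauchy_schwarz_dotv _ _)).
  by rewrite -affB -!/(bary _ _ _) (bary_vertex1 sK aK) (bary_vertex0 sK aK bK ba) subr0.
move=> h1 h2; have g0 : 0 < enorm (bgrad K a).
  rewrite lt_def enorm_ge0 andbT; apply: contraTneq h1 => ->.
  by rewrite mul0r -ltNge ltr01.
by rewrite -(ler_pM2l g0); exact: le_trans h2 h1.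
Qed.

Lemma regular_pos L K c r x : (0 < d)%N -> simplex K -> regular L K c r ->
  enorm (x - c) < r -> pos K x.
Proof.
move=> d0 sK [r0 h _] xc b bK.
have gp : 0 < enorm (bgrad K b) by rewrite enorm_gt0 bgrad_neq0.
pose t := (r - enorm (x - c)) / enorm (bgrad K b).
have t0 : 0 < t by rewrite divr_gt0// subr_gt0.
have /(hullE _ sK)/(_ b bK) : hull K (x + t *: - bgrad K b).
  apply: h; rewrite addrAC; apply: le_trans (ler_enormD _ _) _.
  rewrite enormZ enormN gtr0_norm// divfK ?gt_eqF//; lra.
rewrite /bary aff_line -/(bgrad K b) -/(bary K b x) dotvNr mulrN subr_ge0.
by apply: lt_le_trans; rewrite mulr_gt0// -sqr_enorm exprn_gt0.
Qed.

Lemma hK_ge_radius L K c r : (0 < d)%N -> regular L K c r -> r <= hK K.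
Proof.
move=> d0 Kr; have [r0 h _] := Kr.
pose e : Rd := delta_mx ord0 (Ordinal d0).
have e1 : enorm e = 1 by rewrite /enorm dotv_delta mxE !eqxx sqrtr1.
have Ke : hull K (c + r *: e).
  by apply: h; rewrite addrC addKr enormZ e1 mulr1 gtr0_norm.
have := hK_ge Ke (regular_hull Kr).
by rewrite addrC addKr enormZ e1 mulr1 gtr0_norm.
Qed.

Lemma shape_regular_ball (Th : {fset {fset Rd}}) K : (0 < d)%N -> simplex K -> K \in Th ->
  exists c r, regular (4 * shape_regularity Th) K c r.
Proof.
move=> d0 sK KT.
pose A := [set 2 * r | r in [set r | 0 <= r /\ exists c, forall x, enorm (x - c) <= r -> hull K x]].
have Aub : ubound A (2 * hK K).
  move=> _ [r [r0 [c h]] <-]; rewrite ler_pM2l//.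
  have [->|rn] := eqVneq r 0; first exact: hK_ge0.
  apply: (@hK_ge_radius (hK K / r) K c r d0); split => //; first by rewrite lt_def rn.
  by rewrite divfK.
have [r1 r10 h1] := pos_near (pos_center sK).
have A1 : A (2 * (r1 / 2)).
  exists (r1 / 2) => //; split; first by rewrite divr_ge0 ?ltW.
  exists (center K) => x hx; apply: (pos_hull sK); apply: h1.
  by apply: le_lt_trans hx _; lra.
have hA : has_sup A by split; [exists (2 * (r1 / 2))|exists (2 * hK K)].
have rho0 : 0 < rhoK K.
  apply: (@lt_le_trans _ _ (2 * (r1 / 2))); first by lra.
  by apply: ub_le_sup => //; exact: hA.2.
(* The supremum defining [rhoK] need not be attained here; a ball with diameter 2 r above half of it
   gives [rhoK] < 4 r, whence the factor 4. *)
have [|_ [r [r0 [c h]] <-] hr] := @sup_adherent _ A (rhoK K / 2) _ hA.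
  by rewrite divr_gt0.
rewrite -/(rhoK K) in hr.
have rr : rhoK K < 4 * r by lra.
exists c, r; split => //; first by lra.
have : hK K / rhoK K <= shape_regularity Th.
  rewrite /shape_regularity; have : K \in (Th : seq {fset Rd}) by [].
  elim: (Th : seq {fset Rd}) => // K1 s IH; rewrite inE big_cons le_max.
  by case/orP => [/eqP <-|/IH ->]; rewrite ?lexx ?orbT.
rewrite ler_pdivrMr// => /le_trans; apply.
have s0 : 0 <= shape_regularity Th.
  rewrite /shape_regularity; elim/big_rec: _ => // K' y _ y0.
  by rewrite le_max y0 orbT.
have := ler_wpM2l s0 (ltW rr); lra.
Qed.

End shape_regular_simplices.

(** * Overlap of patches and comparison of diameters *)

Section packing.
Context {R : realType} {d : nat}.
Local Notation Rd := 'rV[R]_d.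
Variables (Om : set Rd) (Th : {fset {fset Rd}}).
Hypotheses (d0 : (0 < d)%N) (hTh : conforming_mesh Om Th).
Implicit Types (K F : {fset Rd}) (a b x y : Rd).

Let sK K : K \in Th -> simplex K.
Proof. exact: (mesh_simplex hTh). Qed.

Lemma sum_integral_disjoint (s : seq {fset Rd}) (Q : {fset Rd} -> set Rd) (D : set Rd)
    (f : Rd -> \bar R) : uniq s -> {subset s <= Th} ->
  (forall K, measurable (Q K)) -> (forall K, K \in s -> Q K `<=` pos K) ->
  (forall K, K \in s -> Q K `<=` D) -> measurable D -> measurable_fun D f ->
  (forall x, D x -> (0 <= f x)%E) ->
  (\sum_(K <- s) \int[vol R d]_(x in Q K) f x <= \int[vol R d]_(x in D) f x)%E.
Proof.
move=> us sT mQ Qpos QD mD mf f0.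
have UD : \big[setU/set0]_(K <- s) Q K `<=` D.
  by rewrite -bigcup_seq => x [K Ks Kx]; exact: (QD K Ks).
rewrite -ge0_integral_bigsetU//.
- apply: ge0_subset_integral => //.
  by rewrite -bigcup_seq; apply: fin_bigcup_measurable => //; exact: finite_seq.
- move=> K K' /= Ks K's [x [Qx Q'x]].
  by apply: (pos_uniq hTh (sT _ Ks) (sT _ K's) (Qpos K Ks x Qx));
    exact: pos_hull (sK (sT _ K's)) (Qpos K' K's x Q'x).
- exact: measurable_funS mf.
- by move=> x /UD; exact: f0.
Qed.

(** Cubes of half-side s serve as test sets in place of balls, since their volume is explicit. *)
Definition cube (c : Rd) (s : R) : set Rd := box (c - const_mx s) (c + const_mx s).

Lemma measurable_cube c s : measurable (cube c s).
Proof. exact: measurable_box. Qed.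

Lemma cubeE c s x : cube c s x <-> forall i, `|x ord0 i - c ord0 i| <= s.
Proof.
split => h i; have := h i; rewrite !mxE ler_norml; first by move=> /andP[? ?]; apply/andP; split; lra.
by move=> /andP[? ?]; apply/andP; split; lra.
Qed.

Lemma vol_cube c s : 0 <= s -> vol R d (cube c s) = ((2 * s) ^+ d)%:E.
Proof.
move=> s0; rewrite /cube vol_box; last by move=> i; rewrite !mxE; lra.
rewrite (eq_bigr (fun=> 2 * s)); last by move=> i _; rewrite !mxE; ring.
by rewrite prodr_const card_ord.
Qed.

Lemma integral_cube c s : 0 <= s ->
  (\int[vol R d]_(x in cube c s) cst 1%E x = ((2 * s) ^+ d)%:E)%E.
Proof.
move=> s0; rewrite integral_cst; last exact: measurable_cube.
by rewrite mul1e; exact: vol_cube.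
Qed.

Lemma cube_enorm c s x : 0 <= s -> cube c s x -> enorm (x - c) <= d%:R * s.
Proof.
move=> s0 /cubeE h; apply: ler_enorm_coord => // i.
by have := h i; rewrite !mxE.
Qed.

Variables (L : R).
Hypothesis hL : forall K, K \in Th -> exists c r, regular L K c r.

Lemma regular_ge1 K : K \in Th -> 1 <= L.
Proof.
move=> KT; have [c [r Kr]] := hL KT; have [r0 _ h] := Kr.
have := le_trans (hK_ge_radius d0 Kr) h.
by rewrite -{1}[r]mul1r ler_pM2r.
Qed.

Lemma hK_gt0 K : K \in Th -> 0 < hK K.
Proof.
move=> KT; have [c [r Kr]] := hL KT; have [r0 _ h] := Kr.
exact: lt_le_trans r0 (hK_ge_radius d0 Kr).
Qed.

(** The homothety of centre a and ratio th shrinks the inscribed ball into the corner of K at a. The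
    half-side is such that the cube has Euclidean radius at most th hK / (2 L), hence less than th
    r. *)
Lemma cube_near_vertex K a (th : R) : K \in Th -> a \in K -> 0 < th -> th <= 1 ->
  exists c, cube c (th * hK K / (2 * d%:R * L)) `<=` pos K /\
    forall x, cube c (th * hK K / (2 * d%:R * L)) x -> exists2 y, pos K y & x = a + th *: (y - a).
Proof.
move=> KT aK t0 t1; have [c [r Kr]] := hL KT; have [r0 h hr] := Kr.
have L1 := regular_ge1 KT; have L0 : 0 < L by exact: lt_le_trans L1.
have dR : 0 < d%:R :> R by rewrite ltr0n.
have hK0 := hK_gt0 KT.
have key x : cube (a + th *: (c - a)) (th * hK K / (2 * d%:R * L)) x ->
    exists2 y, pos K y & x = a + th *: (y - a).
  move=> hx; exists (a + th^-1 *: (x - a)); last first.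
    by rewrite [X in _ *: X]addrC addKr scalerA mulfV ?gt_eqF// scale1r addrC subrK.
  apply: (regular_pos d0 (sK KT) Kr).
  have -> : a + th^-1 *: (x - a) - c = th^-1 *: (x - (a + th *: (c - a))).
    by apply/rowP => i; rewrite !mxE; field; rewrite gt_eqF.
  rewrite enormZ gtr0_norm ?invr_gt0// mulrC ltr_pdivrMr//.
  apply: le_lt_trans (cube_enorm _ hx) _.
    by rewrite !mulr_ge0 ?invr_ge0 ?mulr_ge0 ?ltW.
  have -> : d%:R * (th * hK K / (2 * d%:R * L)) = th * (hK K / (2 * L)).
    by field; rewrite !gt_eqF.
  rewrite mulrC ltr_pM2r// ltr_pdivrMr ?mulr_gt0//.
  have : 0 < L * r by rewrite mulr_gt0.
  lra.
exists (a + th *: (c - a)); split => // x /key[y py ->] b bK.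
rewrite /bary aff_line -affB -!/(bary _ _ _).
have := py b bK; have : 0 <= bary K b a by rewrite (bary_vertex (sK KT))// ler0n.
move: (bary K b a) (bary K b y) => s u s0 u0.
have -> : s + th * (u - s) = (1 - th) * s + th * u by ring.
by apply: ltr_wpDl; [rewrite mulr_ge0 ?subr_ge0|rewrite mulr_gt0].
Qed.

Definition star a := [fset K in Th | a \in K]%fset.

Lemma starE a K : (K \in star a) = (K \in Th) && (a \in K).
Proof. by rewrite !inE. Qed.

Definition star_bound : nat := Num.bound ((4 * d%:R * L) ^+ d).

(** The simplices at a are first scaled about a to a common size dl below all diameters, since these
    need not be comparable. Disjoint cubes of half-side dl / (2 d L) then lie in one cube of
    half-side 2 dl, and (4 d L)^d is the ratio of volumes. *)
Lemma card_star a : (#|` star a| <= star_bound)%N.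
Proof.
have [->|/fset0Pn[K0]] := eqVneq (star a) fset0; first by rewrite cardfs0.
rewrite starE => /andP[K0T aK0].
have L1 := regular_ge1 K0T; have L0 : 0 < L by exact: lt_le_trans L1.
have dR : 0 < d%:R :> R by rewrite ltr0n.
have [|dl /andP[dl0 dl1] hdl] := @small_all R _ Th (fun K t => t <= hK K).
  by move=> K KT; exists (hK K); first exact: hK_gt0.
pose s := dl / (2 * d%:R * L).
have s0 : 0 < s by rewrite divr_gt0 ?mulr_gt0.
have hQ K : exists c, K \in star a -> cube c s `<=` pos K /\ cube c s `<=` cube a (2 * dl).
  have [|nK] := boolP (K \in star a); last by exists 0.
  rewrite starE => /andP[KT aK]; have hK0 := hK_gt0 KT.
  have th1 : dl / hK K <= 1 by rewrite ler_pdivrMr// mul1r hdl.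
  have th0 : 0 < dl / hK K by rewrite divr_gt0.
  have [c [hc1 hc2]] := cube_near_vertex KT aK th0 th1.
  rewrite divfK ?gt_eqF// -/s in hc1 hc2.
  exists c => _; split => // x /hc2[y py ->]; apply/cubeE => i.
  have := ler_coord_enorm ((dl / hK K) *: (y - a)) i.
  have -> : ((dl / hK K) *: (y - a)) ord0 i = (a + (dl / hK K) *: (y - a)) ord0 i - a ord0 i.
    by rewrite !mxE; ring.
  move=> /le_trans; apply; rewrite enormZ (gtr0_norm th0).
  apply: (@le_trans _ _ (dl / hK K * hK K)).
    rewrite ler_pM2l//; apply: hK_ge; first exact: pos_hull (sK KT) py.
    exact: hull_vertex (sK KT) aK.
  by rewrite divfK ?gt_eqF//; lra.
have [c hc] := choice hQ.
have := @sum_integral_disjoint (star a) (fun K => cube (c K) s) (cube a (2 * dl)) (cst 1%E)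
  (fset_uniq _) _ (fun K => measurable_cube _ _) _ _ (measurable_cube _ _) _ _.
move=> /(_ (fun K KS => fsubsetP (fset_sub _ _) K KS) (fun K KS => (hc K KS).1) (fun K KS => (hc K KS).2)
  (measurable_cst _) (fun x _ => @lee01 R)).
rewrite (eq_bigr (fun=> ((2 * s) ^+ d)%:E)); last by move=> K _; exact: integral_cube (ltW s0).
rewrite integral_cube; last by rewrite mulr_ge0 ?(ltW dl0).
rewrite sumEFin lee_fin big_const_seq count_predT iter_addr_0 -/(#|` star a|) -[X in X <= _]mulr_natl => h.
rewrite -(ler_nat R); apply: le_trans (ltW (archi_boundP _)); last first.
  by rewrite exprn_ge0// !mulr_ge0 ?ltW.
have sd : 0 < (2 * s) ^+ d by rewrite exprn_gt0// mulr_gt0.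
rewrite -(ler_pM2r sd); apply: (le_trans h).
rewrite -exprMn le_eqVlt; apply/orP; left; apply/eqP; congr (_ ^+ _).
by rewrite /s; field; rewrite !gt_eqF.
Qed.

(** The common edge is at least as long as the radius in K, and at most as long as the diameter of
    K'. *)
Lemma hK_edge K K' a b : K \in Th -> K' \in Th -> a \in K -> b \in K -> a \in K' -> b \in K' ->
  b != a -> hK K <= L * hK K'.
Proof.
move=> KT K'T aK bK aK' bK' ba; have [c [r Kr]] := hL KT; have [r0 _ h] := Kr.
have L0 : 0 < L by apply: lt_le_trans (regular_ge1 KT).
apply: le_trans h _; rewrite ler_pM2l//.
apply: le_trans (regular_edge (sK KT) Kr aK bK ba) _.
by apply: hK_ge; apply: hull_vertex => //; exact: sK.
Qed.

(** For d > 1 the common facet has a vertex besides a, so that K and K' share an edge. *)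
Lemma hK_adj a K K' : (1 < d)%N -> K \in Th -> a \in K -> adj Th a K K' -> hK K <= L * hK K'.
Proof.
move=> d1 KT aK h; have [K'T aK'] := adj_mem aK h.
move: h => /and3P[_ _ /hasP[b bK /andP[ba s]]].
have [e [eK ea eb]] : exists e, [/\ e \in K, e != a & e != b].
  have : (0 < #|` (K `\ a `\ b)%fset|)%N.
    have := cardfsD1 b (K `\ a)%fset; have := cardfsD1 a K.
    rewrite aK (sK KT).1 !inE ba bK /= !add1n => -[<-] e.
    by rewrite e ltnS in d1.
  by rewrite cardfs_gt0 => /fset0Pn[e]; rewrite !inE => /and3P[? ? ?]; exists e.
apply: (hK_edge KT K'T aK eK aK' _ ea).
by apply: (fsubsetP s); rewrite !inE eb.
Qed.

Lemma path_star_size a K p : K \in Th -> a \in K -> path (adj Th a) K p -> uniq (K :: p) ->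
  (size p < star_bound)%N.
Proof.
move=> KT aK pp up; apply: leq_trans (card_star a).
rewrite -[(size p).+1]/(size (K :: p)); apply: uniq_leq_size up _ => K'.
have all_star : forall q K, K \in Th -> a \in K -> path (adj Th a) K q -> {subset K :: q <= star a}.
  elim=> [|K1 q IH] K2 K2T aK2 /=; first by move=> _ K3; rewrite inE => /eqP ->; rewrite starE K2T.
  move=> /andP[h hq] K3; rewrite inE => /orP[/eqP ->|]; first by rewrite starE K2T.
  by have [K1T aK1] := adj_mem aK2 h; exact: IH.
exact: all_star.
Qed.

Lemma hK_path a K p : (1 < d)%N -> K \in Th -> a \in K -> path (adj Th a) K p ->
  hK K <= L ^+ size p * hK (last K p).
Proof.
move=> d1; elim: p K => [|K1 p IH] K KT aK /=; first by rewrite mul1r.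
move=> /andP[h hp]; have [K1T aK1] := adj_mem aK h.
apply: le_trans (hK_adj d1 KT aK h) _; rewrite exprS -mulrA ler_pM2l; first exact: IH.
exact: lt_le_trans (regular_ge1 KT).
Qed.

Lemma hK_reach a K K' : (1 < d)%N -> K \in Th -> a \in K -> reach Th a K K' ->
  hK K <= L ^+ star_bound * hK K'.
Proof.
move=> d1 KT aK rK; have [K'T _] := reach_mem KT aK rK.
have [p [pp <- up]] := reach_uniq rK.
apply: le_trans (hK_path d1 KT aK pp) _.
have lK : last K p \in Th.
  by have [] := @reach_mem _ _ Th a K (last K p) KT aK (ex_intro2 _ _ p pp erefl).
rewrite ler_pM2r ?hK_gt0// ler_weXn2l// ?(regular_ge1 KT)//.
exact: ltnW (path_star_size KT aK pp up).
Qed.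

End packing.

(** * Measure of faces *)

Section unit_simplex_volume.
Context {R : realType}.

Lemma measurable_unit_simplex n : measurable (@unit_simplex R n).
Proof.
pose g (s : 'rV[R]_n) : R := \sum_i s ord0 i.
have -> : @unit_simplex R n = \bigcap_(i in [set: 'I_n]) ((fun s : 'rV[R]_n => s ord0 i) @^-1` `[0, +oo[%classic)
    `&` g @^-1` `]-oo, 1]%classic.
  apply/seteqP; split => s /=.
    by move=> [h1 h2]; split; [move=> i _ /=; rewrite in_itv/= andbT|rewrite in_itv].
  move=> [h1 h2]; split; last by move: h2; rewrite in_itv.
  by move=> i; move: (h1 i I); rewrite /= in_itv/= andbT.
apply: measurableI.
  apply: fin_bigcap_measurable => // i _.
  by rewrite -[X in measurable X]setTI; exact: measurable_coord.
rewrite -[X in measurable X]setTI; apply: measurable_sum => // i.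
exact: measurable_coord.
Qed.

(** The cube of side 1 / (n + 1) at the origin fits in the unit simplex; this crude bound is
    enough. *)
Lemma vol_unit_simplex_ge n :
  (((n.+1%:R^-1) ^+ n)%:E <= vol R n (@unit_simplex R n))%E.
Proof.
have n0 : 0 <= n.+1%:R^-1 :> R by rewrite invr_ge0 ler0n.
apply: (@le_trans _ _ (vol R n (box (0 : 'rV[R]_n) (const_mx n.+1%:R^-1)))).
  rewrite vol_box; last by move=> i; rewrite !mxE.
  rewrite (eq_bigr (fun=> n.+1%:R^-1)); last by move=> i _; rewrite !mxE subr0.
  by rewrite prodr_const card_ord.
apply: le_measure; rewrite ?inE; [exact: measurable_box|exact: measurable_unit_simplex|].
move=> s hs; split => [i|].
  by have /andP[] := hs i; rewrite mxE.
apply: (@le_trans _ _ (\sum_(i < n) n.+1%:R^-1)).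
  by apply: ler_sum => i _; have /andP[_] := hs i; rewrite mxE.
rewrite sumr_const card_ord -[_ *+ n]mulr_natl ler_pdivrMr ?ltr0n// mul1r ler_nat.
exact: leqnSn.
Qed.

End unit_simplex_volume.

Section face_measure.
Context {R : realType} {n : nat}.
Local Notation Rd := 'rV[R]_n.+1.
Implicit Types (K F : {fset Rd}) (a b x y : Rd).

Definition gram F : R := Num.sqrt (\det (face_edges F *m (face_edges F)^T)).

Lemma norm_det_le (k : nat) (A : 'M[R]_k) (beta : 'I_k -> R) :
  (forall i j, `|A i j| <= beta j) -> `|\det A| <= k`!%:R * \prod_j beta j.
Proof.
move=> hA; rewrite /determinant; apply: le_trans (ler_norm_sum _ _ _) _.
apply: (@le_trans _ _ (\sum_(s : 'S_k) \prod_j beta j)); last first.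
  by rewrite sumr_const card_Sn mulr_natl.
apply: ler_sum => s _; rewrite normrM normrX normrN1 expr1n mul1r normr_prod.
rewrite [X in _ <= X](reindex_inj (@perm_inj _ s)); apply: ler_prod => i _.
by rewrite normr_ge0 hA.
Qed.

(* Bordering the edges of the facet opposite to b with the unit normal gives a
   square matrix with the same Gram determinant; its inverse has as columns the
   normal and the tangential parts of the barycentric gradients, which are
   bounded by the inverse of the inradius. *)
Lemma gram_ge L K c r b : simplex K -> regular L K c r -> b \in K ->
  (r / 2) ^+ n / n.+1`!%:R <= gram (K `\ b)%fset.
Proof.
move=> sK Kr bK; have [r0 _ _] := Kr.
set F := (K `\ b)%fset; pose e i := nth 0 (enum_fset F) i.
have sF : size (enum_fset F) = n.+1.
  have := cardfsD1 b K; rewrite bK sK.1 add1n => -[h].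
  exact: esym h.
have eF i : (i < n.+1)%N -> e i \in F by move=> hi; apply: mem_nth; rewrite sF.
have eK i : (i < n.+1)%N -> e i \in K.
  by move=> /eF; rewrite !inE => /andP[].
have eb i : (i < n.+1)%N -> e i != b.
  by move=> /eF; rewrite !inE => /andP[].
have ee i j : (i < n.+1)%N -> (j < n.+1)%N -> (e i == e j) = (i == j).
  by move=> hi hj; rewrite nth_uniq ?sF// fset_uniq.
have g0 : 0 < enorm (bgrad K b) by rewrite enorm_gt0 bgrad_neq0.
pose nv := (enorm (bgrad K b))^-1 *: bgrad K b.
have nv1 : dotv nv nv = 1.
  by rewrite dotvZl dotvZr -sqr_enorm; field; rewrite gt_eqF.
have nve i : (i < n)%N -> dotv nv (e i.+1 - e 0%N) = 0.
  move=> hi; rewrite dotvZl -affB -!/(bary _ _ _) !(bary_vertex0 sK bK) ?eK ?eb//.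
  by rewrite subrr mulr0.
pose w j := bgrad K (e j.+1).
pose E := face_edges F.
pose G : 'M[R]_(n.+1, n) := \matrix_(k, j) (w j - dotv nv (w j) *: nv) ord0 k.
have Ei (i : 'I_n) k : E i k = (e i.+1 - e 0%N) ord0 k by rewrite mxE.
have Gj k (j : 'I_n) : G k j = (w j - dotv nv (w j) *: nv) ord0 k by rewrite mxE.
pose A : 'M[R]_(1 + n, n.+1) := col_mx nv E.
pose B : 'M[R]_(n.+1, 1 + n) := row_mx nv^T G.
have nvnv : nv *m nv^T = 1%:M.
  by apply/matrixP => i j; rewrite !ord1 -dotv_mx nv1 mxE.
have EnvT : E *m nv^T = 0.
  apply/matrixP => i j; rewrite !mxE.
  transitivity (dotv (e i.+1 - e 0%N) nv); last by rewrite dotvC nve.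
  by apply: eq_bigr => k _; congr (_ * _); [exact: Ei|rewrite mxE (ord1 j)].
have AB : A *m B = 1%:M.
  rewrite mul_col_row scalar_mx_block nvnv EnvT; congr block_mx.
    apply/matrixP => i j; rewrite !mxE (ord1 i).
    transitivity (dotv nv (w j - dotv nv (w j) *: nv)).
      by apply: eq_bigr => k _; congr (_ * _); exact: Gj.
    by rewrite dotvBr dotvZr nv1 mulr1 subrr.
  apply/matrixP => i j; rewrite !mxE.
  transitivity (dotv (e i.+1 - e 0%N) (w j - dotv nv (w j) *: nv)).
    by apply: eq_bigr => k _; congr (_ * _); [exact: Ei|exact: Gj].
  rewrite dotvBr dotvZr [dotv _ nv]dotvC nve// mulr0 subr0 dotvC.
  rewrite -affB -!/(bary _ _ _) !(bary_vertex sK) ?eK// ?ltnS//.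
  by rewrite !ee ?ltnS// eqSS subr0 eq_sym.
pose A' : 'M[R]_n.+1 := A; pose B' : 'M[R]_n.+1 := B.
have dAB : \det A' * \det B' = 1.
  by rewrite -det_mulmx [_ *m _]AB det1.
have dG : \det (face_edges F *m (face_edges F)^T) = (\det A') ^+ 2.
  rewrite expr2 -[X in _ * X]det_tr -det_mulmx.
  pose D : 'M[R]_(1 + n) := block_mx 1%:M 0 0 (E *m E^T).
  have -> : A' *m A'^T = D.
    have AT : A^T = row_mx nv^T E^T by exact: tr_col_mx.
    transitivity (A *m row_mx nv^T E^T); first by rewrite -AT.
    rewrite /A mul_col_row nvnv EnvT.
    have -> // : nv *m E^T = 0.
    by apply: trmx_inj; rewrite trmx_mul trmxK EnvT trmx0.
  by rewrite [\det D]det_ublock det1 mul1r.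
(* The first column is the unit normal. In the others, a barycentric gradient and its normal part
   are each at most 1 / r long. *)
have dB : `|\det B'| <= n.+1`!%:R * (2 / r) ^+ n.
  pose beta (j : 'I_n.+1) : R := if j == ord0 then 1 else 2 / r.
  have -> : (2 / r) ^+ n = \prod_j beta j.
    by rewrite big_ord_recl {1}/beta eqxx mul1r prodr_const card_ord.
  apply: norm_det_le => i j; rewrite /beta /B' /B mxE.
  case: fintype.splitP => k jk.
    have -> : j = ord0 by apply/val_inj; rewrite /= jk; case: (k) => -[].
    rewrite eqxx.
    rewrite [nv^T _ _]mxE (ord1 k); apply: le_trans (ler_coord_enorm _ _) _.
    by rewrite enormZ gtr0_norm ?invr_gt0// mulVf ?gt_eqF.
  have /negPf -> : j != ord0 by rewrite -val_eqE /= jk.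
  rewrite Gj; apply: le_trans (ler_coord_enorm _ _) _.
  have wr : enorm (w k) <= r^-1.
    by rewrite -[r^-1]mul1r ler_pdivlMr// (bgrad_bound sK Kr)// eK// ltnS.
  apply: le_trans (ler_enormB _ _) _; rewrite enormZ.
  have nve1 : enorm nv = 1 by rewrite /enorm nv1 sqrtr1.
  have := cauchy_schwarz_dotv nv (w k); rewrite nve1 mul1r mulr1 => h.
  have -> : 2 / r = r^-1 + r^-1 by ring.
  by apply: lerD => //; exact: le_trans h wr.
have dB0 : 0 < `|\det B'|.
  rewrite normr_gt0; apply/eqP => B0; move: dAB.
  by rewrite B0 mulr0 => /esym/eqP; rewrite oner_eq0.
have dA : `|\det A'| = `|\det B'|^-1.
  have := congr1 (fun x : R => `|x|) dAB; rewrite normrM normr1 => h.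
  by apply: (mulIf (lt0r_neq0 dB0)); rewrite h mulVf ?lt0r_neq0.
rewrite /gram dG sqrtr_sqr dA -[leLHS]invrK.
rewrite lef_pV2 ?posrE ?invr_gt0 ?divr_gt0 ?exprn_gt0 ?divr_gt0 ?ltr0n ?fact_gt0//.
by rewrite invf_div -exprVn invf_div.
Qed.

End face_measure.

(** * Jumps across interior faces *)

Section face_jumps.
Context {R : realType} {n : nat}.
Local Notation Rd := 'rV[R]_n.+1.
Variables (Om : set Rd) (Th : {fset {fset Rd}}).
Hypotheses (hOm : lipschitz_domain Om) (hTh : conforming_mesh Om Th).
Implicit Types (K F : {fset Rd}) (a b x y z : Rd).

Let d0 : (0 < n.+1)%N := ltn0Sn n.
Let sK K : K \in Th -> simplex K.
Proof. exact: (mesh_simplex hTh). Qed.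

(** The conditions defining the outward normal determine it: a vector orthogonal to the facet gives
    an affine function vanishing there, hence a multiple of the coordinate of b, and length and sign
    fix the factor. *)
Lemma normalE K b : simplex K -> b \in K ->
  normal K (K `\ b)%fset = - (enorm (bgrad K b))^-1 *: bgrad K b.
Proof.
move=> hK bK; set g := bgrad K b; set F := (K `\ b)%fset.
have g0 : 0 < enorm g by rewrite enorm_gt0 bgrad_neq0.
have FE x : x \in F -> bary K b x = 0.
  by rewrite !inE => /andP[xb xK]; rewrite bary_vertex0.
pose P := [set nu | [/\ enorm nu = 1, forall x y, x \in F -> y \in F -> dotv nu (x - y) = 0 &
    forall x a, x \in F -> a \in K -> a \notin F -> dotv nu (a - x) < 0]].
have P0 : P (- (enorm g)^-1 *: g).
  split.
  - by rewrite enormZ normrN gtr0_norm ?invr_gt0// mulVf ?gt_eqF.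
  - move=> x y xF yF; rewrite dotvZl -affB -!/(bary _ _ _) !FE//.
    by rewrite subrr mulr0.
  - move=> x a xF aK; rewrite !inE aK andbT negbK => /eqP ->.
    rewrite dotvZl -affB -!/(bary _ _ _) (FE x xF) (bary_vertex1 hK bK).
    by rewrite subr0 mulr1 oppr_lt0 invr_gt0.
have [x0 x0F] : exists x0, x0 \in F.
  apply/fset0Pn; rewrite -cardfs_gt0.
  by have := cardfsD1 b K; rewrite bK hK.1 add1n => -[<-].
have [nu1 nu2 nu3] : P (normal K F) by exact: (@xgetPex _ 0 P (ex_intro _ _ P0)).
move: nu1 nu2 nu3; set nu := normal K F => nu1 nu2 nu3.
pose l : R * Rd := (- dotv nu x0, nu).
have lE x : aff l x = dotv nu (x - x0) by rewrite /aff dotvBr addrC.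
have lF c : c \in K -> c != b -> aff l c = 0.
  by move=> cK cb; rewrite lE nu2// !inE cb.
have [/= nuE _] := aff_facet hK bK lF.
have lb : aff l b < 0 by rewrite lE nu3// !inE eqxx.
rewrite nuE -/g; congr (_ *: _).
move: nu1; rewrite nuE -/g enormZ ltr0_norm// => h.
by apply/eqP; rewrite -eqr_oppLR; apply/eqP/(mulIf (lt0r_neq0 g0)); rewrite h mulVf ?gt_eqF.
Qed.

Lemma enorm_normal K b : simplex K -> b \in K -> enorm (normal K (K `\ b)%fset) = 1.
Proof.
move=> hK bK; have g0 : 0 < enorm (bgrad K b) by rewrite enorm_gt0 bgrad_neq0.
by rewrite normalE// enormZ normrN gtr0_norm ?invr_gt0// mulVf ?gt_eqF.
Qed.

Section neighbours.
Variables (K K' : {fset Rd}) (b : Rd).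
Hypotheses (KT : K \in Th) (K'T : K' \in Th) (bK : b \in K) (K'K : K' != K)
  (s : (K `\ b `<=` K')%fset).

Lemma facet_other : exists b', [/\ b' \in K', K' `\ b' = K `\ b &
  normal K' (K `\ b) = - normal K (K `\ b)]%fset.
Proof.
have KK' : K != K' by rewrite eq_sym.
have [b' [b'K' K'E bb']] := opposite_side d0 hTh KT K'T bK KK' s.
have b'F : b' \notin (K `\ b)%fset.
  apply: contraTN bb'; rewrite !inE => /andP[h1 h2].
  by rewrite (bary_vertex0 (sK KT) bK h2 h1) ltxx.
have FE : (K' `\ b' = K `\ b)%fset.
  by rewrite {1}K'E; apply/fsetP => x; rewrite !inE; have [->|] := eqVneq x b'; rewrite //=;
    move: b'F; rewrite !inE => /negbTE ->.
exists b'; split => //.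
have lF c : c \in K' -> c != b' -> aff (bary_fun K b) c = 0.
  move=> cK' cb'; have : c \in (K' `\ b')%fset by rewrite !inE cb'.
  by rewrite FE !inE => /andP[h1 h2]; exact: (bary_vertex0 (sK KT) bK h2 h1).
have [gE _] := aff_facet (sK K'T) b'K' lF.
have nK' := normalE (sK K'T) b'K'; rewrite FE in nK'.
rewrite -/(bgrad K b) -/(bary K b b') in gE.
rewrite nK' (normalE (sK KT) bK) gE enormZ (ltr0_norm bb') -scaleNr scalerA.
have g'0 : enorm (bgrad K' b') != 0.
  by rewrite gt_eqF// enorm_gt0 bgrad_neq0//; exact: sK.
by congr (_ *: _); field; rewrite g'0/= lt_eqF.
Qed.

Lemma face_jumpE q : face_jump Th (K `\ b)%fset q = dotv (q K - q K') (normal K (K `\ b)%fset).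
Proof.
have [b' [b'K' FE nE]] := facet_other.
rewrite /face_jump big_mkcond (big_fsetD1 K)//= fsubD1set.
rewrite (big_fsetD1 K')/=; last by rewrite !inE K'K.
rewrite s big_seq big1 ?addr0; last first.
  move=> K1; rewrite !inE => /and3P[n1 n2 K1T]; case: ifPn => // s1; exfalso.
  have := @at_most_two _ _ _ _ d0 hTh K K1 K' b KT bK.
  rewrite !nbrsE K1T K'T s s1 n2 K'K => /(_ isT isT isT isT) E.
  by rewrite E eqxx in n1.
by rewrite nE dotvBl dotvNr.
Qed.

Lemma face_jump_le q : `|face_jump Th (K `\ b)%fset q| <= enorm (q K - q K').
Proof.
rewrite face_jumpE; apply: le_trans (cauchy_schwarz_dotv _ _) _.
by rewrite (enorm_normal (sK KT) bK) mulr1.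
Qed.

(** The two affine pieces agree on the facet, so their gradients differ by a multiple of the normal:
    the normal jump is the whole jump. *)
Lemma face_jump_gradK (v : Rd -> R) : (forall K1, K1 \in Th -> affine_on (hull K1) v) ->
  `|face_jump Th (K `\ b)%fset (fun K1 => gradK K1 v)| = enorm (gradK K v - gradK K' v).
Proof.
move=> av; rewrite face_jumpE.
have /affine_onP[l lE] := av K KT; have /affine_onP[l' l'E] := av K' K'T.
rewrite (gradK_unique (sK KT) lE) (gradK_unique (sK K'T) l'E).
pose l0 : R * Rd := (l.1 - l'.1, l.2 - l'.2).
have l0E x : aff l0 x = aff l x - aff l' x by rewrite /aff /= dotvBl; ring.
have lF c : c \in K -> c != b -> aff l0 c = 0.
  move=> cK cb; have cK' : c \in K' by apply: (fsubsetP s); rewrite !inE cb.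
  by rewrite l0E -(lE _ (hull_vertex (sK KT) cK)) -(l'E _ (hull_vertex (sK K'T) cK')) subrr.
have [/= -> _] := aff_facet (sK KT) bK lF.
rewrite (normalE (sK KT) bK) dotvZl dotvZr -sqr_enorm enormZ !normrM normrN.
have g0 : 0 < enorm (bgrad K b) by rewrite enorm_gt0 (bgrad_neq0 d0 (sK KT) bK).
rewrite normfV (ger0_norm (ltW g0)).
by field; rewrite gt_eqF.
Qed.

End neighbours.

(** Up to a dimensional factor, h_F times the area of F; it is of order h^d and is the weight of a
    squared jump in the estimators. *)
Definition face_weight F : R := hF Th F * gram F.

Variable (L : R).
Hypothesis hL : forall K, K \in Th -> exists c r, regular L K c r.

Lemma hull_facet_vertex K b x : simplex K -> x \in (K `\ b)%fset -> hull (K `\ b)%fset x.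
Proof.
move=> hK xF; apply/(hull_faceE _ hK); first exact: fsubD1set.
move: (xF); rewrite !inE => /andP[xb xK]; split; first exact: hull_vertex.
move=> a aK aF; rewrite bary_vertex0//.
by apply: contraNneq aF => <-.
Qed.

Lemma le_hF K F : n = 0%N -> K \in Th -> (F `<=` K)%fset -> hK K <= hF Th F.
Proof.
move=> n0 KT s; have e : (n.+1 == 1)%N by rewrite n0.
rewrite /hF e.
have : K \in (Th : seq {fset Rd}) by [].
elim: (Th : seq {fset Rd}) => // K1 t IH; rewrite inE big_cons.
by case/orP => [/eqP <-|/IH h]; rewrite ?s; [|case: ifP => // _]; rewrite le_max ?lexx ?h ?orbT.
Qed.

(** For d > 1 the facet contains an edge of K; for d = 1 the convention for h_F as a largest
    diameter is used. *)
Lemma hF_ge_radius K c r b : K \in Th -> regular L K c r -> b \in K -> r <= hF Th (K `\ b)%fset.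
Proof.
move=> KT Kr bK; have [n0|n0] := eqVneq n 0%N.
  apply: le_trans (hK_ge_radius d0 Kr) _; apply: le_hF => //; exact: fsubD1set.
rewrite /hF eqSS (negbTE n0).
have [x [y [xF yF xy]]] : exists x y, [/\ x \in K `\ b, y \in K `\ b & y != x]%fset.
  have hc := facet_card hTh KT bK.
  have /fset0Pn[x xF] : (K `\ b)%fset != fset0 by rewrite -cardfs_gt0 hc.
  have /fset0Pn[y] : (K `\ b `\ x)%fset != fset0.
    rewrite -cardfs_gt0; have := cardfsD1 x (K `\ b)%fset; rewrite xF hc add1n => -[<-].
    by rewrite lt0n.
  by rewrite in_fsetD1 => /andP[yx yF]; exists x, y.
have xK : x \in K by move: xF; rewrite !inE => /andP[].
have yK : y \in K by move: yF; rewrite !inE => /andP[].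
apply: le_trans (regular_edge (sK KT) Kr xK yK xy) _.
by apply: ediam_hull_ge; apply: hull_facet_vertex => //; exact: sK.
Qed.

Definition face_cst : R := (2 ^+ n * n.+1`!%:R * L ^+ n.+1)^-1.

Lemma face_weight_ge K b : K \in Th -> b \in K ->
  face_cst * hK K ^+ n.+1 <= face_weight (K `\ b)%fset.
Proof.
move=> KT bK; have [c [r Kr]] := hL KT; have [r0 _ hr] := Kr.
have L1 := regular_ge1 d0 hL KT; have L0 : 0 < L by exact: lt_le_trans L1.
have f0 : 0 < n.+1`!%:R :> R by rewrite ltr0n fact_gt0.
apply: (@le_trans _ _ (r * ((r / 2) ^+ n / n.+1`!%:R))); last first.
  apply: ler_pM; rewrite ?(ltW r0) ?divr_ge0 ?exprn_ge0 ?divr_ge0 ?(ltW r0) ?(ltW f0)//.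
    exact: hF_ge_radius Kr bK.
  exact: gram_ge (sK KT) Kr bK.
have -> : r * ((r / 2) ^+ n / n.+1`!%:R) = face_cst * (L * r) ^+ n.+1.
  rewrite /face_cst [(L * r) ^+ _]exprMn expr_div_n !exprS; field.
  by rewrite !expf_neq0 ?gt_eqF.
have h0 := hK_gt0 d0 hL KT.
rewrite ler_pM2l; last by rewrite invr_gt0 !mulr_gt0 ?exprn_gt0.
by rewrite lerXn2r// nnegrE ltW// mulr_gt0.
Qed.

Let M := star_bound (d := n.+1) L.

(** The powers of L come from two chains, one around z and one around a vertex a of its patch, each
    shorter than [M] and losing a factor L per step. *)
Definition patch_cst : R := face_cst / (L ^+ M * L ^+ M) ^+ n.+1.

(** Every face crossed in the local argument at z has weight of order at least h^d, with h the
    diameter of any chosen simplex at z, so that an energy on that face bounds the pointwise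
    jump. *)
Lemma face_weight_patch z a K0 K K1 b : Om z -> K0 \in Th -> K \in Th -> z \in K0 -> z \in K ->
  a \in K -> a = z \/ ~ Om a -> reach Th a K K1 -> b \in K1 -> b != a ->
  interior_face Th (K1 `\ b)%fset ->
  patch_cst * hK K0 ^+ n.+1 <= face_weight (K1 `\ b)%fset.
Proof.
move=> Oz K0T KT zK0 zK aK az rK bK1 ba iF.
have [K1T aK1] := reach_mem KT aK rK.
have L1 := regular_ge1 d0 hL KT; have L0 : 0 < L by exact: lt_le_trans L1.
have h0 := hK_gt0 d0 hL K0T; have h1 := hK_gt0 d0 hL K1T.
have LM : 0 < L ^+ M * L ^+ M by rewrite mulr_gt0 ?exprn_gt0.
have c0 : 0 < face_cst by rewrite invr_gt0 !mulr_gt0 ?exprn_gt0 ?ltr0n ?fact_gt0.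
have [n0|n0] := posnP n; last first.
  have hKK1 : hK K0 <= L ^+ M * L ^+ M * hK K1.
    rewrite -mulrA; apply: le_trans (hK_reach d0 hTh hL _ K0T zK0 _) _ => //.
      exact: (reach_interior d0 hOm hTh K0T KT zK0 zK Oz).
    rewrite ler_pM2l ?exprn_gt0//.
    exact: (hK_reach d0 hTh hL _ KT aK rK).
  apply: le_trans (face_weight_ge K1T bK1).
  rewrite /patch_cst -mulrA ler_pM2l// mulrC ler_pdivrMr ?exprn_gt0// -exprMn mulrC.
  by rewrite lerXn2r// nnegrE ltW// mulr_gt0.
(* Dimension one, where neighbouring diameters are unrelated: the facet is the single point a. Being
   interior it lies in Om, so a = z, and h_F is at least the length of K0 because K0 contains z. *)
have F1 x : x \in (K1 `\ b)%fset -> x = a.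
  have /eqP/cardfs1P[y yE] : #|` (K1 `\ b)%fset| = 1%N.
    by rewrite (facet_card hTh K1T bK1) n0.
  have : a \in (K1 `\ b)%fset by rewrite !inE eq_sym ba.
  by rewrite yE !inE => /eqP -> /eqP ->.
have aF : a \in (K1 `\ b)%fset by rewrite !inE eq_sym ba.
have ra : relint K1 b a.
  split; first by apply: (bary_vertex0 (sK K1T) bK1 aK1); rewrite eq_sym.
  move=> e eK eb; have -> : e = a by apply: F1; rewrite !inE eb.
  by rewrite (bary_vertex1 (sK K1T) aK1) ltr01.
have Oa := interior_relint_Om d0 hOm hTh K1T bK1 iF ra.
have {az}az : a = z by case: az.
have s0 : (K1 `\ b `<=` K0)%fset by apply/fsubsetP => x /F1 ->; rewrite az.
have [c [r Kr]] := hL K1T.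
have := gram_ge (sK K1T) Kr bK1; have := le_hF n0 K0T s0.
rewrite /face_weight; move: (gram _) (hF _ _) => gr hf.
have cst1 : patch_cst <= 1.
  rewrite /patch_cst ler_pdivrMr ?exprn_gt0// mul1r.
  apply: (@le_trans _ _ 1); last by rewrite exprn_ege1// mulr_ege1 ?exprn_ege1.
  rewrite /face_cst invf_le1; last by rewrite !mulr_gt0 ?exprn_gt0 ?ltr0n ?fact_gt0.
  by rewrite !mulr_ege1 ?exprn_ege1 ?ler1n ?fact_gt0.
have -> : hK K0 ^+ n.+1 = hK K0 by move: (hK K0) => t; rewrite n0 expr1.
have -> : (r / 2) ^+ n / n.+1`!%:R = 1 by rewrite n0 expr0 divr1.
move=> h gr1; apply: (@le_trans _ _ (hK K0)); first by rewrite ler_piMl// ltW.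
by rewrite -[leLHS]mulr1; apply: ler_pM => //; rewrite ltW.
Qed.

End face_jumps.

(** * Finite element functions *)

Section finite_element_space.
Context {R : realType} {n : nat}.
Local Notation Rd := 'rV[R]_n.+1.
Variables (Om : set Rd) (Th : {fset {fset Rd}}).
Hypotheses (hOm : lipschitz_domain Om) (hTh : conforming_mesh Om Th).
Implicit Types (K F : {fset Rd}) (a b x y z : Rd) (v w : Rd -> R).

Let d0 : (0 < n.+1)%N := ltn0Sn n.
Let sK K : K \in Th -> simplex K.
Proof. exact: (mesh_simplex hTh). Qed.
Let mOm : measurable Om.
Proof. by apply: open_measurable_row; case: hOm. Qed.

Lemma interior_verticesP z :
  z \in interior_vertices Om Th <-> Om z /\ exists2 K, K \in Th & z \in K.
Proof.
rewrite /interior_vertices !inE/=; split.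
  by move=> /andP[/imfset2P[K KT [y yK ->]] /set_mem Oz]; split => //; exists K.
move=> [Oz [K KT zK]]; apply/andP; split; last exact: mem_set.
by apply/imfset2P; exists K => //; exists z.
Qed.

Lemma Vh_lin (s : R) v w : Vh Om Th v -> Vh Om Th w -> Vh Om Th (fun x => s * v x + w x).
Proof.
move=> [[g Hv] av v0] [[h Hw] aw w0]; split.
- by exists (fun x => s *: g x + h x); exact: H10_grad_lin.
- move=> K KT; have [g1 [c1 e1]] := av K KT; have [g2 [c2 e2]] := aw K KT.
  exists (s *: g1 + g2), (s * c1 + c2) => x Kx.
  by rewrite e1// e2// dotvDl dotvZl; ring.
- by move=> x Ox; rewrite v0// w0// mulr0 addr0.
Qed.

Lemma Vh_0 : Vh Om Th (fun=> 0).
Proof.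
split => //; first exact: H10_0.
by move=> K _; exists 0, 0 => x _; rewrite dotv0l addr0.
Qed.

Lemma VhB v w : Vh Om Th v -> Vh Om Th w -> Vh Om Th (fun x => v x - w x).
Proof.
move=> Hv Hw; have -> : (fun x => v x - w x) = (fun x => -1 * w x + v x).
  by apply/funext => x; ring.
exact: Vh_lin.
Qed.

Lemma Vh_sum (I : Type) (r : seq I) (c : I -> R) (f : I -> Rd -> R) :
  (forall i, Vh Om Th (f i)) -> Vh Om Th (fun x => \sum_(i <- r) c i * f i x).
Proof.
move=> hf; elim: r => [|i r IH].
  by rewrite (_ : (fun _ => _) = fun=> 0); [exact: Vh_0|apply/funext => x; rewrite big_nil].
rewrite (_ : (fun _ => _) = fun x => c i * f i x + \sum_(j <- r) c j * f j x).
  exact: Vh_lin.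
by apply/funext => x; rewrite big_cons.
Qed.

Lemma affine_on_hull K v (l : R * Rd) : simplex K -> affine_on (hull K) v ->
  (forall b, b \in K -> v b = aff l b) -> forall x, hull K x -> v x = aff l x.
Proof.
move=> hK /affine_onP[l' l'E] h.
suff -> : l = l' by [].
by apply: (aff_inj hK) => a aK; rewrite -h// l'E//; exact: hull_vertex.
Qed.

Lemma gradK_vertices K v (l : R * Rd) : simplex K -> affine_on (hull K) v ->
  (forall b, b \in K -> v b = aff l b) -> gradK K v = l.2.
Proof. by move=> hK av h; apply: (gradK_unique hK); exact: affine_on_hull. Qed.

Lemma gradKB K v w : simplex K -> affine_on (hull K) v -> affine_on (hull K) w ->
  gradK K (fun x => v x - w x) = gradK K v - gradK K w.
Proof.
move=> hK /affine_onP[l lE] /affine_onP[l' l'E].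
rewrite (gradK_unique hK lE) (gradK_unique hK l'E).
rewrite (@gradK_unique _ _ K _ (l.1 - l'.1, l.2 - l'.2) hK)// => x Kx.
by rewrite lE// l'E// /aff /= dotvBl; ring.
Qed.

Lemma gradK_diff K v x y : simplex K -> affine_on (hull K) v -> hull K x -> hull K y ->
  v x - v y = dotv (gradK K v) (x - y).
Proof.
move=> hK /affine_onP[l lE] Kx Ky.
by rewrite (gradK_unique hK lE) !lE// affB.
Qed.

Lemma open_pos K : open (pos K).
Proof.
rewrite openE => x px; have [r r0 h] := pos_near px.
apply: (nbhs_enorm r0) => y; exact: h.
Qed.

Lemma wgradP v : Vh Om Th v -> H10_grad Om v (wgrad Om v).
Proof. by move=> [[g Hg] _ _]; exact: (@xgetPex _ _ [set g | H10_grad Om v g] (ex_intro _ g Hg)). Qed.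

Lemma wgrad_gradK K v : Vh Om Th v -> K \in Th ->
  (vol R n.+1).-negligible [set x | pos K x /\ wgrad Om v x <> gradK K v].
Proof.
move=> Hv KT; have [_ av _] := Hv; have /affine_onP[l lE] := av K KT.
have pO : pos K `<=` Om by move=> x; exact: (pos_Om hOm hTh KT).
have vE x : pos K x -> v x = l.1 + dotv (gradK K v) x.
  by move=> px; rewrite (gradK_unique (sK KT) lE); apply: lE; exact: pos_hull (sK KT) px.
exact: (weak_grad_affine mOm (wgradP Hv) (@open_pos K) pO vE).
Qed.

Lemma hull_pos_null K : simplex K -> (vol R n.+1).-negligible (hull K `\` pos K).
Proof.
move=> hK.
have hb b : b \in K -> (vol R n.+1).-negligible [set x | bary K b x = 0].
  move=> bK; exists [set x | dotv (bgrad K b) x = - (bary_fun K b).1]; split.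
  - have := @continuous_measurable_row R _ _ (@continuous_dotv R _ (bgrad K b)) measurableT [set - (bary_fun K b).1] (measurable_set1 _).
    by rewrite setTI.
  - by apply: vol_hyperplane; exact: bgrad_neq0 hK bK.
  - by move=> x /=; rewrite /bary /aff => /eqP; rewrite addrC addr_eq0 => /eqP.
have : forall s : seq Rd, {subset s <= K} ->
    (vol R n.+1).-negligible [set x | exists2 b, b \in s & bary K b x = 0].
  elim=> [_|b s IH sK']; first by apply: negligibleS (@negligible_set0 _ _ _ _) => x [].
  apply: negligibleS (negligibleU (hb b _) (IH _)).
  - by move=> x [c]; rewrite inE => /orP[/eqP ->|cs xc]; [left|right; exists c].
  - by apply: sK'; rewrite inE eqxx.
  - by move=> c cs; apply: sK'; rewrite inE cs orbT.
move=> /(_ K (fun _ h => h)); apply: negligibleS => x [Kx nx]; apply: contrapT => h.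
apply: nx => b bK; rewrite lt_def ((hullE x hK).1 Kx b bK) andbT.
by apply/eqP => b0; apply: h; exists b.
Qed.

Variable phi : Rd -> Rd -> R.
Hypothesis hphi : nodal_basis Om Th phi.

Definition interp (f : Rd -> R) : Rd -> R :=
  fun x => \sum_(z <- interior_vertices Om Th) f z * phi z x.

Lemma Vh_interp f : Vh Om Th (interp f).
Proof.
rewrite /interp; pose phi' z := if z \in interior_vertices Om Th then phi z else fun=> 0.
rewrite (_ : (fun _ => _) = fun x => \sum_(z <- interior_vertices Om Th) f z * phi' z x).
  apply: Vh_sum => z; rewrite /phi'; case: ifPn => [/hphi[]//|_]; exact: Vh_0.
by apply/funext => x; rewrite big_seq [RHS]big_seq; apply: eq_bigr => z zI; rewrite /phi' zI.
Qed.

Lemma interp_vertex f z : z \in interior_vertices Om Th -> interp f z = f z.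
Proof.
move=> zI; rewrite /interp (big_fsetD1 z)//= (hphi zI).2// eqxx mulr1 big_seq big1 ?addr0//.
move=> y; rewrite !inE => /andP[yz yI].
have yI' : y \in interior_vertices Om Th by rewrite !inE.
by rewrite (hphi yI').2// (negbTE yz) mulr0.
Qed.

Lemma Vh_vertices v w : Vh Om Th v -> Vh Om Th w ->
  (forall z, z \in interior_vertices Om Th -> v z = w z) -> v = w.
Proof.
move=> Hv Hw h; have [_ av v0] := Hv; have [_ aw w0] := Hw.
apply/funext => x; have [Ox|Ox] := EM (Om x); last by rewrite v0// w0.
have [K KT Kx] : exists2 K, K \in Th & hull K x.
  by apply: (closure_hull hTh); exact: subset_closure.
have /affine_onP[l lE] := aw K KT.
rewrite lE//; apply: (affine_on_hull (sK KT) (av K KT)) => // b bK.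
rewrite -lE; last exact: hull_vertex (sK KT) bK.
have [Ob|Ob] := EM (Om b); last by rewrite v0// w0.
by apply: h; apply/interior_verticesP; split => //; exists K.
Qed.

Lemma Vh_expand v : Vh Om Th v -> v = interp v.
Proof.
by move=> Hv; apply: Vh_vertices (Vh_interp v) _ => // z zI; rewrite interp_vertex.
Qed.

(** Interpolation puts 0 at boundary vertices, so it reproduces the affine function on every simplex
    at whose boundary vertices that function vanishes. *)
Lemma interp_aff K (l : R * Rd) : K \in Th -> (forall b, b \in K -> ~ Om b -> aff l b = 0) ->
  (forall x, hull K x -> interp (aff l) x = aff l x) /\ gradK K (interp (aff l)) = l.2.
Proof.
move=> KT h; have [_ av v0] := Vh_interp (aff l).
have e b : b \in K -> interp (aff l) b = aff l b.
  move=> bK; have [Ob|Ob] := EM (Om b); last by rewrite v0// h.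
  by apply: interp_vertex; apply/interior_verticesP; split => //; exists K.
split; first exact: affine_on_hull (sK KT) (av K KT) e.
exact: gradK_vertices (sK KT) (av K KT) e.
Qed.

End finite_element_space.

(** * Pairs of boundary planes *)

Section boundary_planes.
Context {R : realType} {d : nat}.
Local Notation Rd := 'rV[R]_d.
Implicit Types (l : R * Rd).

(* l0 and l1 stand for two boundary planes: if they are not parallel, the
   multiples of their normals are uniformly transversal; if they are parallel
   and distinct, aff l0 is a nonzero constant on the second one. *)
Definition plane_bound (l0 l1 : R * Rd) (k : R) := forall s0 s1 a1 e,
  aff l1 a1 = 0 -> aff l0 a1 != 0 ->
  enorm (s0 *: l0.2 - s1 *: l1.2) <= e -> `|s0 * aff l0 a1| <= e ->
  enorm (s0 *: l0.2) <= k * e.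

(** q is the part of the first normal orthogonal to the second. If q is nonzero, testing with q
    isolates s0. If q = 0 the planes are parallel, [aff l0] is constant on the second one, and a
    bound for its multiple by s0 bounds s0. *)
Lemma plane_boundP l0 l1 : l1.2 != 0 -> exists2 k : R, 0 <= k & plane_bound l0 l1 k.
Proof.
move=> n1; have n1p : 0 < dotv l1.2 l1.2 by rewrite -sqr_enorm exprn_gt0// enorm_gt0.
pose mu := dotv l0.2 l1.2 / dotv l1.2 l1.2.
pose q := l0.2 - mu *: l1.2.
have [q0|q0] := eqVneq q 0.
  have l0E : l0.2 = mu *: l1.2 by apply/eqP; rewrite -subr_eq0; apply/eqP.
  pose dl := l0.1 - mu * l1.1.
  exists (enorm l0.2 / `|dl|); first by rewrite divr_ge0 ?enorm_ge0.
  move=> s0 s1 a1 e h1 h0 _.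
  have -> : aff l0 a1 = dl.
    move: h1; rewrite /aff l0E dotvZl /dl => /eqP; rewrite addr_eq0 => /eqP ->; ring.
  move: h0; have -> : aff l0 a1 = dl.
    move: h1; rewrite /aff l0E dotvZl /dl => /eqP; rewrite addr_eq0 => /eqP ->; ring.
  rewrite -normr_gt0 => dl0; rewrite normrM enormZ => h.
  by rewrite mulrAC ler_pdivlMr// mulrAC [leRHS]mulrC ler_wpM2r// enorm_ge0.
have qp : 0 < enorm q by rewrite enorm_gt0.
have q1 : dotv q l1.2 = 0.
  by rewrite /q dotvBl dotvZl /mu divfK ?gt_eqF// subrr.
exists (enorm l0.2 / enorm q); first by rewrite divr_ge0 ?enorm_ge0.
move=> s0 s1 a1 e _ _ h _.
have h2 : `|s0| * enorm q <= e.
  rewrite -(ler_pM2l qp); apply: (@le_trans _ _ (enorm q * enorm (s0 *: l0.2 - s1 *: l1.2))); last first.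
    by rewrite ler_pM2l.
  apply: le_trans (cauchy_schwarz_dotv _ _).
  rewrite dotvBr !dotvZr q1 mulr0 subr0 normrM.
  have -> : dotv q l0.2 = enorm q ^+ 2.
    rewrite sqr_enorm {3}/q dotvBr dotvZr q1 mulr0 subr0 //.
  by rewrite (ger0_norm (sqr_ge0 _)) expr2 mulrCA.
by rewrite enormZ mulrAC ler_pdivlMr// mulrAC [leRHS]mulrC ler_wpM2r// enorm_ge0.
Qed.

Lemma uniform_bound (I : eqType) (s : seq I) (Q : I -> R -> Prop) :
  (forall i k k', Q i k -> k <= k' -> Q i k') ->
  (forall i, i \in s -> exists2 k : R, 0 <= k & Q i k) ->
  exists2 k : R, 0 <= k & forall i, i \in s -> Q i k.
Proof.
move=> mQ; elim: s => [_|i s IH h]; first by exists 0.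
have [|k k0 hk] := IH; first by move=> j js; apply: h; rewrite inE js orbT.
have [|k1 k10 hk1] := h i; first by rewrite inE eqxx.
exists (k + k1); first by rewrite addr_ge0.
move=> j; rewrite inE => /orP[/eqP ->|js].
  by apply: mQ hk1 _; rewrite lerDr.
by apply: mQ (hk j js) _; rewrite lerDl.
Qed.

(** One constant serves the finitely many pairs of facet planes of the reference mesh; it is
    therefore fixed before the computational mesh. *)
Lemma mesh_planes (Th0 : {fset {fset Rd}}) : (0 < d)%N -> (forall K, K \in Th0 -> simplex K) ->
  exists2 k : R, 0 <= k & forall K0 b0 K1 b1, K0 \in Th0 -> b0 \in K0 -> K1 \in Th0 -> b1 \in K1 ->
    plane_bound (bary_fun K0 b0) (bary_fun K1 b1) k.
Proof.
move=> d0 sK.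
pose P := [seq (K, b) | K <- Th0, b <- (K : {fset Rd})] : seq ({fset Rd} * Rd).
pose Q (p : ({fset Rd} * Rd) * ({fset Rd} * Rd)) k :=
  plane_bound (bary_fun p.1.1 p.1.2) (bary_fun p.2.1 p.2.2) k.
have [||k k0 hk] := @uniform_bound _ [seq (p, p') | p <- P, p' <- P] Q.
- move=> p k k' h kk' s0 s1 a1 e h1 h0 he he'; apply: le_trans (h s0 s1 a1 e h1 h0 he he') _.
  by rewrite ler_wpM2r//; exact: le_trans (enorm_ge0 _) he.
- move=> _ /allpairsP[[p p'] [/= pP /allpairsPdep[K [b [KT bK ->]]] ->]].
  by apply: plane_boundP; exact: bgrad_neq0 (sK K KT) bK.
exists k => // K0 b0 K1 b1 K0T b0K K1T b1K.
apply: (hk ((K0, b0), (K1, b1))); apply/allpairsP; exists ((K0, b0), (K1, b1)); split => //=.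
  by apply/allpairsPdep; exists K0, b0.
by apply/allpairsPdep; exists K1, b1.
Qed.

End boundary_planes.

(** * Local approximation by affine functions *)

Section domain_diameter.
Context {R : realType} {n : nat}.
Local Notation Rd := 'rV[R]_n.+1.

(** A length of the domain enters because the case of two boundary planes passes from gradients to
    point values. *)
Lemma mesh_diameter (Om : set Rd) : bounded_set Om ->
  exists2 D : R, 0 < D & forall Th K, conforming_mesh Om Th -> K \in Th -> hK K <= D.
Proof.
move=> /bounded_in_box[D D0 OD]; exists (n.+1%:R * (2 * D)).
  by rewrite !mulr_gt0.
move=> Th K hTh KT; have sK := mesh_simplex hTh KT.
have clo x : closure Om x -> forall i, `|x ord0 i| <= D.
  have : closure Om `<=` box (const_mx (- D)) (const_mx D).
    rewrite closureE => y; apply; split.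
      by apply: compact_closed; [exact: norm_hausdorff|exact: compact_box].
    by move=> z Oz i; rewrite !mxE -ler_norml ltW// OD.
  by move=> h /h hx i; have := hx i; rewrite !mxE -ler_norml.
have hD x : hull K x -> forall i, `|x ord0 i| <= D.
  by move=> Kx; apply: clo; exact: (hull_closure hTh KT Kx).
apply: ge_sup.
  exists (enorm (center K - center K)), (center K); first exact: pos_hull (pos_center sK).
  by exists (center K) => //; exact: pos_hull (pos_center sK).
move=> _ [x Kx [y Ky <-]]; apply: ler_enorm_coord; first by rewrite mulr_ge0 ?ltW.
move=> i; rewrite !mxE; apply: le_trans (ler_normB _ _) _.
by have := hD x Kx i; have := hD y Ky i; lra.
Qed.

End domain_diameter.

Lemma subr_sub2l (V : zmodType) (x y z : V) : (x - z) - (x - y) = y - z.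
Proof. by rewrite opprB addrC addrA subrK. Qed.

Section local_approximation.
Context {R : realType} {n : nat}.
Local Notation Rd := 'rV[R]_n.+1.
Variables (Om : set Rd) (Th0 Th : {fset {fset Rd}}).
Hypotheses (hOm : lipschitz_domain Om) (hTh0 : conforming_mesh Om Th0)
  (hTh : conforming_mesh Om Th).
Implicit Types (K F : {fset Rd}) (a b x y z : Rd) (v w : Rd -> R).
Variables (L D kp : R).
Hypothesis hL : forall K, K \in Th -> exists c r, regular L K c r.
Hypothesis hD : forall K, K \in Th -> hK K <= D.
Hypothesis kp0 : 0 <= kp.
Hypothesis hkp : forall K0 b0 K1 b1, K0 \in Th0 -> b0 \in K0 -> K1 \in Th0 -> b1 \in K1 ->
  plane_bound (bary_fun K0 b0) (bary_fun K1 b1) kp.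
Variable phi : Rd -> Rd -> R.
Hypothesis hphi : nodal_basis Om Th phi.

Let d0 : (0 < n.+1)%N := ltn0Sn n.
Let sK K : K \in Th -> simplex K.
Proof. exact: (mesh_simplex hTh). Qed.
Let M := star_bound (d := n.+1) L.

(** The first term suffices when the affine substitute is nonzero or the patch avoids the boundary;
    the second is [kp] times the error of the case of two boundary planes. *)
Definition approx_cst : R := 3 * M%:R + 6 * kp * M%:R * (1 + D).

Variables (w : Rd -> R) (z : Rd) (E : R).
Hypotheses (Hw : Vh Om Th w) (zI : z \in interior_vertices Om Th) (E0 : 0 <= E).
Hypothesis jump_le : forall K a K1 K2, K \in Th -> z \in K -> a \in K -> a = z \/ ~ Om a ->
  reach Th a K K1 -> adj Th a K1 K2 -> enorm (gradK K1 w - gradK K2 w) <= E.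

Let av K : K \in Th -> affine_on (hull K) w.
Proof. by move=> KT; case: Hw => _ + _; apply. Qed.

(** A chain without repetition stays in the star of a, hence has fewer than [M] steps, each costing
    E. *)
Lemma jump_reach K a K' : K \in Th -> z \in K -> a \in K -> a = z \/ ~ Om a ->
  reach Th a K K' -> enorm (gradK K w - gradK K' w) <= M%:R * E.
Proof.
move=> KT zK aK az /reach_uniq[p [pp <- up]].
apply: (@le_trans _ _ ((size p)%:R * E)); last first.
  by rewrite ler_wpM2r// ler_nat ltnW// (path_star_size d0 hTh hL KT aK pp up).
have key : forall q K2, reach Th a K K2 -> path (adj Th a) K2 q ->
    enorm (gradK K2 w - gradK (last K2 q) w) <= (size q)%:R * E.
  elim=> [|K1 q IH] K2 rK2 /=; first by rewrite subrr enorm0 mul0r.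
  move=> /andP[h hq].
  have -> : gradK K2 w - gradK (last K1 q) w =
      (gradK K2 w - gradK K1 w) + (gradK K1 w - gradK (last K1 q) w).
    by rewrite addrA subrK.
  apply: le_trans (ler_enormD _ _) _; rewrite -natr1 mulrDl mul1r addrC lerD//.
    exact: (IH K1 (reach_step rK2 h) hq).
  exact: (jump_le KT zK aK az rK2 h).
exact: (key p K (reach_refl _ _ _) pp).
Qed.

Lemma local_affine : exists wt, [/\ Vh Om Th wt, affine_on (patch_of Th z) wt &
  forall K, K \in Th -> z \in K -> enorm (gradK K w - gradK K wt) <= approx_cst * E].
Proof.
have [Oz [K0 K0T zK0]] := (interior_verticesP Om Th z).1 zI.
have D0 : 0 < D by exact: lt_le_trans (hK_gt0 d0 hL K0T) (hD K0T).
have M0 : 0 <= M%:R :> R by [].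
have ME0 : 0 <= M%:R * E by rewrite mulr_ge0.
have C0 : 0 <= 6 * kp * M%:R * (1 + D) * E by rewrite !mulr_ge0// addr_ge0// ltW.
have CE : approx_cst * E = 3 * (M%:R * E) + 6 * kp * M%:R * (1 + D) * E.
  by rewrite /approx_cst; ring.
have gK K : K \in Th -> z \in K -> enorm (gradK K w - gradK K0 w) <= M%:R * E.
  move=> KT zK; apply: (jump_reach KT zK zK (or_introl erefl)).
  exact: (reach_interior d0 hOm hTh KT K0T zK zK0 Oz).
have bdry K a : K \in Th -> z \in K -> a \in K -> ~ Om a -> exists K' b' s,
    [/\ K' \in Th0, b' \in K', bary K' b' a = 0 &
        enorm (gradK K0 w - s *: bgrad K' b') <= 2 * (M%:R * E)].
  move=> KT zK aK Oa.
  have [K1 [b [rK bK1 ba nF]]] := reach_boundary d0 hOm hTh KT aK Oa.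
  have [K1T aK1] := reach_mem KT aK rK.
  have [K' [b' [K'T b'K' h]]] := boundary_facet_plane d0 hOm hTh0 hTh K1T bK1 nF.
  have /affine_onP[l lE] := av K1T.
  (* All vertices of a boundary facet are outside Om, so w vanishes on it and its gradient on K1 is
     a multiple of the corresponding gradient of the reference mesh. *)
  have lF c : c \in K1 -> c != b -> aff l c = 0.
    move=> cK cb; rewrite -lE; last exact: hull_vertex (sK K1T) cK.
    case: Hw => _ _; apply => Oc; move/negP: nF; apply.
    by apply: (vertex_Om_interior d0 hTh K1T bK1 cK cb) => //; case: hOm.
  have [gE _] := aff_facet (sK K1T) bK1 lF.
  have [bE _] := aff_facet (sK K1T) bK1 h.
  have b0 : aff (bary_fun K' b') b != 0.
    apply/eqP => e; move: bE; rewrite e scale0r => /eqP; apply/negP.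
    exact: bgrad_neq0 d0 (mesh_simplex hTh0 K'T) b'K'.
  exists K', b', (aff l b / aff (bary_fun K' b') b); split => //.
    by apply: h => //; rewrite eq_sym.
  have -> : (aff l b / aff (bary_fun K' b') b) *: bgrad K' b' = gradK K1 w.
    by rewrite /bgrad bE scalerA divfK// (gradK_unique (sK K1T) lE).
  rewrite -(subr_sub2l (gradK K w)).
  apply: le_trans (ler_enormB _ _) _.
  have -> : 2 * (M%:R * E) = M%:R * E + M%:R * E by ring.
  apply: lerD; last exact: gK.
  by apply: jump_reach KT zK aK _ rK; right.
have fin l c : (forall K b, K \in Th -> z \in K -> b \in K -> ~ Om b -> aff l b = 0) ->
    0 <= c -> c <= 2 -> enorm (gradK K0 w - l.2) <= c * (M%:R * E) ->
    exists wt, [/\ Vh Om Th wt, affine_on (patch_of Th z) wt &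
      forall K, K \in Th -> z \in K -> enorm (gradK K w - gradK K wt) <= approx_cst * E].
  move=> lb c0 c2 hl; exists (interp Om Th phi (aff l)); split.
  - exact: Vh_interp.
  - exists l.2, l.1 => x [K [KT zK Kx]].
    by have [-> //] := interp_aff hOm hTh hphi KT (fun b bK => lb K b KT zK bK).
  - move=> K KT zK; have [_ ->] := interp_aff hOm hTh hphi KT (fun b bK => lb K b KT zK bK).
    have -> : gradK K w - l.2 = (gradK K w - gradK K0 w) + (gradK K0 w - l.2).
      by rewrite addrA subrK.
    apply: le_trans (ler_enormD _ _) _; rewrite CE.
    have := gK K KT zK; have : c * (M%:R * E) <= 2 * (M%:R * E) by rewrite ler_wpM2r.
    by lra.
(* Without boundary vertices in the patch, the affine function that w equals on K0 needs no boundary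
   condition and can be interpolated. *)
have [[a0 [Ka [KaT zKa a0K Oa0]]]|noB] := EM (exists a0 Ka, [/\ Ka \in Th, z \in Ka, a0 \in Ka & ~ Om a0]); last first.
  have /affine_onP[l lE] := av K0T.
  apply: (fin l 0) => //; last by rewrite (gradK_unique (sK K0T) lE) subrr enorm0 mul0r.
  by move=> K b KT zK bK Ob; exfalso; apply: noB; exists b, K.
have [K' [b' [s [K'T b'K' a0P hs]]]] := bdry Ka a0 KaT zKa a0K Oa0.
have [[a1 [Kb [KbT zKb a1K Oa1 a1P]]]|allP] := EM (exists a1 Kb,
    [/\ Kb \in Th, z \in Kb, a1 \in Kb, ~ Om a1 & bary K' b' a1 <> 0]); last first.
  apply: (fin (s * (bary_fun K' b').1, s *: (bary_fun K' b').2) 2) => //.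
  move=> K b KT zK bK Ob; rewrite /aff /= dotvZl -mulrDr -/(aff _ _) -/(bary _ _ _).
  have -> : bary K' b' b = 0; last by rewrite mulr0.
  by apply: contrapT => h; apply: allP; exists b, K.
have [K1' [b1' [s1 [K1'T b1'K1' a1P1 hs1]]]] := bdry Kb a1 KbT zKb a1K Oa1.
(* A second boundary vertex off the plane through a0 leaves no useful affine function in V_h; the
   gradient of w itself must be small and 0 is the substitute. *)
exists (fun=> 0); split; first exact: Vh_0.
  by exists 0, 0 => x _; rewrite dotv0l addr0.
have nK K : K \in Th -> z \in K -> enorm (s *: bgrad K' b' - gradK K w) <= 3 * (M%:R * E).
  move=> KT zK; rewrite -enormN opprB.
  have -> : gradK K w - s *: bgrad K' b' = (gradK K w - gradK K0 w) + (gradK K0 w - s *: bgrad K' b').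
    by rewrite addrA subrK.
  apply: le_trans (ler_enormD _ _) _; have := gK K KT zK; lra.
have sz K a : K \in Th -> z \in K -> a \in K -> enorm (a - z) <= D.
  move=> KT zK aK; apply: le_trans (hD KT).
  by apply: hK_ge; apply: hull_vertex => //; exact: sK.
(* e dominates both hypotheses of [plane_bound]: the two approximate normals differ by at most 4 M
   E, and the value at a1 costs 6 D M E. *)
pose e := 6 * M%:R * (1 + D) * E.
have eE : e = 6 * (M%:R * E) + 6 * D * (M%:R * E) by rewrite /e; ring.
have DME : 0 <= D * (M%:R * E) by rewrite mulr_ge0// ltW.
have sP : enorm (s *: bgrad K' b') <= kp * e.
  apply: (hkp K'T b'K' K1'T b1'K1') a1P1 _ _ _; first exact/eqP.
    rewrite -(subr_sub2l (gradK K0 w)).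
    by apply: le_trans (ler_enormB _ _) _; rewrite eE; lra.
  have w0 : dotv (gradK Ka w) (a0 - z) = dotv (gradK Kb w) (a1 - z).
    rewrite -(gradK_diff (sK KaT) (av KaT)); [|exact: hull_vertex (sK KaT) _|exact: hull_vertex (sK KaT) _].
    rewrite -(gradK_diff (sK KbT) (av KbT)); [|exact: hull_vertex (sK KbT) _|exact: hull_vertex (sK KbT) _].
    by case: Hw => _ _ wv; rewrite (wv _ Oa0) (wv _ Oa1).
  (* As w vanishes at a0 and a1, its increments from z to both are equal. They cancel, and only the
     deviations of the gradients remain. *)
  have -> : s * aff (bary_fun K' b') a1 = dotv (s *: bgrad K' b' - gradK Kb w) (a1 - z)
      - dotv (s *: bgrad K' b' - gradK Ka w) (a0 - z).
    rewrite -[aff _ a1]subr0 -a0P /bary affB -/(bgrad K' b') !dotvBl w0.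
    rewrite !dotvZl [X in s * X](_ : _ = dotv (bgrad K' b') (a1 - z) - dotv (bgrad K' b') (a0 - z)); first by ring.
    by rewrite -dotvBr opprB addrA subrK.
  apply: le_trans (ler_normB _ _) _.
  have h K a : K \in Th -> z \in K -> a \in K ->
      `|dotv (s *: bgrad K' b' - gradK K w) (a - z)| <= 3 * (M%:R * E) * D.
    move=> KT zK aK; apply: le_trans (cauchy_schwarz_dotv _ _) _.
    by apply: ler_pM; rewrite ?enorm_ge0//; [exact: nK|exact: sz zK aK].
  have := h Kb a1 KbT zKb a1K; have := h Ka a0 KaT zKa a0K; rewrite eE; lra.
move=> K KT zK.
have -> : gradK K (fun=> 0 : R) = 0.
  by rewrite (@gradK_unique _ _ K _ (0, 0) (sK KT))// => x _; rewrite /aff dotv0l addr0.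
rewrite subr0 -[gradK K w](subKr (s *: bgrad K' b')).
apply: le_trans (ler_enormB _ _) _.
have := nK K KT zK; rewrite CE.
have -> : 6 * kp * M%:R * (1 + D) * E = kp * e by rewrite /e; ring.
lra.
Qed.

End local_approximation.

(** * The stabilization at a vertex *)

Section measure_of_patches.
Context {R : realType} {n : nat}.
Local Notation Rd := 'rV[R]_n.+1.
Variables (Om : set Rd) (Th : {fset {fset Rd}}).
Hypotheses (hOm : lipschitz_domain Om) (hTh : conforming_mesh Om Th).
Implicit Types (K F : {fset Rd}) (a b x y z : Rd) (v w : Rd -> R).

Let d0 : (0 < n.+1)%N := ltn0Sn n.
Let sK K : K \in Th -> simplex K.
Proof. exact: (mesh_simplex hTh). Qed.

Lemma measurable_hull K : simplex K -> measurable (hull K).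
Proof.
move=> hK; have -> : hull K = \bigcap_(b in [set` K]) (bary K b @^-1` `[0, +oo[%classic).
  apply/seteqP; split => x.
    by move=> /(hullE x hK) h b /= bK; rewrite in_itv/= andbT h.
  by move=> h; apply/(hullE x hK) => b bK; have := h b bK; rewrite /= in_itv/= andbT.
rewrite bigcap_fset; apply: bigsetI_measurable => b _.
have := @continuous_measurable_row R _ _ (@continuous_aff R _ (bary_fun K b)) measurableT
  `[0, +oo[%classic (measurable_itv _).
by rewrite setTI.
Qed.

Lemma patch_ofE z : patch_of Th z = \bigcup_(K in [set` [fset K in Th | z \in K]%fset]) hull K.
Proof.
apply/seteqP; split => x.
  by move=> [K [KT zK Kx]]; exists K => //=; rewrite !inE KT zK.
by move=> [K /=]; rewrite !inE => /andP[KT zK] Kx; exists K.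
Qed.

Lemma measurable_patch z : measurable (patch_of Th z).
Proof.
rewrite patch_ofE bigcup_fset big_seq; apply: bigsetU_measurable => K.
by rewrite !inE => /andP[KT _]; exact: measurable_hull (sK KT).
Qed.

Lemma vol_patch z H : (forall K, K \in Th -> z \in K -> hK K <= H) -> 0 <= H ->
  (vol R n.+1 (patch_of Th z) <= ((2 * H) ^+ n.+1)%:E)%E.
Proof.
move=> hH H0; apply: (@le_trans _ _ (vol R n.+1 (cube z H))); last first.
  by rewrite le_eqVlt; apply/orP; left; apply/eqP; exact: vol_cube.
apply: le_measure; rewrite ?inE; [exact: measurable_patch|exact: measurable_cube|].
move=> x [K [KT zK Kx]]; apply/cubeE => i.
have -> : x ord0 i - z ord0 i = (x - z) ord0 i by rewrite !mxE.
apply: le_trans (ler_coord_enorm _ _) _; apply: le_trans (hH K KT zK).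
by apply: hK_ge => //; exact: hull_vertex (sK KT) zK.
Qed.

(** Outside a null set a point of the patch lies in an open simplex at z, where the weak gradient is
    the elementwise one. *)
Lemma negligible_patch z v w : Vh Om Th v -> Vh Om Th w ->
  (vol R n.+1).-negligible [set x | patch_of Th z x /\
     forall K, K \in Th -> z \in K -> wgrad Om (fun x => v x - w x) x <> gradK K v - gradK K w].
Proof.
move=> Hv Hw.
have Hvw := VhB hOm Hv Hw.
have hN K : K \in Th -> (vol R n.+1).-negligible ((hull K `\` pos K) `|`
    [set x | pos K x /\ wgrad Om (fun x => v x - w x) x <> gradK K (fun x => v x - w x)]).
  move=> KT; apply: negligibleU; first exact: hull_pos_null (sK KT).
  exact: (wgrad_gradK hOm hTh Hvw KT).
have : forall s : seq {fset Rd}, {subset s <= Th} -> (vol R n.+1).-negligible [set x | exists2 K, K \in s &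
    ((hull K `\` pos K) `|` [set x | pos K x /\
      wgrad Om (fun x => v x - w x) x <> gradK K (fun x => v x - w x)]) x].
  elim=> [_|K s IH sT]; first by apply: negligibleS (@negligible_set0 _ _ _ _) => x [].
  apply: negligibleS (negligibleU (hN K _) (IH _)).
  - by move=> x [c]; rewrite inE => /orP[/eqP ->|cs xc]; [left|right; exists c].
  - by apply: sT; rewrite inE eqxx.
  - by move=> c cs; apply: sT; rewrite inE cs orbT.
move=> /(_ Th (fun _ h => h)); apply: negligibleS => x [[K [KT zK Kx]] h].
exists K => //; have [px|px] := EM (pos K x); last by left.
right; split => // e; apply: (h K KT zK); rewrite e.
by apply: gradKB; [exact: sK|case: Hv => _ + _; apply|case: Hw => _ + _; apply].
Qed.

Lemma normL2v_patch z v w A : Vh Om Th v -> Vh Om Th w -> 0 <= A ->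
  (forall K, K \in Th -> z \in K -> enorm (gradK K v - gradK K w) <= A) ->
  (normL2v (patch_of Th z) (wgrad Om (fun x => v x - w x)%R) <=
   A%:E * sqrte (vol R n.+1 (patch_of Th z)))%E.
Proof.
move=> Hv Hw A0 hA.
have mg : measurable_fun setT (wgrad Om (fun x => v x - w x)).
  by have [_ [h _] _] := wgradP (VhB hOm Hv Hw); exact: h.
have -> : (A%:E * sqrte (vol R n.+1 (patch_of Th z)) =
    sqrte ((A ^+ 2)%:E * vol R n.+1 (patch_of Th z)))%E.
  by rewrite sqrteM ?lee_fin ?sqr_ge0//= sqrtr_sqr ger0_norm.
rewrite /normL2v lee_sqrt; last by rewrite mule_ge0// lee_fin sqr_ge0.
rewrite -integral_cst; last exact: measurable_patch.
apply: ae_ge0_le_integral.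
- exact: measurable_patch.
- by move=> x _; rewrite lee_fin sqr_ge0.
- by apply: measurable_sqr_EFin; apply: measurable_enorm; exact: measurable_funTS.
- by move=> x _; rewrite lee_fin sqr_ge0.
- exact: measurable_cst.
apply: negligibleS (negligible_patch z Hv Hw) => x /= /not_implyP[px nle].
split => // K KT zK e; apply: nle; rewrite lee_fin e.
by rewrite lerXn2r ?nnegrE ?enorm_ge0// hA.
Qed.

End measure_of_patches.

Lemma le_sum_seq (R : numDomainType) (I : eqType) (s : seq I) (P : pred I) (f : I -> R) i :
  (forall j, j \in s -> P j -> 0 <= f j) -> i \in s -> P i -> f i <= \sum_(j <- s | P j) f j.
Proof.
move=> f0 si Pi; rewrite big_mkcond; elim: s f0 si => // j s IH f0.
have fs k : k \in s -> P k -> 0 <= f k by move=> ks; apply: f0; rewrite inE ks orbT.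
have s0 : 0 <= \sum_(k <- s) (if P k then f k else 0).
  by rewrite big_seq; apply: sumr_ge0 => k ks; case: ifP => // /(fs k ks).
rewrite inE big_cons => /orP[/eqP <-|/(IH fs) h]; first by rewrite Pi lerDl.
apply: le_trans h _; rewrite lerDr; case: ifP => // Pj.
by apply: f0 => //; rewrite inE eqxx.
Qed.

Section vertex_bounds.
Context {R : realType} {n : nat}.
Local Notation Rd := 'rV[R]_n.+1.
Variables (Om : set Rd) (Th0 Th : {fset {fset Rd}}).
Hypotheses (hOm : lipschitz_domain Om) (hTh0 : conforming_mesh Om Th0)
  (hTh : conforming_mesh Om Th).
Implicit Types (K F : {fset Rd}) (a b x y z : Rd) (v w : Rd -> R).
Variables (L D kp : R).
Hypothesis hL : forall K, K \in Th -> exists c r, regular L K c r.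
Hypothesis hD : forall K, K \in Th -> hK K <= D.
Hypothesis kp0 : 0 <= kp.
Hypothesis hkp : forall K0 b0 K1 b1, K0 \in Th0 -> b0 \in K0 -> K1 \in Th0 -> b1 \in K1 ->
  plane_bound (bary_fun K0 b0) (bary_fun K1 b1) kp.
Variable phi : Rd -> Rd -> R.
Hypothesis hphi : nodal_basis Om Th phi.

Let d0 : (0 < n.+1)%N := ltn0Sn n.
Let sK K : K \in Th -> simplex K.
Proof. exact: (mesh_simplex hTh). Qed.

Definition jump_energy v K : R := \sum_(F <- interior_faces_of Th K)
  face_weight Th F * face_jump Th F (fun K1 => gradK K1 v) ^+ 2.

(** Chains at z may run around any vertex a of the patch and so leave the patch; this sum contains
    every simplex they can visit. *)
Definition patch_sum (f : {fset Rd} -> R) z : R :=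
  \sum_(K <- Th | z \in K) \sum_(a <- K) \sum_(K1 <- Th | a \in K1) f K1.

Lemma interior_facesP K F : simplex K -> F \in interior_faces_of Th K ->
  interior_face Th F /\ exists2 b, b \in K & F = (K `\ b)%fset.
Proof.
rewrite !inE => hK /andP[]; rewrite fpowersetE => FK iF; split => //.
move: (iF) => /andP[/eqP cF _].
have /eqP/cardfs1P[b bE] : #|` (K `\` F)%fset| = 1%N.
  by have := cardfsDS FK; rewrite hK.1 cF subSnn.
have : b \in (K `\` F)%fset by rewrite bE inE.
rewrite in_fsetD => /andP[_ bK]; exists b => //.
apply/fsetP => x; rewrite in_fsetD1; move/fsetP/(_ x): bE; rewrite in_fsetD in_fset1 => <-.
by have [/(fsubsetP FK) ->|] := boolP (x \in F); rewrite //= andNb.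
Qed.

Lemma face_weight_ge0 K b : K \in Th -> b \in K -> 0 <= face_weight Th (K `\ b)%fset.
Proof.
move=> KT bK; apply: le_trans (face_weight_ge hTh hL KT bK).
have L0 : 0 < L by apply: lt_le_trans (regular_ge1 d0 hL KT).
apply: mulr_ge0; first by rewrite invr_ge0 !mulr_ge0 ?exprn_ge0// ltW.
by rewrite exprn_ge0// ltW// (hK_gt0 d0 hL KT).
Qed.

Lemma jump_energy_ge0 v K : K \in Th -> 0 <= jump_energy v K.
Proof.
move=> KT; rewrite /jump_energy big_seq; apply: sumr_ge0 => F FI.
have [_ [b bK ->]] := interior_facesP (sK KT) FI.
by rewrite mulr_ge0 ?sqr_ge0// (face_weight_ge0 KT).
Qed.

Lemma jump_energy_ge v K b : K \in Th -> b \in K -> interior_face Th (K `\ b)%fset ->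
  face_weight Th (K `\ b)%fset * face_jump Th (K `\ b)%fset (fun K1 => gradK K1 v) ^+ 2 <= jump_energy v K.
Proof.
move=> KT bK iF; rewrite /jump_energy.
apply: (@le_sum_seq _ _ _ xpredT (fun F => face_weight Th F * face_jump Th F (fun K1 => gradK K1 v) ^+ 2)) => //.
  move=> F FI _; have [_ [c cK ->]] := interior_facesP (sK KT) FI.
  by rewrite mulr_ge0 ?sqr_ge0// (face_weight_ge0 KT).
by rewrite !inE fpowersetE fsubD1set.
Qed.

Lemma patch_sum_ge f z K a K1 : (forall K, K \in Th -> 0 <= f K) -> K \in Th -> z \in K ->
  a \in K -> K1 \in Th -> a \in K1 -> f K1 <= patch_sum f z.
Proof.
move=> f0 KT zK aK K1T aK1.
have f1 b : 0 <= \sum_(K2 <- Th | b \in K2) f K2.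
  by rewrite big_seq_cond; apply: sumr_ge0 => K2 /andP[/f0].
have f2 K2 : 0 <= \sum_(b <- K2) \sum_(K3 <- Th | b \in K3) f K3 by apply: sumr_ge0.
apply: (@le_trans _ _ (\sum_(K2 <- Th | a \in K2) f K2)).
  by apply: (@le_sum_seq _ _ _ (fun K2 : {fset Rd} => a \in K2) f) => // K2 /f0.
apply: (@le_trans _ _ (\sum_(b <- K) \sum_(K3 <- Th | b \in K3) f K3)).
  exact: (@le_sum_seq _ _ _ xpredT (fun b => \sum_(K3 <- Th | b \in K3) f K3)).
exact: (@le_sum_seq _ _ _ (fun K2 : {fset Rd} => z \in K2) (fun K2 => \sum_(b <- K2) \sum_(K3 <- Th | b \in K3) f K3)).
Qed.

Lemma patch_sum_ge0 f z : (forall K, K \in Th -> 0 <= f K) -> 0 <= patch_sum f z.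
Proof.
move=> f0; rewrite /patch_sum; apply: sumr_ge0 => K _; apply: sumr_ge0 => a _.
by rewrite big_seq_cond; apply: sumr_ge0 => K2 /andP[/f0].
Qed.

Lemma patch_cst_gt0 K : K \in Th -> 0 < patch_cst (n := n) L.
Proof.
move=> KT; have L0 : 0 < L by apply: lt_le_trans (regular_ge1 d0 hL KT).
by rewrite /patch_cst divr_gt0 ?invr_gt0 ?exprn_gt0 ?mulr_gt0 ?exprn_gt0// ltr0n fact_gt0.
Qed.

Lemma local_affine_energy v z K0 : Vh Om Th v -> z \in interior_vertices Om Th ->
  K0 \in Th -> z \in K0 ->
  exists vt, [/\ Vh Om Th vt, affine_on (patch_of Th z) vt &
    forall K, K \in Th -> z \in K -> enorm (gradK K v - gradK K vt) <=
      approx_cst (n := n) L D kp * Num.sqrt (patch_sum (jump_energy v) z / (patch_cst (n := n) L * hK K0 ^+ n.+1))].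
Proof.
move=> Hv zI K0T zK0.
have [Oz _] := (interior_verticesP Om Th z).1 zI.
have p0 := patch_cst_gt0 K0T; have h0 := hK_gt0 d0 hL K0T.
have ph0 : 0 < patch_cst (n := n) L * hK K0 ^+ n.+1 by rewrite mulr_gt0 ?exprn_gt0.
have j0 K : K \in Th -> 0 <= jump_energy v K by exact: jump_energy_ge0.
apply: (local_affine hOm hTh0 hTh hL hD kp0 hkp hphi Hv zI); first exact: sqrtr_ge0.
move=> K a K1 K2 KT zK aK az rK h.
have [K1T aK1] := reach_mem KT aK rK; have [K2T aK2] := adj_mem aK1 h.
move: (h) => /and3P[_ n21 /hasP[b bK1 /andP[ba s]]].
have iF : interior_face Th (K1 `\ b)%fset by apply/(interior_faceP d0 hTh K1T bK1); exists K2.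
have av K' : K' \in Th -> affine_on (hull K') v by move=> K'T; case: Hv => _ + _; apply.
rewrite -(face_jump_gradK hTh K1T K2T bK1 n21 s av) -sqrtr_sqr.
rewrite ler_sqrt; last by rewrite divr_ge0 ?patch_sum_ge0// ltW.
rewrite ler_pdivlMr// mulrC.
apply: le_trans (@patch_sum_ge (jump_energy v) z K a K1 j0 KT zK aK K1T aK1).
apply: le_trans (jump_energy_ge v K1T bK1 iF).
rewrite ler_wpM2r ?sqr_ge0//.
exact: (face_weight_patch hOm hTh hL Oz K0T KT zK0 zK aK az rK bK1 ba iF).
Qed.

Definition vertex_cst (Lstab : R) : R :=
  Lstab * 2 ^+ n.+1 * approx_cst (n := n) L D kp / Num.sqrt (patch_cst (n := n) L).

(** The largest simplex controls the volume of the patch even in dimension one, where its neighbour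
    may be much smaller. *)
Lemma largest_simplex z : z \in interior_vertices Om Th ->
  exists K0, [/\ K0 \in Th, z \in K0 & forall K, K \in Th -> z \in K -> hK K <= hK K0].
Proof.
move=> /(interior_verticesP Om Th z)[_ [K1 K1T zK1]].
have : forall s : seq {fset Rd}, {subset s <= Th} -> exists K0, [/\ K0 \in Th, z \in K0 &
    forall K, K \in s -> z \in K -> hK K <= hK K0].
  elim=> [_|K s IH sT]; first by exists K1.
  have [|K0 [K0T zK0 h]] := IH; first by move=> K' K's; apply: sT; rewrite inE K's orbT.
  have [zK|zK] := boolP (z \in K); last first.
    by exists K0; split => // K'; rewrite inE => /orP[/eqP ->|]; [rewrite (negbTE zK)|exact: h].
  have [le|lt] := leP (hK K) (hK K0).
    by exists K0; split => // K'; rewrite inE => /orP[/eqP ->//|]; exact: h.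
  exists K; split => //; first by apply: sT; rewrite inE eqxx.
  move=> K'; rewrite inE => /orP[/eqP -> //|K's zK'].
  exact: le_trans (h K' K's zK') (ltW lt).
by move=> /(_ Th (fun _ h => h)).
Qed.

(** Subtracting the value 0 at the affine substitutes leaves [Lstab] |omega_z| times the gradient
    deviation. With |omega_z| at most (2 h)^d and a deviation of order h^(-d/2), the factor h^(d/2)
    remains. *)
Lemma stab_vertex Sh Lstab v w z : 0 < Lstab ->
  vanishes_on_affine Om Th phi Sh -> stab_lipschitz Om Th phi Sh Lstab ->
  Vh Om Th v -> Vh Om Th w -> z \in interior_vertices Om Th ->
  exists K0, [/\ K0 \in Th, z \in K0 & `|Sh v w (phi z)| <= vertex_cst Lstab *
    Num.sqrt (hK K0 ^+ n.+1) *
    (Num.sqrt (patch_sum (jump_energy v) z) + Num.sqrt (patch_sum (jump_energy w) z))].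
Proof.
move=> L0 haff hlip Hv Hw zI.
have [K0 [K0T zK0 hmax]] := largest_simplex zI; exists K0; split => //.
have h0 := hK_gt0 d0 hL K0T; have p0 := patch_cst_gt0 K0T.
have [vt [Hvt avt hv]] := local_affine_energy Hv zI K0T zK0.
have [wt [Hwt awt hw]] := local_affine_energy Hw zI K0T zK0.
have ac0 : 0 <= approx_cst (n := n) L D kp.
  rewrite /approx_cst addr_ge0 ?mulr_ge0// addr_ge0//.
  exact: le_trans (ltW h0) (hD K0T).
have VP := vol_patch hTh hmax (ltW h0).
have Vfin : vol R n.+1 (patch_of Th z) \is a fin_num.
  by rewrite ge0_fin_numE//; apply: le_lt_trans VP _; rewrite ltry.
have := hlip z v w vt wt zI Hv Hw Hvt Hwt.
rewrite (haff z vt wt zI Hvt Hwt avt awt) subr0.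
have := normL2v_patch hOm hTh Hw Hwt (mulr_ge0 ac0 (sqrtr_ge0 _)) hw.
have := normL2v_patch hOm hTh Hv Hvt (mulr_ge0 ac0 (sqrtr_ge0 _)) hv.
set Av := approx_cst L D kp * _; set Aw := approx_cst L D kp * Num.sqrt (patch_sum (jump_energy w) z / _).
have Av0 : 0 <= Av by rewrite mulr_ge0 ?sqrtr_ge0.
have Aw0 : 0 <= Aw by rewrite mulr_ge0 ?sqrtr_ge0.
move: VP Vfin; set V := vol R n.+1 _.
have V0 : (0 <= V)%E by exact: measure_ge0.
case: V V0 => //= V; rewrite lee_fin => V0; rewrite lee_fin => VP _.
set Nv := normL2v _ _; set Nw := normL2v _ _ => hNv hNw hSh.
have {hSh} : (`|Sh v w (phi z)|%:E <= (Lstab * V * (Av + Aw))%:E)%E.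
  apply: (le_trans hSh).
  have -> : (Lstab * V * (Av + Aw) = Lstab * Num.sqrt V * (Av * Num.sqrt V + Aw * Num.sqrt V))%R.
    by rewrite -{1}(sqr_sqrtr V0); ring.
  rewrite !EFinM EFinD; apply: lee_wpmul2l; first by rewrite lee_fin mulr_ge0 ?sqrtr_ge0// ltW.
  by rewrite EFinM EFinM; apply: leeD.
rewrite lee_fin => /le_trans; apply.
have e0 : 0 < hK K0 ^+ n.+1 by rewrite exprn_gt0.
apply: (@le_trans _ _ (Lstab * (2 * hK K0) ^+ n.+1 * (Av + Aw))).
  by rewrite ler_wpM2r ?addr_ge0// ler_wpM2l// ltW.
have sq P : 0 <= P -> Num.sqrt (P / (patch_cst (n := n) L * hK K0 ^+ n.+1)) =
    Num.sqrt P / (Num.sqrt (patch_cst (n := n) L) * Num.sqrt (hK K0 ^+ n.+1)).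
  move=> P0; rewrite sqrtrM// sqrtrV; last by rewrite mulr_ge0 ?(ltW p0) ?(ltW e0).
  by rewrite sqrtrM// ltW.
rewrite /Av /Aw !sq; try by apply: patch_sum_ge0 => K; exact: jump_energy_ge0.
rewrite exprMn /vertex_cst -{1}(sqr_sqrtr (ltW e0)).
have : 0 < Num.sqrt (hK K0 ^+ n.+1) by rewrite sqrtr_gt0.
have : 0 < Num.sqrt (patch_cst (n := n) L) by rewrite sqrtr_gt0.
move: (Num.sqrt (patch_cst _)) (Num.sqrt (hK K0 ^+ _)) => p1 s1 p10 s10.
by rewrite le_eqVlt; apply/orP; left; apply/eqP; field; rewrite !gt_eqF.
Qed.

End vertex_bounds.

(** * The stabilization on a time slab *)

Section sums.
Context {R : realType}.

(** Induction on the sum, each step being the inequality in the plane. *)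
Lemma cauchy_schwarz_sum (I : Type) (s : seq I) (P : pred I) (a b : I -> R) :
  \sum_(i <- s | P i) a i * b i <=
  Num.sqrt (\sum_(i <- s | P i) a i ^+ 2) * Num.sqrt (\sum_(i <- s | P i) b i ^+ 2).
Proof.
pose K (x y z : R) := 0 <= y /\ 0 <= z /\ x <= Num.sqrt y * Num.sqrt z.
suff [_ [_]] : K (\sum_(i <- s | P i) a i * b i) (\sum_(i <- s | P i) a i ^+ 2) (\sum_(i <- s | P i) b i ^+ 2) by [].
elim/big_rec3: _ => [|i z y x _ [y0 [z0 h]]].
  by split => //; split => //; rewrite mulr_ge0.
have y1 : 0 <= a i ^+ 2 + y by rewrite addr_ge0// sqr_ge0.
have z1 : 0 <= b i ^+ 2 + z by rewrite addr_ge0// sqr_ge0.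
split => //; split => //.
apply: (@le_trans _ _ (a i * b i + Num.sqrt y * Num.sqrt z)); first by rewrite lerD2l.
rewrite -[leRHS]sqrtrM//; apply: le_trans (ler_norm _) _; rewrite -sqrtr_sqr ler_wsqrtr//.
move: (sqr_sqrtr y0) (sqr_sqrtr z0); move: (Num.sqrt y) (Num.sqrt z) => p q <- <-.
rewrite -subr_ge0 [X in 0 <= X](_ : _ = (a i * q - b i * p) ^+ 2); first exact: sqr_ge0.
by ring.
Qed.

Lemma count_mem_sym (T : eqType) (s t : seq T) : uniq s -> uniq t ->
  count (mem t) s = count (mem s) t.
Proof.
move=> us ut; rewrite -!size_filter; apply/perm_size/uniq_perm; rewrite ?filter_uniq//.
by move=> x; rewrite !mem_filter /= andbC.
Qed.

End sums.

Section slab_bound.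
Context {R : realType} {n : nat}.
Local Notation Rd := 'rV[R]_n.+1.
Variables (Om : set Rd) (Th0 Th : {fset {fset Rd}}).
Hypotheses (hOm : lipschitz_domain Om) (hTh0 : conforming_mesh Om Th0)
  (hTh : conforming_mesh Om Th).
Implicit Types (K F : {fset Rd}) (a b x y z : Rd) (v w : Rd -> R).
Variables (L D kp : R).
Hypothesis hL : forall K, K \in Th -> exists c r, regular L K c r.
Hypothesis hD : forall K, K \in Th -> hK K <= D.
Hypothesis kp0 : 0 <= kp.
Hypothesis hkp : forall K0 b0 K1 b1, K0 \in Th0 -> b0 \in K0 -> K1 \in Th0 -> b1 \in K1 ->
  plane_bound (bary_fun K0 b0) (bary_fun K1 b1) kp.
Variable phi : Rd -> Rd -> R.
Hypothesis hphi : nodal_basis Om Th phi.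

Let d0 : (0 < n.+1)%N := ltn0Sn n.
Let sK K : K \in Th -> simplex K.
Proof. exact: (mesh_simplex hTh). Qed.
Let mOm : measurable Om.
Proof. by apply: open_measurable_row; case: hOm. Qed.
Let M := star_bound (d := n.+1) L.

Lemma sum_vertices (S : {fset Rd}) (f : {fset Rd} -> R) : (forall K, K \in Th -> 0 <= f K) ->
  \sum_(z <- S) \sum_(K <- Th | z \in K) f K <= n.+2%:R * \sum_(K <- Th) f K.
Proof.
move=> f0; rewrite (exchange_big_dep xpredT)//= mulr_sumr big_seq [leRHS]big_seq.
apply: ler_sum => K KT.
rewrite big_const_seq iter_addr_0 -[_ *+ _]mulr_natl ler_wpM2r ?f0// ler_nat.
rewrite -[X in (X <= _)%N]/(count (mem (K : seq Rd)) S) count_mem_sym ?fset_uniq//.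
by apply: leq_trans (count_size _ _) _; rewrite (sK KT).1.
Qed.

(** A simplex K1 is counted once for each of its n + 2 vertices a, each of at most [M] simplices K
    at a, and each vertex z of K. *)
Lemma sum_patch_sum (S : {fset Rd}) (f : {fset Rd} -> R) : (forall K, K \in Th -> 0 <= f K) ->
  \sum_(z <- S) patch_sum Th f z <= (n.+2 * (n.+2 * M))%:R * \sum_(K <- Th) f K.
Proof.
move=> f0; have f1 K : 0 <= \sum_(a <- K) \sum_(K1 <- Th | a \in K1) f K1.
  by apply: sumr_ge0 => a _; rewrite big_seq_cond; apply: sumr_ge0 => K2 /andP[/f0].
apply: le_trans (sum_vertices S (fun K _ => f1 K)) _.
rewrite natrM -mulrA ler_wpM2l//.
under eq_bigr do rewrite (exchange_big_dep xpredT)//=.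
rewrite exchange_big/= mulr_sumr big_seq [leRHS]big_seq; apply: ler_sum => K1 K1T.
under eq_bigr do rewrite big_const_seq iter_addr_0 -[_ *+ _]mulr_natl.
rewrite -mulr_suml ler_wpM2r ?f0//.
under eq_bigr => K _.
  rewrite -[X in X%:R]/(count (mem (K1 : seq Rd)) K) count_mem_sym ?fset_uniq//.
  rewrite -sum1_count natr_sum.
  over.
rewrite (exchange_big_dep xpredT)//=.
apply: (@le_trans _ _ (\sum_(a <- K1) M%:R)).
  apply: ler_sum => a _; rewrite big_const_seq iter_addr_0 ler_nat.
  apply: leq_trans (card_star d0 hTh hL a).
  rewrite -size_filter; apply: uniq_leq_size; first by rewrite filter_uniq// fset_uniq.
  by move=> K; rewrite mem_filter starE andbC.
by rewrite big_const_seq count_predT iter_addr_0 -[_ *+ _]mulr_natl -natrM (sK K1T).1.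
Qed.

(** (hK / (4 d L))^d is the volume of the cube of [cube_near_vertex] for ratio 1/4, and 1/4 is the
    square of the half below. *)
Definition nodal_cst : R := (4 * n.+1%:R * L) ^- n.+1 / 4.

(* |v| is at least half of its maximum over K on a cube of size h_K near the
   vertex where this maximum is attained. *)
Lemma nodal_L2 v : Vh Om Th v -> exists mu : {fset Rd} -> R, [/\ forall K, 0 <= mu K,
  forall K b, K \in Th -> b \in K -> v b ^+ 2 <= mu K &
  ((nodal_cst * \sum_(K <- Th) hK K ^+ n.+1 * mu K)%:E <= sqint Om v)%E].
Proof.
move=> Hv; have av K : K \in Th -> affine_on (hull K) v by move=> KT; case: Hv => _ + _; apply.
have mv : measurable_fun setT v by have [[]] := wgradP Hv.
pose s K := 4^-1 * hK K / (2 * n.+1%:R * L).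
have hb K : exists p : Rd * Rd, K \in Th -> [/\ p.1 \in K, forall b, b \in K -> `|v b| <= `|v p.1|,
    cube p.2 (s K) `<=` pos K & forall x, cube p.2 (s K) x -> `|v p.1| / 2 <= `|v x| ].
  have [KT|nK] := boolP (K \in Th); last by exists (0, 0).
  have [b bK bmax] : exists2 b, b \in K & forall c, c \in K -> `|v c| <= `|v b|.
    have [b0 b0K] : exists b0, b0 \in K.
      by apply/fset0Pn; rewrite -cardfs_gt0 (sK KT).1.
    have : forall t : seq Rd, {subset t <= K} -> exists2 b, b \in K & forall c, c \in t -> `|v c| <= `|v b|.
      elim=> [_|c t IH tK]; first by exists b0.
      have [|b bK h] := IH; first by move=> c' c't; apply: tK; rewrite inE c't orbT.
      have [le|lt] := leP `|v c| `|v b|.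
        by exists b => // c'; rewrite inE => /orP[/eqP ->//|]; exact: h.
      exists c; first by apply: tK; rewrite inE eqxx.
      by move=> c'; rewrite inE => /orP[/eqP ->//|/h h']; exact: le_trans h' (ltW lt).
    by move=> /(_ K (fun _ h => h)).
  have q0 : 0 < 4^-1 :> R by rewrite invr_gt0.
  have q1 : 4^-1 <= 1 :> R by rewrite invf_le1// ler1n.
  have [c [hc1 hc2]] := cube_near_vertex d0 hTh hL KT bK q0 q1.
  exists (b, c) => _; split => // x /hc2[y py ->] /=.
  have Ky := pos_hull (sK KT) py; have Kb := hull_vertex (sK KT) bK.
  have /affine_onP[l lE] := av K KT.
  have vy : `|v y| <= `|v b|.
    rewrite lE// (aff_bary l y (sK KT)); apply: le_trans (ler_norm_sum _ _ _) _.
    apply: (@le_trans _ _ (\sum_(a <- K) bary K a y * `|v b|)).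
      rewrite big_seq [leRHS]big_seq; apply: ler_sum => a aK.
      have ya := (hullE y (sK KT)).1 Ky a aK.
      rewrite normrM ger0_norm// ler_wpM2l// -lE; first exact: bmax.
      exact: hull_vertex (sK KT) aK.
    by rewrite -mulr_suml (bary_sum1 y (sK KT)) mul1r.
  rewrite [v (_ + _)]lE; last first.
    apply: (pos_hull (sK KT)) => a aK; rewrite /bary aff_line -affB -!/(bary _ _ _).
    have := py a aK; have := (hullE b (sK KT)).1 Kb a aK; lra.
  rewrite aff_line -affB -!lE//.
  (* With |v y| at most |v b|, this is at least 3/4 - 1/4 = 1/2 of |v b|. *)
  have -> : v b + 4^-1 * (v y - v b) = (3 / 4) * v b + 4^-1 * v y by field.
  have := ler_normD ((3 / 4) * v b + 4^-1 * v y) (- (4^-1 * v y)).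
  have n1 : `|3 / 4 * v b| = 3 / 4 * `|v b| by rewrite normrM ger0_norm// divr_ge0.
  have n2 : `|4^-1 * v y| = 4^-1 * `|v y| by rewrite normrM gtr0_norm.
  by rewrite addrK normrN n1 n2; lra.
have [p hp] := choice hb.
exists (fun K => if K \in Th then v (p K).1 ^+ 2 else 0); split.
- by move=> K; case: ifP => // _; rewrite sqr_ge0.
- move=> K b KT bK; rewrite KT; have [_ h _ _] := hp K KT.
  by rewrite -(real_normK (num_real (v b))) -(real_normK (num_real (v _))) lerXn2r ?nnegrE ?h.
have mf : measurable_fun Om (fun x => (v x ^+ 2)%:E).
  by apply: measurable_sqr_EFin; exact: measurable_funTS.
have := @sum_integral_disjoint R n.+1 Om Th hTh (Th : seq _) (fun K => cube (p K).2 (s K)) Om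
  (fun x => (v x ^+ 2)%:E) (fset_uniq _) (fun K h => h) (fun K => measurable_cube _ _) _ _ mOm mf _.
move=> disj; apply: le_trans (disj _ _ _); first last.
- by move=> x _; rewrite lee_fin sqr_ge0.
- by move=> K KT x Kx; have [_ _ h _] := hp K KT; exact: (pos_Om hOm hTh KT (h x Kx)).
- by move=> K KT; have [_ _ h _] := hp K KT.
rewrite mulr_sumr -sumEFin big_seq [leRHS]big_seq; apply: lee_sum => K KT.
rewrite KT; have [_ _ _ h] := hp K KT.
have h0 := hK_gt0 d0 hL KT; have L0 : 0 < L by apply: lt_le_trans (regular_ge1 d0 hL KT).
have s0 : 0 <= s K by rewrite divr_ge0 ?mulr_ge0 ?(ltW h0) ?(ltW L0)// invr_ge0.
apply: (@le_trans _ _ (\int[vol R n.+1]_(x in cube (p K).2 (s K)) cst (v (p K).1 ^+ 2 / 4)%:E x)%E); last first.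
  apply: ge0_le_integral.
  - exact: measurable_cube.
  - by move=> x _; rewrite lee_fin divr_ge0 ?sqr_ge0.
  - exact: measurable_cst.
  - by apply: measurable_sqr_EFin; exact: measurable_funTS.
  - move=> x Kx; rewrite lee_fin.
    rewrite -(real_normK (num_real (v x))) -(real_normK (num_real (v _))).
    have -> : `|v (p K).1| ^+ 2 / 4 = (`|v (p K).1| / 2) ^+ 2 by field.
    by rewrite lerXn2r ?nnegrE ?divr_ge0// h.
rewrite integral_cst; last exact: measurable_cube.
apply: (@le_trans _ _ ((v (p K).1 ^+ 2 / 4)%:E * ((2 * s K) ^+ n.+1)%:E)%E); last first.
  apply: lee_wpmul2l; first by rewrite lee_fin divr_ge0 ?sqr_ge0.
  by rewrite le_eqVlt; apply/orP; left; apply/eqP/esym; exact: vol_cube.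
rewrite -EFinM lee_fin /nodal_cst.
have -> : 2 * s K = hK K / (4 * n.+1%:R * L) by rewrite /s; field; rewrite gt_eqF//= gt_eqF.
rewrite expr_div_n le_eqVlt; apply/orP; left; apply/eqP; field.
by rewrite expf_neq0// !mulf_neq0// gt_eqF.
Qed.

Lemma linear_interp Sh v w p : linear_in_third Om Th Sh -> Vh Om Th v -> Vh Om Th w -> Vh Om Th p ->
  Sh v w p = \sum_(z <- interior_vertices Om Th) p z * Sh v w (phi z).
Proof.
move=> hlin Hv Hw Hp; rewrite [in LHS](Vh_expand hOm hTh hphi Hp) /interp.
have S0 : Sh v w (fun=> 0) = 0.
  have := hlin v w (fun=> 0) (fun=> 0) 1 Hv Hw (Vh_0 _ _) (Vh_0 _ _).
  rewrite (_ : (fun _ => 1 * 0 + 0) = fun=> 0); last by apply/funext => x; rewrite mulr0 addr0.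
  lra.
have key : forall s : seq Rd, {subset s <= interior_vertices Om Th} ->
    Vh Om Th (fun x => \sum_(z <- s) p z * phi z x) /\
    Sh v w (fun x => \sum_(z <- s) p z * phi z x) = \sum_(z <- s) p z * Sh v w (phi z).
  elim=> [_|z s IH sI].
    rewrite big_nil (_ : (fun _ => _) = fun=> 0); last by apply/funext => x; rewrite big_nil.
    by split => //; exact: Vh_0.
  have [|Vs es] := IH; first by move=> y ys; apply: sI; rewrite inE ys orbT.
  have [Vz _] : Vh Om Th (phi z) /\ _ := hphi (sI z (mem_head z s)).
  rewrite big_cons (_ : (fun _ => _) = fun x => p z * phi z x + \sum_(y <- s) p y * phi y x); last first.
    by apply/funext => x; rewrite big_cons.
  by split; [exact: Vh_lin|rewrite hlin// es].
by have [_ ->] := key (interior_vertices Om Th) (fun _ h => h).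
Qed.

Variable CP : R.
Hypothesis CP0 : 0 < CP.
Hypothesis hCP : forall v g, H10_grad Om v g ->
  (sqint Om v <= CP%:E * sqint Om (fun x => enorm (g x)))%E.

Definition grad2 p : R := fine (sqint Om (fun x => enorm (wgrad Om p x))).

(** The two roots come from the Cauchy-Schwarz inequality: nodal values against the gradient of the
    test function, and overlap of the patches. *)
Definition slab_cst (Lstab : R) : R := vertex_cst (n := n) L D kp Lstab *
  Num.sqrt (n.+2%:R * (CP / nodal_cst)) * Num.sqrt (n.+2 * (n.+2 * M))%:R.

Lemma grad2_ge0 p : 0 <= grad2 p.
Proof. by rewrite fine_ge0// sqint_ge0. Qed.

Lemma grad2E p : Vh Om Th p -> sqint Om (fun x => enorm (wgrad Om p x)) = (grad2 p)%:E.
Proof.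
move=> Hp; have [_ [_ gy] _] := wgradP Hp; rewrite fineK// ge0_fin_numE ?sqint_ge0//.
by move: gy; rewrite normL2vE => /sqint_lty.
Qed.

Hypotheses (L1 : 1 <= L) (D0 : 0 < D).

Lemma vertex_cst_ge0 Lstab : 0 < Lstab -> 0 <= vertex_cst (n := n) L D kp Lstab.
Proof.
move=> h; have L0 : 0 <= L by exact: le_trans L1.
rewrite /vertex_cst divr_ge0 ?sqrtr_ge0// mulr_ge0//; first by rewrite mulr_ge0// ltW.
by rewrite /approx_cst addr_ge0 ?mulr_ge0// addr_ge0// ltW.
Qed.

Lemma nodal_cst_gt0 : 0 < nodal_cst.
Proof.
have L0 : 0 < L by exact: lt_le_trans L1.
by rewrite /nodal_cst divr_gt0// invr_gt0 exprn_gt0// !mulr_gt0// ltr0n.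
Qed.

Lemma slab_bound Sh Lstab v w p : 0 < Lstab -> linear_in_third Om Th Sh ->
  vanishes_on_affine Om Th phi Sh -> stab_lipschitz Om Th phi Sh Lstab ->
  Vh Om Th v -> Vh Om Th w -> Vh Om Th p ->
  `|Sh v w p| <= slab_cst Lstab * Num.sqrt (grad2 p) *
    (Num.sqrt (\sum_(K <- Th) jump_energy Th v K) + Num.sqrt (\sum_(K <- Th) jump_energy Th w K)).
Proof.
move=> Ls0 hlin haff hlip Hv Hw Hp.
have [mu [mu0 hmu hmuL2]] := nodal_L2 Hp.
have hz z : exists K0, z \in interior_vertices Om Th -> [/\ K0 \in Th, z \in K0 &
    `|Sh v w (phi z)| <= vertex_cst (n := n) L D kp Lstab * Num.sqrt (hK K0 ^+ n.+1) *
    (Num.sqrt (patch_sum Th (jump_energy Th v) z) + Num.sqrt (patch_sum Th (jump_energy Th w) z))].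
  have [zI|nI] := boolP (z \in interior_vertices Om Th); last by exists fset0.
  have [K0 h] := stab_vertex hOm hTh0 hTh hL hD kp0 hkp hphi Ls0 haff hlip Hv Hw zI.
  by exists K0.
have [kz hkz] := choice hz.
(* The factor h^(d/2) left by the vertex bound goes to the nodal value, so that the sum of the
   squares of [al] is a discrete L^2 norm. *)
pose al z := Num.sqrt (hK (kz z) ^+ n.+1) * `|p z|.
pose be f z := Num.sqrt (patch_sum Th (jump_energy Th f) z).
set I := interior_vertices Om Th.
have vc0 := vertex_cst_ge0 Ls0.
have step1 : `|Sh v w p| <= vertex_cst (n := n) L D kp Lstab *
    (\sum_(z <- I) al z * be v z + \sum_(z <- I) al z * be w z).
  rewrite (linear_interp hlin Hv Hw Hp) -/I; apply: le_trans (ler_norm_sum _ _ _) _.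
  rewrite -big_split/= mulr_sumr big_seq [leRHS]big_seq; apply: ler_sum => z zI.
  have [_ _ h] := hkz z zI; rewrite normrM.
  apply: (le_trans (ler_wpM2l (normr_ge0 _) h)).
  by rewrite le_eqVlt; apply/orP; left; apply/eqP; rewrite /al /be; ring.
have g0 := grad2_ge0 p; have nc0 := nodal_cst_gt0.
have sumA : \sum_(z <- I) al z ^+ 2 <= n.+2%:R * (CP / nodal_cst) * grad2 p.
  apply: (@le_trans _ _ (n.+2%:R * \sum_(K <- Th) hK K ^+ n.+1 * mu K)).
    apply: le_trans (@sum_vertices I (fun K => hK K ^+ n.+1 * mu K) _); last first.
      by move=> K KT; rewrite mulr_ge0// exprn_ge0// ltW// (hK_gt0 d0 hL KT).
    rewrite big_seq [leRHS]big_seq; apply: ler_sum => z zI.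
    have [KT zK _] := hkz z zI; have h0 := hK_gt0 d0 hL KT.
    rewrite /al exprMn sqr_sqrtr ?exprn_ge0 ?(ltW h0)// real_normK ?num_real//.
    apply: (@le_trans _ _ (hK (kz z) ^+ n.+1 * mu (kz z))).
      by rewrite ler_wpM2l ?exprn_ge0 ?(ltW h0)// hmu.
    apply: (le_sum_seq (P := fun K : {fset Rd} => z \in K) (f := fun K => hK K ^+ n.+1 * mu K)) => //.
    by move=> K K'T _; rewrite mulr_ge0// exprn_ge0// ltW// (hK_gt0 d0 hL K'T).
  rewrite -!mulrA ler_wpM2l// mulrCA ler_pdivlMl//.
  rewrite -lee_fin [leRHS]EFinM -(grad2E Hp); apply: le_trans hmuL2 _.
  exact: hCP (wgradP Hp).
have sumB f : \sum_(z <- I) be f z ^+ 2 <= (n.+2 * (n.+2 * M))%:R * \sum_(K <- Th) jump_energy Th f K.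
  have f0 K : K \in Th -> 0 <= jump_energy Th f K by move=> KT; exact: (jump_energy_ge0 hTh hL f KT).
  apply: le_trans (sum_patch_sum I f0); apply: ler_sum => z _.
  by rewrite /be sqr_sqrtr// patch_sum_ge0.
have CS f : \sum_(z <- I) al z * be f z <= Num.sqrt (n.+2%:R * (CP / nodal_cst)) * Num.sqrt (grad2 p) *
    (Num.sqrt (n.+2 * (n.+2 * M))%:R * Num.sqrt (\sum_(K <- Th) jump_energy Th f K)).
  apply: le_trans (cauchy_schwarz_sum _ _ _ _) _; apply: ler_pM; rewrite ?sqrtr_ge0//.
    by rewrite -sqrtrM; [exact: ler_wsqrtr|rewrite mulr_ge0// divr_ge0// ltW].
  by rewrite -sqrtrM//; exact: ler_wsqrtr.
apply: (le_trans step1); apply: le_trans (ler_wpM2l vc0 (lerD (CS v) (CS w))) _.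
by rewrite le_eqVlt; apply/orP; left; apply/eqP; rewrite /slab_cst; ring.
Qed.

End slab_bound.

(** * Lower bounds for the estimators *)

(** The integral of a nonnegative function is a supremum over the simple functions below it, so a
    pointwise lower bound suffices, with no measurability in time or along faces to establish for
    the face residuals. *)
Lemma le_integral_nonneg d (T : measurableType d) (R : realType)
    (mu : {measure set T -> \bar R}) (D : set T) (f g : T -> \bar R) :
  (forall x, D x -> (0 <= f x)%E) -> (forall x, D x -> (f x <= g x)%E) ->
  (\int[mu]_(x in D) f x <= \int[mu]_(x in D) g x)%E.
Proof.
move=> f0 fg; rewrite !ge0_integralE//; last by move=> x Dx; exact: le_trans (f0 x Dx) (fg x Dx).
apply: le_ereal_sup => _ [h hh <-]; exists h => // x; apply: le_trans (hh x) _.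
by rewrite /patch; case: ifPn => // /set_mem; exact: fg.
Qed.

Section time_slabs.
Context {R : realType}.
Variables (T : R) (N : nat) (tt : nat -> R).
Hypothesis htt : time_partition T N tt.

Lemma le_breakpoints i j : (i <= j)%N -> (j <= N)%N -> tt i <= tt j.
Proof.
have [_ _ h] := htt; elim: j => [|j IH]; first by rewrite leqn0 => /eqP ->.
rewrite leq_eqVlt => /orP[/eqP -> //|ij] jN.
exact: le_trans (IH ij (ltnW jN)) (ltW (h j jN)).
Qed.

Lemma slab_itime k : (k < N)%N -> slab tt k `<=` itime T.
Proof.
move=> kN t; rewrite /slab /itime /= !in_itv/= => /andP[h1 h2].
have [t0 tN _] := htt; apply/andP; split.
  by apply: le_lt_trans h1; rewrite -t0; apply: le_breakpoints => //; exact: ltnW.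
by apply: lt_le_trans h2 _; rewrite -tN; exact: le_breakpoints.
Qed.

Lemma slab_gt0 k : (k < N)%N -> 0 < tt k.+1 - tt k.
Proof. by move=> kN; have [_ _ h] := htt; rewrite subr_gt0 h. Qed.

Lemma measure_slab k : (k < N)%N ->
  @lebesgue_measure R (slab tt k) = (tt k.+1 - tt k)%:E.
Proof.
by move=> kN; rewrite /slab lebesgue_measure_itv/= lte_fin -subr_gt0 slab_gt0.
Qed.

End time_slabs.

Section estimator_bounds.
Context {R : realType} {n : nat}.
Local Notation Rd := 'rV[R]_n.+1.
Variables (Om : set Rd) (Th : {fset {fset Rd}}).
Hypotheses (hOm : lipschitz_domain Om) (hTh : conforming_mesh Om Th).
Implicit Types (K F : {fset Rd}) (a b x y z : Rd) (v w : Rd -> R).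
Variables (T : R) (N : nat) (tt : nat -> R).
Hypothesis htt : time_partition T N tt.

Let d0 : (0 < n.+1)%N := ltn0Sn n.
Let sK K : K \in Th -> simplex K.
Proof. exact: (mesh_simplex hTh). Qed.

Definition face_point F (s : 'rV[R]_n) : Rd := nth 0 (enum_fset F) 0 + s *m face_edges F.

Lemma face_point_hull K b s : K \in Th -> b \in K -> unit_simplex s ->
  hull (K `\ b)%fset (face_point (K `\ b)%fset s).
Proof.
move=> KT bK [s0 s1]; set F := (K `\ b)%fset.
have sF : size (enum_fset F) = n.+1 by have := facet_card hTh KT bK.
have eF i : (i < n.+1)%N -> nth 0 (enum_fset F) i \in F by move=> hi; apply: mem_nth; rewrite sF.
have vE c : c \in F -> hull K c /\ bary K b c = 0.
  rewrite !inE => /andP[cb cK]; split; first exact: hull_vertex (sK KT) cK.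
  exact: bary_vertex0 (sK KT) bK cK cb.
have pE l : aff l (face_point F s) = (1 - \sum_i s ord0 i) * aff l (nth 0 (enum_fset F) 0)
    + \sum_i s ord0 i * aff l (nth 0 (enum_fset F) i.+1).
  have -> : face_point F s = nth 0 (enum_fset F) 0 +
      1 *: \sum_i s ord0 i *: (nth 0 (enum_fset F) i.+1 - nth 0 (enum_fset F) 0).
    rewrite scale1r; congr (_ + _); apply/rowP => j; rewrite !mxE summxE.
    by apply: eq_bigr => i _; rewrite !mxE.
  rewrite aff_line mul1r dotv_sumr.
  have -> : \sum_i dotv l.2 (s ord0 i *: (nth 0 (enum_fset F) i.+1 - nth 0 (enum_fset F) 0)) =
      \sum_i s ord0 i * aff l (nth 0 (enum_fset F) i.+1) - (\sum_i s ord0 i) * aff l (nth 0 (enum_fset F) 0).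
    by rewrite mulr_suml -sumrB; apply: eq_bigr => i _; rewrite dotvZr -affB; ring.
  by ring.
apply/(hull_faceE _ (sK KT)); first exact: fsubD1set.
split.
  apply/(hullE _ (sK KT)) => a aK; rewrite /bary pE addr_ge0//.
    by rewrite mulr_ge0 ?subr_ge0//; apply: (hullE _ (sK KT)).1 _ _ aK; apply: (vE _ _).1; exact: eF.
  apply: sumr_ge0 => i _; rewrite mulr_ge0//; apply: (hullE _ (sK KT)).1 _ _ aK.
  by apply: (vE _ _).1; apply: eF; rewrite ltnS.
move=> a aK; rewrite !inE aK andbT negbK => /eqP ->.
rewrite /bary pE -/(bary _ _ _) (vE _ (eF _ _)).2// mulr0 add0r big1// => i _.
by rewrite -/(bary _ _ _) (vE _ (eF _ _)).2 ?mulr0// ltnS.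
Qed.

Definition simplex_cst : R := n.+1%:R^-1 ^+ n.

Lemma face_integral_ge F (f : Rd -> R) (e : R) : 0 <= e ->
  (forall s, unit_simplex s -> e <= f (face_point F s)) ->
  ((e * gram F * simplex_cst)%:E <= face_integral F (fun x => (f x)%:E))%E.
Proof.
move=> e0 h; rewrite /face_integral.
have g0 : 0 <= gram F by exact: sqrtr_ge0.
apply: (@le_trans _ _ (\int[vol R n]_(s in @unit_simplex R n) cst (e * gram F)%:E s)%E).
  rewrite integral_cst; last exact: measurable_unit_simplex.
  rewrite EFinM; apply: lee_wpmul2l; first by rewrite lee_fin mulr_ge0.
  exact: vol_unit_simplex_ge.
apply: le_integral_nonneg => s us; first by rewrite lee_fin mulr_ge0.
by rewrite -EFinM lee_fin ler_wpM2r// h.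
Qed.

Definition time_sum (f : nat -> R) : R := \sum_(k < N) (tt k.+1 - tt k) * f k.

Lemma hF_ge0 F : 0 <= hF Th F.
Proof.
rewrite /hF; case: ifP => _.
  by elim/big_rec: _ => // K y _ y0; rewrite le_max y0 orbT.
rewrite /ediam; set S := image2 _ _ _.
have [[[e Se] hub]|nS] := EM (has_sup S); last by rewrite sup_out.
apply: le_trans (ub_le_sup hub Se); have [x _ [y _ <-]] := Se.
exact: enorm_ge0.
Qed.

(** The volume terms are nonnegative and dropped; on the faces, a lower bound e constant on each
    slab and face is integrated exactly in time. *)
Lemma estimator_ge r (j : {fset Rd} -> R -> Rd -> R) (e : nat -> {fset Rd} -> R) :
  (forall k K b, (k < N)%N -> K \in Th -> b \in K -> interior_face Th (K `\ b)%fset ->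
    0 <= e k (K `\ b)%fset /\ forall t s, slab tt k t -> unit_simplex s ->
    e k (K `\ b)%fset <= j (K `\ b)%fset t (face_point (K `\ b)%fset s) ^+ 2) ->
  ((simplex_cst * time_sum (fun k => \sum_(K <- Th) \sum_(F <- interior_faces_of Th K)
      face_weight Th F * e k F))%:E <= estimator Th N tt r j ^+ 2)%E.
Proof.
move=> he; rewrite /estimator sqr_sqrte; last first.
  apply: sume_ge0 => k _; apply: sume_ge0 => K _; apply: adde_ge0.
    apply: mule_ge0; first by rewrite lee_fin sqr_ge0.
    by apply: integral_ge0 => t _; apply: integral_ge0 => x _; rewrite lee_fin sqr_ge0.
  apply: sume_ge0 => F _; apply: mule_ge0; first by rewrite lee_fin hF_ge0.
  apply: integral_ge0 => t _; apply: integral_ge0 => s _.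
  by rewrite mule_ge0// lee_fin ?sqr_ge0// sqrtr_ge0.
rewrite /time_sum mulr_sumr -sumEFin; apply: lee_sum => k _.
set tau := tt k.+1 - tt k.
have -> : simplex_cst * (tau * \sum_(K <- Th) \sum_(F <- interior_faces_of Th K) face_weight Th F * e k F) =
    \sum_(K <- Th) \sum_(F <- interior_faces_of Th K) hF Th F * (e k F * gram F * simplex_cst * tau).
  rewrite !mulr_sumr; apply: eq_bigr => K _; rewrite !mulr_sumr; apply: eq_bigr => F _.
  by rewrite /face_weight; ring.
rewrite -sumEFin big_seq [X in (_ <= X)%E]big_seq; apply: lee_sum => K KT.
rewrite -sumEFin -[X in (X <= _)%E]add0e; apply: leeD.
  apply: mule_ge0; first by rewrite lee_fin sqr_ge0.
  by apply: integral_ge0 => t _; apply: integral_ge0 => x _; rewrite lee_fin sqr_ge0.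
rewrite big_seq [X in (_ <= X)%E]big_seq; apply: lee_sum => F FI.
rewrite EFinM; apply: lee_wpmul2l; first by rewrite lee_fin hF_ge0.
have [iF [b bK FE]] := interior_facesP (sK KT) FI; subst F.
have [e0 ej] := he k K b (ltn_ord k) KT bK iF.
apply: (@le_trans _ _ (\int[@lebesgue_measure R]_(t in slab tt k) cst (e k (K `\ b)%fset * gram (K `\ b)%fset * simplex_cst)%:E t)%E).
  rewrite integral_cst; last exact: measurable_itv.
  rewrite EFinM; apply: lee_wpmul2l.
    by rewrite lee_fin !mulr_ge0//; [exact: sqrtr_ge0|rewrite exprn_ge0// invr_ge0].
  by rewrite le_eqVlt; apply/orP; left; apply/eqP/esym; exact: (measure_slab htt (ltn_ord k)).
apply: le_integral_nonneg => t st.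
  rewrite lee_fin !mulr_ge0//; first exact: sqrtr_ge0.
  by rewrite exprn_ge0// invr_ge0.
by apply: face_integral_ge => // s us; exact: ej.
Qed.

End estimator_bounds.

(** * Pointwise bound for the density *)

Section density_bound.
Context {R : realType} {n : nat}.
Local Notation Rd := 'rV[R]_n.+1.
Variables (Om : set Rd) (Th : {fset {fset Rd}}).
Hypotheses (hOm : lipschitz_domain Om) (hTh : conforming_mesh Om Th).
Implicit Types (K F : {fset Rd}) (a b x y z : Rd) (v w : Rd -> R).
Variables (T : R) (N : nat) (tt : nat -> R).
Hypothesis htt : time_partition T N tt.

Let sK K : K \in Th -> simplex K.
Proof. exact: (mesh_simplex hTh). Qed.

(* An open subset of the cylinder where |m| exceeds the bound would have
   positive measure. *)
Lemma Linf_slab_bound (m : R -> Rd -> R) (Minf : R) k w K x :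
  (normLinfQ T Om m <= Minf%:E)%E -> (k < N)%N -> Vh Om Th w ->
  (forall t, slab tt k t -> m t = w) -> K \in Th -> hull K x -> `|w x| <= Minf.
Proof.
move=> hm kN Hw mE KT Kx; rewrite leNgt; apply/negP => wx.
have [_ /(_ K KT)/affine_onP[l lE] _] := Hw.
(* The sign reduces the two-sided excess to positivity at x of one affine function, which persists
   at a nearby point of the open simplex and in a cube around it. *)
pose s : R := if 0 <= w x then 1 else -1.
have sw : s * w x = `|w x|.
  by rewrite /s; case: ifPn => h; [rewrite mul1r ger0_norm|rewrite mulN1r ltr0_norm// ltNge].
pose l' : R * Rd := (s * l.1 - Minf, s *: l.2).
have l'E y : aff l' y = s * aff l y - Minf by rewrite /aff /= dotvZl; ring.
have l'x : 0 < aff l' x by rewrite l'E -lE// sw subr_gt0.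
have [e e0 he] := aff_small_pos (center K - x) l'x.
pose t0 := Num.min e 1; have t00 : 0 < t0 by rewrite lt_min e0 ltr01.
pose y := x + t0 *: (center K - x).
have l'y : 0 < aff l' y by apply: he => //; rewrite ge_min lexx.
have py : pos K y.
  move=> a aK; rewrite /bary aff_line -affB -!/(bary _ _ _).
  have c0 : 0 < bary K a (center K) by exact: (pos_center (sK KT)) a aK.
  have x0 := (hullE x (sK KT)).1 Kx a aK.
  have t01 : t0 <= 1 by rewrite ge_min lexx orbT.
  have -> : bary K a x + t0 * (bary K a (center K) - bary K a x) =
    (1 - t0) * bary K a x + t0 * bary K a (center K) by ring.
  by apply: ltr_wpDl; [rewrite mulr_ge0// subr_ge0|rewrite mulr_gt0].
have [r1 r10 h1] := pos_near py; have [r2 r20 h2] := aff_pos_near l'y.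
pose r := Num.min r1 r2 / (2 * n.+1%:R).
have m0 : 0 < Num.min r1 r2 by rewrite lt_min r10.
have r0 : 0 < r by rewrite divr_gt0// mulr_gt0.
have hQ z : cube y r z -> pos K z /\ 0 < aff l' z.
  move=> Qz; have := cube_enorm (ltW r0) Qz.
  have -> : n.+1%:R * r = Num.min r1 r2 / 2.
    have : n.+1%:R != 0 :> R by rewrite pnatr_eq0.
    by rewrite /r; move: (n.+1%:R) => q q0; field.
  move=> h; have {h} : enorm (z - y) < Num.min r1 r2 by apply: le_lt_trans h _; lra.
  by rewrite lt_min => /andP[/h1 ? /h2 ?].
pose B := slab tt k `*` cube y r.
have mB : measurable B by apply: measurableX; [exact: measurable_itv|exact: measurable_cube].
have B0 : (0 < (@lebesgue_measure R \x vol R n.+1) B)%E.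
  rewrite product_measure1E; [|exact: measurable_itv|exact: measurable_cube].
  have gt0 (X : \bar R) (c : R) : X = c%:E -> 0 < c -> (0 < X)%E by move=> -> c0; rewrite lte_fin.
  apply: mule_gt0.
    by apply: gt0 (measure_slab htt kN) _; exact: (slab_gt0 htt kN).
  by apply: gt0 (vol_cube y (ltW r0)) _; rewrite exprn_gt0// mulr_gt0.
(* The norm of exponent +oo is the essential supremum provided the whole space has positive measure,
   which holds because it contains B. *)
move: hm; rewrite /normLinfQ unlock ifT; last first.
  by apply: lt_le_trans B0 _; apply: le_measure; rewrite ?inE//.
move=> /ess_supP[A [mA A0 hA]].
have : ((@lebesgue_measure R \x vol R n.+1) B <= 0)%E.
  rewrite -A0; apply: le_measure; rewrite ?inE// => -[t z] [/= st Qz].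
  apply: hA => /=; have [pz lz] := hQ z Qz.
  rewrite patchE mem_set/=; last first.
    by split; [exact: (slab_itime htt kN)|exact: (pos_Om hOm hTh KT)].
  rewrite (mE t st) lee_fin => h.
  move: lz; rewrite l'E -lE; last exact: pos_hull (sK KT) pz.
  have : s * w z <= `|w z|.
    by rewrite /s; case: ifP => _; rewrite ?mul1r ?mulN1r ?ler_norm// -normrN ler_norm.
  lra.
by rewrite leNgt B0.
Qed.

End density_bound.

(** * Step functions in time and jump energies *)

Section step_functions.
Context {R : realType}.
Local Notation leb := (@lebesgue_measure R).
Variables (T : R) (N : nat) (tt : nat -> R).
Hypothesis htt : time_partition T N tt.

Definition slabs : set R := \big[setU/set0]_(k <- index_iota 0 N) slab tt k.

Lemma measurable_slab k : measurable (slab tt k).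
Proof. exact: measurable_itv. Qed.

Lemma slabsP t : slabs t <-> exists2 k, (k < N)%N & slab tt k t.
Proof.
rewrite /slabs -bigcup_seq; split => [[k /=]|[k kN kt]].
  by rewrite mem_index_iota => kN kt; exists k.
by exists k => //=; rewrite mem_index_iota.
Qed.

Lemma measurable_slabs : measurable slabs.
Proof. by apply: bigsetU_measurable => k _; exact: measurable_slab. Qed.

Lemma slabs_itime : slabs `<=` itime T.
Proof. by move=> t /slabsP[k kN]; exact: slab_itime htt k kN t. Qed.

Lemma breakpoints_countable : countable (itime T `\` slabs).
Proof.
apply: (@sub_countable _ _ _ [set tt k | k in [set: nat]]); last exact: (card_image_le tt setT).
apply: subset_card_le => t [tT nt].
have [t0 tN hlt] := htt.
move: tT; rewrite /itime /= in_itv/= -t0 -tN => /andP[h0 hN].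
have : forall j, (j <= N)%N -> t <= tt j -> exists k, tt k = t.
  elim=> [_|j IH jN tj]; first by rewrite leNgt h0.
  have [le|lt] := leP t (tt j); first exact: IH (ltnW jN) le.
  move: tj; rewrite le_eqVlt => /orP[/eqP ->|lt']; first by exists j.+1.
  by exfalso; apply: nt; apply/slabsP; exists j => //; rewrite /slab /= in_itv/= lt.
by move=> /(_ N (leqnn N) (ltW hN))[k kt]; exists k.
Qed.

(** Only the breakpoints lie outside the open slabs. They form a countable set, every subset of
    which is measurable, so the values there may be arbitrary. *)
Lemma step_measurable d (X : measurableType d) (f : R -> X) :
  (forall k, (k < N)%N -> exists c, forall t, slab tt k t -> f t = c) ->
  measurable_fun (itime T) f.
Proof.
move=> hf.
have -> : itime T = slabs `|` (itime T `\` slabs).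
  by rewrite setDUK//; exact: slabs_itime.
apply/measurable_funU; first exact: measurable_slabs.
  by apply: measurableD; [exact: measurable_itv|exact: measurable_slabs].
split; last first.
  move=> _ B _; apply: countable_measurable; first by move=> t; exact: measurable_set1.
  by apply: sub_countable breakpoints_countable; apply: subset_card_le; exact: subIsetl.
rewrite /slabs; have : {subset index_iota 0 N <= gtn N} by move=> k; rewrite mem_index_iota.
elim: (index_iota 0 N) => [|k s IH] ks; first by rewrite big_nil; exact: measurable_fun_set0.
rewrite big_cons; apply/measurable_funU; first exact: measurable_slab.
  by apply: bigsetU_measurable => j _; exact: measurable_slab.
split; last by apply: IH => j js; apply: ks; rewrite inE js orbT.
have [c hc] := hf k (ks k (mem_head _ _)).
by apply: (eq_measurable_fun (cst c)) => [t /set_mem/hc ->//|]; exact: measurable_cst.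
Qed.

Lemma integral_step (f : R -> \bar R) (c : nat -> R) : (forall t, (0 <= f t)%E) ->
  (forall k t, (k < N)%N -> slab tt k t -> f t = (c k)%:E) ->
  (\int[leb]_(t in itime T) f t = (time_sum N tt c)%:E)%E.
Proof.
move=> f0 hf.
have mf : measurable_fun (itime T) f.
  by apply: step_measurable => k kN; exists (c k)%:E => t; exact: hf.
have mB : measurable (itime T `\` slabs).
  by apply: measurableD; [exact: measurable_itv|exact: measurable_slabs].
have iE : itime T = slabs `|` (itime T `\` slabs).
  by rewrite setDUK//; exact: slabs_itime.
rewrite [in LHS]iE ge0_integral_setU//; last 3 first.
- exact: measurable_slabs.
- by rewrite -iE.
- by apply/disj_setPS => t [? []].
rewrite [X in (_ + X)%E](_ : _ = 0%E); last first.
  apply: null_set_integral => //; first by apply: measurable_funS mf; [exact: measurable_itv|exact: subDsetl].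
  exact: countable_lebesgue_measure0 breakpoints_countable.
rewrite adde0 /slabs ge0_integral_bigsetU//; last 4 first.
- by move=> k; exact: measurable_slab.
- exact: iota_uniq.
- move=> i j /=; rewrite !mem_index_iota => /andP[_ iN] /andP[_ jN] [t []].
  rewrite /slab /= !in_itv/= => /andP[a1 a2] /andP[b1 b2].
  apply/eqP; rewrite eqn_leq; apply/andP; split; rewrite leqNgt; apply/negP => h.
    by have := le_breakpoints htt h (ltnW iN); rewrite leNgt (lt_trans a1 b2).
  by have := le_breakpoints htt h (ltnW jN); rewrite leNgt (lt_trans b1 a2).
- by apply: measurable_funS mf; [exact: measurable_itv|exact: slabs_itime].
rewrite /time_sum -sumEFin -(big_mkord xpredT (fun k => ((tt k.+1 - tt k) * c k)%:E)).
apply: eq_big_nat => k /andP[_ kN].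
rewrite (eq_integral (cst (c k)%:E)); last by move=> t /set_mem; exact: hf.
rewrite integral_cst; last exact: measurable_slab.
by rewrite mulrC EFinM; congr (_ * _)%E; exact: measure_slab htt k kN.
Qed.

End step_functions.

Section energy_bounds.
Context {R : realType} {n : nat}.
Local Notation Rd := 'rV[R]_n.+1.
Variables (Om : set Rd) (Th : {fset {fset Rd}}).
Hypotheses (hOm : lipschitz_domain Om) (hTh : conforming_mesh Om Th).
Implicit Types (K F : {fset Rd}) (a b x y z : Rd) (v w : Rd -> R).
Variables (L : R).
Hypothesis hL : forall K, K \in Th -> exists c r, regular L K c r.
Variables (T : R) (N : nat) (tt : nat -> R).
Hypothesis htt : time_partition T N tt.
Variables (u m : R -> Rd -> R) (uk mk : nat -> Rd -> R).
Hypothesis hu : forall k, (k < N)%N -> Vh Om Th (uk k) /\ forall t, slab tt k t -> u t = uk k.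
Hypothesis hm : forall k, (k < N)%N -> Vh Om Th (mk k) /\ forall t, slab tt k t -> m t = mk k.

Let d0 : (0 < n.+1)%N := ltn0Sn n.
Let sK K : K \in Th -> simplex K.
Proof. exact: (mesh_simplex hTh). Qed.

Definition mesh_energy v : R := \sum_(K <- Th) jump_energy Th v K.

Lemma mesh_energy_ge0 v : 0 <= mesh_energy v.
Proof.
rewrite /mesh_energy big_seq; apply: sumr_ge0 => K KT.
exact: (jump_energy_ge0 hTh hL v KT).
Qed.

Lemma estimator1_ge r nu :
  ((simplex_cst (R := R) (n := n) * nu ^+ 2 * time_sum N tt (fun k => mesh_energy (uk k)))%:E <=
   estimator Th N tt r (face_residual1 Th nu u) ^+ 2)%E.
Proof.
pose e k F := (nu * face_jump Th F (fun K => gradK K (uk k))) ^+ 2.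
apply: (le_trans _ (estimator_ge hTh htt r (e := e) _)); last first.
  move=> k K b kN KT bK iF; split; first exact: sqr_ge0.
  by move=> t s st _; rewrite /face_residual1 (hu kN).2.
rewrite lee_fin le_eqVlt; apply/orP; left; apply/eqP; rewrite -mulrA; congr (_ * _).
rewrite /time_sum mulr_sumr; apply: eq_bigr => k _; rewrite mulrCA; congr (_ * _).
rewrite mulr_sumr; apply: eq_bigr => K _; rewrite mulr_sumr; apply: eq_bigr => F _.
by rewrite /e; ring.
Qed.

Variables (nu LHp Minf : R) (Hp : R -> Rd -> Rd -> Rd).
Hypotheses (hMinf : 0 < Minf) (hlinf : (normLinfQ T Om m <= Minf%:E)%E).
Hypothesis hHp : forall t x, closed_cylinder T Om t x -> forall p q,
  enorm (Hp t x p - Hp t x q) <= LHp * enorm (p - q).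

(* The jump of H_p[grad u] is controlled by that of grad u, so j_2 and j_1
   together control the jump of grad m. *)
Lemma estimator2_ge r :
  ((simplex_cst (R := R) (n := n) * time_sum N tt (fun k =>
      nu ^+ 2 / 2 * mesh_energy (mk k) - (Minf * LHp) ^+ 2 * mesh_energy (uk k)))%:E <=
   estimator Th N tt r (face_residual2 Th nu Hp u m) ^+ 2)%E.
Proof.
pose J (w : Rd -> R) F := face_jump Th F (fun K => gradK K w).
pose e0 k F := (nu * J (mk k) F) ^+ 2 / 2 - (Minf * LHp * J (uk k) F) ^+ 2.
(* The lower bound [e0] may be negative, while [estimator_ge] asks for a nonnegative one; a negative
   value is trivially below a square. *)
pose e k F := Num.max 0 (e0 k F).
have us0 : 0 <= simplex_cst (R := R) (n := n) by rewrite exprn_ge0// invr_ge0.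
apply: (le_trans _ (estimator_ge hTh htt r (e := e) _)); last first.
  move=> k K b kN KT bK iF; split; first by rewrite le_max lexx.
  move=> t s st us; rewrite /e ge_max sqr_ge0/=.
  have [K' [K'T K'K sF]] := (interior_faceP d0 hTh KT bK).1 iF.
  set F := (K `\ b)%fset; set x := face_point F s.
  have [Hu uE] := hu kN; have [Hm mE] := hm kN.
  have Kx : hull K x.
    by have [] := (hull_faceE x (sK KT) (fsubD1set K b)).1 (face_point_hull hTh KT bK us).
  (* The face residual uses values of m on faces, which are null sets; being affine on closed
     simplices, m inherits the essential bound there. *)
  have mx : `|m t x| <= Minf.
    by rewrite (mE t st); exact: (Linf_slab_bound hOm hTh htt hlinf kN Hm mE KT Kx).
  have cyl : closed_cylinder T Om t x.
    split; last exact: (hull_closure hTh KT Kx).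
    by have := slab_itime htt kN st; rewrite /itime /= !in_itv/= => /andP[/ltW -> /ltW ->].
  have au K1 : K1 \in Th -> affine_on (hull K1) (uk k) by move=> K1T; case: Hu => _ + _; apply.
  pose h := face_jump Th F (fun K => Hp t x (gradK K (u t))).
  have hh : `|h| <= LHp * `|J (uk k) F|.
    rewrite /h (uE t st) /J (face_jump_gradK hTh KT K'T bK K'K sF au).
    apply: le_trans (face_jump_le hTh KT K'T bK K'K sF _) _.
    exact: hHp.
  have jE : face_residual2 Th nu Hp u m F t x = nu * J (mk k) F + m t x * h.
    by rewrite /face_residual2 /J /h (mE t st).
  rewrite jE /e0.
  have mh : (m t x * h) ^+ 2 <= (Minf * LHp * J (uk k) F) ^+ 2.
    rewrite -[leLHS]real_normK ?num_real// -[leRHS]real_normK ?num_real//.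
    rewrite lerXn2r ?nnegrE// !normrM -mulrA; apply: ler_pM => //.
      by rewrite (ger0_norm (ltW hMinf)).
    by apply: le_trans hh _; rewrite ler_wpM2r// ler_norm.
  move: mh; move: (nu * _) (m t x * h) => p q; rewrite /= -subr_ge0.
  (* (p + q)^2 - p^2 / 2 + q^2 equals (p + 2 q)^2 / 2. *)
  have : 0 <= (p + 2 * q) ^+ 2 by rewrite sqr_ge0.
  by rewrite !expr2; lra.
rewrite lee_fin ler_wpM2l// /time_sum; apply: ler_sum => k _.
apply: ler_wpM2l; first exact: ltW (slab_gt0 htt (ltn_ord k)).
rewrite /mesh_energy !mulr_sumr -sumrB big_seq [leRHS]big_seq; apply: ler_sum => K KT.
rewrite /jump_energy !mulr_sumr -sumrB big_seq [leRHS]big_seq; apply: ler_sum => F FI.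
have [_ [b bK FE]] := interior_facesP (sK KT) FI.
apply: (@le_trans _ _ (face_weight Th F * e0 k F)); last first.
  by rewrite ler_wpM2l// ?le_max ?lexx ?orbT// FE (face_weight_ge0 hTh hL KT bK).
by rewrite le_eqVlt; apply/orP; left; apply/eqP; rewrite /e0 /J; ring.
Qed.

End energy_bounds.

Lemma slab_values (R : realType) d (Om : set 'rV[R]_d) Th N (tt : nat -> R) v : Vtau Om Th N tt v ->
  exists vk : nat -> 'rV[R]_d -> R,
    forall k, (k < N)%N -> Vh Om Th (vk k) /\ forall t, slab tt k t -> v t = vk k.
Proof.
move=> Vv.
have hv k : exists w, (k < N)%N -> Vh Om Th w /\ forall t, slab tt k t -> v t = w.
  by have [kN|kN] := ltnP k N; [have [w Hw hw] := Vv k kN; exists w|exists (fun=> 0)].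
by have [vk h] := choice hv; exists vk.
Qed.

(** * The dual norm over the whole time interval *)

Section dual_norm.
Context {R : realType} {n : nat}.
Local Notation Rd := 'rV[R]_n.+1.
Local Notation leb := (@lebesgue_measure R).
Variables (Om : set Rd) (Th0 Th : {fset {fset Rd}}).
Hypotheses (hOm : lipschitz_domain Om) (hTh0 : conforming_mesh Om Th0)
  (hTh : conforming_mesh Om Th).
Implicit Types (K F : {fset Rd}) (a b x y z : Rd) (v w : Rd -> R).
Variables (L D kp CP : R).
Hypothesis hL : forall K, K \in Th -> exists c r, regular L K c r.
Hypothesis hD : forall K, K \in Th -> hK K <= D.
Hypothesis kp0 : 0 <= kp.
Hypothesis hkp : forall K0 b0 K1 b1, K0 \in Th0 -> b0 \in K0 -> K1 \in Th0 -> b1 \in K1 ->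
  plane_bound (bary_fun K0 b0) (bary_fun K1 b1) kp.
Hypothesis CP0 : 0 < CP.
Hypothesis hCP : forall v g, H10_grad Om v g ->
  (sqint Om v <= CP%:E * sqint Om (fun x => enorm (g x)))%E.
Hypotheses (L1 : 1 <= L) (D0 : 0 < D).
Variable phi : Rd -> Rd -> R.
Hypothesis hphi : nodal_basis Om Th phi.
Variables (T : R) (N : nat) (tt : nat -> R).
Hypothesis htt : time_partition T N tt.
Variables (u m : R -> Rd -> R) (uk mk : nat -> Rd -> R).
Hypothesis hu : forall k, (k < N)%N -> Vh Om Th (uk k) /\ forall t, slab tt k t -> u t = uk k.
Hypothesis hm : forall k, (k < N)%N -> Vh Om Th (mk k) /\ forall t, slab tt k t -> m t = mk k.

Lemma slab_cst_ge0 Lstab : 0 < Lstab -> 0 <= slab_cst (n := n) L D kp CP Lstab.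
Proof.
move=> h; rewrite /slab_cst; apply: mulr_ge0; last exact: sqrtr_ge0.
by apply: mulr_ge0; [exact: (vertex_cst_ge0 kp0 L1 D0 h)|exact: sqrtr_ge0].
Qed.

Lemma time_sum_cauchy_schwarz (f g : nat -> R) : (forall k, 0 <= f k) -> (forall k, 0 <= g k) ->
  time_sum N tt (fun k => Num.sqrt (f k) * Num.sqrt (g k)) <=
  Num.sqrt (time_sum N tt f) * Num.sqrt (time_sum N tt g).
Proof.
move=> f0 g0.
have tau0 k : (k < N)%N -> 0 <= tt k.+1 - tt k by move=> kN; exact: ltW (slab_gt0 htt kN).
have := cauchy_schwarz_sum (index_enum 'I_N) xpredT
  (fun k : 'I_N => Num.sqrt ((tt k.+1 - tt k) * f k)) (fun k : 'I_N => Num.sqrt ((tt k.+1 - tt k) * g k)).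
have sq (h : nat -> R) : (forall k, 0 <= h k) ->
    \sum_(k < N) Num.sqrt ((tt k.+1 - tt k) * h k) ^+ 2 = time_sum N tt h.
  by move=> h0; apply: eq_bigr => k _; rewrite sqr_sqrtr// mulr_ge0// tau0.
rewrite !sq// => /(le_trans _); apply; rewrite le_eqVlt; apply/orP; left; apply/eqP.
apply: eq_bigr => k _; rewrite !sqrtrM ?tau0// -[X in X * _ = _](sqr_sqrtr (tau0 k (ltn_ord k))).
by ring.
Qed.

Lemma stab_dual_norm_le Sh Lstab (E : R) : 0 < Lstab -> linear_in_third Om Th Sh ->
  vanishes_on_affine Om Th phi Sh -> stab_lipschitz Om Th phi Sh Lstab -> 0 <= E ->
  time_sum N tt (fun k => mesh_energy Th (uk k)) <= E ^+ 2 ->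
  time_sum N tt (fun k => mesh_energy Th (mk k)) <= E ^+ 2 ->
  (stab_dual_norm T Om Th N tt Sh u m <= (slab_cst (n := n) L D kp CP Lstab * (2 * E))%:E)%E.
Proof.
move=> Ls0 hlin haff hlip E0 hEu hEm; have sc0 := slab_cst_ge0 Ls0.
apply: ge_ereal_sup => _ [v [Vv _] <-]; rewrite lee_fin.
have [vk hv] := slab_values Vv.
pose c k := `|Sh (uk k) (mk k) (vk k)|.
pose G := time_sum N tt (fun k => grad2 Om (vk k)).
have fE k t : (k < N)%N -> slab tt k t -> Sh (u t) (m t) (v t) = Sh (uk k) (mk k) (vk k).
  by move=> kN kt; rewrite (hu kN).2// (hm kN).2// (hv k kN).2.
have nE : normX T Om v = (Num.sqrt G)%:E.
  rewrite /normX (@integral_step _ T N tt htt _ (fun k => grad2 Om (vk k)))//.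
    by move=> t; exact: sqre_ge0.
  move=> k t kN kt; rewrite (hv k kN).2// /normH10 normL2vE sqr_sqrte ?sqint_ge0//.
  by rewrite -(grad2E (hv k kN).1).
have hX : (`|\int[leb]_(t in itime T) (Sh (u t) (m t) (v t))%:E| <= (time_sum N tt c)%:E)%E.
  apply: le_trans (le_abse_integral _ _ _) _; first exact: measurable_itv.
    apply: (@step_measurable _ T N tt htt) => k kN.
    by exists (Sh (uk k) (mk k) (vk k))%:E => t kt; rewrite (fE k).
  rewrite (@integral_step _ T N tt htt _ c)// => k t kN kt.
  by rewrite (fE k).
(* The real-valued integral is the finite part of the extended one, so the bound on the absolute
   value is transferred. *)
have {hX} hX : \int[leb]_(t in itime T) Sh (u t) (m t) (v t) <= time_sum N tt c.
  have fin_le (X : \bar R) (y : R) : (`|X| <= y%:E)%E -> fine X <= y.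
    by case: X => [r|//|//]; rewrite lee_fin /=; apply: le_trans; exact: ler_norm.
  exact: fin_le hX.
have g0 k : 0 <= grad2 Om (vk k) by exact: grad2_ge0.
have e0 w : 0 <= mesh_energy Th w by exact: (mesh_energy_ge0 hTh hL).
have sE (w : nat -> Rd -> R) : time_sum N tt (fun k => mesh_energy Th (w k)) <= E ^+ 2 ->
    Num.sqrt (time_sum N tt (fun k => mesh_energy Th (w k))) <= E.
  by move=> h; rewrite -[leRHS](ger0_norm E0) -sqrtr_sqr ler_wsqrtr.
have hc : time_sum N tt c <= slab_cst (n := n) L D kp CP Lstab * (2 * E) * Num.sqrt G.
  apply: (@le_trans _ _ (slab_cst (n := n) L D kp CP Lstab * (
      time_sum N tt (fun k => Num.sqrt (grad2 Om (vk k)) * Num.sqrt (mesh_energy Th (uk k))) +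
      time_sum N tt (fun k => Num.sqrt (grad2 Om (vk k)) * Num.sqrt (mesh_energy Th (mk k)))))).
    rewrite /time_sum -big_split/= mulr_sumr; apply: ler_sum => k _.
    rewrite -mulrDr mulrCA ler_wpM2l ?(ltW (slab_gt0 htt (ltn_ord k)))// -mulrDr mulrA.
    have kN := ltn_ord k.
    exact: (slab_bound hOm hTh0 hTh hL hD kp0 hkp hphi CP0 hCP L1 D0 Ls0 hlin haff hlip
      (hu kN).1 (hm kN).1 (hv k kN).1).
  rewrite -mulrA ler_wpM2l// mulrDl mul1r.
  have CS (w : nat -> Rd -> R) : time_sum N tt (fun k => mesh_energy Th (w k)) <= E ^+ 2 ->
      time_sum N tt (fun k => Num.sqrt (grad2 Om (vk k)) * Num.sqrt (mesh_energy Th (w k))) <= Num.sqrt G * E.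
    move=> h; apply: le_trans (time_sum_cauchy_schwarz g0 (fun k => e0 (w k))) _.
    by rewrite ler_wpM2l ?sqrtr_ge0// sE.
  by have := CS uk hEu; have := CS mk hEm; lra.
(* For a vanishing norm the quotient is 0, by the convention for the inverse of 0. *)
rewrite nE /=; have [->|G0] := eqVneq (Num.sqrt G) 0.
  by rewrite invr0 mulr0 mulr_ge0// mulr_ge0.
rewrite ler_pdivrMr ?lt_def ?G0 ?sqrtr_ge0//.
exact: le_trans hX hc.
Qed.

End dual_norm.

Lemma time_sum_lin (R : realType) N (tt : nat -> R) a b f g :
  time_sum N tt (fun k => a * f k - b * g k) = a * time_sum N tt f - b * time_sum N tt g.
Proof. by rewrite /time_sum !mulr_sumr -sumrB; apply: eq_bigr => k _; ring. Qed.

(** * The constant and the final estimate *)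

Section estimator_constant.
Context {R : realType}.

(** The first estimator bounds the energy [Uu] of u; inserted in the second inequality, this bounds
    the energy [Um] of m. The two terms of A are these two bounds, so A serves for both. *)
Lemma energy_constant (sc nu b Uu Um e1 e2 : R) : 0 < sc -> 0 < nu -> 0 <= e1 -> 0 <= e2 ->
  sc * nu ^+ 2 * Uu <= e1 ^+ 2 -> sc * (nu ^+ 2 / 2 * Um - b ^+ 2 * Uu) <= e2 ^+ 2 ->
  let A := (sc * nu ^+ 2)^-1 + 2 / nu ^+ 2 * (sc^-1 + b ^+ 2 / (sc * nu ^+ 2)) in
  0 <= A /\ Uu <= A * (e1 + e2) ^+ 2 /\ Um <= A * (e1 + e2) ^+ 2.
Proof.
move=> sc0 nu0 e10 e20 h1 h2 A.
have n20 : 0 < nu ^+ 2 by rewrite exprn_gt0.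
have k0 : 0 < sc * nu ^+ 2 by rewrite mulr_gt0.
have b0 : 0 <= b ^+ 2 by rewrite sqr_ge0.
have S1 : e1 ^+ 2 <= (e1 + e2) ^+ 2 by rewrite lerXn2r ?nnegrE ?addr_ge0// lerDl.
have S2 : e2 ^+ 2 <= (e1 + e2) ^+ 2 by rewrite lerXn2r ?nnegrE ?addr_ge0// lerDr.
set S := (e1 + e2) ^+ 2 in S1 S2 *.
have S0 : 0 <= S by rewrite sqr_ge0.
have ki : 0 <= (sc * nu ^+ 2)^-1 by rewrite invr_ge0 ltW.
have B0 : 0 <= 2 / nu ^+ 2 * (sc^-1 + b ^+ 2 / (sc * nu ^+ 2)).
  by rewrite mulr_ge0 ?divr_ge0 ?(ltW n20)// addr_ge0 ?invr_ge0 ?(ltW sc0)// mulr_ge0.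
have hu : Uu <= (sc * nu ^+ 2)^-1 * S by rewrite ler_pdivlMl//; exact: le_trans h1 S1.
split; first by rewrite addr_ge0.
split; first by apply: le_trans hu _; rewrite ler_wpM2r// lerDl.
apply: (@le_trans _ _ (2 / nu ^+ 2 * (sc^-1 + b ^+ 2 / (sc * nu ^+ 2)) * S)); last first.
  by rewrite ler_wpM2r// lerDr.
have h3 : nu ^+ 2 / 2 * Um <= sc^-1 * S + b ^+ 2 * ((sc * nu ^+ 2)^-1 * S).
  have : nu ^+ 2 / 2 * Um - b ^+ 2 * Uu <= sc^-1 * S.
    by rewrite ler_pdivlMl//; exact: le_trans h2 S2.
  by have := ler_wpM2l b0 hu; lra.
have -> : Um = 2 / nu ^+ 2 * (nu ^+ 2 / 2 * Um) by field; rewrite gt_eqF.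
rewrite -[leRHS]mulrA ler_wpM2l ?divr_ge0 ?(ltW n20)//.
by apply: le_trans h3 _; rewrite le_eqVlt; apply/orP; left; apply/eqP; ring.
Qed.

End estimator_constant.

Lemma estimator_ge0 (R : realType) d (Th : {fset {fset 'rV[R]_d}}) N tt r j :
  (0 <= estimator Th N tt r j)%E.
Proof. exact: sqrte_ge0. Qed.

Unset Implicit Arguments.
Set Strict Implicit.

Theorem proposition6p3 (R : realType) (d : nat) (hd : (0 < d)%N)
    (Om : set 'rV[R]_d) (hOm : lipschitz_domain Om)
    (nu LHp Lstab Minf sigma : R) (hnu : 0 < nu) (hLstab : 0 < Lstab)
    (hMinf : 0 < Minf) :
  exists2 C : R, 0 < C &
  forall (T : R) (hT : 0 < T)
    (A : metricType R) (b : R -> 'rV[R]_d -> A -> 'rV[R]_d)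
    (f : R -> 'rV[R]_d -> A -> R)
    (Hp : R -> 'rV[R]_d -> 'rV[R]_d -> 'rV[R]_d)
    (hH : hamiltonian_data T Om b f Hp LHp)
    (m0 : 'rV[R]_d -> R) (hm0 : initial_density Om m0)
    (Z : completeNormedModType R) (ip : Z -> Z -> R)
    (jX : (R -> 'rV[R]_d -> R) -> Z) (hZ : embedding_data T Om ip jX)
    (F : Z -> (R -> 'rV[R]_d -> R) -> R)
    (S : ('rV[R]_d -> R) -> 'rV[R]_d -> R) (LF LS : R)
    (hFS : coupling_data T Om jX F S LF LS)
    (G : (R -> 'rV[R]_d -> R) -> R) (g0 : R -> 'rV[R]_d -> R)
    (g1 : R -> 'rV[R]_d -> 'rV[R]_d) (r s : \bar R)
    (hG : source_data T Om G g0 g1 r s)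
    (Th : {fset {fset 'rV[R]_d}}) (hTh : conforming_mesh Om Th)
    (hsigma : shape_regularity Th = sigma)
    (phi : 'rV[R]_d -> 'rV[R]_d -> R) (hphi : nodal_basis Om Th phi)
    (N : nat) (tt : nat -> R) (htt : time_partition T N tt)
    (Pi0 PiT : ('rV[R]_d -> R) -> 'rV[R]_d -> R)
    (hPi0 : L2_to_Vh Om Th Pi0) (hPiT : L2_to_Vh Om Th PiT)
    (Sh1 Sh2 : ('rV[R]_d -> R) -> ('rV[R]_d -> R) -> ('rV[R]_d -> R) -> R)
    (hlin1 : linear_in_third Om Th Sh1) (hlin2 : linear_in_third Om Th Sh2)
    (haff1 : vanishes_on_affine Om Th phi Sh1)
    (haff2 : vanishes_on_affine Om Th phi Sh2)
    (hlip1 : stab_lipschitz Om Th phi Sh1 Lstab)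
    (hlip2 : stab_lipschitz Om Th phi Sh2 Lstab)
    (u m : R -> 'rV[R]_d -> R)
    (hum : scheme_solution T Om Th N tt nu (Ham b f) Hp jX F S G m0 Pi0 PiT
             (stab1 T Om Th N tt phi Sh1) (stab2 T Om Th N tt phi Sh2) u m)
    (hm : (normLinfQ T Om m <= Minf%:E)%E)
    (* L^2 representatives of F[m], of G and of div(m H_p[grad u]) *)
    (Fm g dq : R -> 'rV[R]_d -> R)
    (hFm : represented_by T Om (F (jX m)) Fm)
    (hg : represented_by T Om G g)
    (hdq : broken_div Th N tt
             (fun t x => m t x *: Hp t x (wgrad Om (u t) x)) dq),
  let r1 := residual1 T Om N tt nu (Ham b f) Fm u in
  let r2 := residual2 T N tt nu g dq m in
  elementwise_L2 Th N tt r1 -> elementwise_L2 Th N tt r2 ->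
  (stab_dual_norm T Om Th N tt Sh1 u m + stab_dual_norm T Om Th N tt Sh2 u m <=
   C%:E * (estimator Th N tt r1 (face_residual1 Th nu u) +
           estimator Th N tt r2 (face_residual2 Th nu Hp u m)))%E.
Proof.
case: d hd Om hOm => // n _ Om hOm.
(* Any mesh of Om serves as the reference mesh; if Om has none, there is nothing to prove. *)
have [[Th0 hTh0]|noTh] := EM (exists Th0, conforming_mesh Om Th0); last first.
  by exists 1 => // T ? A b f Hp ? m0 ? Z ip jX ? F S LF LS ? G g0 g1 r s ? Th hTh; exfalso; apply: noTh; exists Th.
have [oO bO _ _] := hOm.
have [D D0 hD] := mesh_diameter bO.
have [kp kp0 hkp] := mesh_planes (ltn0Sn n) (fun K KT => mesh_simplex hTh0 KT).
have [CP CP0 hCP] := poincare (open_measurable_row oO) bO.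
(* The maximum gives L >= 1, and thus the sign of the constants, before any mesh with this sigma is
   at hand. *)
pose L : R := Num.max 1 (4 * sigma); have L1 : 1 <= L by rewrite le_max lexx.
pose sl := slab_cst (n := n) L D kp CP Lstab.
have sl0 : 0 <= sl by exact: slab_cst_ge0 kp0 L1 D0 _ hLstab.
pose sc := simplex_cst (R := R) (n := n); have sc0 : 0 < sc by rewrite exprn_gt0// invr_gt0.
pose A2 := (sc * nu ^+ 2)^-1 + 2 / nu ^+ 2 * (sc^-1 + (Minf * LHp) ^+ 2 / (sc * nu ^+ 2)).
(* Two stabilizations, each bounded by 2 E times [sl], E being [Num.sqrt A2] times the sum of the
   estimators; the summand 1 makes C positive. *)
pose C := 4 * sl * Num.sqrt A2 + 1.
have C0 : 0 < C by rewrite /C ltr_wpDl//; apply: mulr_ge0; [exact: mulr_ge0|exact: sqrtr_ge0].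
exists C => // T hT A b f Hp hH m0 _ Z ip jX _ F S LF LS _ G g0 g1 r s _ Th hTh hsigma
  phi hphi N tt htt Pi0 PiT _ _ Sh1 Sh2 hlin1 hlin2 haff1 haff2 hlip1 hlip2 u m hum hm
  Fm g dq _ _ _ r1 r2 _ _.
have hL K : K \in Th -> exists c r, regular L K c r.
  move=> KT; have [c [rr [rr0 h hr]]] := shape_regular_ball (ltn0Sn n) (mesh_simplex hTh KT) KT.
  exists c, rr; split => //; apply: le_trans hr _; rewrite hsigma ler_wpM2r ?(ltW rr0)//.
  by rewrite le_max lexx orbT.
have [uk hu] : exists uk : nat -> 'rV[R]_n.+1 -> R,
    forall k, (k < N)%N -> Vh Om Th (uk k) /\ forall t, slab tt k t -> u t = uk k.
  by apply: slab_values; case: (scheme_u hum).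
have [mk hmk] : exists mk : nat -> 'rV[R]_n.+1 -> R,
    forall k, (k < N)%N -> Vh Om Th (mk k) /\ forall t, slab tt k t -> m t = mk k.
  by apply: slab_values; case: (scheme_m hum).
have := estimator2_ge hOm hTh hL htt hu hmk nu hMinf hm (Hp_lipschitz hH) r2.
have := estimator1_ge hTh htt hu r1 nu.
have := estimator_ge0 Th N tt r1 (face_residual1 Th nu u).
have := estimator_ge0 Th N tt r2 (face_residual2 Th nu Hp u m).
move: (estimator _ _ _ r1 _) (estimator _ _ _ r2 _) => E1 E2.
(* With an infinite estimator the right side is +oo, because C is positive; the argument below
   concerns finite ones. *)
case: E2 => [e2| |//] e20; case: E1 => [e1| |//] e10 h1 h2; rewrite ?addey ?addye ?gt0_muley ?lte_fin ?leey//.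
rewrite !lee_fin in e10 e20.
move: h1 h2; rewrite -!EFin_expe !lee_fin => h1 h2.
rewrite time_sum_lin in h2.
have [A20 [hU hM]] := energy_constant sc0 hnu e10 e20 h1 h2.
have e120 : 0 <= e1 + e2 by exact: addr_ge0.
pose E := Num.sqrt A2 * (e1 + e2); have E0 : 0 <= E by exact: mulr_ge0 (sqrtr_ge0 _) e120.
have EE : E ^+ 2 = A2 * (e1 + e2) ^+ 2 by rewrite exprMn sqr_sqrtr.
rewrite -EE in hU hM.
have B Sh := @stab_dual_norm_le R n Om Th0 Th hOm hTh0 hTh L D kp CP hL
  (fun K KT => hD Th K hTh KT) kp0 hkp CP0 hCP L1 D0 phi hphi T N tt htt u m uk mk hu hmk Sh Lstab E hLstab.
apply: le_trans (leeD (B Sh1 hlin1 haff1 hlip1 E0 hU hM) (B Sh2 hlin2 haff2 hlip2 E0 hU hM)) _.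
rewrite -!(EFinD, EFinM) lee_fin -/sl.
have -> : sl * (2 * E) + sl * (2 * E) = (C - 1) * (e1 + e2) by rewrite /C /E; ring.
by rewrite ler_wpM2r// gerBl.
Qed.
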